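(* Let $\Delta$ be a degree and let $p_1,\dots,p_n\in\mathbb R^2$ and $\lambda'_1,\dots,\lambda'_l$ be point conditions and tropical cross-ratios in general position with $n+l=|\Delta|-1$. Let $\lambda_1,\dots,\lambda_l$ be the degenerations of $\lambda'_1,\dots,\lambda'_l$, and let $$N_{0,n}(\lambda_1,\dots,\lambda_l):=\deg\Big(\prod_{j=1}^{l}\mathrm{ft}_{\lambda_j}^*(0)\cdot\prod_{i=1}^n\mathrm{ev}_i^*(p_i)\cdot\mathcal M_{0,n}(\mathbb R^2,\Delta)\Big).$$ Then $$N_{0,n}(\lambda'_1,\dots,\lambda'_l)=N_{0,n}(\lambda_1,\dots,\lambda_l).$$ Moreover, for every tropical curve $C$ contributing to the right-hand side, its multiplicity $\mathrm{mult}(C)$ (its weight in the $0$-dimensional cycle above) is $$\mathrm{mult}(C)=\prod_{v\text{ vertex of }C}\mathrm{mult}_{\mathrm{ev}}(v)\cdot\omega_v(\sigma_C),$$ where $\sigma_C$ is the top-dimensional cell of $X:=\prod_{j=1}^{l}\mathrm{ft}_{\lambda_j}^*(0)\cdot\mathcal M_{0,n}(\mathbb R^2,\Delta)$ containing $C$.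
   Context: **Moduli spaces.** An $N$-marked abstract rational tropical curve is a metric tree $\Gamma$ with all vertices of valence $\ge 3$ and exactly $N$ unbounded edges (ends), carrying pairwise distinct labels; $\mathcal M_{0,N}$ is the set of these up to label-preserving isometry. Forgetting lengths gives the combinatorial type. Via the vector of pairwise distances between ends, in $\mathbb R^{\binom N2}/\{(a_i+a_j)_{i<j}\mid a\in\mathbb R^N\}$, $\mathcal M_{0,N}$ is a pure $(N-3)$-dimensional balanced fan with all weights $1$; cones correspond to combinatorial types, coordinates on a cone are the lengths of bounded edges, and the lattice is generated by the vectors $v_I$ of curves with one bounded edge, of length $1$, separating the ends $I$ from $I^c$ ($|I|,|I^c|\ge2$). A degree is a finite set $\Delta$ of $|\Delta|$ pairs $(v_i,\text{label})$ with $0\ne v_i\in\mathbb Z^2$, pairwise distinct labels, $\sum_i v_i=0$, and the $v_i$ spanning $\mathbb R^2$. For $n\ge1$ and $N=n+|\Delta|$, $\mathcal M_{0,n}(\mathbb R^2,\Delta)$ is the set of isomorphism classes of $(\Gamma,x_1,\dots,x_N,h)$ where $(\Gamma,x_1,\dots,x_N)$ is an $N$-marked abstract rational tropical curve and $h:\Gamma\to\mathbb R^2$ is continuous, on each edge $e$ of the form $t\mapsto a+t\,v(e,V)$ ($t$ = distance from a vertex $V$ of $e$, $v(e,V)\in\mathbb Z^2$ the direction vector at $V$), balanced ($\sum_{e\ni V}v(e,V)=0$ at each vertex), with $x_1,\dots,x_n$ of direction $0$ (contracted ends, ''points'') and the other ends having directions and labels given by $\Delta$. The map $(\Gamma,x,h)\mapsto((\Gamma,x),h(x_1))$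 identifies it with the fan $\mathcal M_{0,N}\times\mathbb R^2$. Put $\mathrm{ev}_i(\Gamma,x,h)=h(x_i)$; for a set $I$ of labels, $\mathrm{ft}_I:\mathcal M_{0,n}(\mathbb R^2,\Delta)\to\mathcal M_{0,|I|}$ forgets $h$ and all ends outside $I$ and straightens $2$-valent vertices. **Intersections.** For a weighted balanced polyhedral complex $(Y,\omega)$ of dimension $k$ and a continuous function $\varphi$ which is integer affine linear on its cells, $\varphi\cdot Y$ is the $(k-1)$-skeleton with weights $\omega_\varphi(\tau)=\sum_{\sigma>\tau}\varphi_\sigma(\omega(\sigma)v_{\sigma/\tau})-\varphi_\tau(\sum_{\sigma>\tau}\omega(\sigma)v_{\sigma/\tau})$, where $\varphi_\sigma,\varphi_\tau$ are linear parts and $v_{\sigma/\tau}$ represent the primitive normal vectors (refine $Y$ first if necessary). The degree $\deg$ of a $0$-dimensional cycle is the sum of its weights. $\mathrm{ev}_i^*(p)\cdot Y$, for $p=(p^1,p^2)$, is the intersection with the pull-backs under $\mathrm{ev}_i$ of $\max(p^1,x)$ and $\max(p^2,y)$. **Cross-ratios.** A (non-degenerated) tropical cross-ratio $\lambda'$ is an unordered pair of unordered pairs $(\beta_1\beta_2|\beta_3\beta_4)$ of pairwise distinct end labels with a number $|\lambda'|>0$. $\mathcal M_{0,4}$ (labels $\beta_1,\dots,\beta_4$) consists of three rays; let $\ell$ be the function equal to the length of the bounded edge on the ray of curves separating $\beta_1,\beta_2$ from $\beta_3,\beta_4$ and $0$ on the other rays. $\mathrm{ft}_{\lambda'}^*(|\lambda'|)$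 is the intersection with the function $\max(\ell\circ\mathrm{ft}_{\{\beta_1,\dots,\beta_4\}},|\lambda'|)$. The degeneration of $\lambda'$ is the set $\lambda=\{\beta_1,\dots,\beta_4\}$ with $|\lambda|=0$, and $\mathrm{ft}_\lambda^*(0)$ is the intersection with $\ell\circ\mathrm{ft}_\lambda$ (the result does not depend on the choice of one of the three rays). **General position.** $p_1,\dots,p_n,\lambda'_1,\dots,\lambda'_l$ (the cross-ratios having pairwise distinct pairs of pairs) with $n+l=|\Delta|-1$ are in general position if $\prod_j\mathrm{ft}^*_{\lambda'_j}(|\lambda'_j|)\cdot\prod_i\mathrm{ev}_i^*(p_i)\cdot\mathcal M_{0,n}(\mathbb R^2,\Delta)$ is a nonempty finite set contained in the union of the interiors of top-dimensional polyhedra of $\mathcal M_{0,n}(\mathbb R^2,\Delta)$; its degree is then $N_{0,n}(\lambda'_1,\dots,\lambda'_l)$. Degenerated conditions are in general position if they are degenerations of conditions in general position; it is understood that then the curves in $\prod_i\mathrm{ev}_i^*(p_i)\cdot X$ lie in the interiors of top-dimensional cells of $X$. **Local weight $\omega_v$.** For a vertex $v$ of a curve $C$ (or combinatorial type), $\lambda_v$ is the set of those $\lambda_j$ such that the image of $v$ under $\mathrm{ft}_{\lambda_j}$ is $4$-valent. For the curves considered, $\mathrm{val}(v)=3+\#\lambda_v$ and $\{\lambda_1,\dots,\lambda_l\}$ is the disjoint union of the $\lambda_v$. Let $r=\#\lambda_v$; for $\lambda=\{\beta_1,\dots,\beta_4\}\in\lambda_v$ replace each $\beta_i$ by the edge adjacent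 to $v$ through which the path from $v$ to $\beta_i$ starts, giving cross-ratios $\tilde\lambda_1,\dots,\tilde\lambda_r$ on the $3+r$ edges adjacent to $v$. The local weight $\omega_v(\sigma_C)$ is the weight of the $0$-dimensional cone in $\prod_{j=1}^r\mathrm{ft}^*_{\tilde\lambda_j}(0)\cdot\mathcal M_{0,3+r}$ (it is $1$ if $r=0$). **Local ev-multiplicity.** If a contracted end (point) is adjacent to $v$, then $\mathrm{mult}_{\mathrm{ev}}(v)=1$. Otherwise, for each edge $e$ adjacent to $v$, cut $e$, stretch it to infinity and consider the resulting tropical curve not containing $v$ (a component of $v$). It is called fixed if it is fixed by the points on it (it admits no deformation within its combinatorial type keeping the images of its marked points; a line is fixed iff there is a point on it), and free otherwise. There are exactly two fixed components; let $e_1,e_2$ be the corresponding edges. Then $\mathrm{mult}_{\mathrm{ev}}(v)=|\det(v(e_1,v),v(e_2,v))|$. *)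

(* Defs.v *)
From HB Require Import structures.
From mathcomp Require Import all_boot all_order all_algebra.
From mathcomp Require Import all_classical all_reals.

Set Implicit Arguments.
Unset Strict Implicit.
Unset Printing Implicit Defensive.

Import Order.TTheory GRing.Theory Num.Theory.
Local Open Scope classical_set_scope.
Local Open Scope ring_scope.

Section Complexes.
Context {R : realType} {m : nat}.
Implicit Types (s t : set 'rV[R]_m) (f : 'cV[R]_m) (v x : 'rV[R]_m).
Implicit Types (phi : 'rV[R]_m -> R) (Lam : set 'rV[R]_m).

Definition pairing v f : R := (v *m f) 0 0.

(* The linear space V_s parallel to the affine hull of s. *)
Definition lin s : {vspace 'rV[R]_m} :=
  xget 0%VS [set U : {vspace 'rV[R]_m} |
    (forall x y, s x -> s y -> x - y \in U) /\
    (forall W : {vspace 'rV[R]_m},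
       (forall x y, s x -> s y -> x - y \in W) -> (U <= W)%VS)].

Definition pdim s : nat := \dim (lin s).

Definition is_face t s : Prop :=
  t !=set0 /\ exists f (b : R),
    (forall x, s x -> pairing x f <= b) /\ t = s `&` [set x | pairing x f = b].

Definition relint s : set 'rV[R]_m :=
  [set x | s x /\ forall t, is_face t s -> t <> s -> ~ t x].

(* The linear part of phi on s; only its values on lin s are meaningful. *)
Definition linear_part phi s : 'cV[R]_m :=
  xget 0 [set f | exists c : R, forall x, s x -> phi x = pairing x f + c].

(* v represents the generator of Lam_s / Lam_t pointing from t into s, where
   Lam_s is the intersection of Lam and lin s. *)
Definition is_primitive_normal Lam t s v : Prop :=
  [/\ Lam v, v \in lin s,
      (forall w, Lam w -> w \in lin s ->
         exists z : int, w - v *~ z \in lin t)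
    & exists x (e : R), [/\ t x, 0 < e & s (x + e *: v)]].

Definition primitive_normal Lam t s : 'rV[R]_m :=
  xget 0 (is_primitive_normal Lam t s).

(* The weight function is only meaningful on the cells of dimension wdim. *)
Record wcomplex := WComplex {
  cells : set (set 'rV[R]_m);
  wt : set 'rV[R]_m -> R;
  wdim : nat
}.

Definition facets (Y : wcomplex) : set (set 'rV[R]_m) :=
  [set s | cells Y s /\ pdim s = wdim Y].

Definition support (Y : wcomplex) : set 'rV[R]_m :=
  [set x | exists s, [/\ facets Y s, wt Y s != 0 & s x]].

Definition deg (Y : wcomplex) : R := \sum_(s \in facets Y) wt Y s.

(* phi . Y, for phi integer affine linear on the cells of Y. *)
Definition divisor Lam phi (Y : wcomplex) : wcomplex :=
  let above t := [set s | facets Y s /\ is_face t s] in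
  {| cells := [set t | cells Y t /\ (pdim t < wdim Y)%N];
     wt := fun t =>
       \sum_(s \in above t)
          pairing (wt Y s *: primitive_normal Lam t s) (linear_part phi s)
       - pairing (\sum_(s \in above t) wt Y s *: primitive_normal Lam t s)
                 (linear_part phi t);
     wdim := (wdim Y).-1 |}.

(* The refinement of Y along {g = c}, for g affine linear on the cells of Y. *)
Definition refine (g : 'rV[R]_m -> R) (c : R) (Y : wcomplex) : wcomplex :=
  {| cells := [set t | t !=set0 /\ exists s, cells Y s /\
       [\/ t = s `&` [set x | g x <= c], t = s `&` [set x | g x = c]
         | t = s `&` [set x | c <= g x]]];
     wt := fun t => wt Y (xget set0 [set s | facets Y s /\ t `<=` s]);
     wdim := wdim Y |}.

(* max(g, c) . Y, for g integer affine linear on the cells of Y: after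
   refining along {g = c}, max(g, c) is affine linear on the cells. *)
Definition cut Lam (g : 'rV[R]_m -> R) (c : R) (Y : wcomplex) : wcomplex :=
  divisor Lam (fun x => Num.max (g x) c) (refine g c Y).

(* The function on a subset of R^m induced by F along a parametrization pt of
   this subset (F must be constant on the fibres of pt). *)
Definition descend (T : Type) (pt : T -> 'rV[R]_m) (F : T -> R) :
    'rV[R]_m -> R :=
  fun x => xget 0 [set r | exists C : T, pt C = x /\ F C = r].

End Complexes.

Arguments wcomplex : clear implicits.

(* A graph with node set vert + L: the inner nodes are the vertices of the
   curve; a node inr i stands for the point at infinity of the end labelled i,
   so that the edge joining it to a vertex is that end.  Only the edges
   between two vertices (the bounded edges) have a length. *)
Record pretree (R : realType) (L : finType) := Pretree {
  vert : finType;
  adj : rel (vert + L)%type;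
  len : vert -> vert -> R
}.

Definition node (R : realType) (L : finType) (G : pretree R L) : finType :=
  (vert G + L)%type.

Section Trees.
Context {R : realType} {L : finType}.
Implicit Types (G : pretree R L).

Definition is_simple_path G (x y : node G) (p : seq (node G)) : Prop :=
  [/\ path (@adj R L G) x p, last x p = y & uniq (x :: p)].

Definition valence G (v : vert G) : nat := #|[set y | adj (inl v) y]|.

Definition is_marked_tree G : Prop :=
  [/\ (forall x y : node G, adj x y = adj y x) /\
      (forall x : node G, ~~ adj x x),
      (forall x y : node G, exists! p, is_simple_path x y p),
      (forall i : L, exists v : vert G,
         forall y : node G, adj (inr i) y = (y == inl v)),
      (forall v : vert G, (3 <= valence v)%N)
    & (forall u v : vert G, adj (inl u) (inl v) ->
         0 < len u v /\ len u v = len v u)].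

(* The path from x to y, without its starting node x. *)
Definition geod G (x y : node G) : seq (node G) :=
  xget [::] [set p | is_simple_path x y p].

(* The first edge of the path from x to y, given by its second node. *)
Definition branch G (x y : node G) : node G := head x (geod x y).

Definition edge_len G (x y : node G) : R :=
  match x, y with inl u, inl v => len u v | _, _ => 0 end.

Definition dist G (x y : node G) : R :=
  \sum_(r <- pairmap (@edge_len G) x (geod x y)) r.

Definition with_len G (l : vert G -> vert G -> R) : pretree R L :=
  {| vert := vert G; adj := @adj R L G; len := l |}.

(* The curve with one bounded edge, of length 1, separating I from ~: I. *)
Definition split_tree (I : {set L}) : pretree R L :=
  {| vert := bool;
     adj := fun x y : (bool + L)%type =>
       match x, y with
       | inl b, inl b' => b != b'
       | inl b, inr i | inr i, inl b => b == (i \in I)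
       | inr _, inr _ => false
       end;
     len := fun _ _ => 1 |}.

End Trees.

Record marked_tree (R : realType) (L : finType) := MarkedTree {
  tree_data :> pretree R L;
  tree_valid : is_marked_tree tree_data
}.

Lemma adj_branch (R : realType) (L : finType) (G : marked_tree R L)
  (x y : node G) : x != y -> adj x (branch x y).
Proof.
move=> xy; have [_ exp _ _ _] := tree_valid G.
have [p [pP _]] := exp x y.
have : is_simple_path x y (geod x y) by apply: xgetPex; exists p.
rewrite /branch /is_simple_path; case: (geod x y) => [|z q] [] /=.
  by move=> _ e; rewrite e eqxx in xy.
by case/andP.
Qed.

(* ft_K, for K a set of labels given with an injection f : K -> L.  The
   vertices that remain are those at which at least three branches contain an
   end of f(K); two remaining nodes are joined by an edge if there is no
   remaining vertex strictly between them. *)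
Section Forget.
Context {R : realType} {L K : finType} (f : K -> L) (G : pretree R L).

Definition remains (v : vert G) : bool :=
  (3 <= #|[set branch (inl v : node G) (inr (f k)) | k : K]|)%N.

Definition ft_vert : finType := {v : vert G | remains v}.

Definition ft_node (x : ft_vert + K) : node G :=
  match x with inl v => inl (val v) | inr k => inr (f k) end.

Definition ft : pretree R K :=
  {| vert := ft_vert;
     adj := fun x y => (x != y) &&
       all (fun z => (z == ft_node y) ||
                     (if z is inl v then ~~ remains v else true))
           (geod (ft_node x) (ft_node y));
     len := fun u v => dist (inl (val u) : node G) (inl (val v)) |}.

End Forget.

(* The length of the bounded edge separating the ends 0, 1 from the ends 2, 3,
   and 0 if there is no such edge.  An edge is counted once, oriented from
   0, 1 to 2, 3. *)
Definition ell (R : realType) (G : pretree R 'I_4) : R :=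
  \sum_(u : vert G) \sum_(v : vert G |
     [&& adj (inl u) (inl v),
         branch (inl v : node G) (inr 0) == inl u,
         branch (inl v : node G) (inr 1) == inl u,
         branch (inl u : node G) (inr 2) == inl v
       & branch (inl u : node G) (inr 3) == inl v]) len u v.

Section M0.
Variables (R : realType) (L : finType).

Definition lpair : finType :=
  {e : L * L | (enum_rank e.1 < enum_rank e.2)%N}.

Definition fst_end (k : 'I_#|lpair|) : L := (val (enum_val k)).1.
Definition snd_end (k : 'I_#|lpair|) : L := (val (enum_val k)).2.

(* Its row space consists of the vectors (a_i + a_j)_{i<j}. *)
Definition Phi : 'M[R]_(#|L|, #|lpair|) :=
  \matrix_(i, k) ((enum_val i == fst_end k)%:R + (enum_val i == snd_end k)%:R).

(* The quotient of R^{pairs} by the row space of Phi is realized as R^q: right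
   multiplication by quot_mx is onto and its kernel is the row space of Phi. *)
Definition qdim : nat := \rank (cokermx Phi).
Definition quot_mx : 'M[R]_(#|lpair|, qdim) := col_base (cokermx Phi).

Definition pt0 (G : pretree R L) : 'rV[R]_qdim :=
  (\row_k dist (inr (fst_end k) : node G) (inr (snd_end k))) *m quot_mx.

Definition lattice0 : set 'rV[R]_qdim :=
  [set x | exists z : {set L} -> int,
    x = \sum_(I : {set L} | (1 < #|I|)%N && (1 < #|~: I|)%N)
          pt0 (split_tree I) *~ z I].

(* The closed cone of the combinatorial type of G: its coordinates are the
   lengths of the bounded edges, where 0 means that the edge is contracted. *)
Definition cone (G : pretree R L) : set 'rV[R]_qdim :=
  [set x | exists l : vert G -> vert G -> R,
    (forall u v, 0 <= l u v /\ l u v = l v u) /\ x = pt0 (with_len l)].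

Definition M0 : wcomplex R qdim :=
  {| cells := [set s | exists G : marked_tree R L, s = cone G];
     wt := fun=> 1;
     wdim := (#|L| - 3)%N |}.

(* ft_b^*(0) . Y in M_{0,L}, for b a 4-tuple of labels; b 0, b 1 | b 2, b 3 is
   the ray of M_{0,4} used for the function ell. *)
Definition ft0_div (b : 'I_4 -> L) (Y : wcomplex R qdim) : wcomplex R qdim :=
  divisor lattice0
    (descend (fun G : marked_tree R L => pt0 G)
             (fun G : marked_tree R L => ell (ft b G))) Y.

End M0.

Definition vecR (R : realType) (v : 'rV[int]_2) : 'rV[R]_2 := map_mx intr v.

Definition is_degree (R : realType) (d : nat) (Delta : 'I_d -> 'rV[int]_2) :
    Prop :=
  [/\ forall k, Delta k != 0, \sum_k Delta k = 0
    & row_full (\matrix_(k < d) vecR R (Delta k))].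

(* The labels: n + 1 contracted ends and the d ends of the degree. *)
Definition ends (n d : nat) : finType := ('I_n.+1 + 'I_d)%type.

(* pos v = h(v), and dir x y is the direction vector at x of the edge
   joining x and y (only meaningful if x and y are adjacent). *)
Record tcurve (R : realType) (n d : nat) (Delta : 'I_d -> 'rV[int]_2) :=
  Tcurve {
  abstract :> marked_tree R (ends n d);
  dir : node abstract -> node abstract -> 'rV[int]_2;
  pos : vert abstract -> 'rV[R]_2;
  tcurve_edge : forall u v : vert abstract, adj (inl u) (inl v) ->
    pos v = pos u + len u v *: vecR R (dir (inl u) (inl v));
  tcurve_balanced : forall v : vert abstract,
    \sum_(x : node abstract | adj (inl v) x) dir (inl v) x = 0;
  tcurve_contracted : forall (v : vert abstract) (i : 'I_n.+1),
    adj (inl v) (inr (inl i)) -> dir (inl v) (inr (inl i)) = 0;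
  tcurve_end : forall (v : vert abstract) (k : 'I_d),
    adj (inl v) (inr (inr k)) -> dir (inl v) (inr (inr k)) = Delta k
}.

(* A non-degenerated cross-ratio (b 0 b 1 | b 2 b 3) of given length; the
   unordered pair of unordered pairs is cr_pairs. *)
Record cross_ratio (R : realType) (L : finType) := CrossRatio {
  cr_lab : 'I_4 -> L;
  cr_lab_inj : injective cr_lab;
  cr_len : R;
  cr_len_gt0 : 0 < cr_len
}.

Definition cr_pairs (R : realType) (L : finType) (c : cross_ratio R L) :
    {set {set L}} :=
  [set [set cr_lab c 0; cr_lab c 1]; [set cr_lab c 2; cr_lab c 3]]%SET.

Section Moduli.
Variables (R : realType) (n d : nat) (Delta : 'I_d -> 'rV[int]_2).
Notation E := (ends n d).
Notation curve := (tcurve R n Delta).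
Notation W := 'rV[R]_(qdim R E + 2).

(* ev_i(C): the image of the vertex adjacent to the contracted end i. *)
Definition ev (i : 'I_n.+1) (C : curve) : 'rV[R]_2 :=
  if [pick v : vert C | adj (inl v) (inr (inl i))] is Some v
  then pos v else 0.

Definition pt (C : curve) : W := row_mx (pt0 C) (ev ord0 C).

Definition lattice : set W :=
  [set x | lattice0 (lsubmx x) /\ forall k, rsubmx x 0 k \is a Num.int].

Definition M : wcomplex R (qdim R E + 2) :=
  {| cells := [set s | exists2 c, cells (M0 R E) c & s = [set x | c (lsubmx x)]];
     wt := fun=> 1;
     wdim := (wdim (M0 R E) + 2)%N |}.

Definition ev_fun (i : 'I_n.+1) (k : 'I_2) : W -> R :=
  descend pt (fun C => ev i C 0 k).

Definition ft_fun (b : 'I_4 -> E) : W -> R :=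
  descend pt (fun C => ell (ft b C)).

(* ev_i^*(q) . Y *)
Definition ev_cut (i : 'I_n.+1) (q : 'rV[R]_2) (Y : wcomplex R _) :=
  cut lattice (ev_fun i 1) (q 0 1) (cut lattice (ev_fun i 0) (q 0 0) Y).

(* ft_{c}^*(|c|) . Y *)
Definition cr_cut (c : cross_ratio R E) (Y : wcomplex R _) :=
  cut lattice (ft_fun (cr_lab c)) (cr_len c) Y.

(* ft^*(0) . Y for the degeneration of c, using the ray of M_{0,4} singled out
   by the pairs of c; the function is linear on the cones of M. *)
Definition cr_div (c : cross_ratio R E) (Y : wcomplex R _) :=
  divisor lattice (ft_fun (cr_lab c)) Y.

Variables (l : nat) (p : 'I_n.+1 -> 'rV[R]_2) (lam : 'I_l -> cross_ratio R E).

Definition ev_prod (Y : wcomplex R _) :=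
  foldr (fun i => ev_cut i (p i)) Y (enum 'I_n.+1).

Definition cr_prod (Y : wcomplex R _) :=
  foldr (fun j => cr_cut (lam j)) Y (enum 'I_l).

Definition cr_prod_degen (Y : wcomplex R _) :=
  foldr (fun j => cr_div (lam j)) Y (enum 'I_l).

Definition cycle : wcomplex R _ := cr_prod (ev_prod M).
Definition cycle_degen : wcomplex R _ := cr_prod_degen (ev_prod M).

(* As a complex X is a skeleton of the fan M, without refinement. *)
Definition X : wcomplex R _ := cr_prod_degen M.

Definition in_interiors (A : set W) (Y : wcomplex R _) : Prop :=
  forall x, A x -> exists2 s, facets Y s & relint s x.

Definition general_position : Prop :=
  [/\ injective (fun j => cr_pairs (lam j)),
      support cycle !=set0, finite_set (support cycle)
    & in_interiors (support cycle) M].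

(* What it means for the degenerated conditions to be in general position,
   besides being degenerations of conditions in general position. *)
Definition degen_in_interiors : Prop :=
  in_interiors (support (ev_prod X)) X.

Definition N : R := deg cycle.
Definition N_degen : R := deg cycle_degen.

Definition contributes (C : curve) : Prop := support cycle_degen (pt C).

Definition mult (C : curve) : R := wt cycle_degen [set pt C].

Section Local.
Variables (C : curve) (v : vert C).

(* lambda_v, as a set of indices: v survives under ft and is 4-valent there. *)
Definition lambda_at : {set 'I_l} :=
  [set j | [exists w : vert (ft (cr_lab (lam j)) C),
              (val w == v) && (valence w == 4%N)]]%SET.

(* The edges adjacent to v. *)
Definition star : finType := {x : node C | adj (inl v) x}.

Definition star_branch (i : E) : star :=
  exist (fun x : node C => adj (inl v) x) (branch (inl v : node C) (inr i))
        (@adj_branch R E C (inl v) (inr i) isT).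

(* omega_v, the weight of the origin of M_{0,star}.  It only depends on the
   combinatorial type of C; for C in the interior of a cell of X, this is the
   combinatorial type of that cell. *)
Definition omega : R :=
  wt (foldr (fun j => ft0_div (star_branch \o cr_lab (lam j)))
            (M0 R star) (enum lambda_at))
     [set 0].

Definition component (w : vert C) : {set vert C} :=
  [set u | branch (inl v : node C) (inl u) == inl w]%SET.

(* The edges leaving K have been stretched to ends, so that they impose no
   condition; the points on K keep their images. *)
Definition is_deformation (K : {set vert C})
    (len' : vert C -> vert C -> R) (pos' : vert C -> 'rV[R]_2) : Prop :=
  (forall a b, a \in K -> b \in K -> adj (inl a) (inl b) ->
     [/\ 0 < len' a b, len' a b = len' b a
       & pos' b = pos' a + len' a b *: vecR R (dir (inl a) (inl b))]) /\
  (forall a i, a \in K -> adj (inl a) (inr (inl i)) -> pos' a = pos a).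

(* If the edge joining v to x is an end (not contracted), then the component
   of v is a line without points on it, which is free. *)
Definition is_fixed (x : node C) : Prop :=
  if x is inl w then
    forall len' pos', is_deformation (component w) len' pos' ->
      forall a, a \in component w ->
        pos' a = pos a /\
        forall b, b \in component w -> adj (inl a) (inl b) ->
          len' a b = len a b
  else False.

Definition fixed_edges : {set node C} :=
  [set x | adj (inl v) x && `[< is_fixed x >]]%SET.

(* The value 0 is a dummy for the case where there are not exactly two fixed
   components. *)
Definition mult_ev : int :=
  if [exists i : 'I_n.+1, adj (inl v : node C) (inr (inl i))] then 1
  else if [pick e : node C * node C |
             (e.1 != e.2) && (fixed_edges == [set e.1; e.2]%SET)] is Some e
  then `|\det (col_mx (dir (inl v) e.1) (dir (inl v) e.2) : 'M[int]_2)|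
  else 0.

End Local.

End Moduli.

(* Main.v *)
(** On the whole moduli space every coordinate of ev_i is the restriction of one
    linear functional, and ell (ft b) = max (L, 0) for the functional
    L = (d(b0,b2) + d(b1,b3) - d(b0,b1) - d(b2,b3)) / 2.  Hence all the divisors
    are stable intersections of one balanced fan with hyperplanes {L = c}, and
    the degenerated product differs from the other one only in the constants c.
    The weight of a point x is the number of maximal cones around the cone of x
    that meet a generic translate of the common kernel of the L, each counted
    with |det L|; balancing makes it independent of the translate, and the degree
    of the product is this number for the cone {0}, which does not involve c.

    Let S be the set of rays of the cone of C.  General position makes the
    evaluations as many as the elements of S, while the cross-ratio functionals
    vanish on S, and nonvanishing of the weight forces each of them to live at
    exactly one vertex.  The cones around S are products of cones of
    M_{0,star v}, so that the weight of C is |det (ev on S)| times the product of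
    the omega_v.  The determinant is also that of the conditions on arbitrary
    displacements of the vertices: bounded edges keep their directions and
    marked points do not move.  When each bounded edge is directed from its fixed
    to its free side, every vertex receives exactly two of these conditions,
    those of its marked point or those of two incoming edges; the matrix becomes
    block triangular with diagonal blocks of determinant +-mult_ev(v). *)

(* Lattice indices are the obstacle to comparing an iterated divisor with a count of determinants.
   The shape of the invariant [inv] absorbs them: it does not state the weight of a cell but its
   product with |[pdet B g|], for every lattice basis [B] of the cell and every list [g] of as many
   functionals. In a divisor by L, the functional L joins the front of [g], the primitive normal
   becomes one more basis vector, and the determinant expands along the column of L. Points and
   cells are tied to the count by [dgr_hit], which perturbs a target that is not generic: each
   maximal cone meeting the perturbed target has exactly one face whose interior meets the original
   one. The orientation of the edges in the evaluation determinant comes from parity. There are 2n+1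
   vertices and n+1 marked points, so deleting a bounded edge leaves one side with an odd and one
   with an even number of vertices. A nonzero determinant forces a side K to carry (#K + 1)/2 marked
   points if #K is odd and #K/2 if it is even; comparing conditions with unknowns then shows that
   the odd side is the fixed one. *)
From HB Require Import structures.
Require Import Defs.
From mathcomp Require Import all_boot all_order all_fingroup all_algebra.
From mathcomp Require Import all_classical all_reals.
From mathcomp Require Import ring lra zify fintype finset.

Set Implicit Arguments.
Unset Strict Implicit.
Unset Printing Implicit Defensive.

Import Order.TTheory GRing.Theory Num.Theory.
Local Open Scope classical_set_scope.
Local Open Scope ring_scope.

(** * Counting the maximal cones that contain a generic vector *)

Section Pairing.
Variables (R : realType) (m : nat).
Implicit Types (v w : 'rV[R]_m) (f g : 'cV[R]_m).

Lemma pairingE v f : pairing v f = \sum_j v 0 j * f j 0.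
Proof. by rewrite /pairing mxE. Qed.

Lemma pairingDl v w f : pairing (v + w) f = pairing v f + pairing w f.
Proof. by rewrite /pairing mulmxDl mxE. Qed.

Lemma pairingZl a v f : pairing (a *: v) f = a * pairing v f.
Proof. by rewrite /pairing -scalemxAl mxE. Qed.

Lemma pairingNl v f : pairing (- v) f = - pairing v f.
Proof. by rewrite -scaleN1r pairingZl mulN1r. Qed.

Lemma pairingBl v w f : pairing (v - w) f = pairing v f - pairing w f.
Proof. by rewrite pairingDl pairingNl. Qed.

Lemma pairing0l f : pairing 0 f = 0.
Proof. by rewrite -(scale0r 0) pairingZl mul0r. Qed.

Lemma pairing_suml (I : Type) (r : seq I) (P : pred I) (F : I -> 'rV[R]_m) f :
  pairing (\sum_(i <- r | P i) F i) f = \sum_(i <- r | P i) pairing (F i) f.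
Proof.
by elim/big_rec2: _ => [|i x y _ <-]; rewrite ?pairing0l ?pairingDl.
Qed.

Lemma pairingDr v f g : pairing v (f + g) = pairing v f + pairing v g.
Proof. by rewrite /pairing mulmxDr mxE. Qed.

Lemma pairingZr a v f : pairing v (a *: f) = a * pairing v f.
Proof. by rewrite /pairing -scalemxAr mxE. Qed.

Lemma pairingNr v f : pairing v (- f) = - pairing v f.
Proof. by rewrite -scaleN1r pairingZr mulN1r. Qed.

Lemma pairing0r v : pairing v 0 = 0.
Proof. by rewrite -(scale0r 0) pairingZr mul0r. Qed.

Lemma pairing_sumr (I : Type) (r : seq I) (P : pred I) v (F : I -> 'cV[R]_m) :
  pairing v (\sum_(i <- r | P i) F i) = \sum_(i <- r | P i) pairing v (F i).
Proof.
by elim/big_rec2: _ => [|i x y _ <-]; rewrite ?pairing0r ?pairingDr.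
Qed.

(** On the moment curve (1, t, t^2, ...) each functional becomes a nonzero polynomial in t. Their
    product has fewer roots than its size, so some natural number below that size avoids them
    all. *)
Lemma avoid_kernels (fs : seq 'cV[R]_m) :
  (forall f, f \in fs -> f != 0) -> exists w, forall f, f \in fs -> pairing w f != 0.
Proof.
move=> fs0.
pose p (f : 'cV[R]_m) := \sum_(j < m) f j 0 *: 'X^j : {poly R}.
have pE f j : (p f)`_(j : 'I_m) = f j 0.
  rewrite /p coef_sum (bigD1 j) //= coefZ coefXn eqxx mulr1 big1 ?addr0 // => i ij.
  by rewrite coefZ coefXn eq_sym (inj_eq val_inj) (negbTE ij) mulr0.
pose P := \prod_(f <- fs) p f.
have P0 : P != 0.
  rewrite /P prodf_seq_neq0; apply/allP => f ffs /=.
  apply: contra (fs0 f ffs) => /eqP pf.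
  by apply/eqP/colP => j; rewrite -pE pf coef0 mxE.
have /hasP [t _ Pt] : has (fun t => ~~ root P t) [seq (k%:R : R) | k <- iota 0 (size P)].
  apply: contraNT P0 => /hasPn h; apply: contraT => P0.
  suff : (size [seq (k%:R : R) | k <- iota 0 (size P)] < size P)%N.
    by rewrite size_map size_iota ltnn.
  apply: max_poly_roots => //; first by apply/allP => x /h; rewrite negbK.
  by rewrite map_inj_uniq ?iota_uniq // => x y /eqP; rewrite eqr_nat => /eqP.
exists (\row_j t ^+ j) => f ffs.
have -> : pairing (\row_j t ^+ j) f = (p f).[t].
  rewrite pairingE horner_sum; apply: eq_bigr => j _.
  by rewrite hornerZ hornerXn mxE mulrC.
move: Pt; rewrite /root /P horner_prod; apply: contraNneq => pf.
by apply/negPn; rewrite prodf_seq_neq0; apply/allPn; exists f; rewrite // pf negbK.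
Qed.

End Pairing.

Section Det.
Variables (R : realType) (N : nat).
Implicit Types (s t : seq 'rV[R]_N) (w : 'rV[R]_N).

Definition rmat s : 'M[R]_N := \matrix_(i < N) nth 0 s i.
Definition detr s : R := \det (rmat s).

Lemma detr_perm s t : perm_eq s t -> size s = N -> `|detr s| = `|detr t|.
Proof.
move=> st sz; have szt : size t == N by rewrite -(perm_size st) sz.
have /tuple_permP [p sp] : perm_eq s (Tuple szt) by [].
have -> : detr s = \det (row_perm p (rmat t)).
  congr (\det _); apply/matrixP => i j.
  by rewrite !mxE sp -tnth_nth tnth_mktuple (tnth_nth 0).
by rewrite row_permE det_mulmx det_perm normrM normr_sign mul1r.
Qed.

(** Laplace expansion along the first row: the cofactors of that row do not depend on it, so they
    may be computed with 0 in its place. *)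
Lemma detr_ex s : (0 < N)%N -> exists f, forall w, detr (w :: s) = pairing w f.
Proof.
move=> hN; pose i0 := Ordinal hN.
exists (\col_j cofactor (rmat (0 :: s)) i0 j) => w.
rewrite /detr (expand_det_row _ i0) pairingE; apply: eq_bigr => j _.
rewrite !mxE /=; congr (_ * (_ * \det _)).
apply/matrixP => a b; rewrite !mxE.
by case: (unliftP i0 (lift i0 a)) (neq_lift i0 a) => // a' /lift_inj <- _.
Qed.

Definition hc s : 'cV[R]_N := xget 0 [set f | forall w, detr (w :: s) = pairing w f].

Lemma detr_cons s w : (0 < N)%N -> detr (w :: s) = pairing w (hc s).
Proof. move=> hN; move: w.
exact: (@xgetPex _ 0 [set f | forall w, detr (w :: s) = pairing w f] (detr_ex s hN)). Qed.

(** Two equal rows; the bound on [size s] keeps the second copy of [w] from being cut off when the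
    list is read as a matrix with N rows. *)
Lemma detr_in s w : (size s < N)%N -> w \in s -> detr (w :: s) = 0.
Proof.
move=> sz ws; have ik : (index w s < size s)%N by rewrite index_mem.
have h0 : (0 < N)%N by exact: leq_ltn_trans sz.
have hk : ((index w s).+1 < N)%N by exact: leq_ltn_trans sz.
apply: (determinant_alternate (i1 := Ordinal h0) (i2 := Ordinal hk)) => // j.
by rewrite !mxE /= nth_index.
Qed.

Variables (J : finType) (v : J -> 'rV[R]_N).
Implicit Types (S : {set J}) (A B : J).

Definition rows S := [seq v A | A <- enum S].
Definition vol S : R := `|detr (rows S)|.

Lemma size_rows S : size (rows S) = #|S|.
Proof. by rewrite size_map -cardE. Qed.

Lemma detr_span S (c : J -> R) :
  (#|S| < N)%N -> detr ((\sum_(A in S) c A *: v A) :: rows S) = 0.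
Proof.
move=> SN; rewrite detr_cons ?(leq_ltn_trans _ SN) // pairing_suml big1 // => A AS.
rewrite pairingZl -detr_cons ?(leq_ltn_trans _ SN) // detr_in ?mulr0 ?size_rows //.
by apply/map_f; rewrite mem_enum.
Qed.

Lemma perm_rows S A : A \in S -> perm_eq (rows S) (v A :: rows (S :\ A)).
Proof.
move=> AS; rewrite -map_cons; apply: perm_map; apply: uniq_perm.
- exact: enum_uniq.
- by rewrite /= enum_uniq andbT mem_enum !inE eqxx.
- by move=> B; rewrite inE !mem_enum !inE; case: eqP => // ->.
Qed.

Lemma vol_cons S A : #|S| = N -> A \in S -> vol S = `|detr (v A :: rows (S :\ A))|.
Proof. by move=> SN AS; apply: detr_perm (perm_rows AS) _; rewrite size_rows. Qed.

Lemma detr_solve S w : #|S| = N -> vol S != 0 ->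
  exists c : J -> R, w = \sum_(A in S) c A *: v A.
Proof.
move=> SN; rewrite normr_eq0 => d0.
have u : rmat (rows S) \in unitmx by rewrite unitmxE unitfE.
pose y := w *m invmx (rmat (rows S)).
exists (fun A => if insub (index A (enum S)) is Some i then y 0 i else 0).
have -> : w = y *m rmat (rows S) by rewrite /y mulmxKV.
rewrite mulmx_sum_row -[RHS]big_enum /=.
case: (pickP (mem S)) => [A0 A0S|S0]; last first.
  have e0 : N = 0%N by rewrite -SN; apply: eq_card0.
  rewrite [RHS]big1_seq; last by move=> A /=; rewrite mem_enum; move: (S0 A) => /= ->.
  by rewrite big1 // => i _; have := ltn_ord i; rewrite {2}e0.
rewrite (big_nth A0) big_mkord -cardE SN; apply: eq_bigr => i _.
have iS : (i < size (enum S))%N by rewrite -cardE SN.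
rewrite index_uniq ?enum_uniq // valK; congr (_ *: _).
by apply/rowP => j; rewrite !mxE (nth_map A0).
Qed.

End Det.

Section Count.
Variables (R : realType) (N : nat) (J : finType) (v : J -> 'rV[R]_N).
Variable good : {set J} -> bool.
Implicit Types (S T : {set J}) (A B : J) (u w : 'rV[R]_N).

Definition top S := [&& good S, #|S| == N & vol v S != 0].

(** Cramer's rule for the coefficient of [v A] when [u] is expanded in the images of [S]. Numerator
    and denominator list the other rows in the same order, so no sign depends on that order. *)
Definition co S A u : R :=
  detr (u :: rows v (S :\ A)) / detr (v A :: rows v (S :\ A)).

(** The multiplicity over [u] of the star of [S0], as in the fan displacement rule for stable
    intersections: coordinates along [S0] are unrestricted, so a maximal cone counts if its image,
    enlarged by the span of [S0], contains [u]. *)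
Definition dcount S0 u : R :=
  \sum_(S | top S && (S0 \subset S)) vol v S * [forall A in S :\: S0, 0 < co S A u]%:R.

Lemma top_card S : top S -> #|S| = N.
Proof. by case/and3P => _ /eqP. Qed.

Lemma top_gt0 S A : top S -> A \in S -> (0 < N)%N.
Proof. by move=> /top_card <- AS; apply/card_gt0P; exists A. Qed.

Lemma top_cardD1 S A : top S -> A \in S -> (#|S :\ A| < N)%N.
Proof. by move=> /top_card <- AS; rewrite [#|S|](cardsD1 A) AS. Qed.

Lemma top_det S A : top S -> A \in S -> detr (v A :: rows v (S :\ A)) != 0.
Proof.
move=> tS AS; have := tS; rewrite /top (vol_cons _ (top_card tS) AS) normr_eq0.
by case/and3P.
Qed.

Lemma co_ex S A : top S -> A \in S -> exists f, forall u, co S A u = pairing u f.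
Proof.
move=> tS AS; have N0 := top_gt0 tS AS.
exists ((detr (v A :: rows v (S :\ A)))^-1 *: hc (rows v (S :\ A))) => u.
by rewrite pairingZr /co detr_cons // mulrC.
Qed.

Lemma coD S A a b u w : top S -> A \in S ->
  co S A (a *: u + b *: w) = a * co S A u + b * co S A w.
Proof. by move=> tS /(co_ex tS) [f fE]; rewrite !fE pairingDl !pairingZl. Qed.

Lemma co_eq S A (c : J -> R) : top S -> A \in S ->
  co S A (\sum_(B in S) c B *: v B) = c A.
Proof.
move=> tS AS; rewrite /co (bigD1 A) //=.
have := detr_span v c (top_cardD1 tS AS).
rewrite !detr_cons ?(top_gt0 tS AS) // pairingDl pairingZl.
have -> : \sum_(B in S :\ A) c B *: v B = \sum_(B in S | B != A) c B *: v B.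
  by apply: eq_bigl => B; rewrite !inE andbC.
move=> ->; rewrite addr0 -detr_cons ?(top_gt0 tS AS) // mulfK // top_det //.
Qed.

Lemma co_solve S u : top S -> u = \sum_(B in S) co S B u *: v B.
Proof.
move=> tS; have /and3P [_ /eqP SN d0] := tS.
have [c uc] := detr_solve u SN d0.
by rewrite {1}uc; apply: eq_bigr => B BS; rewrite uc co_eq.
Qed.

(** Double counting: maximal cones with a chosen wall become walls with a chosen maximal cone. *)
Lemma sum_toggle (V : nmodType) (F : {set J} -> J -> V) :
  \sum_(S : {set J}) \sum_(A in S) F S A = \sum_(S : {set J}) \sum_(A | A \notin S) F (A |: S) A.
Proof.
rewrite (exchange_big_dep xpredT) //= [RHS](exchange_big_dep xpredT) //=.
apply: eq_bigr => A _.
rewrite (reindex_onto (fun S => A |: S) (fun S => S :\ A)) /=; last first.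
  by move=> S AS; rewrite setD1K.
apply: eq_bigl => S; rewrite setU11 /=.
apply/eqP/idP => [<-|AS]; first by rewrite !inE eqxx.
by rewrite setU1K.
Qed.

Hypothesis balanced : forall T, good T -> #|T|.+1 = N ->
  \sum_(A | (A \notin T) && good (A |: T)) detr (v A :: rows v T) = 0.
Hypothesis good_down : forall S0 T S,
  good S0 -> S0 \subset T -> T \subset S -> good S -> good T.

(** When the target moves from [ua] to [ub] through [us], only cones with a coordinate vanishing at
    [us] can change, and each of them has just one such coordinate A. The changes of the cones
    around one wall T are a common factor times det(v A, T), and [balanced] makes them cancel. *)
Lemma wall_crossing S0 (ua us ub : 'rV[R]_N) (s : R) : good S0 -> 0 < s < 1 ->
  us = (1 - s) *: ua + s *: ub ->
  (forall S A, top S -> S0 \subset S -> A \in S :\: S0 ->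
    [/\ co S A ua != 0, co S A ub != 0 & co S A us != 0 ->
      ((0 < co S A ua) = (0 < co S A us)) /\ ((0 < co S A ub) = (0 < co S A us))]) ->
  (forall S A B, top S -> S0 \subset S -> A \in S :\: S0 -> B \in S :\: S0 ->
    co S A us = 0 -> co S B us = 0 -> A = B) ->
  dcount S0 ua = dcount S0 ub.
Proof.
move=> gS0 s01 usE sgn uniqz; apply/eqP; rewrite -subr_eq0.
pose others (S : {set J}) A := [forall B in (S :\: S0) :\ A, 0 < co S B us].
(* [cond S A]: at [us] the target meets the wall of S opposite to A. Then [G S A] is the resulting
   change of the contribution of S. *)
pose cond (S : {set J}) A := [&& top S, S0 \subset S, A \in S :\: S0 & co S A us == 0].
pose G (S : {set J}) A : R := vol v S * ((others S A)%:R * ((0 < co S A ua)%R%:R - (0 < co S A ub)%R%:R)).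
have -> : dcount S0 ua - dcount S0 ub = \sum_(S : {set J}) \sum_(A in S) (if cond S A then G S A else 0).
  rewrite /dcount -sumrB [LHS]big_mkcond /=; apply: eq_bigr => S _.
  case: ifPn => [/andP [tS SS]|nS]; last first.
    rewrite big1 // => A _; rewrite /cond; case: ifP => // /and4P [tS SS _ _].
    by rewrite tS SS in nS.
  rewrite -mulrBr -big_mkcondr /=.
  have eqo A u : A \in S :\: S0 -> (u = ua) \/ (u = ub) -> co S A us = 0 ->
      [forall B in S :\: S0, 0 < co S B u] = others S A && (0 < co S A u).
    move=> AS ue zA; apply/forall_inP/andP => [h|[/forall_inP h1 h2] B BS].
      split; last exact: h.
      apply/forall_inP => B; rewrite in_setD1 => /andP [BA BS].
      have zB : co S B us != 0 by apply: contra_neq BA => z; apply: uniqz z zA.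
      by case: (sgn S B tS SS BS) => _ _ /(_ zB) [e1 e2]; have := h B BS; case: ue => ->; rewrite ?e1 ?e2.
    have [->//|BA] := eqVneq B A.
    have := h1 B; rewrite in_setD1 BA BS => /(_ isT) p.
    by case: (sgn S B tS SS BS) => _ _; rewrite gt_eqF // => /(_ isT) [e1 e2]; case: ue => ->; rewrite ?e1 ?e2.
  case: (pickP (fun A => (A \in S :\: S0) && (co S A us == 0))) => [A /andP [AS zA]|none].
    rewrite (bigD1 A) /=; last by rewrite /cond tS SS AS zA; move: AS; rewrite inE => /andP [_ ->].
    rewrite [X in _ = _ + X]big1 ?addr0; last first.
      move=> B /andP [/andP [_ /and4P [_ _ BS /eqP zB]] BA].
      by rewrite (uniqz _ _ _ tS SS BS AS zB (eqP zA)) eqxx in BA.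
    rewrite /G (eqo A ua) ?(eqo A ub) //; try by [apply/eqP | left | right].
    by congr (_ * _); case: (others S A); rewrite /= ?mul1r ?mul0r ?subrr.
  rewrite [RHS]big1; last by move=> A /andP [_ /and4P [_ _ AS zA]]; move: (none A); rewrite AS zA.
  suff -> : [forall A in S :\: S0, 0 < co S A ua] = [forall A in S :\: S0, 0 < co S A ub] by rewrite subrr mulr0.
  apply: eq_forallb_in => A AS; have := none A; rewrite AS /= => /negbT zA.
  by case: (sgn S A tS SS AS) => _ _ /(_ zA) [-> ->].
rewrite sum_toggle big1 // => T _.
rewrite -big_mkcondr /=.
case: (pickP (fun A => (A \notin T) && cond (A |: T) A)) => [A0|none]; last first.
  by rewrite big1 // => A /andP [AT cA]; move: (none A); rewrite AT cA.
move=> /andP [A0T /and4P [tS SS A0S /eqP z0]].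
have A0in : A0 \in A0 |: T by rewrite setU11.
have N0 := top_gt0 tS A0in.
have ST : S0 \subset T.
  apply/subsetP => B B0; have := subsetP SS B B0; rewrite in_setU1.
  by case: eqP => //= e; move: A0S; rewrite -e inE B0.
have cT : #|T|.+1 = N by rewrite -(top_card tS) cardsU1 A0T.
pose c B := co (A0 |: T) B us.
have usT : us = \sum_(B in T) c B *: v B.
  by rewrite {1}(co_solve us tS) big_setU1 //= z0 scale0r add0r.
have topE A : A \notin T -> good (A |: T) -> detr (v A :: rows v T) != 0 -> top (A |: T).
  move=> AT gA dA; rewrite /top gA cardsU1 AT add1n cT eqxx /=.
  by rewrite (@vol_cons _ _ _ _ _ A) ?setU11 ?setU1K ?normr_eq0 // cardsU1 AT add1n cT.
have coT A B : A \notin T -> top (A |: T) -> B \in A |: T ->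
    co (A |: T) B us = if B == A then 0 else c B.
  move=> AT tA BA.
  have -> : us = \sum_(B in A |: T) (if B == A then 0 else c B) *: v B.
    rewrite big_setU1 //= eqxx scale0r add0r usT; apply: eq_bigr => C CT.
    by case: eqP => // e; rewrite -e CT in AT.
  exact: (co_eq (fun B => if B == A then 0 else c B)).
pose ya := detr (ua :: rows v T); pose yb := detr (ub :: rows v T).
(* At [us], which lies in the span of T, the determinant with the rows of T vanishes; hence [ya] and
   [yb] have opposite signs. *)
have yab : (1 - s) * ya + s * yb = 0.
  have cT1 : (#|T| < N)%N by rewrite -cT.
  have := @detr_span R N J v T c cT1; rewrite -usT usE /ya /yb !detr_cons //.
  by rewrite pairingDl !pairingZl.
have ya0 : ya != 0.
  case: (sgn _ _ tS SS A0S) => h _ _; apply: contra h => /eqP h.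
  by rewrite /co setU1K // -/ya h mul0r.
pose P := [forall B in T :\: S0, 0 < c B].
have oth A : A \notin T -> top (A |: T) -> others (A |: T) A = P.
  move=> AT tA; rewrite /others /P.
  have -> : ((A |: T) :\: S0) :\ A = T :\: S0.
    apply/setP => B; rewrite !inE; have [->|] //= := eqVneq B A.
    by rewrite (negbTE AT) andbF.
  apply: eq_forallb_in => B; rewrite inE => /andP [_ BT].
  rewrite coT // ?in_setU1 ?BT ?orbT //.
  by case: eqP => // e; rewrite -e BT in AT.
(* The volume carries only the absolute value of det(v A, T); its sign comes back through the
   question whether the cone lies on the side of [ua] or of [ub]. *)
have Gx A : A \notin T -> good (A |: T) ->
   (if cond (A |: T) A then G (A |: T) A else 0) =
   P%:R * Num.sg ya * detr (v A :: rows v T).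
  move=> AT gA; set x := detr (v A :: _).
  have [x0|x0] := eqVneq x 0.
    rewrite x0 mulr0; case: ifP => // /and4P [/(top_det) /(_ (setU11 _ _))].
    by rewrite setU1K // -/x x0 eqxx.
  have tA := topE A AT gA x0.
  have -> : cond (A |: T) A.
    rewrite /cond tA (subset_trans ST) ?subsetUr //= inE setU11 andbT coT ?setU11 // !eqxx andbT.
    by apply: contra AT => /(subsetP ST).
  rewrite /G (@vol_cons _ _ _ _ _ A) ?setU11 ?setU1K ?(top_card tA) // oth // /co !setU1K // -/x -/ya -/yb.
  rewrite mulrCA -mulrA; congr (_ * _).
  case/andP: s01 => s0 s1.
  have s1' : 0 < 1 - s by rewrite subr_gt0.
  have [yp|yn|/esym y0] := ltrgtP 0 ya; last by rewrite y0 eqxx in ya0.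
    have yb0 : yb < 0 by nra.
    have [xp|xn|/esym e] := ltrgtP 0 x; last by rewrite e eqxx in x0.
      by rewrite gtr0_norm // gtr0_sg // divr_gt0 // ltNge nmulr_rle0 ?invr_ge0 ?ltW //= subr0 mulr1 mul1r.
    rewrite ltr0_norm // gtr0_sg // ltNge mulr_ge0_le0 ?invr_le0 ?ltW //= nmulr_rgt0 ?invr_lt0 // xn.
    by rewrite sub0r mulrN1 opprK mul1r.
  have yb0 : 0 < yb by nra.
  have [xp|xn|/esym e] := ltrgtP 0 x; last by rewrite e eqxx in x0.
    rewrite gtr0_norm // ltr0_sg // ltNge nmulr_rle0 ?invr_ge0 ?ltW //= divr_gt0 //.
    by rewrite sub0r mulrN1 mulN1r.
  rewrite ltr0_norm // ltr0_sg // nmulr_rgt0 ?invr_lt0 // xn ltNge mulr_ge0_le0 ?invr_le0 ?ltW //=.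
  by rewrite subr0 mulr1 mulN1r.
rewrite big_mkcondr /=.
rewrite (eq_bigr (fun A => if good (A |: T) then P%:R * Num.sg ya * detr (v A :: rows v T) else 0)).
  rewrite -big_mkcondr -mulr_sumr balanced ?mulr0 //.
  have /and3P [gA0 _ _] := tS.
  exact: (good_down gS0 ST (subsetUr [set A0] T) gA0).
move=> A AT; have [gA|ngA] := boolP (good (A |: T)); first exact: Gx.
by rewrite /cond /top (negbTE ngA).
Qed.

End Count.

Lemma small_eps (R : realType) (s : seq (R * R)) : exists2 e : R, 0 < e &
  forall a b t, (a, b) \in s -> 0 < t <= e ->
    (0 < a -> 0 < a + t * b) /\ (a < 0 -> a + t * b < 0).
Proof.
elim: s => [|[a0 b0] s [e e0 he]]; first by exists 1.
(* The summand 1 covers [b0 = 0]; for [t <= d] the perturbation [t * b0] stays below [a0] in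
   absolute value. *)
pose d := `|a0| / (1 + `|b0|).
have b1 : 0 < 1 + `|b0| by rewrite ltr_pwDl.
have key t : 0 < t <= d -> a0 != 0 -> `|t * b0| < `|a0|.
  case/andP => t0 td a00; rewrite normrM gtr0_norm //.
  apply: lt_le_trans (_ : t * (1 + `|b0|) <= _).
    by rewrite ltr_pM2l // ltrDr.
  by rewrite -ler_pdivlMr.
have [a00|a00] := eqVneq a0 0.
  exists e => // a b t; rewrite inE => /orP [/eqP [-> _]|]; last exact: he.
  by rewrite a00 ltxx.
exists (Num.min d e) => [|a b t].
  by rewrite lt_min e0 divr_gt0 ?normr_gt0.
rewrite le_min inE => /orP [/eqP [-> ->]|ab] /and3P [t0 td te]; last by apply: he => //; rewrite t0.
have := key t; rewrite t0 td => /(_ isT a00).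
have := ler_norm (t * b0); have := ler_norm (- (t * b0)); rewrite normrN => n1 n2 n3.
split=> ha; last by move: n3; rewrite (ltr0_norm ha); lra.
by move: n3; rewrite (gtr0_norm ha); lra.
Qed.

Lemma seq_min (R : realType) (s : seq R) : s != [::] ->
  exists2 x, x \in s & forall y, y \in s -> x <= y.
Proof.
elim: s => //= a s ih _; have [->|/ih [x xs hx]] := eqVneq s [::].
  by exists a; rewrite ?inE // => y; rewrite inE => /eqP ->.
have [ax|xa] := leP a x.
  exists a; first by rewrite inE eqxx.
  by move=> y; rewrite inE => /orP [/eqP ->//|/hx]; exact: le_trans.
exists x; first by rewrite inE xs orbT.
by move=> y; rewrite inE => /orP [/eqP ->|/hx//]; exact: ltW.
Qed.

Section CountConst.
Variables (R : realType) (N : nat) (J : finType) (v : J -> 'rV[R]_N).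
Variable good : {set J} -> bool.
Implicit Types (S T : {set J}) (A B : J) (u w : 'rV[R]_N).
Notation top := (top v good).
Notation co := (co v).
Notation dcount := (dcount v good).

Definition cf S A : 'cV[R]_N := xget 0 [set f | forall u, co S A u = pairing u f].

Lemma cfE S A u : top S -> A \in S -> co S A u = pairing u (cf S A).
Proof.
move=> tS AS; move: u.
exact: (@xgetPex _ 0 [set f | forall u, co S A u = pairing u f] (co_ex tS AS)).
Qed.

Lemma co_v S A B : top S -> A \in S -> B \in S -> co S A (v B) = (A == B)%:R.
Proof.
move=> tS AS BS; rewrite -(@co_eq _ _ _ _ _ S A (fun A => (A == B)%:R) tS AS).
congr (co S A _); rewrite (bigD1 B) //= eqxx scale1r big1 ?addr0 // => C /andP [_ CB].
by rewrite (negbTE CB) scale0r.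
Qed.

Definition generic S0 u := forall S A,
  top S -> S0 \subset S -> A \in S :\: S0 -> co S A u != 0.

Lemma generic_ex : exists u, generic set0 u.
Proof.
pose fs := [seq cf p.1 p.2 | p <- enum {: {set J} * J} & top p.1 && (p.2 \in p.1)].
have [f /mapP [[S A]]|u hu] := @avoid_kernels R N fs.
  rewrite mem_filter /= => /andP [/andP [tS AS] _] ->.
  apply: contraTneq isT => e; have := cfE (v A) tS AS.
  by rewrite e pairing0r co_v // eqxx => /eqP; rewrite oner_eq0.
exists u => S A tS _; rewrite setD0 => AS; rewrite cfE //; apply: hu.
by apply/mapP; exists (S, A) => //; rewrite mem_filter /= tS AS mem_enum.
Qed.

Lemma generic_set0 S0 u : generic set0 u -> generic S0 u.
Proof.
move=> gu S A tS _; rewrite inE => /andP [_ AS]; apply: gu => //; first exact: sub0set.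
by rewrite setD0.
Qed.

Hypothesis balanced : forall T, good T -> #|T|.+1 = N ->
  \sum_(A | (A \notin T) && good (A |: T)) detr (v A :: rows v T) = 0.
Hypothesis good_down : forall S0 T S,
  good S0 -> S0 \subset T -> T \subset S -> good S -> good T.

Definition seg u w (t : R) := (1 - t) *: u + t *: w.

Lemma affine_root (x y a b : R) : a < b ->
  ((1 - a) * x + a * y) * ((1 - b) * x + b * y) < 0 ->
  exists2 z, a < z < b & (1 - z) * x + z * y = 0.
Proof.
move=> ab; set p := (1 - a) * x + _; set q := (1 - b) * x + _ => pq.
have pq0 : p - q != 0 by apply: contraTneq pq => /eqP; rewrite subr_eq0 => /eqP ->; rewrite -leNgt -expr2 sqr_ge0.
(* The zero of the affine function with value [p] at [a] and [q] at [b]. *)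
exists (a + (b - a) * (p / (p - q))); last first.
  have e : (b - a) * (y - x) = q - p by rewrite /p /q; ring.
  have ex k : (1 - (a + (b - a) * k)) * x + (a + (b - a) * k) * y
     = p + (b - a) * (y - x) * k by rewrite /p; ring.
  rewrite ex.
  by rewrite e; field.
have ba : 0 < b - a by rewrite subr_gt0.
have pq1 : 0 < p / (p - q) < 1.
  have [pp|pn|p0] := ltrgtP 0 p; last by rewrite -p0 mul0r ltxx in pq.
    have qn : q < 0 by nra.
    by rewrite divr_gt0 /= ?ltr_pdivrMr; lra.
  have qp : 0 < q by nra.
  rewrite -[p / _]mulrNN -invrN divr_gt0 /= ?ltr_pdivrMr; lra.
case/andP: pq1 => h0 h1; rewrite ltrDl mulr_gt0 //=.
have : (b - a) * (p / (p - q)) < (b - a) * 1 by rewrite ltr_pM2l.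
lra.
Qed.

Section Segment.
Variables (S0 : {set J}) (u w : 'rV[R]_N) (cs : seq R).
Hypothesis gS0 : good S0.
Hypothesis cs_uniq : uniq cs.
Hypothesis csP : forall S A t, top S -> S0 \subset S -> A \in S :\: S0 ->
  co S A (seg u w t) = 0 -> t \in cs.
Hypothesis one_zero : forall S A B t, top S -> S0 \subset S ->
  A \in S :\: S0 -> B \in S :\: S0 ->
  co S A (seg u w t) = 0 -> co S B (seg u w t) = 0 -> A = B.

(** A coordinate that does not vanish at the critical parameter t has no zero between a and b, so by
    [affine_root] it keeps its sign; this is the sign condition of [wall_crossing] at t. *)
Lemma one_crit a b t : a < t < b -> a \notin cs -> b \notin cs ->
  (forall t', t' \in cs -> a < t' < b -> t' = t) ->
  dcount S0 (seg u w a) = dcount S0 (seg u w b).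
Proof.
case/andP => at_ tb acs bcs tu.
have ba : 0 < b - a by lra.
apply: (wall_crossing balanced good_down (us := seg u w t) (s := (t - a) / (b - a))) => //.
- by rewrite divr_gt0 ?ltr_pdivrMr //=; lra.
- rewrite /seg !scalerDr !scalerA addrACA -!scalerDl.
  by congr (_ *: _ + _ *: _); field; lra.
- move=> S A tS SS AS; have AS' : A \in S by move: AS; rewrite inE => /andP [].
  split; [by apply: contra acs => /eqP; exact: csP|by apply: contra bcs => /eqP; exact: csP|].
  move=> t0.
  have sg x y : (a <= x) -> (x < y) -> (y <= b) -> (forall t', x < t' < y -> t' != t) ->
      co S A (seg u w x) != 0 -> co S A (seg u w y) != 0 ->
      (0 < co S A (seg u w x)) = (0 < co S A (seg u w y)).
    move=> ax xy yb nt x0 y0; apply/idP/idP => h; apply: contraT => h'.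
      have := @affine_root (co S A u) (co S A w) _ _ xy.
      rewrite -!(coD _ _ _ _ tS AS') -!/(seg _ _ _) => -[|r rxy r0].
        by rewrite nmulr_llt0 // lt_neqAle y0 leNgt.
      have rcs : r \in cs by apply: (csP tS SS AS); rewrite /seg (coD _ _ _ _ tS AS').
      have := tu r rcs; 
      by case/andP: (rxy) => r1 r2 e; have := nt r rxy; rewrite e ?eqxx //; lra.
    have := @affine_root (co S A u) (co S A w) _ _ xy.
    rewrite -!(coD _ _ _ _ tS AS') -!/(seg _ _ _) => -[|r rxy r0].
      by rewrite pmulr_llt0 // lt_neqAle x0 leNgt.
    have rcs : r \in cs by apply: (csP tS SS AS); rewrite /seg (coD _ _ _ _ tS AS').
      have := tu r rcs.
    by case/andP: (rxy) => r1 r2 e; have := nt r rxy; rewrite e ?eqxx //; lra.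
  split; [|symmetry]; apply: sg => //; try lra.
  + by move=> t' /andP [_ h]; rewrite lt_eqF.
  + by apply: contra acs => /eqP; exact: csP.
  + by move=> t' /andP [h _]; rewrite gt_eqF.
  + by apply: contra bcs => /eqP; exact: csP.
- by move=> S A B; exact: one_zero.
Qed.

(** Induction on the number of critical parameters in between: the smallest one is crossed alone, up
    to the midpoint [m] between it and the next one. *)
Lemma seg_dcount a b : a < b -> a \notin cs -> b \notin cs ->
  dcount S0 (seg u w a) = dcount S0 (seg u w b).
Proof.
pose inn a b := [seq t <- cs | a < t < b].
have [n le_n] : exists n, (size (inn a b) <= n)%N by exists (size (inn a b)).
elim: n a b le_n => [|n ih] a b le_n ab acs bcs.
  apply: (@one_crit a b ((a + b) / 2%:R)) => //; first by lra.
  move=> t tcs tab; have : t \in inn a b by rewrite mem_filter tab.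
  by move: le_n; rewrite leqn0 size_eq0 => /eqP ->.
have [e|/seq_min [t1]] := eqVneq (inn a b) [::]; first by apply: ih => //; rewrite e.
rewrite mem_filter => /andP [/andP [at1 t1b] t1cs] t1min.
have [e|/seq_min [t2]] := eqVneq (inn t1 b) [::].
  apply: (@one_crit a b t1) => //; first by rewrite at1.
  move=> t tcs tab; have := t1min t; rewrite mem_filter tab tcs => /(_ isT).
  rewrite le_eqVlt => /orP [/eqP //|t1t].
  by have : t \in inn t1 b; [rewrite mem_filter t1t tcs; case/andP: tab => _ -> | rewrite e].
rewrite mem_filter => /andP [/andP [t12 t2b] t2cs] t2min.
pose m := (t1 + t2) / 2%:R.
have mt : t1 < m < t2 by rewrite /m; lra.
case/andP: (mt) => mt1 mt2.
have no t : t \in cs -> t1 < t -> t < t2 -> False.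
  move=> tcs t1t tt2; have := t2min t; rewrite mem_filter tcs t1t (lt_trans tt2) // => /(_ isT).
  by rewrite leNgt tt2.
have mcs : m \notin cs by apply/negP => /no; exact.
rewrite (@one_crit a m t1) ?at1 //; last first.
  move=> t tcs /andP [ta tm]; have := t1min t; rewrite mem_filter tcs ta.
  rewrite (lt_trans tm) ?(lt_trans mt2) // => /(_ isT); rewrite le_eqVlt => /orP [/eqP //|t1t].
  by case: (no t tcs t1t (lt_trans tm mt2)).
apply: ih => //; last exact: lt_trans t2b.
rewrite -ltnS (leq_trans _ le_n) // -/(size (t1 :: inn m b)) uniq_leq_size //=.
  by rewrite filter_uniq // mem_filter (lt_gtF mt1).
move=> t; rewrite inE => /orP [/eqP ->|]; rewrite !mem_filter ?at1 ?t1b ?t1cs //.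
by case/andP => /andP [mt' ->] ->; rewrite (lt_trans at1) ?(lt_trans mt1).
Qed.

End Segment.

(** The segment from [u] to [u'] may meet two walls of one cone at the same moment. Both ends are
    therefore joined to an auxiliary [w] off finitely many hyperplanes, chosen so that this happens
    on neither segment. *)
Lemma dcount_const S0 u u' : good S0 -> generic S0 u -> generic S0 u' ->
  dcount S0 u = dcount S0 u'.
Proof.
move=> gS0 gu gu'.
pose val S A := [&& top S, S0 \subset S & A \in S :\: S0].
have valS S A : val S A -> top S /\ A \in S by rewrite /val !inE => /and4P [].
(* If the coordinates A and B of a cone S vanish at the same point of the segment from [u] to [w],
   then [cross u (S, A, B)] vanishes at [w]. It is not the zero functional, since its value at [v B]
   is [co S A u]. *)
pose cross u (p : {set J} * J * J) := co p.1.1 p.1.2 u *: cf p.1.1 p.2 - co p.1.1 p.2 u *: cf p.1.1 p.1.2.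
pose ps := [seq p <- enum {: {set J} * J * J} | [&& val p.1.1 p.1.2, val p.1.1 p.2 & p.1.2 != p.2]].
pose fs := [seq cf p.1 p.2 | p <- enum {: {set J} * J} & val p.1 p.2] ++
  [seq cross u p | p <- ps] ++ [seq cross u' p | p <- ps].
have cross0 x p : generic S0 x -> p \in ps -> cross x p != 0.
  move=> gx; case: p => [[S A] B]; rewrite mem_filter /= => /andP [/and3P [vA vB AB] _].
  have [[tS AS] [_ BS]] := (valS _ _ vA, valS _ _ vB).
  apply: contraTneq isT => /(congr1 (pairing (v B))); rewrite /cross /=.
  rewrite pairingDr pairingNr !pairingZr -!cfE // !co_v // eqxx (negbTE AB) mulr1 mulr0 subr0 pairing0r.
  by move=> /eqP; rewrite (negbTE (gx S A _ _ _)) //; case/and3P: vA.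
have [f|w hw] := @avoid_kernels R N fs.
  rewrite !mem_cat => /or3P [] /mapP [p]; [|by move=> pp ->; apply: cross0..].
  rewrite mem_filter => /andP [/valS [tS AS] _] ->.
  apply: contraTneq isT => e; have := cfE (v p.2) tS AS.
  by rewrite e pairing0r co_v // eqxx => /eqP; rewrite oner_eq0.
have gw : generic S0 w.
  move=> S A tS SS AS; have vA : val S A by rewrite /val tS SS.
  rewrite cfE //; last by case: (valS _ _ vA).
  by apply: hw; rewrite mem_cat; apply/orP; left; apply/mapP; exists (S, A); rewrite // mem_filter /= vA mem_enum.
have key x : generic S0 x -> (forall p, p \in ps -> cross x p \in fs) -> dcount S0 x = dcount S0 w.
  move=> gx xfs.
  (* The parameters at which a coordinate vanishes on the segment from [x] to [w]. A coordinate with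
     equal values at both ends is constant and never vanishes, so it is left out. *)
  pose cs := undup [seq co p.1 p.2 x / (co p.1 p.2 x - co p.1 p.2 w) |
    p <- enum {: {set J} * J} & val p.1 p.2 && (co p.1 p.2 x != co p.1 p.2 w)].
  have csP S A t : top S -> S0 \subset S -> A \in S :\: S0 -> co S A (seg x w t) = 0 -> t \in cs.
    move=> tS SS AS; have AS' : A \in S by move: AS; rewrite inE => /andP [].
    rewrite /seg (coD _ _ _ _ tS AS') => e; have x0 := gx _ _ tS SS AS.
    have d0 : co S A x - co S A w != 0.
      apply: contra_neq x0 => d; have ew : co S A w = co S A x by lra.
      by move: e; rewrite ew -mulrDl subrK mul1r.
    rewrite mem_undup; apply/mapP; exists (S, A).
      by rewrite mem_filter mem_enum /val /= tS SS AS -subr_eq0 d0.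
    by apply/(canRL (mulfK d0)); lra.
  have -> : x = seg x w 0 by rewrite /seg subr0 scale1r scale0r addr0.
  have {2}-> : w = seg x w 1 by rewrite /seg subrr scale1r scale0r add0r.
  apply: (@seg_dcount S0 x w cs gS0 (undup_uniq _)) => //.
  - move=> S A B t tS SS AS BS; have [AS' BS'] : A \in S /\ B \in S.
      by move: AS BS; rewrite !inE => /andP [_ ->] /andP [_ ->].
    rewrite /seg (coD _ _ _ _ tS AS') (coD _ _ _ _ tS BS') => eA eB; apply: contraTeq isT => AB.
    have pps : (S, A, B) \in ps by rewrite mem_filter /= /val tS SS AS BS AB mem_enum.
    have := hw _ (xfs _ pps); rewrite /cross /= pairingDr pairingNr !pairingZr -!cfE //.
    set a := co S A x in eA *; set a' := co S A w in eA *.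
    set b := co S B x in eB *; set b' := co S B w in eB *.
    have -> : a * b' - b * a' = 0.
      have -> : a * b' - b * a' = ((1 - t) * a + t * a') * (b' - b) - ((1 - t) * b + t * b') * (a' - a) by ring.
      by rewrite eA eB !mul0r subr0.
    by rewrite eqxx.
  - rewrite mem_undup; apply/mapP => -[[S A]]; rewrite mem_filter /= => /andP [/andP [/and3P [tS SS AS] d] _] /esym /eqP.
    by rewrite mulf_eq0 invr_eq0 subr_eq0 (negbTE d) orbF (negbTE (gx S A _ _ _)).
  - rewrite mem_undup; apply/mapP => -[[S A]]; rewrite mem_filter /= => /andP [/andP [/and3P [tS SS AS] d] _] e.
    have d0 : co S A x - co S A w != 0 by rewrite subr_eq0.
    have /eqP := gw _ _ tS SS AS; apply.
    have : 1 * (co S A x - co S A w) = co S A x by rewrite e divfK.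
    lra.
rewrite (key u) ?(key u') // => p pp; rewrite /fs !mem_cat map_f ?orbT //.
Qed.

Variable q0 : 'rV[R]_N.

(** A cone of the star of [S0] whose relative interior, enlarged by the span of [S0], has a point
    over [q0]: on [S0] itself the coefficients may have any sign. *)
Definition hit S0 S1 : Prop := [/\ good S1, S0 \subset S1 & exists b : J -> R,
  (forall A, A \in S1 :\: S0 -> 0 < b A) /\ q0 = \sum_(A in S1) b A *: v A].

(* The weight of a stable intersection along the cone S0. *)
Definition dgr S0 : R := dcount S0 (xget 0 [set u | generic set0 u]).

Lemma dgrE S0 u : good S0 -> generic S0 u -> dcount S0 u = dgr S0.
Proof.
move=> gS0 gu; apply: dcount_const => //; apply: generic_set0.
exact: (@xgetPex _ 0 [set u | generic set0 u] generic_ex).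
Qed.

(** The left side is evaluated at [q0 + e *: u] with [u] generic and e small. A maximal cone S
    counted there has a unique face [Sz] in whose relative interior [q0] lies modulo the span of
    [S0]; the coordinates of S outside [Sz] see only [u], so S is counted in [dgr Sz]. *)
Lemma dgr_hit S0 : good S0 ->
  dgr S0 = \sum_(S1 : {set J} | `[< hit S0 S1 >]) dgr S1.
Proof.
move=> gS0; have [u gu] := generic_ex.
have [e e0 eP] := small_eps [seq (co p.1 p.2 q0, co p.1 p.2 u) | p <- enum {: {set J} * J}].
have sgn S A : (0 < co S A q0 -> 0 < co S A q0 + e * co S A u) /\
    (co S A q0 < 0 -> co S A q0 + e * co S A u < 0).
  by apply: eP; rewrite ?e0 ?lexx //; apply/mapP; exists (S, A); rewrite ?mem_enum.
pose ue := q0 + e *: u.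
have coe S A : top S -> A \in S -> co S A ue = co S A q0 + e * co S A u.
  by move=> tS AS; rewrite !cfE // pairingDl pairingZl.
have gue : generic S0 ue.
  move=> S A tS SS; rewrite inE => /andP [_ AS]; rewrite coe //.
  have [s1 s2] := sgn S A.
  have [p|n|z] := ltrgtP 0 (co S A q0); first by rewrite gt_eqF ?s1.
    by rewrite lt_eqF ?s2.
  rewrite -z add0r; apply: mulf_neq0; first by rewrite gt_eqF.
  apply: gu => //; first exact: sub0set.
  by rewrite setD0.
rewrite -(dgrE gS0 gue).
rewrite [RHS](eq_bigr (fun S1 => dcount S1 u)); last first.
  by move=> S1 /asboolP [gS1 _ _]; rewrite dgrE //; exact: generic_set0.
rewrite /dcount [RHS](exchange_big_dep top) /=; last by move=> S1 S _ /andP [].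
rewrite [LHS]big_mkcondr /=; apply: eq_bigr => S tS.
rewrite -big_distrr /=.
(* The only face of S that can be hit: the coordinates outside [S0] that vanish at [q0] are
   dropped. *)
pose Sz := S :\: [set A in S :\: S0 | co S A q0 == 0]%SET.
have SzS : Sz \subset S by exact: subsetDl.
have hitE S1 : S1 \subset S -> hit S0 S1 ->
    S1 = Sz /\ forall A, A \in Sz :\: S0 -> 0 < co S A q0.
  move=> S1S [gS1 SS1 [b [b0 q0E]]].
  have q0S : q0 = \sum_(A in S) (if A \in S1 then b A else 0) *: v A.
    rewrite q0E [RHS](bigID (mem S1)) /= [X in _ = _ + X]big1 ?addr0; last first.
      by move=> A /andP [_ /negbTE ->]; rewrite scale0r.
    apply: eq_big => [A|A ->//].
    by rewrite andb_idl // => /(subsetP S1S).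
  have cE A : A \in S -> co S A q0 = if A \in S1 then b A else 0.
    by move=> AS; rewrite {1}q0S (co_eq (fun A => if A \in S1 then b A else 0) tS).
  have e1 : S1 = Sz.
    apply/setP => A; rewrite !inE; have [AS|AS] := boolP (A \in S); last first.
      by rewrite andbF; apply: contraNF AS => /(subsetP S1S).
    rewrite !andbT cE //; have [AS1|AS1] := boolP (A \in S1).
      have [//|AS0 /=] := boolP (A \in S0).
      by rewrite gt_eqF // b0 // inE AS0.
    by rewrite eqxx andbT negbK; apply/esym; apply: contraNF AS1 => /(subsetP SS1).
  split=> // A; rewrite -e1 => AS1; rewrite cE; last first.
    by apply: (subsetP S1S); move: AS1; rewrite inE => /andP [].
  by move: (b0 A AS1); move: AS1; rewrite inE => /andP [_ ->].
have [SS|nSS] := boolP (S0 \subset S); last first.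
  rewrite big_pred0 ?mulr0 // => S1; apply/negbTE; apply/negP => /and3P [/asboolP [_ h _] _ h'].
  by move/negP: nSS; apply; exact: subset_trans h'.
congr (_ * _).
have SSz : S0 \subset Sz.
  by apply/subsetP => A A0; rewrite !inE A0 (subsetP SS).
have gS : good S by case/and3P: tS.
have [pos|npos] := boolP [forall A in Sz :\: S0, 0 < co S A q0]; last first.
  rewrite big_pred0 => [|S1]; last first.
    apply/negbTE/negP => /and3P [/asboolP h _ S1S]; have [_ p] := hitE _ S1S h.
    by move/negP: npos; apply; apply/forall_inP.
  case: forall_inP => // h; exfalso; move/negP: npos; apply; apply/forall_inP => A.
  rewrite inE => /andP [A0 ASz].
  have AS : A \in S by apply: (subsetP SzS).
  have := h A; rewrite inE A0 AS coe // => /(_ isT) p.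
  have [s1 s2] := sgn S A.
  have [//|n|z] := ltrgtP 0 (co S A q0); first by rewrite ltNge ltW ?s2 in p.
  by move: ASz; rewrite !inE A0 AS -z eqxx.
have hSz : hit S0 Sz.
  split=> //; first exact: good_down gS0 SSz SzS gS.
  exists (fun A => co S A q0); split; first by move=> A; exact: (forall_inP pos).
  rewrite {1}(co_solve q0 tS) (bigID (mem Sz)) /= [X in _ + X]big1 ?addr0; last first.
    move=> A; rewrite !inE => /andP [AS]; rewrite AS !andbT negbK => /andP [_ /eqP ->].
    by rewrite scale0r.
  by apply: eq_bigl => A; rewrite andb_idl // => /(subsetP SzS).
rewrite (big_pred1 Sz) => [|S1]; last first.
  apply/and3P/eqP => [[/asboolP h _ S1S]|->]; first by case: (hitE _ S1S h).
  by split=> //; apply/asboolP.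
congr (_%:R); congr nat_of_bool; apply: eq_forallb => A; rewrite !inE.
have [AS|] := boolP (A \in S); last by rewrite !andbF.
rewrite !andbT coe //; have [s1 s2] := sgn S A.
have [A0|A0] := boolP (A \in S0) => //=.
have [z|nz] := eqVneq (co S A q0) 0; first by rewrite z add0r pmulr_rgt0.
by rewrite s1 // (forall_inP pos) // !inE A0 AS nz.
Qed.

End CountConst.

(** * Balanced fans and their sections by hyperplanes *)

Section Fan.
Variables (R : realType) (m N : nat) (Lam : set 'rV[R]_m).
Variables (J : finType) (q : J -> 'rV[R]_m) (J0 : {set J}) (good : {set J} -> bool).
Implicit Types (S T : {set J}) (A B : J) (x y w : 'rV[R]_m) (a b : J -> R).
Implicit Types (f g L : 'cV[R]_m) (Ls : seq ('cV[R]_m * R)).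

Definition integral f := forall w, Lam w -> pairing w f \is a Num.int.

Definition positive S a := forall A, A \in S :\: J0 -> 0 < a A.

Definition comb S a := \sum_(A in S) a A *: q A.

(* A fan with rays q A; its cones are indexed by the good sets of rays, all of
   which contain the set J0 of generators of the lineality space. *)
Record fan : Prop := Fan {
  fan_base : forall S, good S -> J0 \subset S;
  fan_zero : good J0;
  fan_down : forall S T, J0 \subset T -> T \subset S -> good S -> good T;
  fan_dim : forall S, good S -> (#|S| <= N)%N;
  fan_dual : forall S A, good S -> A \in S -> exists2 f, integral f &
    forall B, B \in S -> pairing (q B) f = (B == A)%:R;
  fan_lat : forall S A, good S -> A \in S -> Lam (q A);
  fan_lat0 : Lam 0;
  fan_latB : forall x y, Lam x -> Lam y -> Lam (x - y);
  fan_uniq : forall S T a b, good S -> good T -> positive S a -> positive T b ->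
    comb S a = comb T b -> S = T;
  fan_bal : forall T, good T -> #|T|.+1 = N -> exists a,
    \sum_(A | (A \notin T) && good (A |: T)) q A = comb T a
}.

Hypothesis F : fan.

(** Since the rays lie in [Lam] and have an integral dual basis, they form a lattice basis of [Lam]
    in their span: all cones are unimodular. *)
Definition dualf S A : 'cV[R]_m :=
  xget 0 [set f | integral f /\ forall B, B \in S -> pairing (q B) f = (B == A)%:R].

Lemma dualP S A : good S -> A \in S -> integral (dualf S A) /\
  forall B, B \in S -> pairing (q B) (dualf S A) = (B == A)%:R.
Proof.
move=> gS AS; have [f f1 f2] := fan_dual F gS AS.
by apply: (@xgetPex _ 0 [set f | integral f /\ _]); exists f.
Qed.

Lemma pairing_comb S T a A : good S -> A \in S -> T \subset S ->
  pairing (comb T a) (dualf S A) = if A \in T then a A else 0.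
Proof.
move=> gS AS TS; have [_ dS] := dualP gS AS.
rewrite pairing_suml (eq_bigr (fun B => if B == A then a B else 0)) => [|B BT].
  rewrite -big_mkcondr /=; case: ifPn => AT.
    by rewrite (big_pred1 A) // => B /=; case: eqP => [->|_]; rewrite ?AT ?andbF.
  by rewrite big_pred0 // => B /=; case: eqP => [->|_]; rewrite ?(negbTE AT) ?andbF.
rewrite pairingZl dS ?(subsetP TS) //.
by case: eqP; rewrite ?mulr1 ?mulr0.
Qed.

Definition supset x : set {set J} :=
  [set S | exists a, [/\ good S, positive S a & x = comb S a]].

Definition inM x : Prop := exists S, supset x S.
Definition supp x : {set J} := xget set0 (supset x).
Definition crd x A : R := if A \in supp x then pairing x (dualf (supp x) A) else 0.

Lemma sup_good x : inM x -> good (supp x).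
Proof. by move=> /(@xgetPex _ set0) [a []]. Qed.

Lemma sup_base x : inM x -> J0 \subset supp x.
Proof. by move=> /sup_good /(fan_base F). Qed.

Lemma crdP x : inM x -> positive (supp x) (crd x) /\ x = comb (supp x) (crd x).
Proof.
move=> xM; have [a [gS pa xE]] : supset x (supp x) := xgetPex set0 xM.
have e A : A \in supp x -> crd x A = a A.
  move=> AS; rewrite /crd AS.
  have -> : pairing x (dualf (supp x) A) = pairing (comb (supp x) a) (dualf (supp x) A) by rewrite -xE.
  by rewrite pairing_comb // AS.
split=> [A AS|]; last by rewrite {1}xE; apply: eq_bigr => A AS; rewrite e.
by rewrite e ?pa //; move: AS; rewrite inE => /andP [].
Qed.

Lemma sup_eq x S a : good S -> positive S a -> x = comb S a -> inM x /\ supp x = S.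
Proof.
move=> gS pa xE; have xM : inM x by exists S, a.
have [pc xc] := crdP xM.
by split=> //; apply: (fan_uniq F (sup_good xM) gS pc pa); rewrite -xc.
Qed.

Lemma crd_sub x S A : inM x -> good S -> A \in S -> supp x \subset S ->
  pairing x (dualf S A) = crd x A.
Proof.
move=> xM gS AS xS; have [_ {1}->] := crdP xM; rewrite pairing_comb //.
by rewrite /crd; case: (A \in supp x).
Qed.

Lemma crd_ge0 x A : inM x -> A \notin J0 -> 0 <= crd x A.
Proof.
move=> xM A0; have [AS|AS] := boolP (A \in supp x); last by rewrite /crd (negbTE AS).
by have [p _] := crdP xM; apply/ltW/p; rewrite inE A0.
Qed.

Lemma inM_comb x S a : good S -> (forall A, A \in S :\: J0 -> 0 <= a A) ->
  x = comb S a -> inM x /\ supp x = [set A in S | (A \in J0) || (0 < a A)]%SET.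
Proof.
move=> gS pa xE; set T := [set A in _ | _]%SET.
have TS : T \subset S by apply/subsetP => A; rewrite !inE => /andP [].
apply: (@sup_eq _ _ a).
- apply: (fan_down F _ TS) => //; apply/subsetP => A A0.
  by rewrite !inE A0 (subsetP (fan_base F gS)).
- by move=> A; rewrite !inE => /and3P [/negbTE -> _].
- rewrite xE /comb (bigID (mem T)) /= [X in _ + X]big1 ?addr0; last first.
    move=> A /andP [AS]; rewrite !inE AS negb_or -leNgt => /andP [A0 aA].
    have : 0 <= a A by apply: pa; rewrite inE A0.
    by move=> h; have -> : a A = 0 by [apply/le_anti; rewrite aA]; rewrite scale0r.
  by apply: eq_bigl => A; rewrite andb_idl // => /(subsetP TS).
Qed.

Definition sp S : {vspace 'rV[R]_m} := (\sum_(A in S) <[q A]>)%VS.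

Lemma spP S w : reflect (exists a, w = comb S a) (w \in sp S).
Proof.
apply: (iffP idP) => [/memv_sumP [u uq ->]|[a ->]]; last first.
  apply: memv_suml => A AS; apply: memvZ.
  by apply: (subvP (sumv_sup A AS (subvv _))); exact: memv_line.
exists (fun A => xget 0 [set c | u A = c *: q A]); apply: eq_bigr => A AS.
by apply: (@xgetPex _ 0 [set c | u A = c *: q A]); have /vlineP [c uc] := uq A AS; exists c.
Qed.

Lemma sp_sub S T : S \subset T -> (sp S <= sp T)%VS.
Proof.
move=> ST; apply/subvP => w /spP [a ->]; apply: memv_suml => A AS.
apply: memvZ; apply: (subvP (sumv_sup A (subsetP ST _ AS) (subvv _))).
exact: memv_line.
Qed.

Lemma inM_sp x : inM x -> x \in sp (supp x).
Proof. by move=> /crdP [_ e]; apply/spP; exists (crd x). Qed.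

Lemma sp_dual S w : good S -> w \in sp S ->
  w = \sum_(A in S) pairing w (dualf S A) *: q A.
Proof.
move=> gS /spP [a ->]; rewrite {1}/comb; apply: eq_bigr => A AS.
by rewrite pairing_comb // AS.
Qed.

Definition kr L : {vspace 'rV[R]_m} := lker (linfun (mulmxr L : 'rV_m -> 'rV_1)).

Lemma krP L w : (w \in kr L) = (pairing w L == 0).
Proof.
rewrite memv_ker lfunE /= /pairing; apply/eqP/eqP => [->|h]; first by rewrite mxE.
by apply/rowP => i; rewrite !ord1 h mxE.
Qed.

(** The tangent space of the cell of x: along the cone of x, inside the hyperplanes that pass
    through x. *)
Definition V Ls x : {vspace 'rV[R]_m} :=
  (sp (supp x) :&: \bigcap_(Lc <- Ls | pairing x Lc.1 == Lc.2) kr Lc.1)%VS.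

Lemma VP Ls x w : reflect (w \in sp (supp x) /\
  forall L c, (L, c) \in Ls -> pairing x L = c -> pairing w L = 0) (w \in V Ls x).
Proof.
rewrite memv_cap.
have -> : (w \in \bigcap_(Lc <- Ls | pairing x Lc.1 == Lc.2) kr Lc.1)%VS =
    all (fun Lc => (pairing x Lc.1 == Lc.2) ==> (pairing w Lc.1 == 0)) Ls.
  elim: Ls => [|Lc Ls ih]; first by rewrite big_nil memvf.
  by rewrite big_cons /= -ih; case: eqP => //= _; rewrite memv_cap krP.
apply: (iffP andP) => -[h1]; last first.
  move=> h2; split=> //; apply/allP => -[L c] Lc; apply/implyP => /eqP /= e.
  by rewrite (h2 _ _ Lc e).
by move=> /allP h2; split=> // L c /h2 /implyP /= h /eqP /h /eqP.
Qed.

(** The closed cell with x in its relative interior, in the fan subdivided along the hyperplanes of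
    [Ls]. Cells are named by points in this way, so that faces, dimensions and refinements become
    statements about points. *)
Definition P Ls x : set 'rV[R]_m := [set y | [/\ inM y, supp y \subset supp x &
  forall L c, (L, c) \in Ls ->
    (pairing x L <= c -> pairing y L <= c) /\ (c <= pairing x L -> c <= pairing y L)]].

Lemma P_refl Ls x : inM x -> P Ls x x.
Proof. by []. Qed.

Lemma P_trans Ls x y : P Ls y x -> P Ls x `<=` P Ls y.
Proof.
move=> [xM xy Lxy] z [zM zx Lzx]; split=> //; first exact: subset_trans xy.
move=> L c Lc; have [h1 h2] := Lxy L c Lc; have [h3 h4] := Lzx L c Lc.
by split; auto.
Qed.

Lemma P_eq Ls x y : P Ls y x -> P Ls x y -> P Ls x = P Ls y.
Proof. by move=> h1 h2; apply/seteqP; split; apply: P_trans. Qed.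

Lemma V_sub Ls x y : P Ls y x -> (V Ls x <= V Ls y)%VS.
Proof.
move=> [xM xy Lxy]; apply/subvP => w /VP [wx Lw]; apply/VP; split.
  exact: (subvP (sp_sub xy)).
move=> L c Lc e; apply: (Lw L c Lc); have [h1 h2] := Lxy L c Lc.
by apply/le_anti; rewrite h1 ?h2 ?e.
Qed.

(** A small step from x in a direction that is positive on the new rays enters the relative interior
    of the larger cone and crosses no hyperplane off which x lies. *)
Lemma moveP Ls x S1 w : inM x -> good S1 -> supp x \subset S1 -> w \in sp S1 ->
  (forall A, A \in S1 :\: supp x -> 0 < pairing w (dualf S1 A)) ->
  exists2 e : R, 0 < e & forall t, 0 < t <= e ->
    [/\ inM (x + t *: w), supp (x + t *: w) = S1 & forall L c, (L, c) \in Ls ->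
      (pairing x L < c -> pairing (x + t *: w) L < c) /\
      (c < pairing x L -> c < pairing (x + t *: w) L)].
Proof.
move=> xM gS xS wS wpos.
pose l1 := [seq (pairing x (dualf S1 A), pairing w (dualf S1 A)) | A <- enum S1].
pose l2 := [seq (pairing x Lc.1 - Lc.2, pairing w Lc.1) | Lc <- Ls].
have [e e0 he] := small_eps (l1 ++ l2); exists e => // t te; have /andP [t0 _] := te.
have [pc xc] := crdP xM.
have [M1 S1E] : inM (x + t *: w) /\ supp (x + t *: w) = S1.
  apply: (@sup_eq _ _ (fun A => pairing x (dualf S1 A) + t * pairing w (dualf S1 A))) => //.
    move=> A /[1!inE] /andP [A0 AS]; 
    have hin : (pairing x (dualf S1 A), pairing w (dualf S1 A)) \in l1 ++ l2.
      by rewrite mem_cat (map_f (fun A => (pairing x (dualf S1 A), pairing w (dualf S1 A)))) // mem_enum.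
    have [h _] := he _ _ t hin te.
    have [Ax|Ax] := boolP (A \in supp x).
      by apply: h; rewrite crd_sub // pc // inE A0.
    by rewrite crd_sub // /crd (negbTE Ax) add0r mulr_gt0 // wpos // inE Ax.
  have xS1 : x \in sp S1 by apply: (subvP (sp_sub xS)); exact: inM_sp.
  rewrite {1}(sp_dual gS xS1) {1}(sp_dual gS wS) scaler_sumr -big_split /=.
  by apply: eq_bigr => A _; rewrite scalerA -scalerDl.
split=> // L c Lc.
have hin : (pairing x L - c, pairing w L) \in l1 ++ l2.
  by rewrite mem_cat (map_f (fun Lc => (pairing x Lc.1 - Lc.2, pairing w Lc.1)) Lc) orbT.
have [h1 h2] := he _ _ t hin te.
rewrite pairingDl pairingZl; split=> h.
  by have := h2; rewrite subr_lt0 => /(_ h); rewrite addrAC subr_lt0.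
by have := h1; rewrite subr_gt0 => /(_ h); rewrite addrAC subr_gt0.
Qed.

Lemma openP Ls x w : inM x -> w \in V Ls x -> exists2 e : R, 0 < e &
  forall t, 0 < t <= e -> P Ls x (x + t *: w) /\ P Ls (x + t *: w) x.
Proof.
move=> xM /VP [wS Lw].
have [|e e0 he] := @moveP Ls x (supp x) w xM (sup_good xM) (subxx _) wS.
  by move=> A; rewrite setDv inE.
exists e => // t /he [M1 S1 L1].
have eqL L c : (L, c) \in Ls -> pairing x L = c -> pairing (x + t *: w) L = c.
  by move=> Lc e'; rewrite pairingDl pairingZl (Lw L c) // mulr0 addr0.
split; split; rewrite ?S1 // => L c Lc; have [h1 h2] := L1 L c Lc; split.
- by rewrite le_eqVlt => /orP [/eqP /(eqL _ _ Lc) -> //|/h1/ltW].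
- by rewrite le_eqVlt => /orP [/eqP /esym /(eqL _ _ Lc) -> //|/h2/ltW].
- by rewrite leNgt => h; rewrite leNgt; apply: contra h.
- by rewrite leNgt => h; rewrite leNgt; apply: contra h.
Qed.

Lemma lin_eq (s : set 'rV[R]_m) (U : {vspace 'rV[R]_m}) :
  (forall x y, s x -> s y -> x - y \in U) ->
  (forall W : {vspace 'rV[R]_m}, (forall x y, s x -> s y -> x - y \in W) -> (U <= W)%VS) ->
  lin s = U.
Proof.
move=> h1 h2; rewrite /lin; case: xgetP => [W _ [W1 W2]|/(_ U)].
  by apply/eqP; rewrite eqEsubv W2 ?h2.
by case; split.
Qed.

Lemma diff_V Ls x y z : P Ls x y -> P Ls x z -> y - z \in V Ls x.
Proof.
move=> [yM yx Ly] [zM zx Lz]; apply/VP; split.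
  by apply: memvB; [move: (inM_sp yM)|move: (inM_sp zM)]; apply: (subvP (sp_sub _)).
move=> L c Lc e; have [h1 h2] := Ly L c Lc; have [h3 h4] := Lz L c Lc.
rewrite pairingBl; apply/eqP; rewrite subr_eq0; apply/eqP.
by apply/le_anti/andP; split; [apply: le_trans (h1 _) (h4 _)|apply: le_trans (h3 _) (h2 _)]; rewrite e.
Qed.

Lemma linP Ls x : inM x -> lin (P Ls x) = V Ls x.
Proof.
move=> xM; apply: lin_eq => [y z|W hW]; first exact: diff_V.
apply/subvP => w /(openP xM) [e e0 /(_ e)]; rewrite e0 lexx => -[//|h _].
have := hW _ _ h (P_refl Ls xM).
by rewrite addrC addKr rpredZeq gt_eqF.
Qed.

(** Either the cone of y has a ray that the cone of x lacks, and its dual functional separates, or a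
    hyperplane passes through x but not through y, and L or -L separates. All these functionals are
    integral. *)
Lemma kappaP Ls x y : inM x -> inM y -> P Ls y x -> ~ P Ls x y -> exists k,
  [/\ (forall L c, (L, c) \in Ls -> integral L) -> integral k,
      forall w, w \in V Ls x -> pairing w k = 0, 0 < pairing (y - x) k &
      forall x' y', P Ls x x' -> P Ls y y' -> 0 <= pairing (y' - x') k].
Proof.
move=> xM yM [_ xy Lxy] nxy.
have [yx|/subsetPn [A Ay Ax]] := boolP (supp y \subset supp x); last first.
  have A0 : A \notin J0 by apply: contra Ax; apply: (subsetP (sup_base xM)).
  have x0 x' : supp x' \subset supp x -> inM x' -> pairing x' (dualf (supp y) A) = 0.
    move=> x'x x'M; rewrite crd_sub ?sup_good // ?(subset_trans x'x) //.
    by rewrite /crd ifN //; apply: contra Ax; apply: (subsetP x'x).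
  exists (dualf (supp y) A); split.
  - by move=> _; case: (dualP (sup_good yM) Ay).
  - move=> w /VP [/spP [a ->] _]; rewrite pairing_comb ?sup_good //.
    by rewrite (negbTE Ax).
  - rewrite pairingBl (x0 x) // subr0 crd_sub ?sup_good //.
    by have [p _] := crdP yM; apply: p; rewrite inE A0.
  - move=> x' y' [x'M x'x _] [y'M y'y _]; rewrite pairingBl (x0 x') // subr0.
    by rewrite crd_sub ?sup_good // crd_ge0.
have [L [c [Lc nL]]] : exists L c, (L, c) \in Ls /\
   ~ ((pairing x L <= c -> pairing y L <= c) /\ (c <= pairing x L -> c <= pairing y L)).
  apply: contrapT => h; apply: nxy; split=> // L c Lc; apply: contrapT => h'.
  by apply: h; exists L, c.
have [h1 h2] := Lxy L c Lc.
have eqP' x' : pairing x L = c -> P Ls x x' -> pairing x' L = c.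
  move=> e [_ _ /(_ L c Lc) [k1 k2]]; apply/le_anti.
  by rewrite k1 ?k2 ?e.
have [yc|cy|e] := ltrgtP (pairing y L) c; last by case: nL; rewrite e.
- have xc : pairing x L = c.
    apply/le_anti; rewrite (h1 (ltW yc)) /=.
    by rewrite leNgt; apply/negP => xc; apply: nL; split=> [_|h]; [exact: ltW|move: h; rewrite leNgt xc].
  exists (- L); split.
  + by move=> iL w /(iL L c Lc); rewrite pairingNr rpredN.
  + by move=> w /VP [_ /(_ L c Lc xc) wL]; rewrite pairingNr wL oppr0.
  + by rewrite pairingNr pairingBl xc oppr_gt0 subr_lt0.
  + move=> x' y' /(eqP' _ xc) x'c [_ _ /(_ L c Lc) [k _]].
    by rewrite pairingNr pairingBl x'c oppr_ge0 subr_le0 k // ltW.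
- have xc : pairing x L = c.
    apply/le_anti; rewrite (h2 (ltW cy)) andbT.
    by rewrite leNgt; apply/negP => xc; apply: nL; split=> [h|_]; [move: h; rewrite leNgt xc|exact: ltW].
  exists L; split.
  + by move=> iL; apply: iL Lc.
  + by move=> w /VP [_ /(_ L c Lc xc)].
  + by rewrite pairingBl xc subr_gt0.
  + move=> x' y' /(eqP' _ xc) x'c [_ _ /(_ L c Lc) [_ k]].
    by rewrite pairingBl x'c subr_ge0 k // ltW.
Qed.

(** The supporting functional is minus a sum of terms that vanish on the cell of x and are
    nonnegative on that of y: the coordinates of the additional rays, and the hyperplanes through x
    signed by the side on which y lies. *)
Lemma faceP Ls x y : inM x -> inM y -> is_face (P Ls x) (P Ls y) <-> P Ls y x.
Proof.
move=> xM yM; split=> [[_ [f [b [_ Pe]]]]|Pyx].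
  by have := P_refl Ls xM; rewrite Pe => -[].
have [_ xy Lxy] := Pyx.
split; first by exists x; exact: P_refl.
pose act := [seq Lc <- Ls | pairing x Lc.1 == Lc.2].
pose sg (Lc : 'cV[R]_m * R) : R := Num.sg (pairing y Lc.1 - Lc.2).
pose g y' : R := \sum_(A in supp y :\: supp x) pairing y' (dualf (supp y) A) +
  \sum_(Lc <- act) sg Lc * (pairing y' Lc.1 - Lc.2).
exists (- \sum_(A in supp y :\: supp x) dualf (supp y) A - \sum_(Lc <- act) sg Lc *: Lc.1),
  (- \sum_(Lc <- act) sg Lc * Lc.2).
have gE y' : pairing y' (- \sum_(A in supp y :\: supp x) dualf (supp y) A - \sum_(Lc <- act) sg Lc *: Lc.1)
    = - \sum_(Lc <- act) sg Lc * Lc.2 - g y'.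
  rewrite pairingDr !pairingNr !pairing_sumr /g.
  have -> : \sum_(Lc <- act) sg Lc * (pairing y' Lc.1 - Lc.2) =
      \sum_(Lc <- act) pairing y' (sg Lc *: Lc.1) - \sum_(Lc <- act) sg Lc * Lc.2.
    by rewrite -sumrB; apply: eq_bigr => Lc _; rewrite pairingZr mulrBr.
  ring.
have t1 y' A : P Ls y y' -> A \in supp y :\: supp x -> 0 <= pairing y' (dualf (supp y) A).
  move=> [y'M y'y _] /[1!inE] /andP [Ax Ay]; rewrite crd_sub ?sup_good //.
  by rewrite crd_ge0 //; apply: contra Ax; apply: (subsetP (sup_base xM)).
have t2 y' Lc : P Ls y y' -> Lc \in act -> 0 <= sg Lc * (pairing y' Lc.1 - Lc.2).
  case: Lc => L c [_ _ Ly']; rewrite mem_filter /= => /andP [_ /Ly' [h1 h2]].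
  rewrite /sg /=; have [h|h|->] := ltrgtP (pairing y L) c.
  - by rewrite ltr0_sg ?subr_lt0 // mulN1r oppr_ge0 subr_le0 h1 // ltW.
  - by rewrite gtr0_sg ?subr_gt0 // mul1r subr_ge0 h2 // ltW.
  - by rewrite subrr sgr0 mul0r.
have g0 y' : P Ls y y' -> 0 <= g y'.
  move=> Py'; apply: addr_ge0; first by apply: sumr_ge0 => A; exact: t1.
  by rewrite big_seq; apply: sumr_ge0 => Lc; exact: t2.
split=> [y' Py'|]; first by rewrite gE gerDl oppr_le0 g0.
apply/seteqP; split=> y' /=.
  move=> Px; have Py := P_trans Pyx Px; split=> //.
  rewrite gE; suff -> : g y' = 0 by rewrite subr0.
  case: Px => y'M y'x Ly'.
  rewrite /g big1 ?add0r => [|A /[1!inE] /andP [Ax Ay]]; last first.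
    rewrite crd_sub ?sup_good ?(subset_trans y'x) // /crd ifN //.
    by apply: contra Ax; exact: (subsetP y'x).
  rewrite big_seq big1 // => -[L c]; rewrite mem_filter /= => /andP [/eqP xc /Ly' [h1 h2]].
  suff -> : pairing y' L = c by rewrite subrr mulr0.
  by apply/le_anti; rewrite h1 ?h2 ?xc.
move=> [Py' /eqP]; rewrite gE -subr_eq0 addrAC subrr add0r oppr_eq0 => gy0.
have [e1 e2] : \sum_(A in supp y :\: supp x) pairing y' (dualf (supp y) A) = 0 /\
   \sum_(Lc <- act) sg Lc * (pairing y' Lc.1 - Lc.2) = 0.
  have a0 : 0 <= \sum_(A in supp y :\: supp x) pairing y' (dualf (supp y) A).
    by apply: sumr_ge0 => A; exact: t1.
  have b0 : 0 <= \sum_(Lc <- act) sg Lc * (pairing y' Lc.1 - Lc.2).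
    by rewrite big_seq; apply: sumr_ge0 => Lc; exact: t2.
  by move: gy0; rewrite /g paddr_eq0 // => /andP [/eqP -> /eqP ->].
have [y'M y'y Ly'] := Py'; split=> //.
  apply/subsetP => A Ay'; apply: contraT => Ax.
  have Ay : A \in supp y :\: supp x by rewrite inE Ax (subsetP y'y).
  have A0 : A \notin J0 by apply: contra Ax; apply: (subsetP (sup_base xM)).
  move: e1; move=> /(psumr_eq0P (fun A => t1 y' A Py')) /(_ A Ay).
  rewrite crd_sub ?sup_good //; last by move: Ay; rewrite inE => /andP [].
  have [p _] := crdP y'M; have := p A; rewrite inE A0 Ay' => /(_ isT) /[swap] ->.
  by rewrite ltxx.
move=> L c Lc; have [h1 h2] := Lxy L c Lc; have [h3 h4] := Ly' L c Lc.
have [xc|cx|xc] := ltrgtP (pairing x L) c.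
- split=> // _; apply: h3; rewrite leNgt; apply/negP => h.
  by have := h2 (ltW h); rewrite leNgt xc.
- split=> // _; apply: h4; rewrite leNgt; apply/negP => h.
  by have := h1 (ltW h); rewrite leNgt cx.
suff -> : pairing y' L = c by rewrite lexx.
have La : (L, c) \in act by rewrite mem_filter /= xc eqxx.
have s0 : sg (L, c) * (pairing y' L - c) = 0.
  move: e2; rewrite big_seq => /eqP; rewrite psumr_eq0; last by move=> Lc' h; exact: t2.
  by move=> /allP /(_ _ La); rewrite La => /eqP.
have [yc|cy|yc] := ltrgtP (pairing y L) c.
- move/eqP: s0; rewrite mulf_eq0 sgr_eq0 /= subr_eq0 lt_eqF //= subr_eq0.
  by move/eqP.
- move/eqP: s0; rewrite mulf_eq0 sgr_eq0 /= subr_eq0 gt_eqF //= subr_eq0.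
  by move/eqP.
- by apply/le_anti; rewrite h3 ?h4 ?yc.
Qed.

End Fan.

Lemma free_map_uniq (K : fieldType) (W : vectType K) (I : eqType) (zs : seq I) (g : I -> W) :
  uniq zs ->
  (forall c : I -> K, \sum_(i <- zs) c i *: g i = 0 -> forall i, i \in zs -> c i = 0) ->
  free [seq g i | i <- zs].
Proof.
move=> uz hc; suff : free (in_tuple [seq g i | i <- zs]) by [].
apply/freeP => k kE i; have iz : (i < size zs)%N by rewrite -(size_map g).
case: zs uz hc k kE i iz => [|z0 zs] // uz hc k kE i iz.
pose c z := if insub (index z (z0 :: zs)) is Some j then k j else 0.
have cE (j : 'I_(size [seq g i | i <- z0 :: zs])) : c (nth z0 (z0 :: zs) j) = k j.
  by rewrite /c index_uniq ?valK //; rewrite -[X in (_ < X)%N](size_map g).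
rewrite -cE; apply: hc; last exact: mem_nth.
rewrite (big_nth z0) big_mkord -(size_map g) -[RHS]kE; apply: eq_bigr => j _.
by rewrite cE (nth_map z0) // -[X in (_ < X)%N](size_map g).
Qed.

Lemma big_map_index (W : nmodType) (V0 : nmodType) (I : eqType) (zs : seq I) (g : I -> W)
    (H : W -> nat -> V0) : uniq zs ->
  \sum_(k < size [seq g i | i <- zs]) H [seq g i | i <- zs]`_k k =
  \sum_(i <- zs) H (g i) (index i zs).
Proof.
case: zs => [|z0 zs] uz; first by rewrite big_nil big_ord0.
rewrite [RHS](big_nth z0) big_mkord -(size_map g); apply: eq_bigr => k _.
have kz : (k < size (z0 :: zs))%N by rewrite -(size_map g).
by rewrite (nth_map z0) // index_uniq.
Qed.

(** * Lattice bases and primitive normal vectors of cells *)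

Section Lattice.
Variables (R : realType) (m N : nat) (Lam : set 'rV[R]_m).
Variables (J : finType) (q : J -> 'rV[R]_m) (J0 : {set J}) (good : {set J} -> bool).
Implicit Types (S T : {set J}) (A : J) (x y w : 'rV[R]_m) (U : {vspace 'rV[R]_m}).
Implicit Types (f g L : 'cV[R]_m) (Ls : seq ('cV[R]_m * R)) (B : seq 'rV[R]_m).
Hypothesis F : fan N Lam q J0 good.
Notation integral := (integral Lam).
Notation supp := (supp q J0 good).
Notation inM := (inM q J0 good).
Notation crd := (crd Lam q J0 good).
Notation dualf := (dualf Lam q).
Notation V := (V q J0 good).
Notation P := (P q J0 good).
Notation sp := (sp q).

Definition zbasis B U := [/\ basis_of U B, forall b, b \in B -> Lam b &
  forall w, Lam w -> w \in U -> exists z : nat -> int, w = \sum_(i < size B) B`_i *~ z i].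

Lemma zbasis_size B U : zbasis B U -> size B = \dim U.
Proof. by case=> bB _ _; rewrite (size_basis (X := in_tuple B)). Qed.

Lemma LamMz w (z : int) : Lam w -> Lam (w *~ z).
Proof.
move=> Lw; have L0 := fan_lat0 F.
have LN u : Lam u -> Lam (- u) by move=> /(fan_latB F L0); rewrite sub0r.
have Ln n : Lam (w *+ n).
  elim: n => [|n ih]; first by rewrite mulr0n.
  by rewrite mulrS -[_ *+ n]opprK; apply: (fan_latB F) => //; exact: LN.
by case: z => n; [exact: Ln|rewrite NegzE mulrNz; exact/LN/Ln].
Qed.

Lemma LamD w u : Lam w -> Lam u -> Lam (w + u).
Proof.
move=> Lw Lu; rewrite -[u]opprK; apply: (fan_latB F) => //.
by rewrite -sub0r; apply: (fan_latB F) => //; exact: fan_lat0 F.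
Qed.

Lemma memvMz U w (z : int) : w \in U -> w *~ z \in U.
Proof. by move=> wU; rewrite -scaler_int memvZ. Qed.

Lemma Lam_sum (I : Type) (r : seq I) (Q : pred I) (G : I -> 'rV[R]_m) :
  (forall i, Q i -> Lam (G i)) -> Lam (\sum_(i <- r | Q i) G i).
Proof. by move=> h; elim/big_ind: _ => //; [exact: fan_lat0 F|exact: LamD]. Qed.

(** In ray coordinates the lattice of a cell is the integer kernel of the matrix of values of the
    active functionals on the rays. Its Smith normal form L D R exhibits a basis: the rows of the
    inverse of L that belong to zero rows of D. *)
Lemma zbasis_ex Ls x : inM x -> (forall L c, (L, c) \in Ls -> integral L) ->
  exists B, zbasis B (V Ls x).
Proof.
move=> xM iL; set S := supp x; have gS : good S := sup_good xM.
pose n := #|S|; pose qv (i : 'I_n) := q (enum_val i).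
pose qS : 'M[R]_(n, m) := \matrix_i qv i.
pose Dm : 'M[R]_(m, n) := \matrix_(i, j) dualf S (enum_val j) i 0.
have pD w j : (w *m Dm) 0 j = pairing w (dualf S (enum_val j)).
  by rewrite mxE pairingE; apply: eq_bigr => i _; rewrite !mxE.
have qD : qS *m Dm = 1%:M.
  apply/row_matrixP => i; rewrite row_mul rowK; apply/rowP => j; rewrite pD !mxE.
  have [_ ->] := dualP F gS (enum_valP j); last exact: enum_valP.
  by rewrite (inj_eq enum_val_inj).
have wqD w : w \in sp S -> w = (w *m Dm) *m qS.
  move=> wS; rewrite {1}(sp_dual F gS wS) big_enum_val mulmx_sum_row.
  by apply: eq_bigr => i _; rewrite pD rowK.
have cS (c : 'rV[R]_n) : c *m qS \in sp S.
  rewrite mulmx_sum_row; apply: memv_suml => i _; apply: memvZ; rewrite rowK.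
  by apply: (subvP (sumv_sup _ (enum_valP i) (subvv _))); exact: memv_line.
have LamD_int w (i : 'I_n) : Lam w -> (w *m Dm) 0 i \is a Num.int.
  by rewrite pD; have [h _] := dualP F gS (enum_valP i); exact: h.
pose a := [seq Lc.1 | Lc <- Ls & pairing x Lc.1 == Lc.2]; pose r := size a.
have ia (j : 'I_r) : integral a`_j.
  have : a`_j \in a by exact: mem_nth.
  case/mapP => -[L c]; rewrite mem_filter => /andP [_ Lc] ->; exact: iL Lc.
pose Mi : 'M[int]_(n, r) := \matrix_(i, j) Num.floor (pairing (qv i) a`_j).
pose MR : 'M[R]_(n, r) := map_mx intr Mi.
have MRE i j : MR i j = pairing (qv i) a`_j.
  by rewrite !mxE floorK //; apply: ia; apply: fan_lat F _ _ gS (enum_valP i).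
have [L uL [Rm uR [d _ ME]]] := int_Smith_normal_form Mi.
move: ME; set D : 'M[int]_(n, r) := \matrix_(i, j) _ => ME.
pose LR : 'M[R]_n := map_mx intr L; pose KR : 'M[R]_n := map_mx intr (invmx L).
pose DR : 'M[R]_(n, r) := map_mx intr D; pose RR : 'M[R]_r := map_mx intr Rm.
have LK : LR *m KR = 1%:M by rewrite -map_mxM mulmxV // map_mx1.
have KL : KR *m LR = 1%:M by rewrite -map_mxM mulVmx // map_mx1.
have MRL : MR = LR *m DR *m RR by rewrite /MR ME !map_mxM.
have RRu : RR *m map_mx intr (invmx Rm) = 1%:M by rewrite -map_mxM mulmxV // map_mx1.
pose Z (i : 'I_n) := [forall j, D i j == 0].
have wV w : w \in V Ls x -> w \in sp S /\ (w *m Dm) *m MR = 0.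
  move=> /VP [wS wL]; split=> //; apply/rowP => j; rewrite mxE [RHS]mxE.
  have : a`_j \in a by exact: mem_nth.
  case/mapP => -[L0 c]; rewrite mem_filter => /andP [/eqP /= xc Lc] aj.
  have := wL _ _ Lc xc; rewrite -aj.
  have -> : pairing w a`_j = pairing (w *m Dm *m qS) a`_j by rewrite -wqD.
  rewrite mulmx_sum_row pairing_suml => h; rewrite -[RHS]h.
  by apply: eq_bigr => i _; rewrite MRE pairingZl rowK.
have Vw (c : 'rV[R]_n) : c *m MR = 0 -> c *m qS \in V Ls x.
  move=> cM; apply/VP; split=> // L0 c0 Lc xc.
  have /(nthP 0) [j jr aj] : L0 \in a.
    by apply/mapP; exists (L0, c0) => //; rewrite mem_filter /= xc eqxx.
  have := congr1 (fun M : 'rV_r => M 0 (Ordinal jr)) cM; rewrite mxE [RHS]mxE => <-.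
  rewrite mulmx_sum_row pairing_suml; apply: eq_bigr => i _.
  by rewrite MRE pairingZl rowK /= aj.
have kerZ (c : 'rV[R]_n) i : c *m MR = 0 -> ~~ Z i -> (c *m LR) 0 i = 0.
  move=> cM; rewrite negb_forall => /existsP [j Dij].
  have e : c *m LR *m DR = 0.
    have h : c *m LR *m DR *m RR = 0 by rewrite -cM MRL !mulmxA.
    by rewrite -[LHS]mulmx1 -RRu mulmxA h mul0mx.
  have := congr1 (fun M : 'rV_r => M 0 j) e; rewrite mxE [RHS]mxE (bigD1 i) //= big1 ?addr0.
    by move/eqP; rewrite mulf_eq0 [DR i j]mxE intr_eq0 (negbTE Dij) orbF => /eqP.
  move=> k ki; rewrite /DR /D !mxE; move: Dij; rewrite /D !mxE.
  case: (eqVneq (i : nat) j) => [ij _|_]; last by rewrite mulr0n eqxx.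
  by rewrite -ij (inj_eq val_inj) (negbTE ki) mulr0n mulr0.
pose zs := [seq i <- enum 'I_n | Z i].
have uzs : uniq zs by rewrite filter_uniq // enum_uniq.
pose g i := row i KR *m qS.
have gD i : g i *m Dm = row i KR by rewrite /g -mulmxA qD mulmx1.
exists [seq g i | i <- zs].
have BV i : i \in zs -> g i \in V Ls x.
  rewrite mem_filter => /andP [/forallP Zi _]; apply: Vw.
  rewrite MRL !mulmxA -row_mul KL row1 -[delta_mx _ _ *m DR]rowE.
  suff -> : row i DR = 0 by rewrite mul0mx.
  by apply/rowP => j; rewrite !mxE; move: (Zi j); rewrite mxE => /eqP ->.
have wE w : w \in V Ls x -> w = \sum_(i <- zs) (w *m Dm *m LR) 0 i *: g i.
  move=> /wV [wS wM]; 
  have e0 : w = w *m Dm *m LR *m (KR *m qS).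
    by rewrite !mulmxA -[_ *m LR *m KR]mulmxA LK mulmx1 -wqD.
  rewrite {1}e0 mulmx_sum_row (bigID Z) /= [X in _ + X]big1 ?addr0; last first.
    by move=> i nZ; rewrite kerZ // scale0r.
  by rewrite big_filter big_enum_cond /=; apply: eq_bigr => i _; rewrite row_mul.
split.
- rewrite basisEfree; apply/and3P; split.
  + apply: free_map_uniq => // c c0 i iz.
    have e : \sum_(i <- zs) c i *: row i (1%:M : 'M[R]_n) = 0.
      rewrite -KL -[RHS](mul0mx _ (Dm *m LR)) -c0 mulmx_suml; apply: eq_bigr => k _.
      by rewrite -scalemxAl mulmxA gD row_mul.
    have := congr1 (fun M : 'rV_n => M 0 i) e; rewrite summxE [RHS]mxE (bigD1_seq i) //=.
    rewrite big1 ?addr0 => [|k ki]; last by rewrite !mxE (negbTE ki) mulr0.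
    by rewrite !mxE eqxx mulr1.
  + by apply/span_subvP => _ /mapP [i iz ->]; exact: BV.
  + apply: leq_trans (dim_span _); apply: dimvS; apply/subvP => w /wE ->.
    rewrite big_seq; apply: memv_suml => i iz; apply: memvZ; apply: memv_span.
    exact: map_f.
- move=> _ /mapP [i _ ->]; rewrite /g mulmx_sum_row; apply: Lam_sum => j _.
  by rewrite !mxE scaler_int rowK; apply: LamMz; apply: fan_lat F _ _ gS (enum_valP j).
- move=> w Lw wVx; pose co i := (w *m Dm *m LR) 0 i.
  exists (fun k => Num.floor [seq co i | i <- zs]`_k).
  rewrite (big_map_index g (fun b k => b *~ Num.floor [seq co i | i <- zs]`_k)) //.
  rewrite {1}(wE w wVx) big_seq [RHS]big_seq; apply: eq_bigr => i iz.
  rewrite (nth_map i) ?index_mem // nth_index // -scaler_int floorK //.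
  rewrite /co mxE rpred_sum // => j _; rewrite rpredM ?LamD_int //.
  by rewrite mxE intr_int.
Qed.

Lemma zbasis_coord B U w : zbasis B U -> w \in U ->
  exists c : nat -> R, w = \sum_(i < size B) c i *: B`_i.
Proof.
case=> bB _ _ wU; exists (fun k => if insub k is Some i then coord (in_tuple B) i w else 0).
rewrite {1}(coord_basis (X := in_tuple B) bB wU).
by apply: eq_bigr => i _; rewrite valK.
Qed.

(** In codimension one the functional of [kappaP] cuts out exactly the smaller tangent space; it
    measures the height above the face. *)
Lemma codim1 Ls x y : inM x -> inM y -> P Ls y x ->
  \dim (V Ls y) = (\dim (V Ls x)).+1 -> (forall L c, (L, c) \in Ls -> integral L) ->
  exists k, [/\ integral k,
    (forall w, w \in V Ls y -> (w \in V Ls x) = (pairing w k == 0)), 0 < pairing (y - x) k &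
    forall x' y', P Ls x x' -> P Ls y y' -> 0 <= pairing (y' - x') k].
Proof.
move=> xM yM Pyx dimV iL.
have nP : ~ P Ls x y by move=> /V_sub /dimvS; rewrite dimV ltnn.
have [k [ik k0 kp kge]] := kappaP F xM yM Pyx nP.
exists k; split=> //; first exact: ik.
have e : V Ls x = (V Ls y :&: kr k)%VS.
  apply/eqP; rewrite eqEdim; apply/andP; split.
    by rewrite subv_cap V_sub //; apply/subvP => w /k0 /eqP; rewrite krP.
  rewrite -ltnS -dimV ltn_neqAle dimvS ?capvSl // andbT.
  apply/negP => /eqP h; have /eqP : (V Ls y :&: kr k)%VS == V Ls y.
    by rewrite eqEdim capvSl h leqnn.
  move=> /eqP; rewrite eqEsubv => /andP [_ /subvP /(_ (y - x))].
  by rewrite memv_cap krP gt_eqF // andbF => /(_ (diff_V F (P_refl Ls yM) Pyx)).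
by move=> w wy; rewrite e memv_cap wy krP.
Qed.

(** Near x, a direction that points towards y, up to a vector tangent to the cell of x, runs in the
    relative interior of the cell of y; the cell can thus be recovered from the direction. *)
Lemma rayP Ls x y vx (b : R) : inM x -> inM y -> P Ls y x -> vx \in V Ls x -> 0 < b ->
  exists2 e : R, 0 < e & forall t, 0 < t <= e ->
    let z := x + t *: (b *: (y - x) + vx) in [/\ P Ls y z, P Ls z y & P Ls z x].
Proof.
move=> xM yM Pyx /VP [vxS vxL] b0; have [_ xy Lxy] := Pyx; have gy := sup_good yM.
have vy : b *: (y - x) + vx \in sp (supp y).
  apply: memvD; last exact: (subvP (sp_sub _ xy)).
  by apply: memvZ; have /VP [] := diff_V F (P_refl Ls yM) Pyx.
have [|e e0 he] := @moveP _ _ _ _ _ _ _ _ F Ls x (supp y) _ xM gy xy vy.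
  move=> A /[1!inE] /andP [Ax Ay]; rewrite pairingDl pairingZl pairingBl.
  rewrite (crd_sub F yM gy Ay (subxx _)) (crd_sub F xM gy Ay xy).
  have -> : crd x A = 0 by rewrite /crd (negbTE Ax).
  rewrite subr0.
  have /spP [c ->] := vxS; rewrite (pairing_comb F) // (negbTE Ax) addr0 mulr_gt0 //.
  have [p _] := crdP F yM; apply: p; rewrite inE Ay andbT.
  by apply: contra Ax; apply: (subsetP (sup_base F xM)).
exists e => // t te z; have [zM zS Lz] := he t te; have /andP [t0 _] := te.
have key L c : (L, c) \in Ls ->
    ((pairing z L <= c) = (pairing y L <= c)) /\ ((c <= pairing z L) = (c <= pairing y L)).
  move=> Lc; have [h1 h2] := Lxy L c Lc; have [k1 k2] := Lz L c Lc.
  have [xc|cx|xc] := ltrgtP (pairing x L) c.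
  - have yc : pairing y L < c by rewrite ltNge; apply/negP => /h2; rewrite leNgt xc.
    have zc : pairing z L < c := k1 xc.
    by rewrite (ltW zc) (ltW yc) (lt_geF zc) (lt_geF yc).
  - have yc : c < pairing y L by rewrite ltNge; apply/negP => /h1; rewrite leNgt cx.
    have zc : c < pairing z L := k2 cx.
    by rewrite (ltW zc) (ltW yc) (lt_geF zc) (lt_geF yc).
  have -> : pairing z L = c + t * b * (pairing y L - c).
    by rewrite /z pairingDl pairingZl pairingDl pairingZl pairingBl (vxL _ _ Lc) // xc addr0 mulrA.
  by rewrite gerDl lerDl pmulr_rle0 ?pmulr_rge0 ?mulr_gt0 // subr_le0 subr_ge0.
have Pyz : P Ls y z by split; rewrite ?zS // => L c /key [-> ->].
have Pzy : P Ls z y by split; rewrite ?zS // => L c /key [-> ->].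
by split=> //; apply: (P_trans Pzy).
Qed.

Lemma normal_dir Ls x y v : inM x -> inM y -> P Ls y x ->
  \dim (V Ls y) = (\dim (V Ls x)).+1 -> (forall L c, (L, c) \in Ls -> integral L) ->
  is_primitive_normal Lam (P Ls x) (P Ls y) v ->
  exists b vx, [/\ 0 < b, vx \in V Ls x & v = b *: (y - x) + vx].
Proof.
move=> xM yM Pyx dimV iL [Lv]; rewrite !(linP F) // => vy vZ [x' [e [Px' e0 Py']]].
have [k [ik kE kp kge]] := codim1 xM yM Pyx dimV iL.
have kv : 0 <= pairing v k.
  by have := kge _ _ Px' Py'; rewrite addrC addKr pairingZl pmulr_rge0.
have yx : y - x \in V Ls y by exact: (diff_V F (P_refl Ls yM) Pyx).
(* At height 0, v would be tangent to the face, and with it every lattice vector of the larger cell,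
   against the dimensions. *)
have kv0 : pairing v k != 0.
  apply/negP => kv0; have vx : v \in V Ls x by rewrite kE.
  suff /dimvS : (V Ls y <= V Ls x)%VS by rewrite dimV ltnn.
  have [B zB] := zbasis_ex yM iL; apply/subvP => w /(zbasis_coord zB) [c ->].
  apply: memv_suml => i _; apply: memvZ.
  have Bi : B`_i \in B by exact: mem_nth.
  have [bB LB _] := zB; have [] := vZ _ (LB _ Bi); first exact: (basis_mem bB Bi).
  move=> z; rewrite -[X in _ -> X \in _](subrK (v *~ z)) => h; apply: memvD => //.
  by rewrite -scaler_int memvZ.
exists (pairing v k / pairing (y - x) k), (v - (pairing v k / pairing (y - x) k) *: (y - x)).
split; first by rewrite divr_gt0 // lt_neqAle eq_sym kv0.
  rewrite kE; last by apply: memvB => //; exact: memvZ.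
  by rewrite [pairing (v - _) k]pairingBl pairingZl divfK ?subrr // gt_eqF.
by rewrite addrC subrK.
Qed.

(** Take a lattice vector of least positive height above the face; division with remainder brings
    any other lattice vector to height 0 by subtracting a multiple of it. *)
Lemma normal_ex Ls x y : inM x -> inM y -> P Ls y x ->
  \dim (V Ls y) = (\dim (V Ls x)).+1 -> (forall L c, (L, c) \in Ls -> integral L) ->
  is_primitive_normal Lam (P Ls x) (P Ls y) (primitive_normal Lam (P Ls x) (P Ls y)).
Proof.
move=> xM yM Pyx dimV iL; rewrite /primitive_normal; apply: xgetPex.
have [k [ik kE kp kge]] := codim1 xM yM Pyx dimV iL.
have yx : y - x \in V Ls y by exact: (diff_V F (P_refl Ls yM) Pyx).
(* [n] stands for the height n + 1, so that only positive heights compete for the minimum. *)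
pose Q (n : nat) : bool := `[< exists v, [/\ Lam v, v \in V Ls y & pairing v k = n.+1%:R] >].
have absQ v : Lam v -> v \in V Ls y -> pairing v k != 0 ->
    exists n, Q n /\ `|pairing v k| = n.+1%:R.
  move=> Lv vy v0; have /intrP [z zE] := ik v Lv.
  have [z0|z0] := leP 0 z.
    case: z zE z0 => // -[|n] zE _; first by rewrite zE eqxx in v0.
    exists n; split; last by rewrite zE normr_nat.
    by apply/asboolP; exists v; rewrite zE.
  case: z zE z0 => // n zE _; exists n; split; last by rewrite zE NegzE mulrNz normrN normr_nat.
  apply/asboolP; exists (- v); rewrite memvN pairingNl zE NegzE mulrNz opprK; split=> //.
  by rewrite -sub0r; apply: (fan_latB F) => //; exact: fan_lat0 F.
have exQ : exists n, Q n.
  apply: contrapT => nQ; have [B zB] := zbasis_ex yM iL.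
  have : pairing (y - x) k = 0; last by move=> h; rewrite h ltxx in kp.
  have [c ->] := zbasis_coord zB yx; rewrite pairing_suml big1 // => i _.
  have Bi : B`_i \in B by exact: mem_nth.
  have [bB LB _] := zB; rewrite pairingZl; apply/eqP; rewrite mulf_eq0.
  apply/orP; right; apply: contrapT => /negP h; apply: nQ.
  by have [n []] := absQ _ (LB _ Bi) (basis_mem bB Bi) h; exists n.
have [n /asboolP [v [Lv vy vk]] nmin] := ex_minnP exQ.
exists v; split; rewrite ?(linP F) //.
  move=> w Lw wy; have /intrP [z zE] := ik w Lw.
  exists (z %/ n.+1)%Z; rewrite kE; last first.
    by apply: memvB => //; rewrite -scaler_int memvZ.
  apply: contrapT => /negP h.
  have [n' [Qn' n'E]] := absQ _ (fan_latB F Lw (LamMz (z %/ n.+1)%Z Lv)) (memvB wy (memvMz _ vy)) h.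
  have := nmin _ Qn'; apply/negP; rewrite -ltnNge -ltnS -(ltr_nat R) -n'E.
  rewrite pairingBl -scaler_int pairingZl vk zE.
  have -> : (z%:~R : R) - (z %/ n.+1)%Z%:~R * n.+1%:R = (z %% n.+1)%Z%:~R.
    by rewrite {1}(divz_eq z n.+1) intrD intrM addrAC subrr add0r.
  rewrite ger0_norm ?ler0z ?modz_ge0 // -[n.+1%:R]/(n.+1%:Z%:~R) ltr_int.
  exact: ltz_pmod.
have [b [b0 vx]] : exists b, 0 < b /\ v - b *: (y - x) \in V Ls x.
  exists (pairing v k / pairing (y - x) k); rewrite divr_gt0 ?vk //; split=> //.
  rewrite kE; last by apply: memvB => //; exact: memvZ.
  by rewrite [pairing (v - _) k]pairingBl pairingZl vk divfK ?subrr // gt_eqF.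
have [e e0 he] := rayP xM yM Pyx vx b0.
exists x, e; split=> //.
have := he e; rewrite e0 lexx => /(_ isT) [].
by rewrite [b *: _ + _]addrC subrK.
Qed.

(** This is how the lattice index in the weight formula disappears: the basis of the larger cell is
    that of the face with the normal in front. *)
Lemma zbasis_normal Ls x y B v : inM x -> inM y -> P Ls y x ->
  \dim (V Ls y) = (\dim (V Ls x)).+1 -> (forall L c, (L, c) \in Ls -> integral L) ->
  is_primitive_normal Lam (P Ls x) (P Ls y) v -> zbasis B (V Ls x) -> zbasis (v :: B) (V Ls y).
Proof.
move=> xM yM Pyx dimV iL pn zB; have [Lv] := pn; rewrite !(linP F) // => vy vZ _.
have [bB LB cB] := zB.
have int_span w : Lam w -> w \in V Ls y ->
    exists z : nat -> int, w = \sum_(i < size (v :: B)) (v :: B)`_i *~ z i.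
  move=> Lw wy; have [z wz] := vZ w Lw wy.
  have [z' wz'] := cB _ (fan_latB F Lw (LamMz z Lv)) wz.
  exists (fun k => if k is k'.+1 then z' k' else z).
  by rewrite big_ord_recl /= -wz' addrC subrK.
split=> //; last by move=> b; rewrite inE => /orP [/eqP ->|/LB].
rewrite basisEdim /= dimV (zbasis_size zB) leqnn andbT.
have [B' zB'] := zbasis_ex yM iL; apply/subvP => w /(zbasis_coord zB') [c ->].
apply: memv_suml => i _; apply: memvZ.
have Bi : B'`_i \in B' by exact: mem_nth.
have [bB' LB' _] := zB'; have [z ->] := int_span _ (LB' _ Bi) (basis_mem bB' Bi).
by apply: memv_suml => j _; apply: memvMz; rewrite memv_span // mem_nth.
Qed.

(** A cell is determined by the cone of the point that names it and by the weak inequalities that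
    hold there. *)
Lemma finite_cells Ls : finite_set [set s | exists2 x, inM x & s = P Ls x].
Proof.
pose T : finType := ({set J} * (size Ls).-tuple (bool * bool))%type.
pose cell (t : T) : set 'rV[R]_m := [set y | [/\ inM y, supp y \subset t.1 &
  forall i : 'I_(size Ls), ((tnth t.2 i).1 -> pairing y (nth (0, 0) Ls i).1 <= (nth (0, 0) Ls i).2) /\
     ((tnth t.2 i).2 -> (nth (0, 0) Ls i).2 <= pairing y (nth (0, 0) Ls i).1)]].
apply: (@sub_finite_set _ _ (cell @` [set: T])); last exact: (finite_image cell finite_finset).
move=> _ [x xM ->]; exists (supp x, map_tuple (fun Lc : 'cV[R]_m * R => (pairing x Lc.1 <= Lc.2, Lc.2 <= pairing x Lc.1)) (in_tuple Ls)) => //.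
apply/seteqP; split=> y /=.
  move=> [yM yx h]; split=> // L c /(nthP (0, 0)) [i iL e].
  have := h (Ordinal iL); rewrite (tnth_nth (false, false)) /= (nth_map (0, 0)) //.
  by rewrite e.
move=> [yM yx h]; split=> // i; rewrite (tnth_nth (false, false)) /= (nth_map (0, 0)) //.
by case: (nth _ _ _) (mem_nth (0, 0) (ltn_ord i)) => L c /h.
Qed.

End Lattice.

(** * Linear changes of the target coordinates *)

Section ColumnChange.
Variables (R : realType) (N : nat) (J : finType) (v : J -> 'rV[R]_N).
Variables (good : {set J} -> bool) (D : 'M[R]_N).
Hypothesis uD : D \in unitmx.
Let v' A := v A *m D.

Lemma detr_mul (s : seq 'rV[R]_N) : detr [seq w *m D | w <- s] = detr s * \det D.
Proof.
rewrite /detr -det_mulmx; congr (\det _); apply/row_matrixP => i.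
rewrite row_mul !rowK; have [h|h] := ltnP i (size s); first by rewrite (nth_map 0).
by rewrite !nth_default ?size_map // mul0mx.
Qed.

Lemma vol_mul S : vol v' S = vol v S * `|\det D|.
Proof. by rewrite /vol -normrM -detr_mul /rows -map_comp. Qed.

Lemma top_mul : top v' good =1 top v good.
Proof.
move=> S; rewrite /top vol_mul mulf_eq0 [`|\det D| == 0]normr_eq0.
by move: uD; rewrite unitmxE unitfE => /negbTE ->; rewrite orbF.
Qed.

Lemma co_mul S A u : co v' S A (u *m D) = co v S A u.
Proof.
have e w T : detr (w *m D :: rows v' T) = detr (w :: rows v T) * \det D.
  by rewrite -detr_mul /= /rows -map_comp.
rewrite /co !e invfM mulrACA divff ?mulr1 //.
by move: uD; rewrite unitmxE unitfE.
Qed.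

Lemma dcount_mul S0 u : dcount v' good S0 (u *m D) = `|\det D| * dcount v good S0 u.
Proof.
rewrite /dcount mulr_sumr; apply: eq_big => [S|S _]; first by rewrite top_mul.
rewrite vol_mul [vol v S * _]mulrC -mulrA; congr (_ * (_ * _)).
by congr (_%:R); congr nat_of_bool; apply: eq_forallb => A; rewrite co_mul.
Qed.

Lemma generic_mul S0 u : generic v good S0 u -> generic v' good S0 (u *m D).
Proof. by move=> gu S A; rewrite top_mul co_mul; exact: gu. Qed.

End ColumnChange.

(** * Pairing matrices of vectors and functionals *)

Section PairDet.
Variables (R : realType) (m : nat).
Implicit Types (B : seq 'rV[R]_m) (g : seq 'cV[R]_m).

Definition pdet B g : R := \det (\matrix_(i < size g, j < size g) pairing B`_i g`_j).

Lemma pdet_cons n f B g : (forall b, b \in B -> pairing b f = 0) -> size B = size g ->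
  pdet (n :: B) (f :: g) = pairing n f * pdet B g.
Proof.
move=> Bf sz; rewrite /pdet /= (expand_det_col _ ord0) big_ord_recl big1 ?addr0; last first.
  by move=> i _; rewrite mxE lift0 /= Bf ?mul0r // mem_nth // sz.
rewrite mxE /= /cofactor /= expr0 mul1r; congr (_ * \det _).
by apply/matrixP => i j; rewrite !mxE.
Qed.

Lemma pdet_solve B g (a : 'I_(size g) -> R) : pdet B g != 0 ->
  exists c : 'I_(size g) -> R, 
    forall j : 'I_(size g), pairing (\sum_i c i *: B`_i) g`_j = a j.
Proof.
move=> d0; set M := \matrix_(i < size g, j < size g) pairing B`_i g`_j.
have uM : M \in unitmx by rewrite unitmxE unitfE.
exists (fun i => ((\row_j a j) *m invmx M) 0 i) => j.
have e : (\row_j a j) *m invmx M *m M = \row_j a j by rewrite mulmxKV.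
have := congr1 (fun r : 'rV_(size g) => r 0 j) e; rewrite mxE [RHS]mxE => <-.
by rewrite pairing_suml; apply: eq_bigr => i _; rewrite pairingZl [M i j]mxE.
Qed.

Lemma pdet_ex B : free B -> exists g, size g = size B /\ pdet B g != 0.
Proof.
move=> fB; pose MB : 'M[R]_(size B, m) := \matrix_i B`_i.
have /row_freeP [C BC] : row_free MB.
  apply: inj_row_free => u; rewrite mulmx_sum_row => h; apply/rowP => i.
  have h' : \sum_(i < size B) u 0 i *: (in_tuple B)`_i = 0.
    by rewrite -[RHS]h; apply: eq_bigr => k _; rewrite rowK.
  by rewrite (freeP (X := in_tuple B) fB _ h') mxE.
exists [seq col j C | j <- enum 'I_(size B)]; rewrite size_map size_enum_ord; split=> //.
rewrite /pdet size_map size_enum_ord.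
suff -> : \matrix_(i < size B, j < size B) pairing B`_i [seq col j C | j <- enum 'I_(size B)]`_j = 1%:M.
  by rewrite det1 oner_eq0.
apply/matrixP => i j; rewrite mxE (nth_map j) ?size_enum_ord // nth_ord_enum -BC.
by rewrite pairingE mxE; apply: eq_bigr => k _; rewrite !mxE.
Qed.

Lemma dim_le_kernel (U : {vspace 'rV[R]_m}) g :
  (forall w, w \in U -> (forall f, f \in g -> pairing w f = 0) -> w = 0) ->
  (\dim U <= size g)%N.
Proof.
move=> inj; pose M : 'M[R]_(m, size g) := \matrix_(i, j) g`_j i 0.
have ME w j : (w *m M) 0 j = pairing w g`_j.
  by rewrite mxE pairingE; apply: eq_bigr => i _; rewrite mxE.
pose h := linfun (mulmxr M : 'rV_m -> 'rV_(size g)).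
rewrite -(limg_ker_dim h U).
have -> : (U :&: lker h = 0)%VS.
  apply/eqP; rewrite -subv0; apply/subvP => w; rewrite memv_cap memv_ker lfunE /= memv0.
  case/andP => wU /eqP w0; apply/eqP/inj => // f /(nthP 0) [j jg <-].
  by rewrite -(ME w (Ordinal jg)) w0 mxE.
rewrite dimv0 add0n; apply: leq_trans (dimvS (subvf _)) _.
by rewrite dimvf /dim /= mul1n.
Qed.

End PairDet.

(** * Divisors as stable intersections *)

Section Slices.
Variables (R : realType) (m N : nat) (Lam : set 'rV[R]_m).
Variables (J : finType) (q : J -> 'rV[R]_m) (J0 : {set J}) (good : {set J} -> bool).
Implicit Types (S T : {set J}) (A : J) (x y w z : 'rV[R]_m) (U : {vspace 'rV[R]_m}).
Implicit Types (f L : 'cV[R]_m) (fs g : seq 'cV[R]_m) (Ls : seq ('cV[R]_m * R)) (B : seq 'rV[R]_m).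
Hypothesis F : fan N Lam q J0 good.
Notation integral := (integral Lam).
Notation supp := (supp q J0 good).
Notation inM := (inM q J0 good).
Notation crd := (crd Lam q J0 good).
Notation dualf := (dualf Lam q).
Notation V := (V q J0 good).
Notation P := (P q J0 good).
Notation sp := (sp q).
Notation zbasis := (zbasis Lam).

Definition vec fs w : 'rV[R]_N := \row_(j < N) pairing w fs`_j.
Definition vq fs A := vec fs (q A).
Definition dg fs S : R := dgr (vq fs) good S.

Lemma vec_comb fs S a : vec fs (comb q S a) = \sum_(A in S) a A *: vq fs A.
Proof.
apply/rowP => j; rewrite mxE summxE pairing_suml; apply: eq_bigr => A _.
by rewrite pairingZl !mxE.
Qed.

Lemma fan_balanced fs T : good T -> #|T|.+1 = N ->
  \sum_(A | (A \notin T) && good (A |: T)) detr (vq fs A :: rows (vq fs) T) = 0.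
Proof.
move=> gT cT; have [a aE] := fan_bal F gT cT.
have cT' : (#|T| < N)%N by rewrite -cT.
have N0 : (0 < N)%N by rewrite -cT.
have e := detr_span (vq fs) a cT'.
rewrite -[RHS]e -vec_comb -aE detr_cons //.
have -> : vec fs (\sum_(A | (A \notin T) && good (A |: T)) q A) =
    \sum_(A | (A \notin T) && good (A |: T)) vq fs A.
  by apply/rowP => j; rewrite mxE summxE pairing_suml; apply: eq_bigr => A _; rewrite mxE.
by rewrite [RHS]pairing_suml; apply: eq_bigr => A _; rewrite detr_cons.
Qed.

Lemma fan_good_down S0 T S :
  good S0 -> S0 \subset T -> T \subset S -> good S -> good T.
Proof.
move=> g0 h1 h2 gS; apply: (fan_down F _ h2 gS).
exact: subset_trans (fan_base F g0) h1.
Qed.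

Lemma dg_generic fs S u : good S -> generic (vq fs) good S u -> dcount (vq fs) good S u = dg fs S.
Proof. exact: (dgrE (fan_balanced fs) fan_good_down). Qed.

Lemma dg_hit fs (q0 : 'rV[R]_N) S0 : good S0 ->
  dg fs S0 = \sum_(S1 : {set J} | `[< hit (vq fs) good q0 S0 S1 >]) dg fs S1.
Proof. exact: (dgr_hit (fan_balanced fs) fan_good_down). Qed.

Lemma dg_mul fs fs' (D : 'M[R]_N) S : good S -> D \in unitmx ->
  (forall w, vec fs' w = vec fs w *m D) -> dg fs' S = `|\det D| * dg fs S.
Proof.
move=> gS uD fsD; have [u gu] := generic_ex (vq fs) good.
have gu' := generic_set0 (S0 := S) gu.
have e : vq fs' = (fun A => vq fs A *m D) by apply/funext => A; exact: fsD.
rewrite -(dg_generic gS gu') -(@dg_generic fs' S (u *m D)) // e; last exact: generic_mul.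
exact: dcount_mul.
Qed.

Lemma dg_sign fs f g S : good S -> (size fs + size g).+1 = N ->
  dg (fs ++ - f :: g) S = dg (fs ++ f :: g) S.
Proof.
move=> gS sz; have k0 : (size fs < N)%N by rewrite -sz ltnS leq_addr.
pose D : 'M[R]_N := diag_mx (\row_j if j == Ordinal k0 then -1 else 1).
have dD : \det D = -1.
  rewrite det_diag (bigD1 (Ordinal k0)) //= big1 ?mulr1 => [|j /negbTE jk].
    by rewrite mxE eqxx.
  by rewrite mxE jk.
rewrite (@dg_mul (fs ++ f :: g) _ D) //.
- by rewrite dD normrN1 mul1r.
- by rewrite unitmxE dD unitrN1.
move=> w; apply/rowP => j; rewrite mul_mx_diag !mxE !nth_cat.
have [jk|jk] := eqVneq j (Ordinal k0).
  by rewrite jk /= ltnn subnn /= pairingNr mulrN1.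
rewrite mulr1; case: ltnP => // kj.
by rewrite -[(j - size fs)%N]prednK // subn_gt0 ltn_neqAle kj andbT eq_sym; apply: contra jk.
Qed.

Lemma dg_perm fs fs' S : good S -> size fs = N -> perm_eq fs fs' -> dg fs S = dg fs' S.
Proof.
move=> gS sz pf; have sz' : size fs' == N by rewrite -(perm_size pf) sz.
have /tuple_permP [p sp] : perm_eq fs (Tuple sz') by [].
rewrite (@dg_mul fs' fs (perm_mx p)^T) //.
- by rewrite det_tr det_perm normr_sign mul1r.
- by rewrite unitmx_tr unitmx_perm.
move=> w; apply/rowP => j; rewrite tr_perm_mx -[_ *m _]col_permE !mxE sp.
by rewrite -tnth_nth tnth_mktuple (tnth_nth 0).
Qed.

(** A nonzero count has a maximal cone around S with independent images, which makes the conditions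
    injective on its span and hence on that of S. *)
Lemma dg_inj fs S w : dg fs S != 0 -> good S -> w \in sp S -> vec fs w = 0 -> w = 0.
Proof.
move=> d0 gS /spP [a wE] w0; have [u gu] := generic_ex (vq fs) good.
have gu' := generic_set0 (S0 := S) gu; move: d0; rewrite -(dg_generic gS gu').
have [[T tT ST]|nT] := pselect (exists2 T, top (vq fs) good T & S \subset T); last first.
  rewrite /dcount big_pred0 ?eqxx // => T; apply/negbTE/negP => /andP [tT ST].
  by apply: nT; exists T.
move=> _; rewrite wE /comb big1 // => A AS.
have AT : A \in T by apply: (subsetP ST).
have : co (vq fs) T A 0 = 0.
  by have [f ->] := co_ex tT AT; rewrite pairing0l.
rewrite -{1}w0 wE vec_comb.
have -> : \sum_(B in S) a B *: vq fs B = \sum_(B in T) (if B \in S then a B else 0) *: vq fs B.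
  rewrite [RHS](bigID (mem S)) /= [X in _ = _ + X]big1 ?addr0 => [|B /andP [_ /negbTE ->]]; last by rewrite scale0r.
  apply: eq_big => [B|B ->//]; by rewrite andb_idl // => /(subsetP ST).
by rewrite (co_eq (fun B : J => if B \in S then a B else 0) tT AT) AS => ->; rewrite scale0r.
Qed.

Lemma dg_top fs S : good S -> #|S| = N -> dg fs S = vol (vq fs) S.
Proof.
move=> gS cS; have [u gu] := generic_ex (vq fs) good.
rewrite -(dg_generic gS (generic_set0 gu)) /dcount.
have only T : top (vq fs) good T && (S \subset T) -> T = S.
  case/andP => tT ST; apply/esym/eqP; rewrite eqEcard ST cS.
  by rewrite (top_card tT) leqnn.
have [tS|ntS] := boolP (top (vq fs) good S).
  rewrite (big_pred1 S) => [|T]; last first.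
    by apply/idP/eqP => [/only //|->]; rewrite tS subxx.
  suff -> : [forall A in S :\: S, 0 < co (vq fs) S A u] by rewrite mulr1.
  by apply/forall_inP => A; rewrite setDv inE.
rewrite big_pred0 => [|T]; last first.
  by apply/negbTE/negP => h; move: (h); rewrite (only _ h) (negbTE ntS).
by move: ntS; rewrite /top gS cS eqxx /= negbK => /eqP.
Qed.

Definition inH Ls x := all (fun Lc => pairing x Lc.1 == Lc.2) Ls.

(** One list [g] with nonzero [pdet B g] fixes the weight; leaving [g] free is what allows the next
    functional to be put in front of it. Cells off the hyperplanes are kept as cells and get weight
    0 from the factor [inH]. *)
Definition inv (Y : wcomplex R m) Ls := [/\ (wdim Y + size Ls)%N = N,
  forall L c, (L, c) \in Ls -> integral L,
  cells Y = [set s | exists x, [/\ inM x, (\dim (V Ls x) <= wdim Y)%N & s = P Ls x]] &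
  forall x B g, inM x -> \dim (V Ls x) = wdim Y -> zbasis B (V Ls x) -> size g = wdim Y ->
    wt Y (P Ls x) * `|pdet B g| = (inH Ls x)%:R * dg (map fst Ls ++ g) (supp x)].

(* The situation between two divisors: Y is subdivided along the next pair Lc
   but its weights are still those given by Ls. *)
Definition mid (Y : wcomplex R m) Ls Lc := [/\ (wdim Y + size Ls)%N = N,
  forall L c, (L, c) \in rcons Ls Lc -> integral L,
  cells Y = [set s | exists x, [/\ inM x, (\dim (V Ls x) <= wdim Y)%N & s = P (rcons Ls Lc) x]] &
  forall x B g, inM x -> \dim (V Ls x) = wdim Y -> \dim (V (rcons Ls Lc) x) = wdim Y ->
    zbasis B (V (rcons Ls Lc) x) -> size g = wdim Y ->
    wt Y (P (rcons Ls Lc) x) * `|pdet B g| = (inH Ls x)%:R * dg (map fst Ls ++ g) (supp x)].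

Lemma P_rcons Ls Lc x : P (rcons Ls Lc) x `<=` P Ls x.
Proof. by move=> y [yM yx h]; split=> // L c Lin; apply: h; rewrite mem_rcons inE Lin orbT. Qed.

Lemma V_rcons Ls Lc x : (V (rcons Ls Lc) x <= V Ls x)%VS.
Proof.
apply/subvP => w /VP [ws wL]; apply/VP; split=> // L c Lin.
by apply: wL; rewrite mem_rcons inE Lin orbT.
Qed.

Lemma inH_P Ls x y : P Ls y x -> inH Ls y -> inH Ls x.
Proof.
move=> [_ _ h] /allP Hy; apply/allP => -[L c] Lin; have /eqP /= e := Hy _ Lin.
by have [h1 h2] := h L c Lin; rewrite /= eq_le h1 ?h2 ?e.
Qed.

Section Divisor.
Variables (Y : wcomplex R m) (Ls : seq ('cV[R]_m * R)) (L : 'cV[R]_m) (c : R).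
Let Ls' := rcons Ls (L, c).
Hypothesis mY : mid Y Ls (L, c).
Variables (x : 'rV[R]_m).
Hypothesis xM : inM x.
Hypothesis dim_x : (\dim (V Ls' x)).+1 = wdim Y.

Let above := [set s | facets Y s /\ is_face (P Ls' x) s].
Let r := finmap.enum_fset (fset_set above).
Let yof (s : set 'rV[R]_m) := xget 0 [set y | inM y /\ s = P Ls' y].
Let nrm s := primitive_normal Lam (P Ls' x) s.

Let iL' L0 c0 : (L0, c0) \in Ls' -> integral L0.
Proof. by case: mY => _ h _ _; exact: h. Qed.

Lemma above_finite : finite_set above.
Proof.
apply: sub_finite_set (finite_cells q J0 good Ls'); case: mY => _ _ cY _.
by move=> s [[]]; rewrite cY => -[y [yM _ sE]] _ _; exists y.
Qed.

Lemma above_sum (h : set 'rV[R]_m -> R) : \sum_(s \in above) h s = \sum_(s <- r) h s.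
Proof. by rewrite fsbig_finite //; exact: above_finite. Qed.

Lemma above_sumv (h : set 'rV[R]_m -> 'rV[R]_m) : \sum_(s \in above) h s = \sum_(s <- r) h s.
Proof. by rewrite fsbig_finite //; exact: above_finite. Qed.

Lemma P_V_eq (K : seq ('cV[R]_m * R)) y z : P K y z -> P K z y -> V K y = V K z.
Proof. by move=> h1 h2; apply/eqP; rewrite eqEsubv !(V_sub h1, V_sub h2). Qed.

Lemma P_supp_eq (K : seq ('cV[R]_m * R)) y z : P K y z -> P K z y -> supp y = supp z.
Proof. by move=> [_ h1 _] [_ h2 _]; apply/eqP; rewrite eqEsubset h1 h2. Qed.

Lemma aboveP s : s \in r -> [/\ inM (yof s), \dim (V Ls (yof s)) = wdim Y,
  \dim (V Ls' (yof s)) = wdim Y, P Ls' (yof s) x & s = P Ls' (yof s)].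
Proof.
rewrite /r in_fset_set; last exact: above_finite.
move=> /set_mem [[cs ds] fs]; case: mY => _ _ cY _; move: cs; rewrite cY => -[y [yM dy sE]].
have [yoM yoE] : inM (yof s) /\ s = P Ls' (yof s).
  by apply: (@xgetPex _ 0 [set y | inM y /\ s = P Ls' y]); exists y.
have ey : P Ls' y = P Ls' (yof s) by rewrite -yoE -/Ls' -sE.
have Pyyo : P Ls' y (yof s) by rewrite ey; exact: P_refl.
have Pyoy : P Ls' (yof s) y by rewrite -ey; exact: P_refl.
have d' : \dim (V Ls' (yof s)) = wdim Y by rewrite -ds /pdim yoE (linP F) // -yoE.
split=> //.
- apply/eqP; rewrite eqn_leq -{2}d' dimvS ?V_rcons // andbT.
  by rewrite -(P_V_eq (P_rcons Pyyo) (P_rcons Pyoy)).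
- by apply/(faceP F) => //; rewrite -yoE.
Qed.

Lemma in_above y : inM y -> (\dim (V Ls y) <= wdim Y)%N -> \dim (V Ls' y) = wdim Y ->
  P Ls' y x -> [/\ P Ls' y \in r, P Ls' y (yof (P Ls' y)) & P Ls' (yof (P Ls' y)) y].
Proof.
move=> yM dy dy' Pyx.
have sr : P Ls' y \in r.
  rewrite /r in_fset_set; last exact: above_finite.
  apply: mem_set; split; last by apply/(faceP F).
  by case: mY => _ _ cY _; split; [rewrite cY; exists y|rewrite /pdim (linP F)].
have [yoM _ _ _ e] := aboveP sr.
by split=> //; [rewrite {1}e|rewrite -e]; exact: P_refl.
Qed.

Lemma nrmP s : s \in r -> is_primitive_normal Lam (P Ls' x) (P Ls' (yof s)) (nrm s).
Proof.
move=> sr; have [yM _ dy Pyx e] := aboveP sr; rewrite /nrm {2}e.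
by apply: (normal_ex F) => //; rewrite dy -dim_x.
Qed.

Lemma nrm_dir s : s \in r -> exists b vx,
  [/\ 0 < b, vx \in V Ls' x & nrm s = b *: (yof s - x) + vx].
Proof.
move=> sr; have [yM _ dy Pyx e] := aboveP sr.
by apply: (normal_dir F _ _ Pyx _ _ (nrmP sr)) => //; rewrite dy -dim_x.
Qed.

Section Star.
Variables (B : seq 'rV[R]_m) (g : seq 'cV[R]_m) (f : 'cV[R]_m).
Hypothesis zB : zbasis B (V Ls' x).
Hypothesis sg : (size g).+1 = wdim Y.
Hypothesis f0 : forall w, w \in V Ls' x -> pairing w f = 0.
Let fs := map fst Ls ++ f :: g.

Let sLs : (size Ls + (size g).+1)%N = N.
Proof. by case: mY => <- _ _ _; rewrite sg addnC. Qed.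

(** The target used in [star_sum] is the unit vector in the position of [f]. A vector over it is
    tangent to the old hyperplanes, has height 1 for [f], and is killed by [g]. *)
Let vec_fs w : vec fs w = \row_j (j == size Ls :> nat)%:R <->
  [/\ forall L0 c0, (L0, c0) \in Ls -> pairing w L0 = 0, pairing w f = 1 &
      forall h, h \in g -> pairing w h = 0].
Proof.
have fsE j : fs`_j = if (j < size Ls)%N then (nth (0, 0) Ls j).1 else (f :: g)`_(j - size Ls).
  rewrite /fs nth_cat size_map; case: ltnP => // jL; by rewrite (nth_map (0, 0)).
split=> [e|[wLs wf wg]].
  have wE j : (j < N)%N -> pairing w fs`_j = (j == size Ls)%:R.
    by move=> jN; have := congr1 (fun u : 'rV_N => u 0 (Ordinal jN)) e; rewrite !mxE.
  split.
  - move=> L0 c0 /(nthP (0, 0)) [i iL ei].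
    have := wE i; rewrite fsE iL ei /= (ltn_eqF iL) => -> //.
    by rewrite -sLs (leq_trans iL) // leq_addr.
  - have := wE (size Ls); rewrite fsE ltnn subnn eqxx /= => -> //.
    by rewrite -sLs -addSnnS leq_addr.
  - move=> h /(nthP 0) [i ig <-]; have := wE (size Ls + i.+1)%N.
    rewrite fsE [(_ < size Ls)%N]ltnNge leq_addr /= addKn /= => ->.
      by rewrite -[X in _ == X]addn0 eqn_add2l.
    by rewrite -sLs ltn_add2l.
apply/rowP => j; rewrite !mxE fsE; case: ltnP => jL.
  rewrite (ltn_eqF jL); case e : (nth _ _ _) (mem_nth (0, 0) jL) => [L0 c0] /wLs ->.
  by [].
rewrite eqn_leq jL andbT; case ej : (j - size Ls)%N => [|k] /=.
  by rewrite -subn_eq0 ej eqxx.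
rewrite -subn_eq0 ej /= wg // mem_nth // -ltnS -ej.
by rewrite ltn_subLR // sLs.
Qed.

Let wt_term s : s \in r -> 0 < pairing (nrm s) f ->
  wt Y s * pairing (nrm s) f * `|pdet B g| = (inH Ls (yof s))%:R * dg fs (supp (yof s)).
Proof.
move=> sr fp; have [yM dy dy' Pyx e] := aboveP sr.
have [_ _ _ wY] := mY.
rewrite -(wY (yof s) (nrm s :: B) (f :: g)) //; first last.
  by apply: (zbasis_normal F _ _ Pyx _ _ (nrmP sr)) => //; rewrite dy' -dim_x.
rewrite -e pdet_cons ?normrM ?(gtr0_norm fp) ?mulrA //.
  by move=> b bB; apply: f0; case: zB => bV _ _; exact: basis_mem bV bB.
by rewrite (zbasis_size zB); apply/eqP; rewrite -eqSS dim_x sg.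
Qed.

(** The vector over the target that belongs to the cell s: the normal scaled to height 1, corrected
    inside the face by a combination of [B] so that [g] kills it. The correction exists because
    [pdet B g] is nonzero. *)
Let solve s : s \in r -> 0 < pairing (nrm s) f -> inH Ls (yof s) ->
  dg fs (supp (yof s)) != 0 -> exists z b vx,
  [/\ vec fs z = \row_j (j == size Ls :> nat)%:R, 0 < b, vx \in V Ls' x & z = b *: (yof s - x) + vx].
Proof.
move=> sr fp Hy d0; have := wt_term sr fp; rewrite Hy mul1r => e.
have pB : pdet B g != 0.
  by apply: contra_neq d0 => pB; rewrite -e pB normr0 mulr0.
have [yM dy dy' Pyx _] := aboveP sr.
have [b [vx [b0 vxV nE]]] := nrm_dir sr.
have [a aE] := pdet_solve (fun j => - pairing (nrm s) g`_j / pairing (nrm s) f) pB.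
have [bV _ _] := zB; have sB : size B = size g.
  by rewrite (zbasis_size zB); apply/eqP; rewrite -eqSS dim_x sg.
have aV : \sum_i a i *: B`_i \in V Ls' x.
  apply: memv_suml => i _; apply: memvZ; apply: (basis_mem bV).
  by rewrite mem_nth // sB.
exists ((pairing (nrm s) f)^-1 *: nrm s + \sum_i a i *: B`_i), (b / pairing (nrm s) f),
  ((pairing (nrm s) f)^-1 *: vx + \sum_i a i *: B`_i); split.
- apply/vec_fs; split.
  + move=> L0 c0 Lin; have Lin' : (L0, c0) \in Ls' by rewrite mem_rcons inE Lin orbT.
    have /eqP /= yc := allP Hy _ Lin.
    have nV : nrm s \in V Ls' (yof s) by case: (nrmP sr) => _; rewrite (linP F).
    have aVy := subvP (V_sub Pyx) _ aV.
    move: nV aVy => /VP [_ /(_ _ _ Lin' yc) n0] /VP [_ /(_ _ _ Lin' yc) a0].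
    by rewrite pairingDl pairingZl n0 a0 mulr0 addr0.
  + by rewrite pairingDl pairingZl (f0 aV) addr0 mulVf // gt_eqF.
  + move=> h /(nthP 0) [j jg <-]; rewrite pairingDl pairingZl (aE (Ordinal jg)) /=.
    by rewrite mulrC mulNr addrN.
- by rewrite divr_gt0.
- by apply: memvD => //; exact: memvZ.
- by rewrite nE scalerDr scalerA mulrC addrA.
Qed.

(** [dg_hit] is applied to the cone of x with the target of [vec_fs]. The cones that are hit with
    nonzero count are those of the cells above the face on which [f] is positive and which lie on
    the old hyperplanes. *)
Lemma star_sum : \sum_(s <- r | 0 < pairing (nrm s) f) wt Y s * pairing (nrm s) f * `|pdet B g| =
  (inH Ls x)%:R * dg fs (supp x).
Proof.
rewrite big_seq_cond (eq_bigr (fun s => (inH Ls (yof s))%:R * dg fs (supp (yof s)))); last first.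
  by move=> s /andP [sr fp]; exact: wt_term.
rewrite -big_seq_cond; have [Hx|nHx] := boolP (inH Ls x); last first.
  rewrite mul0r big_seq_cond big1 // => s /andP [sr _]; have [_ _ _ Pyx _] := aboveP sr.
  by rewrite (negbTE (contra (inH_P (P_rcons Pyx)) nHx)) mul0r.
rewrite mul1r (dg_hit fs (\row_j (j == size Ls :> nat)%:R) (sup_good xM)).
pose cond s := [&& 0 < pairing (nrm s) f, inH Ls (yof s) & dg fs (supp (yof s)) != 0].
(* Two such cells with the same cone would have the same vector over the target, by [dg_inj]; by
   [rayP] both are the cell entered from x along this vector. *)
have uS : uniq [seq supp (yof s) | s <- [seq s <- r | cond s]].
  rewrite map_inj_in_uniq ?filter_uniq ?finmap.fset_uniq // => s s'.
  rewrite !mem_filter => /andP [/and3P [fp Hy d0] sr] /andP [/and3P [fp' Hy' d0'] sr'] eS.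
  have [z [b [vx [zE b0 vxV zD]]]] := solve sr fp Hy d0.
  have [z' [b' [vx' [zE' b0' vxV' zD']]]] := solve sr' fp' Hy' d0'.
  have [yM _ _ Pyx e] := aboveP sr; have [yM' _ _ Pyx' e'] := aboveP sr'.
  have spz t u : P Ls' t x -> inM t -> u \in V Ls' x -> forall k : R, k *: (t - x) + u \in sp (supp t).
    move=> Pt tM uV k; apply: memvD.
      by apply: memvZ; have /VP [] := diff_V F (P_refl Ls' tM) Pt.
    by have /VP [] := subvP (V_sub Pt) _ uV.
  have zz : z = z'.
    apply/eqP; rewrite -subr_eq0; apply/eqP; apply: (dg_inj d0 (sup_good yM)).
      by apply: memvB; [rewrite zD|rewrite zD' eS]; apply: spz.
    have vB : vec fs (z - z') = vec fs z - vec fs z'.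
      by apply/rowP => j; rewrite !mxE pairingBl.
    by rewrite vB zE zE' subrr.
  have [t0 t0p h] := rayP F xM yM Pyx vxV b0.
  have [t0' t0p' h'] := rayP F xM yM' Pyx' vxV' b0'.
  have [p1 p2 _] : let z := x + Num.min t0 t0' *: (b *: (yof s - x) + vx) in
     [/\ P Ls' (yof s) z, P Ls' z (yof s) & P Ls' z x].
    by apply: h; rewrite lt_min t0p t0p' ge_min lexx.
  have [p1' p2' _] : let z := x + Num.min t0 t0' *: (b' *: (yof s' - x) + vx') in
     [/\ P Ls' (yof s') z, P Ls' z (yof s') & P Ls' z x].
    by apply: h'; rewrite lt_min t0p t0p' ge_min lexx orbT.
  by rewrite e e' -(P_eq p1 p2) -(P_eq p1' p2') -zD -zD' zz.
transitivity (\sum_(s <- r | cond s) dg fs (supp (yof s))).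
  rewrite [RHS]big_mkcond [LHS]big_mkcond; apply: eq_bigr => s _; rewrite /cond.
  case: (0 < _) => //=; case: (inH _ _) => /=; last by rewrite mul0r.
  by rewrite mul1r; case: eqP => [->|].
rewrite -big_filter -[LHS](big_map (fun s => supp (yof s)) xpredT (dg fs)) (big_uniq _ uS) /=.
rewrite big_mkcond [RHS]big_mkcond; apply: eq_bigr => S1 _.
have [d0|d0] := eqVneq (dg fs S1) 0; first by rewrite d0 !if_same.
congr (if _ then _ else _); apply/mapP/asboolP => [[s]|].
  rewrite mem_filter => /andP [/and3P [fp Hy d0'] sr] SE.
  have [z [b [vx [zE b0 vxV zD]]]] := solve sr fp Hy d0'.
  have [yM _ _ Pyx e] := aboveP sr; have [_ xy _] := Pyx; have gy := sup_good yM.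
  have zS : z \in sp S1.
    rewrite SE zD; apply: memvD; last by have /VP [] := subvP (V_sub Pyx) _ vxV.
    by apply: memvZ; have /VP [] := diff_V F (P_refl Ls' yM) Pyx.
  rewrite SE in zS *; split=> //; exists (fun A => pairing z (dualf (supp (yof s)) A)); split.
    move=> A /[1!inE] /andP [Ax Ay]; rewrite zD pairingDl pairingZl pairingBl.
    rewrite (crd_sub F yM gy Ay (subxx _)) (crd_sub F xM gy Ay xy).
    have -> : crd x A = 0 by rewrite /crd (negbTE Ax).
    have /VP [/spP [a ->] _] := vxV; rewrite (pairing_comb F) // (negbTE Ax) addr0 subr0 mulr_gt0 //.
    have [p _] := crdP F yM; apply: p; rewrite inE Ay andbT.
    by apply: contra Ax; apply: (subsetP (sup_base F xM)).
  by rewrite -vec_comb /comb -(sp_dual F gy zS) zE.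
(* Conversely, a short step from x along the vector [z] over the target leads into a cell above the
   face. *)
move=> [gS1 xS1 [b [b0 qE]]]; pose z := comb q S1 b.
have zS : z \in sp S1 by apply/spP; exists b.
have zE : vec fs z = \row_j (j == size Ls :> nat)%:R by rewrite vec_comb -qE.
have [zLs zf zg] := (vec_fs z).1 zE.
have [|e e0 he] := @moveP _ _ _ _ _ _ _ _ F Ls' x S1 z xM gS1 xS1 zS.
  move=> A AS; rewrite (pairing_comb F) //; last by move: AS; rewrite inE => /andP [].
  by have := b0 A AS; move: AS; rewrite inE => /andP [_ ->].
have te : 0 < e <= e by rewrite e0 lexx.
have [yM yS yL] := he e te; set y := x + e *: z in yM yS yL.
have Pyx : P Ls' y x.
  split; rewrite ?yS // => L0 c0 Lin; have [h1 h2] := yL L0 c0 Lin.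
  by split=> h; rewrite leNgt; apply/negP => k; [move: (h2 k)|move: (h1 k)]; rewrite ltNge h.
have Hy : inH Ls y.
  apply/allP => -[L0 c0] Lin /=; have /eqP /= xc := allP Hx _ Lin.
  by rewrite /y pairingDl pairingZl (zLs _ _ Lin) mulr0 addr0 xc.
have dy : (\dim (V Ls y) <= wdim Y)%N.
  rewrite -sg; apply: (@dim_le_kernel _ _ _ (f :: g)) => w wV wfg.
  have /VP [wS wL] := wV; apply: (dg_inj d0 gS1); first by rewrite -yS.
  apply/rowP => j; rewrite !mxE; have jfs : (j < size fs)%N.
    by rewrite /fs size_cat size_map /= sLs.
  have := mem_nth 0 jfs; rewrite {2}/fs mem_cat => /orP [/mapP [[L0 c0] Lin ->]|/wfg //].
  by apply: (wL _ _ Lin); apply/eqP; exact: (allP Hy _ Lin).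
have zVy : z \in V Ls' y.
  apply/VP; rewrite yS; split=> // L0 c0 Lin yc.
  have [_ _ /(_ _ _ Lin) [h1 h2]] := Pyx.
  have xc : pairing x L0 = c0 by apply/le_anti; rewrite h1 ?h2 ?yc.
  move: yc; rewrite /y pairingDl pairingZl xc => /eqP; rewrite -subr_eq0 addrAC subrr add0r.
  by rewrite mulf_eq0 gt_eqF //= => /eqP.
have dy' : \dim (V Ls' y) = wdim Y.
  apply/eqP; rewrite eqn_leq (leq_trans (dimvS (V_rcons _ _ _)) dy) /= -dim_x.
  rewrite ltn_neqAle dimvS ?V_sub // andbT; apply/negP => /eqP h.
  have /eqP e1 : V Ls' x == V Ls' y by rewrite eqEdim V_sub //= h.
  by move: zf; rewrite f0 ?e1 // => /eqP; rewrite eq_sym oner_eq0.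
have [sr p1 p2] := in_above yM dy dy' Pyx; have eS := P_supp_eq p2 p1.
have Hyo : inH Ls (yof (P Ls' y)) := inH_P (P_rcons p1) Hy.
exists (P Ls' y); last by rewrite eS yS.
rewrite mem_filter sr andbT /cond Hyo eS yS d0 andbT /=.
have [yoM _ dyo Pyox _] := aboveP sr.
have pn : is_primitive_normal Lam (P Ls' x) (P Ls' y) (nrm (P Ls' y)).
  by apply: (normal_ex F) => //; rewrite dy' -dim_x.
have [|k [vx [k0 vxV ->]]] := normal_dir F xM yM Pyx _ iL' pn; first by rewrite dy' -dim_x.
by rewrite pairingDl (f0 vxV) addr0 pairingZl /y addrC addKr pairingZl zf mulr1 mulr_gt0.
Qed.

End Star.

(** Balancing of the intermediate complex. For [f] vanishing on the face, [star_sum] for [f] and for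
    [- f] gives the same count by [dg_sign], so the weighted heights on the two sides of [f] cancel.
    A vector killed by all such [f] is tangent to the face. *)
Lemma normal_sum : \sum_(s <- r) wt Y s *: nrm s \in V Ls' x.
Proof.
have [B zB] := zbasis_ex F xM iL'; have [bB _ _] := zB.
have [g [sgB pB]] := pdet_ex (basis_free bB).
have sg : (size g).+1 = wdim Y by rewrite sgB (zbasis_size zB).
have sLs : (size (map fst Ls) + size g).+1 = N.
  by case: mY => <- _ _ _; rewrite size_map addnC -sg addSn.
have key f : (forall w, w \in V Ls' x -> pairing w f = 0) ->
    pairing (\sum_(s <- r) wt Y s *: nrm s) f = 0.
  move=> f0; have h1 := star_sum zB sg f0.
  have f0' w : w \in V Ls' x -> pairing w (- f) = 0 by move=> /f0; rewrite pairingNr => ->; rewrite oppr0.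
  have h2 := star_sum zB sg f0'.
  rewrite (dg_sign f (sup_good xM) sLs) -h1 in h2.
  rewrite pairing_suml (eq_bigr (fun s => wt Y s * pairing (nrm s) f)); last by move=> s _; rewrite pairingZl.
  have pB' : `|pdet B g| != 0 by rewrite normr_eq0.
  apply: (mulIf pB'); rewrite mul0r mulr_suml.
  rewrite (bigID (fun s => 0 < pairing (nrm s) f)) /= -h2.
  rewrite [X in _ + X](bigID (fun s => 0 < pairing (nrm s) (- f))) /= [X in _ + (_ + X)]big1 ?addr0; last first.
    move=> s /andP [h h']; have -> : pairing (nrm s) f = 0; last by rewrite mulr0 mul0r.
    by apply/le_anti; move: h h'; rewrite pairingNr oppr_gt0 -!leNgt => -> ->.
  rewrite [X in _ + X](eq_bigl (fun s => 0 < pairing (nrm s) (- f))); last first.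
    by move=> s /=; rewrite pairingNr oppr_gt0 -leNgt andb_idl // => /ltW.
  rewrite -big_split /= big1 // => s _.
  by rewrite pairingNr mulrN mulNr addNr.
set w := \sum_(s <- r) _ in key *.
(* The coordinates of a vector minus its projection to [U] are functionals that vanish on [U];
   together they test membership in [U]. *)
pose U := V Ls' x; pose M : 'M[R]_m := lin1_mx (projv U).
have ME v : v *m M = projv U v by rewrite mul_rV_lin1.
suff e : w = projv U w by rewrite e memv_proj.
apply/eqP; rewrite -subr_eq0; apply/eqP/rowP => j; rewrite [RHS]mxE.
have := key (delta_mx j 0 - col j M).
have pE v : pairing v (delta_mx j 0 - col j M) = (v - projv U v) 0 j.
  have -> : (v - projv U v) 0 j = v 0 j - (v *m M) 0 j by rewrite ME !mxE.
  rewrite pairingDr pairingNr; congr (_ - _).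
    rewrite pairingE (bigD1 j) //= mxE !eqxx mulr1 big1 ?addr0 // => i /negbTE ij.
    by rewrite mxE ij mulr0.
  by rewrite pairingE mxE; apply: eq_bigr => i _; rewrite mxE.
rewrite pE; apply => v vU; rewrite pE projv_id // subrr mxE //.
Qed.

End Divisor.

(** [linear_part] is chosen only up to functionals that vanish on [lin s], hence the restriction on
    [w]. *)
Lemma linear_partP (s : set 'rV[R]_m) phi f (b : R) w : s !=set0 ->
  (forall y, s y -> phi y = pairing y f + b) -> w \in lin s ->
  (forall y z, s y -> s z -> y - z \in lin s) ->
  (forall W : {vspace 'rV[R]_m}, (forall y z, s y -> s z -> y - z \in W) -> (lin s <= W)%VS) ->
  pairing w (linear_part phi s) = pairing w f.
Proof.
move=> _ phiE wl _ lmin.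
have [b' lE] : exists b', forall y, s y -> phi y = pairing y (linear_part phi s) + b'.
  by apply: (@xgetPex _ 0 [set f | exists c : R, forall x, s x -> phi x = pairing x f + c]); exists f, b.
apply/eqP; rewrite -subr_eq0 -pairingNr -pairingDr -krP.
apply: (subvP (lmin (kr (linear_part phi s - f)) _)) => // y z sy sz.
rewrite krP pairingDr pairingNr !pairingBl.
have := lE y sy; have := lE z sz; rewrite (phiE y sy) (phiE z sz) => e1 e2.
apply/eqP; lra.
Qed.

Lemma linear_part_P Ls x phi f (b : R) w : inM x -> (forall y, P Ls x y -> phi y = pairing y f + b) ->
  w \in V Ls x -> pairing w (linear_part phi (P Ls x)) = pairing w f.
Proof.
move=> xM phiE wV.
have lE := linP F Ls xM.
apply: (@linear_partP _ _ _ b) => //; rewrite ?lE //.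
- by exists x; exact: P_refl.
- by move=> y z; exact: (diff_V F).
- move=> W hW; apply/subvP => u /(openP F xM) [e e0 /(_ e)]; rewrite e0 lexx => -[//|h _].
  have := hW _ _ h (P_refl Ls xM).
  by rewrite addrC addKr rpredZeq gt_eqF.
Qed.

(** If L is not c at x, [phi] is affine around the cell, so the two sums in the weight cancel. If L
    is c at x, [phi] is constantly c on the cell and on the cells where L is at most c; only the
    positive side of L contributes, and this is [star_sum] with L as functional. *)
Lemma divisor_inv Y Ls L c phi : mid Y Ls (L, c) -> (0 < wdim Y)%N ->
  (forall y, inM y -> phi y = Num.max (pairing y L) c) ->
  inv (divisor Lam phi Y) (rcons Ls (L, c)).
Proof.
move=> mY Y0 phiE; have [sY iL cY wY] := mY; set Ls' := rcons Ls (L, c) in iL cY wY *.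
split=> //.
- by rewrite /= size_rcons -sY addnS -addSn prednK.
- rewrite /= cY; apply/seteqP; split=> s /=.
    move=> [[x [xM dx ->]]]; rewrite /pdim (linP F) // => lt.
    by exists x; split=> //; rewrite -ltnS prednK.
  move=> [x [xM dx ->]]; rewrite /pdim (linP F) // -[X in (_ < X)%N](prednK Y0) ltnS; split=> //.
  exists x; split=> //; apply: leq_trans (_ : (\dim (V Ls' x)).+1 <= _)%N; last by rewrite -[X in (_ <= X)%N](prednK Y0).
  (* One more functional lowers the dimension by at most one, so every cell of the divisor was
     already a cell of [Y]. *)
  rewrite -(limg_ker_dim (linfun (mulmxr L : 'rV_m -> 'rV_1)) (V Ls x)) -[(\dim (V Ls' x)).+1]addn1.
  apply: leq_add; last by apply: leq_trans (dimvS (subvf _)) _; rewrite dimvf /dim /= mul1n.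
  apply: dimvS; apply/subvP => w; rewrite memv_cap => /andP [/VP [wS wL]]; rewrite -/(kr L) krP => /eqP w0.
  apply/VP; split=> // L0 c0; rewrite mem_rcons inE => /orP [/eqP [-> _] //|]; exact: wL.
move=> x B g xM dx zB sg; rewrite /= in dx sg.
have dx' : (\dim (V Ls' x)).+1 = wdim Y by rewrite dx prednK.
have sg' : (size g).+1 = wdim Y by rewrite sg prednK.
have HE : inH Ls' x = inH Ls x && (pairing x L == c) by rewrite /inH all_rcons andbC.
rewrite [wt (divisor _ _ _) _]/= (above_sum mY) (above_sumv mY).
set r := finmap.enum_fset _; set v := \sum_(s <- r) wt Y s *: _.
have vV : v \in V Ls' x := normal_sum mY xM dx'.
have [xc|xc] := eqVneq (pairing x L) c; last first.
  rewrite HE (negbTE xc) andbF mul0r; apply/eqP; rewrite mulf_eq0; apply/orP; left.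
  pose f : 'cV[R]_m := if c < pairing x L then L else 0.
  pose b : R := if c < pairing x L then 0 else c.
  have side y : P Ls' y x -> forall z, P Ls' y z -> phi z = pairing z f + b.
    move=> [_ _ Pyx] z [zM _ Pyz].
    have Lin : (L, c) \in Ls' by rewrite mem_rcons inE eqxx.
    have [h1 h2] := Pyx _ _ Lin; have [h3 h4] := Pyz _ _ Lin.
    rewrite phiE // /f /b; have [xL|cL|e] := ltrgtP (pairing x L) c; last by rewrite e eqxx in xc.
      rewrite pairing0r add0r max_r // h3 // leNgt; apply/negP => h.
      by have := h2 (ltW h); rewrite leNgt xL.
    rewrite addr0 max_l // h4 // leNgt; apply/negP => h.
    by have := h1 (ltW h); rewrite leNgt cL.
  rewrite (linear_part_P xM (side x (P_refl _ xM)) vV) subr_eq0 pairing_suml.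
  apply/eqP; rewrite big_seq [RHS]big_seq; apply: eq_bigr => s sr.
  have [yM _ _ Pyx e] := aboveP mY xM sr.
  rewrite !pairingZl [linear_part phi s](congr1 (linear_part phi) e) (linear_part_P yM (side _ Pyx)) //.
  by have [_] := nrmP mY xM dx' sr; rewrite (linP F).
have Lin : (L, c) \in Ls' by rewrite mem_rcons inE eqxx.
have -> : pairing v (linear_part phi (P Ls' x)) = 0.
  rewrite (linear_part_P (f := 0) (b := c) xM _ vV) ?pairing0r // => z [zM _ Pxz].
  have [h1 h2] := Pxz _ _ Lin.
  by rewrite phiE // pairing0r add0r max_r // h1 ?xc.
have f0 w : w \in V Ls' x -> pairing w L = 0.
  by move=> /VP [_ /(_ L c) h]; apply: h => //; rewrite mem_rcons inE eqxx.
have := star_sum mY xM dx' zB sg' f0; rewrite HE xc eqxx andbT map_rcons cat_rcons => <-.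
rewrite subr0 mulr_suml [RHS]big_mkcond big_seq [RHS]big_seq; apply: eq_bigr => s sr.
have [yM _ _ Pyx e] := aboveP mY xM sr.
have [Lv vV' _ [x' [t [Px' t0 Py']]]] := nrmP mY xM dx' sr.
rewrite (linP F) // in vV'; rewrite pairingZl.
have [x'M _ /(_ L c)] := Px'; rewrite mem_rcons inE eqxx => /(_ isT) [h1 h2].
have x'c : pairing x' L = c by apply/le_anti; rewrite h1 ?h2 ?xc.
have [y'M _ /(_ _ _ Lin) [h3 h4]] := Py'.
rewrite pairingDl pairingZl x'c in h3 h4.
have [yc|cy] := leP (pairing (xget 0 [set y | inM y /\ s = P Ls' y]) L) c.
  have n0 : pairing (primitive_normal Lam (P Ls' x) s) L <= 0.
    by have := h3 yc; rewrite gerDl pmulr_rle0.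
  rewrite ifN ?ltNge ?n0 // [linear_part phi s](congr1 (linear_part phi) e) (linear_part_P (f := 0) (b := c) yM) //.
    by rewrite pairing0r mulr0 mul0r.
  by move=> z [zM _ /(_ _ _ Lin) [k1 _]]; rewrite phiE // pairing0r add0r max_r // k1.
have n0 : 0 <= pairing (primitive_normal Lam (P Ls' x) s) L.
  by have := h4 (ltW cy); rewrite lerDl pmulr_rge0.
have -> : pairing (primitive_normal Lam (P Ls' x) s) (linear_part phi s) =
    pairing (primitive_normal Lam (P Ls' x) s) L.
  rewrite [linear_part phi s](congr1 (linear_part phi) e) (linear_part_P (f := L) (b := 0) yM) //.
  by move=> z [zM _ /(_ _ _ Lin) [_ k2]]; rewrite phiE // addr0 max_l // k2 // ltW.
case: ltP => // n0'; have -> : pairing (primitive_normal Lam (P Ls' x) s) L = 0.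
  by apply/le_anti; rewrite n0 n0'.
by rewrite mulr0 mul0r.
Qed.

End Slices.

Section Averages.
Variables (R : realType) (a b c : R).

Lemma avg_le : a <= c -> b <= c -> 2^-1 * (a + b) <= c. Proof. lra. Qed.
Lemma avg_ge : c <= a -> c <= b -> c <= 2^-1 * (a + b). Proof. lra. Qed.
Lemma avg_lt : a < c -> b <= c -> 2^-1 * (a + b) < c. Proof. lra. Qed.
Lemma avg_gt : c < a -> c <= b -> c < 2^-1 * (a + b). Proof. lra. Qed.
Lemma avg_id : 2^-1 * (c + c) = c. Proof. lra. Qed.
Lemma avg_eqr : 2^-1 * (c + b) = c -> b = c. Proof. lra. Qed.

End Averages.

Lemma int_matrix (R : realType) (m N : nat) (M1 M2 : 'M[R]_(N, m)) :
  (forall i, exists z : nat -> int, row i M1 = \sum_(k < N) row k M2 *~ z k) ->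
  exists Z : 'M[int]_N, M1 = map_mx intr Z *m M2.
Proof.
move=> /boolp.choice [zf zE]; exists (\matrix_(i, k) zf i k).
apply/row_matrixP => i; rewrite row_mul mulmx_sum_row zE; apply: eq_bigr => k _.
by rewrite !mxE scaler_int.
Qed.

Lemma pdetE (R : realType) (m n : nat) (B : seq 'rV[R]_m) (g : seq 'cV[R]_m) : size g = n ->
  pdet B g = \det (\matrix_(i < n, j < n) pairing B`_i g`_j).
Proof. by move=> <-. Qed.

Lemma free_row_free (R : realType) (m n : nat) (B : seq 'rV[R]_m) : size B = n ->
  free B -> row_free (\matrix_(i < n) B`_i).
Proof.
move=> <- fB; apply: inj_row_free => u; rewrite mulmx_sum_row => h; apply/rowP => i.
have h' : \sum_(i < size B) u 0 i *: (in_tuple B)`_i = 0.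
  by rewrite -[RHS]h; apply: eq_bigr => k _; rewrite rowK.
by rewrite (freeP (X := in_tuple B) fB _ h') mxE.
Qed.

(** * Subdivisions along hyperplanes and zero-dimensional cycles *)

Section Subdivision.
Variables (R : realType) (m N : nat) (Lam : set 'rV[R]_m).
Variables (J : finType) (q : J -> 'rV[R]_m) (J0 : {set J}) (good : {set J} -> bool).
Implicit Types (S T : {set J}) (A : J) (x y w z : 'rV[R]_m) (U : {vspace 'rV[R]_m}).
Implicit Types (f L : 'cV[R]_m) (fs g : seq 'cV[R]_m) (Ls : seq ('cV[R]_m * R)) (B : seq 'rV[R]_m).
Hypothesis F : fan N Lam q J0 good.
Notation integral := (integral Lam).
Notation supp := (supp q J0 good).
Notation inM := (inM q J0 good).
Notation crd := (crd Lam q J0 good).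
Notation dualf := (dualf Lam q).
Notation V := (V q J0 good).
Notation P := (P q J0 good).
Notation sp := (sp q).
Notation zbasis := (zbasis Lam).
Notation dg := (dg N q good).
Notation inv := (inv N Lam q J0 good).
Notation mid := (mid N Lam q J0 good).

Lemma count_strict (T : eqType) (p1 p2 : pred T) (s : seq T) (a : T) :
  (forall b, b \in s -> p1 b -> p2 b) -> a \in s -> ~~ p1 a -> p2 a ->
  (seq.count p1 s < seq.count p2 s)%N.
Proof.
elim: s => // b s ih h; rewrite inE => /orP [/eqP <-|as_] n1 y2.
  rewrite /= (negbTE n1) y2 add0n add1n ltnS.
  apply: leq_trans (_ : seq.count (predI p1 (mem s)) s <= _)%N.
    rewrite (eq_in_count (a2 := predI p1 (mem s))) // => z zs /=.
    by rewrite zs andbT.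
  by apply: sub_count => z /andP [/= z1 zs]; apply: h; rewrite // inE zs orbT.
rewrite /= -addnS leq_add //; last by apply: ih => // z zs; apply: h; rewrite inE zs orbT.
by case e : (p1 b) => //; rewrite (h b) ?inE ?eqxx.
Qed.

Lemma mid_supp x y S : good S -> inM x -> inM y -> supp x \subset S -> supp y \subset S ->
  inM (2^-1 *: (x + y)) /\ supp (2^-1 *: (x + y)) = supp x :|: supp y.
Proof.
move=> gS xM yM xS yS.
have xyS : supp x :|: supp y \subset S by rewrite subUset xS yS.
apply: (@sup_eq _ _ N Lam _ _ _ _ F _ _ (fun A => 2^-1 * (crd x A + crd y A))).
- apply: (fan_down F _ xyS gS); apply: subset_trans (sup_base F xM) _.
  exact: subsetUl.
- move=> A; rewrite !inE => /andP [A0 Axy]; rewrite mulr_gt0 ?invr_gt0 ?ltr0n //.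
  have [px _] := crdP F xM; have [py _] := crdP F yM.
  have [Ax|Ax] := boolP (A \in supp x).
    by apply: ltr_wpDr; [exact: (crd_ge0 F)|apply: px; rewrite inE A0].
  rewrite (negbTE Ax) /= in Axy.
  by apply: ltr_wpDl; [exact: (crd_ge0 F)|apply: py; rewrite inE A0].
have e t : inM t -> supp t \subset supp x :|: supp y -> t = \sum_(A in supp x :|: supp y) crd t A *: q A.
  move=> tM tS; have [_ {1}->] := crdP F tM; rewrite /comb.
  rewrite [RHS](bigID (mem (supp t))) /= [X in _ = _ + X]big1 ?addr0.
    by apply: eq_bigl => A; rewrite andb_idl // => /(subsetP tS).
  by move=> A /andP [_ At]; rewrite /crd (negbTE At) scale0r.
transitivity (2^-1 *: (\sum_(A in supp x :|: supp y) crd x A *: q A +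
    \sum_(A in supp x :|: supp y) crd y A *: q A)).
  by rewrite -(e x xM (subsetUl _ _)) -(e y yM (subsetUr _ _)).
by rewrite -big_split /= scaler_sumr; apply: eq_bigr => A _; rewrite -scalerDl scalerA.
Qed.

(** Choose x in t with as many rays and as many strict inequalities as possible. The midpoint of x
    and any z in t has those of both, so by maximality z has none that x lacks. *)
Lemma ex_top (K : seq ('cV[R]_m * R)) (t : set 'rV[R]_m) S : good S -> t !=set0 ->
  (forall z, t z -> inM z /\ supp z \subset S) ->
  (forall y z, t y -> t z -> t (2^-1 *: (y + z))) ->
  (forall L c, (L, c) \in K -> (forall z, t z -> pairing z L <= c) \/ (forall z, t z -> c <= pairing z L)) ->
  exists2 x, t x & t `<=` P K x.
Proof.
move=> gS [t0 tt0] tM tmid tside.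
pose act x := fun Lc : 'cV[R]_m * R => pairing x Lc.1 != Lc.2.
pose mu x := (#|supp x| + seq.count (act x) K)%N.
pose Q k : bool := `[< exists2 x, t x & mu x = k >].
have exQ : exists k, Q k by exists (mu t0); apply/asboolP; exists t0.
have bQ k : Q k -> (k <= #|J| + size K)%N.
  by move=> /asboolP [x _ <-]; rewrite leq_add ?max_card ?count_size.
have [k /asboolP [x tx mux] kmax] := ex_maxnP exQ bQ.
exists x => // z tz; have [xM xS] := tM x tx; have [zM zS] := tM z tz.
set w := 2^-1 *: (x + z); have tw : t w by exact: tmid.
have [wM wE] := mid_supp gS xM zM xS zS.
have wL L : pairing w L = 2^-1 * (pairing x L + pairing z L) by rewrite pairingZl pairingDl.
have muw : (mu w <= mu x)%N by rewrite mux; apply: kmax; apply/asboolP; exists w.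
have actw Lc : Lc \in K -> act x Lc -> act w Lc.
  case: Lc => L c Lin; rewrite /act /= wL; case: (tside L c Lin) => h xc.
    have h1 := h z tz; have h2 := h x tx.
    have {}h2 : pairing x L < c by rewrite lt_neqAle xc h2.
    by rewrite lt_eqF // avg_lt.
  have h1 := h z tz; have h2 := h x tx.
  have {}h2 : c < pairing x L by rewrite lt_neqAle eq_sym xc h2.
  by rewrite gt_eqF // avg_gt.
have cle : (seq.count (act x) K <= seq.count (act w) K)%N.
  rewrite (eq_in_count (a2 := predI (act x) (mem K))); last by move=> u uK /=; rewrite uK andbT.
  by apply: sub_count => u /andP [/= h1 h2]; exact: actw.
have sle : (#|supp x| <= #|supp w|)%N by rewrite subset_leq_card // wE subsetUl.
have [se ce] : #|supp x| = #|supp w| /\ seq.count (act x) K = seq.count (act w) K.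
  by move: muw; rewrite /mu; lia.
split=> //.
  have /eqP -> : supp x == supp w by rewrite eqEcard {1}wE subsetUl se leqnn.
  by rewrite wE subsetUr.
move=> L c Lin.
have xz : pairing x L = c -> pairing z L = c.
  move=> xc; apply: contrapT => /eqP zc.
  have : (seq.count (act x) K < seq.count (act w) K)%N; last by rewrite ce ltnn.
  apply: (count_strict actw Lin); rewrite /act /= ?xc ?negbK //.
  by rewrite wL xc; apply: contra zc => /eqP /avg_eqr ->.
case: (tside L c Lin) => h; split=> hx; try exact: h.
  by rewrite xz //; apply/le_anti; rewrite hx h.
by rewrite xz //; apply/le_anti; rewrite hx h.
Qed.

Lemma P_side Ls x y L c : P (rcons Ls (L, c)) x y <->
  P Ls x y /\ ((pairing x L <= c -> pairing y L <= c) /\ (c <= pairing x L -> c <= pairing y L)).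
Proof.
split=> [Pxy|[[yM yx h] hL]].
  by split; [exact: P_rcons Pxy|case: Pxy => _ _; apply; rewrite mem_rcons inE eqxx].
split=> // L0 c0; rewrite mem_rcons inE => /orP [/eqP [-> ->] //|]; exact: h.
Qed.

(** [gf] may differ from L as long as both compare with c in the same way. This covers the length of
    a cross-ratio, which is max(L, 0), at a positive level c. *)
Lemma refine_mid Y Ls L c (gf : 'rV[R]_m -> R) : inv Y Ls -> integral L ->
  (forall y, inM y -> ((gf y <= c) = (pairing y L <= c)) /\ ((c <= gf y) = (c <= pairing y L))) ->
  mid (refine gf c Y) Ls (L, c).
Proof.
move=> [sY iL cY wY] iL0 gfE.
have gE z : inM z -> (gf z = c) <-> (pairing z L = c).
  move=> /gfE [g1 g2]; split=> e; apply/le_anti; [rewrite -g1 -g2|rewrite g1 g2]; by rewrite e lexx.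
split=> //.
- by move=> L0 c0; rewrite mem_rcons inE => /orP [/eqP [-> _] //|]; exact: iL.
- rewrite /= cY; apply/seteqP; split=> t /=.
    move=> [t0 [s [[y [yM dy ->]] tE]]].
    have tP z : t z -> P Ls y z by case: tE => ->; case.
    have gl z : P Ls y z -> (gf z <= c) = (pairing z L <= c) by case=> /gfE [].
    have gg z : P Ls y z -> (c <= gf z) = (c <= pairing z L) by case=> /gfE [].
    have ge z : P Ls y z -> (gf z = c) <-> (pairing z L = c) by case=> /gE.
    have tLc : (forall z, t z -> pairing z L <= c) \/ (forall z, t z -> c <= pairing z L).
      case: tE => ->; [left|left|right] => z [Pz /=].
      - by rewrite gl.
      - by move/(ge _ Pz) ->.
      - by rewrite gg.
    have [|||x tx txP] := @ex_top (rcons Ls (L, c)) t (supp y) (sup_good yM) t0.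
    + by move=> z /tP [zM zy _].
    + move=> u v tu tv; have [Pu Pv] := (tP _ tu, tP _ tv).
      have [[uM uy hu] [vM vy hv]] := (Pu, Pv).
      have [wM wE] := mid_supp (sup_good yM) uM vM uy vy.
      have wL K : pairing (2^-1 *: (u + v)) K = 2^-1 * (pairing u K + pairing v K) by rewrite pairingZl pairingDl.
      have Pw : P Ls y (2^-1 *: (u + v)).
        split; rewrite ?wE ?subUset ?uy // => K k Kin; rewrite wL.
        have [h1 h2] := hu K k Kin; have [h3 h4] := hv K k Kin.
        by split=> h; [apply: avg_le; [exact: h1|exact: h3]|apply: avg_ge; [exact: h2|exact: h4]].
      case: tE tu tv => -> [_ /= gu] [_ /= gv]; split=> //=.
      * by move: gu gv; rewrite !gl // wL; exact: avg_le.
      * by apply/(ge _ Pw); move: gu gv => /(ge _ Pu) gu /(ge _ Pv) gv; rewrite wL gu gv avg_id.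
      * by move: gu gv; rewrite !gg // wL; exact: avg_ge.
    + move=> L0 c0; rewrite mem_rcons inE => /orP [/eqP [-> ->] //|Lin].
      have [yc|cy] := leP (pairing y L0) c0; [left|right] => z /tP [_ _ /(_ _ _ Lin) [h1 h2]].
        exact: h1.
      by apply: h2; exact: ltW.
    exists x; have Pyx := tP _ tx; have [xM _ _] := Pyx; split=> //.
      exact: leq_trans (dimvS (V_sub Pyx)) dy.
    apply/seteqP; split=> // z Pxz; have [/(P_trans Pyx) Pyz [h1 h2]] := (P_side _ _ _ _ _).1 Pxz.
    move: tx; case: tE => -> [_ /= xc]; split=> //=.
    + by rewrite gl // h1 // -gl.
    + move/(ge _ Pyx): xc => xc; apply/(ge _ Pyz).
      by apply/le_anti; rewrite h1 ?h2 ?xc.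
    + by rewrite gg // h2 // -gg.
  move=> [x [xM dx ->]]; split; first by exists x; exact: P_refl.
  exists (P Ls x); split; first by exists x.
  have gl z : P Ls x z -> (gf z <= c) = (pairing z L <= c) by case=> /gfE [].
  have gg z : P Ls x z -> (c <= gf z) = (c <= pairing z L) by case=> /gfE [].
  have ge z : P Ls x z -> (gf z = c) <-> (pairing z L = c) by case=> /gE.
  have [xc|cx|xc] := ltrgtP (pairing x L) c; [apply: Or31|apply: Or33|apply: Or32];
    apply/seteqP; split=> z.
  + by move=> /P_side [Pz [h _]]; split=> //=; rewrite gl // h // ltW.
  + move=> [Pz /=]; rewrite gl // => zc; apply/P_side; split=> //; split=> // h.
    by move: h; rewrite leNgt xc.
  + by move=> /P_side [Pz [_ h]]; split=> //=; rewrite gg // h // ltW.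
  + move=> [Pz /=]; rewrite gg // => zc; apply/P_side; split=> //; split=> // h.
    by move: h; rewrite leNgt cx.
  + by move=> /P_side [Pz [h1 h2]]; split=> //=; apply/(ge _ Pz)/le_anti; rewrite h1 ?h2 ?xc.
  + by move=> [Pz /= /(ge _ Pz) zc]; apply/P_side; split=> //; rewrite zc lexx.
move=> x B g xM dx dx' zB sg /=.
have VE : V (rcons Ls (L, c)) x = V Ls x.
  by apply/eqP; rewrite eqEdim V_rcons /= dx dx'.
rewrite -(wY x B g) // -?VE //; congr (wt Y _ * _).
(* The weight of a refined cell is inherited from a chosen facet of [Y] that contains it; for
   dimension reasons every such facet is [P Ls x]. *)
case: xgetP => [s _ [[]]|/(_ (P Ls x))]; last first.
  case; split; last exact: P_rcons.
  by split; [rewrite cY; exists x; rewrite dx leqnn|rewrite /pdim (linP F)].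
rewrite cY => -[y [yM dy ->]]; rewrite /pdim (linP F) // => dy' sub.
have Pyx : P Ls y x by apply: sub; exact: P_refl.
apply: P_eq => //; apply: contrapT => nP.
have [k [_ k0 kp _]] := kappaP F xM yM Pyx nP.
have /eqP e : V Ls x == V Ls y by rewrite eqEdim V_sub //= dx dy'.
by move: kp; rewrite k0 ?ltxx // e; exact: (diff_V F (P_refl Ls yM) Pyx).
Qed.

(** L has constant sign on every cone, so the hyperplane {L = 0} subdivides nothing and [divisor]
    applies without refinement. *)
Lemma self_mid Y Ls L : inv Y Ls -> integral L ->
  (forall x y, inM x -> inM y -> supp y \subset supp x ->
    (pairing x L <= 0 -> pairing y L <= 0) /\ (0 <= pairing x L -> 0 <= pairing y L)) ->
  mid Y Ls (L, 0).
Proof.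
move=> [sY iL cY wY] iL0 sgn.
have PE x : inM x -> P (rcons Ls (L, 0)) x = P Ls x.
  move=> xM; apply/seteqP; split=> y; first exact: P_rcons.
  by move=> Py; apply/P_side; split=> //; case: Py => yM yx _; exact: sgn.
split=> //.
- by move=> L0 c0; rewrite mem_rcons inE => /orP [/eqP [-> _] //|]; exact: iL.
- by rewrite cY; apply/seteqP; split=> s [x [xM dx ->]]; exists x; rewrite PE.
move=> x B g xM dx dx' zB sg; rewrite PE // wY //.
have -> // : V Ls x = V (rcons Ls (L, 0)) x.
by apply/esym/eqP; rewrite eqEdim V_rcons /= dx dx'.
Qed.

Lemma cut_inv Y Ls L c (gf : 'rV[R]_m -> R) : inv Y Ls -> integral L -> (0 < wdim Y)%N ->
  (forall y, inM y -> Num.max (gf y) c = Num.max (pairing y L) c) ->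
  (forall y, inM y -> ((gf y <= c) = (pairing y L <= c)) /\ ((c <= gf y) = (c <= pairing y L))) ->
  inv (cut Lam gf c Y) (rcons Ls (L, c)).
Proof.
move=> iY iL Y0 gmax gle; have mY := refine_mid iY iL gle.
exact: (divisor_inv F mY).
Qed.

Lemma div_inv Y Ls L (gf : 'rV[R]_m -> R) : inv Y Ls -> integral L -> (0 < wdim Y)%N ->
  (forall y, inM y -> gf y = Num.max (pairing y L) 0) ->
  (forall x y, inM x -> inM y -> supp y \subset supp x ->
    (pairing x L <= 0 -> pairing y L <= 0) /\ (0 <= pairing x L -> 0 <= pairing y L)) ->
  inv (divisor Lam gf Y) (rcons Ls (L, 0)).
Proof.
move=> iY iL Y0 gmax sgn; have mY := self_mid iY iL sgn.
exact: (divisor_inv F mY).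
Qed.

(** On a maximal cone the lattice basis and the rays express each other with integral coefficients,
    so their determinants agree up to sign and weight 1 matches the count. *)
Lemma fan_inv Y : wdim Y = N ->
  cells Y = [set s | exists2 x, inM x & s = P [::] x] -> (forall s, wt Y s = 1) -> inv Y [::].
Proof.
move=> dY cY wY.
have dV x : inM x -> (\dim (V [::] x) <= #|supp x|)%N.
  move=> xM; apply: leq_trans (_ : \dim <<[seq q A | A <- enum (supp x)]>>%VS <= _)%N.
    apply: dimvS; apply/subvP => w /VP [/spP [a ->] _].
    by apply: memv_suml => A AS; apply: memvZ; apply: memv_span; rewrite map_f // mem_enum.
  by apply: leq_trans (dim_span _) _; rewrite size_map -cardE.
split=> //.
- by rewrite dY addn0.
- rewrite cY; apply/seteqP; split=> s; last by case=> x [xM _ ->]; exists x.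
  move=> [x xM ->]; exists x; split=> //; rewrite dY.
  exact: leq_trans (dV x xM) (fan_dim F (sup_good xM)).
move=> x B g xM dx zB sg; rewrite wY /= mul1r mul1r; set S := supp x.
have gS : good S := sup_good xM.
have cS : #|S| = N.
  by apply/eqP; rewrite eqn_leq (fan_dim F gS) /= -dY -dx; exact: dV.
rewrite (dg_top F g gS cS).
have sB : size B = N by rewrite (zbasis_size zB) dx dY.
have sgN : size g = N by rewrite sg dY.
have [bB LB cB] := zB.
pose MB : 'M[R]_(N, m) := \matrix_(i < N) B`_i.
pose QS := [seq q A | A <- enum S]; have sQ : size QS = N by rewrite size_map -cardE.
pose MQ : 'M[R]_(N, m) := \matrix_(i < N) QS`_i.
pose G : 'M[R]_(m, N) := \matrix_(i < m, j < N) g`_j i 0.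
have pE (M : 'M[R]_(N, m)) i j : (M *m G) i j = pairing (row i M) g`_j.
  by rewrite mxE pairingE; apply: eq_bigr => k _; rewrite !mxE.
have -> : pdet B g = \det (MB *m G).
  by rewrite (pdetE _ sgN); congr (\det _); apply/matrixP => i j; rewrite pE rowK mxE.
have -> : vol (vq N q g) S = `|\det (MQ *m G)|.
  rewrite /vol /detr; congr (`|\det _|); apply/matrixP => i j; rewrite pE rowK mxE.
  have -> : rows (vq N q g) S = [seq vec N g w | w <- QS] by rewrite /QS -map_comp.
  by rewrite (nth_map 0) ?sQ // mxE.
have [ZB MBE] : exists Z : 'M[int]_N, MB = map_mx intr Z *m MQ.
  apply: int_matrix => i; have Bi : B`_i \in B by rewrite mem_nth // sB.
  pose d A := pairing B`_i (dualf S A).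
  exists (fun k => Num.floor [seq d A | A <- enum S]`_k).
  have /VP [BS _] := basis_mem bB Bi.
  rewrite rowK (sp_dual F gS BS) -big_enum /=.
  rewrite (eq_bigr (fun k : 'I_N => QS`_k *~ Num.floor [seq d A | A <- enum S]`_k)); last by move=> k _; rewrite rowK.
  have h := big_map_index q (fun w k => w *~ Num.floor [seq d A | A <- enum S]`_k) (enum_uniq S).
  rewrite -/QS sQ in h; rewrite h big_seq [RHS]big_seq; apply: eq_bigr => A AS.
  rewrite (nth_map A) ?index_mem // nth_index // -scaler_int floorK //.
  by rewrite mem_enum in AS; have [iA _] := dualP F gS AS; apply: iA; exact: LB.
have [ZQ MQE] : exists Z : 'M[int]_N, MQ = map_mx intr Z *m MB.
  apply: int_matrix => i; have : QS`_i \in QS by rewrite mem_nth // sQ.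
  move=> /mapP [A]; rewrite mem_enum => AS e.
  have [||z zE] := cB (q A).
  - exact: (fan_lat F gS AS).
  - by apply/VP; split=> //; apply: (subvP (sumv_sup _ AS (subvv _))); exact: memv_line.
  - exists z; rewrite rowK e zE sB; apply: eq_bigr => k _; by rewrite rowK.
have fB : row_free MB := free_row_free sB (basis_free bB).
have ZZ : map_mx intr ZB *m map_mx intr ZQ = 1%:M :> 'M[R]_N.
  by apply: (row_free_inj fB); rewrite mul1mx -mulmxA -MQE -MBE.
have dZ : `|\det (map_mx intr ZB : 'M[R]_N)| = 1.
  have := congr1 (fun M : 'M[R]_N => `|\det M|) ZZ.
  rewrite det_mulmx det1 normrM normr1 !det_map_mx -!intr_norm -intrM => /eqP.
  rewrite -[1]/(1%:~R) eqr_int => /eqP h.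
  have := congr1 absz h; rewrite abszM absz1 => /eqP; rewrite muln_eq1 => /andP [/eqP h1 _].
  by rewrite -[`|\det ZB|]gez0_abs ?normr_ge0 // h1.
by rewrite MBE -mulmxA det_mulmx normrM dZ mul1r.
Qed.

Section Points.
Variables (Y : wcomplex R m) (Ls : seq ('cV[R]_m * R)).
Hypothesis iY : inv Y Ls.
Hypothesis Y0 : wdim Y = 0%N.

Lemma point_cell x : inM x -> \dim (V Ls x) = 0%N -> P Ls x = [set x].
Proof.
move=> xM dx; apply/seteqP; split=> [y Py|y ->]; last exact: P_refl.
have := diff_V F Py (P_refl Ls xM).
have /eqP -> : V Ls x == 0%VS by rewrite -dimv_eq0 dx.
by rewrite memv0 subr_eq0 => /eqP.
Qed.

Lemma point_wt x : inM x -> \dim (V Ls x) = 0%N ->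
  wt Y [set x] = (inH Ls x)%:R * dg (map fst Ls) (supp x).
Proof.
move=> xM dx; have [_ iL _ wY] := iY.
have [B zB] := zbasis_ex F xM iL.
have := wY x B [::] xM; rewrite dx Y0 => /(_ erefl zB erefl).
by rewrite /pdet det_mx00 normr1 mulr1 cats0 point_cell.
Qed.

Lemma facetsP s : facets Y s <-> exists x, [/\ inM x, \dim (V Ls x) = 0%N & s = [set x]].
Proof.
have [_ _ cY _] := iY; split.
  move=> [+]; rewrite cY Y0 => -[x [xM dx ->]] _.
  have {}dx : \dim (V Ls x) = 0%N by apply/eqP; rewrite -leqn0.
  by exists x; rewrite point_cell.
move=> [x [xM dx ->]]; split; first by rewrite cY; exists x; rewrite dx point_cell.
by rewrite -(point_cell xM dx) /pdim (linP F) // dx Y0.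
Qed.

Let sLs : size Ls = N.
Proof. by case: iY => <- _ _ _; rewrite Y0. Qed.

Lemma vec_inH x : inH Ls x <-> vec N (map fst Ls) x = \row_j (map snd Ls)`_j.
Proof.
split=> [/allP h|h].
  apply/rowP => j; rewrite !mxE !(nth_map (0, 0)) ?sLs //.
  by apply/eqP; apply: h; rewrite mem_nth // sLs.
apply/allP => -[L c] /(nthP (0, 0)) [i iL e].
have iN : (i < N)%N by rewrite -sLs.
have := congr1 (fun u : 'rV_N => u 0 (Ordinal iN)) h; rewrite !mxE !(nth_map (0, 0)) // e /=.
by move=> ->.
Qed.

Lemma dim0 x : inM x -> inH Ls x -> dg (map fst Ls) (supp x) != 0 -> \dim (V Ls x) = 0%N.
Proof.
move=> xM /allP Hx d0; apply/eqP; rewrite dimv_eq0 -subv0; apply/subvP => w /VP [wS wL].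
rewrite memv0; apply/eqP; apply: (dg_inj F d0 (sup_good xM) wS); apply/rowP => j.
rewrite !mxE (nth_map (0, 0)) ?sLs //.
have jL : (j < size Ls)%N by rewrite sLs.
have := mem_nth (0, 0) jL; case: (nth _ _ _) => L c Lin /=.
by apply: (wL L c Lin); apply/eqP; exact: (Hx _ Lin).
Qed.

(** [dg_hit] for the lineality cone, with the constants of the conditions as target: the cones that
    are hit with nonzero count are those of the points of nonzero weight, one point for each. The
    result involves the functionals but not the constants. *)
Lemma deg_inv : deg Y = dg (map fst Ls) J0.
Proof.
have fin : finite_set (facets Y).
  apply: sub_finite_set (finite_cells q J0 good Ls) => s /facetsP [x [xM dx ->]].
  by exists x => //; rewrite point_cell.
rewrite /deg fsbig_finite //; set r := finmap.enum_fset _.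
have rP s : s \in r <-> facets Y s.
  by rewrite /r in_fset_set //; split=> [/set_mem|/mem_set].
pose xof (s : set 'rV[R]_m) := xget 0 s.
have xofE x : xof [set x] = x.
  by rewrite /xof; case: xgetP => [y _ Py //|/(_ x) []].
have wE s : s \in r -> wt Y s = (inH Ls (xof s))%:R * dg (map fst Ls) (supp (xof s)).
  by move=> /rP /facetsP [x [xM dx ->]]; rewrite xofE point_wt.
rewrite big_seq (eq_bigr _ wE) -big_seq.
pose cond s := inH Ls (xof s) && (dg (map fst Ls) (supp (xof s)) != 0).
transitivity (\sum_(s <- r | cond s) dg (map fst Ls) (supp (xof s))).
  rewrite [RHS]big_mkcond; apply: eq_bigr => s _; rewrite /cond.
  by case: (inH _ _); rewrite ?mul0r // mul1r; case: eqP => [->|].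
rewrite (dg_hit F _ (\row_j (map snd Ls)`_j) (fan_zero F)).
have uS : uniq [seq supp (xof s) | s <- [seq s <- r | cond s]].
  rewrite map_inj_in_uniq ?filter_uniq ?finmap.fset_uniq // => s s'.
  rewrite !mem_filter => /andP [/andP [Hx d0] /rP /facetsP [x [xM dx sE]]].
  move=> /andP [/andP [Hx' d0'] /rP /facetsP [x' [xM' dx' sE']]].
  move: Hx d0 Hx' d0'; rewrite sE sE' !xofE => Hx d0 Hx' d0' eS; congr [set _].
  apply/eqP; rewrite -subr_eq0; apply/eqP; apply: (dg_inj F d0 (sup_good xM)).
    by apply: memvB; [exact: (inM_sp F)|rewrite eS; exact: (inM_sp F)].
  have vB : vec N (map fst Ls) (x - x') = vec N (map fst Ls) x - vec N (map fst Ls) x'.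
    by apply/rowP => j; rewrite !mxE pairingBl.
  by rewrite vB (vec_inH x).1 // (vec_inH x').1 // subrr.
rewrite -big_filter -[LHS](big_map (fun s => supp (xof s)) xpredT (dg (map fst Ls))) (big_uniq _ uS) /=.
rewrite big_mkcond [RHS]big_mkcond; apply: eq_bigr => S1 _.
have [d0|d0] := eqVneq (dg (map fst Ls) S1) 0; first by rewrite d0 !if_same.
congr (if _ then _ else _); apply/mapP/asboolP => [[s]|].
  rewrite mem_filter => /andP [/andP [Hx _] /rP /facetsP [x [xM dx sE]]] ->.
  move: Hx; rewrite sE xofE => Hx; have [p xE] := crdP F xM.
  split; [exact: sup_good|exact: (sup_base F)|exists (crd x); split=> //].
  by rewrite -((vec_inH x).1 Hx) -vec_comb -xE.
move=> [gS1 JS1 [b [b0 qE]]]; pose x := comb q S1 b.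
have [xM xS] : inM x /\ supp x = S1 by exact: (sup_eq F gS1 b0).
have Hx : inH Ls x by apply/vec_inH; rewrite vec_comb -qE.
have dx : \dim (V Ls x) = 0%N by apply: dim0 => //; rewrite xS.
exists [set x]; last by rewrite xofE.
by rewrite mem_filter /cond xofE Hx xS d0; apply/rP/facetsP; exists x.
Qed.

End Points.

End Subdivision.

(* A tree on the nodes X, rooted at root: par is the next node on the way to
   the root and rk the distance to it. *)
Record rooted (X : finType) (e : rel X) (root : X) (par : X -> X) (rk : X -> nat) : Prop := Rooted {
  r_sym : forall x y, e x y = e y x;
  r_rk0 : rk root = 0%N;
  r_par : forall x, x != root -> e x (par x) /\ rk x = (rk (par x)).+1;
  r_adj : forall x y, e x y -> (x != root /\ y = par x) \/ (y != root /\ x = par y)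
}.

(** * Rooted trees *)

Section RootedTree.
Variables (X : finType) (e : rel X) (root : X) (par : X -> X) (rk : X -> nat).
Hypothesis T : rooted e root par rk.
Implicit Types (x y z v c : X).

Definition anc x y := (rk x <= rk y)%N && (iter (rk y - rk x) par y == x).

(** The second node of the path from x to another node y: down towards y if y lies below x,
    otherwise up. *)
Definition nx x y := if anc x y then iter (rk y - rk x).-1 par y else par x.

Definition spath x p y := [/\ path e x p, last x p = y & uniq (x :: p)].

Lemma tree_ind (Q : X -> Prop) : Q root -> (forall y, y != root -> Q (par y) -> Q y) -> forall y, Q y.
Proof.
move=> Q0 QS y; have [n] := ubnP (rk y); elim: n y => // n ih y ltn.
have [->//|y0] := eqVneq y root; apply: QS => //; apply: ih.
by move: ltn; rewrite (r_par T y0).2.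
Qed.

Lemma anc_refl x : anc x x.
Proof. by rewrite /anc leqnn subnn /= eqxx. Qed.

Lemma anc_root x : anc x root = (x == root).
Proof.
rewrite /anc (r_rk0 T); have [->|x0] := eqVneq x root; first by rewrite (r_rk0 T) /= ?eqxx.
by rewrite (r_par T x0).2.
Qed.

Lemma anc_par x y : y != root -> anc x y = (x == y) || anc x (par y).
Proof.
move=> y0; rewrite /anc (r_par T y0).2; have [xy|xy] := leqP (rk x) (rk (par y)).
  rewrite (leqW xy) subSn //= -iterS iterSr.
  by have [e0|//] := eqVneq x y; move: xy; rewrite e0 (r_par T y0).2 ltnn.
rewrite andFb orbF; have [xy'|xy'] := leqP (rk x) (rk (par y)).+1.
  have -> : ((rk (par y)).+1 - rk x)%N = 0%N by apply/eqP; rewrite subn_eq0.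
  by rewrite /= eq_sym.
by rewrite andFb; apply/esym/eqP => e0; move: xy'; rewrite e0 (r_par T y0).2 ltnn.
Qed.

Lemma root_anc y : anc root y.
Proof.
elim/tree_ind: y => [|y y0 ih]; first exact: anc_refl.
by rewrite anc_par // ih orbT.
Qed.

Lemma anc_trans y x z : anc x y -> anc y z -> anc x z.
Proof.
move=> xy; elim/tree_ind: z => [|z z0 ih]; first by rewrite anc_root => /eqP <-.
move=> yz; move: (yz); rewrite (anc_par y z0) => /orP [/eqP <- //|/ih h].
by rewrite (anc_par x z0) h orbT.
Qed.

Lemma anc_rk x y : anc x y -> (rk x <= rk y)%N.
Proof. by case/andP. Qed.

Lemma anc_anti x y : anc x y -> anc y x -> x = y.
Proof.
move=> /andP [h1 /eqP h2] /anc_rk h3; move: h2.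
by have -> : (rk y - rk x = 0)%N by apply/eqP; rewrite subn_eq0.
Qed.

Lemma anc_total x y z : anc x z -> anc y z -> anc x y || anc y x.
Proof.
elim/tree_ind: z => [|z z0 ih].
  by rewrite !anc_root => /eqP -> /eqP ->; rewrite anc_refl.
rewrite !(anc_par _ z0) => /orP [/eqP -> yz|xz /orP [/eqP ->|]]; last exact: ih.
  by rewrite (anc_par _ z0) yz orbT.
by rewrite (anc_par x z0) xz !orbT.
Qed.

Lemma anc_par_self x : x != root -> anc x (par x) = false.
Proof. by move=> x0; apply/negP => /anc_rk; rewrite (r_par T x0).2 ltnn. Qed.

Lemma par_anc x : x != root -> anc (par x) x.
Proof. by move=> x0; rewrite anc_par // anc_refl orbT. Qed.

Lemma nx_down x y : anc x y -> x != y -> [/\ nx x y != root, par (nx x y) = x & anc (nx x y) y].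
Proof.
move=> axy; rewrite /nx axy; have /andP [lexy /eqP xE] := axy => xy.
have lt : (rk x < rk y)%N.
  rewrite ltn_neqAle lexy andbT; apply: contra xy => /eqP exy.
  by move: xE; rewrite exy subnn /= => ->.
have [k kE] : exists k, (rk y - rk x = k.+1)%N by exists (rk y - rk x).-1; rewrite prednK ?subn_gt0.
rewrite kE /=; move: xE; rewrite kE /= => xE.
have h j : (j <= rk y)%N -> rk (iter j par y) = (rk y - j)%N /\ anc (iter j par y) y.
  elim: j => [|j ih] jy; first by rewrite subn0 anc_refl.
  have [h1 h2] := ih (ltnW jy); have n0 : iter j par y != root.
    by apply/negP => /eqP e0; move: h1; rewrite e0 (r_rk0 T); lia.
  rewrite iterS; split; first by have := (r_par T n0).2; rewrite h1; lia.
  exact: anc_trans (par_anc n0) h2.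
have [h1 h2] := h k ltac:(lia); split=> //.
by apply/negP => /eqP e0; move: h1; rewrite e0 (r_rk0 T); lia.
Qed.

Lemma nx_up x y : anc x y = false -> nx x y = par x /\ x != root.
Proof.
by rewrite /nx => h; rewrite h; split=> //; apply: contraFneq h => ->; exact: root_anc.
Qed.

Lemma anc_cut v a b : e a b -> anc v a -> ~~ anc v b -> a = v /\ b = par v.
Proof.
move=> eab va nvb; have [[a0 bE]|[b0 aE]] := r_adj T eab.
  by move: va; rewrite (anc_par _ a0) -bE (negbTE nvb) orbF => /eqP ->.
by rewrite (anc_par _ b0) -aE va orbT in nvb.
Qed.

Lemma path_exit v a p : path e a p -> anc v a -> ~~ anc v (last a p) -> v \in a :: p.
Proof.
elim: p a => [|b p ih] a /=; first by move=> _ ->.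
move=> /andP [eab pb] va nl; have [vb|nvb] := boolP (anc v b).
  by rewrite inE (ih b) ?orbT.
by have [-> _] := anc_cut eab va nvb; rewrite inE eqxx.
Qed.

Lemma path_enter v a p : path e a p -> ~~ anc v a -> anc v (last a p) -> par v \in a :: p.
Proof.
elim: p a => [|b p ih] a /=; first by move=> _ /negP h /h.
move=> /andP [eab pb] nva vl; have [vb|nvb] := boolP (anc v b); last by rewrite inE (ih b) ?orbT.
have [_ ->] := anc_cut (etrans (r_sym T b a) eab) vb nva.
by rewrite inE eqxx.
Qed.

Lemma spath_head x z p y : spath x (z :: p) y -> z = nx x y.
Proof.
move=> [/= /andP [exz pz] ly /andP [xzp _]].
have xy : x != y by apply: contraNneq xzp => ->; rewrite -ly mem_last.
have [axy|naxy] := boolP (anc x y).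
  have [c0 cx cy] := nx_down axy xy; set c := nx x y in c0 cx cy *.
  have ncx : ~~ anc c x by rewrite -cx anc_par_self.
  have [cz|ncz] := boolP (anc c z).
    by have [-> _] := anc_cut (etrans (r_sym T z x) exz) cz ncx.
  by have := path_enter pz ncz; rewrite ly cx => /(_ cy); rewrite (negbTE xzp).
have [-> _] := nx_up (negbTE naxy).
have [xz|nxz] := boolP (anc x z).
  by have := path_exit pz xz; rewrite ly => /(_ naxy); rewrite (negbTE xzp).
by have [_ ->] := anc_cut exz (anc_refl x) nxz.
Qed.

Lemma spath_nil x p : spath x p x -> p = [::].
Proof.
case: p => // z p [_ lx /andP [xp _]].
move: xp lx => /negP xp /= lx; case: xp; rewrite -{1}lx; exact: mem_last.
Qed.

Lemma spath_cons x z p y : spath x (z :: p) y -> spath z p y.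
Proof. by move=> [/= /andP [_ h1] h2 /andP [_ h3]]. Qed.

Lemma spath_uniq x y p p' : spath x p y -> spath x p' y -> p = p'.
Proof.
elim: p p' x => [|z p ih] p' x h h'.
  by case: (h) => _ /= xy _; rewrite -xy in h'; rewrite (spath_nil h').
case: p' h' => [|z' p'] h'.
  by case: (h') => _ /= xy _; rewrite -xy in h; have := spath_nil h.
have zz : z = z' by rewrite (spath_head h) (spath_head h').
by congr (_ :: _) => //; apply: (ih p' z); [exact: spath_cons h|rewrite zz; exact: spath_cons h'].
Qed.

(** An edge is named by its lower end; this is the name of the first edge on the path from x to
    y. *)
Definition tog x y := if anc x y then nx x y else x.

Lemma nx_toggle x y : x != y -> [/\ tog x y != root, anc (tog x y) x != anc (tog x y) y,
  e x (nx x y), (nx x y = tog x y /\ x = par (tog x y)) \/ (x = tog x y /\ nx x y = par (tog x y))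
  & forall v, (anc v (nx x y) != anc v y) = (v != tog x y) && (anc v x != anc v y)].
Proof.
move=> xy; rewrite /tog; have [axy|naxy] := boolP (anc x y).
  have [c0 cx cy] := nx_down axy xy; set c := nx x y in c0 cx cy *.
  have cx' : anc c x = false by rewrite -cx anc_par_self.
  split=> //.
  - by rewrite cx' cy.
  - by rewrite (r_sym T); case: (r_par T c0); rewrite cx.
  - by left.
  move=> v; rewrite (anc_par v c0) cx; have [->|] //= := eqVneq v c.
  by rewrite cy.
have [-> x0] := nx_up (negbTE naxy).
split=> //.
- by rewrite anc_refl (negbTE naxy).
- by case: (r_par T x0).
- by right.
move=> v; rewrite (anc_par v x0); have [->|] //= := eqVneq v x.
by rewrite anc_par_self // (negbTE naxy).
Qed.

(** The names of the edges that separate x from y, which are the edges of the path between them. *)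
Definition sep x y := [set v | anc v x != anc v y]%SET.

Lemma sep_nx x y : x != y -> sep (nx x y) y = sep x y :\ tog x y.
Proof.
by move=> xy; have [_ _ _ _ h] := nx_toggle xy; apply/setP => v; rewrite !inE h.
Qed.

Lemma tog_sep x y : x != y -> tog x y \in sep x y.
Proof. by move=> xy; have [_ h _ _ _] := nx_toggle xy; rewrite inE. Qed.

(** Each step by [nx] removes exactly one edge from [sep]; this gives termination and shows that no
    node is repeated. *)
Lemma spath_ex x y : exists p, spath x p y /\ forall z, z \in p -> (#|sep z y| < #|sep x y|)%N.
Proof.
have [n] := ubnP #|sep x y|; elim: n x => // n ih x lt.
have [->|xy] := eqVneq x y; first by exists [::].
have ltn : (#|sep (nx x y) y| < #|sep x y|)%N.
  by rewrite sep_nx // [#|sep x y|](cardsD1 (tog x y)) tog_sep.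
have [|p [[h1 h2 h3] h4]] := ih (nx x y); first by rewrite (leq_trans ltn).
have pz z : z \in nx x y :: p -> (#|sep z y| < #|sep x y|)%N.
  by rewrite inE => /orP [/eqP ->//|/h4 h]; exact: ltn_trans h ltn.
exists (nx x y :: p); split=> //; split=> //=.
  by rewrite h1 andbT; have [_ _ ->] := nx_toggle xy.
by move: h3 => /= ->; rewrite andbT; apply/negP => /pz; rewrite ltnn.
Qed.

Lemma spath_nx x y p : x != y -> spath x p y -> exists2 q, p = nx x y :: q & spath (nx x y) q y.
Proof.
move=> xy; case: p => [[_ /= e0 _]|z p h]; first by rewrite e0 eqxx in xy.
by exists p; [rewrite (spath_head h)|rewrite -(spath_head h); exact: spath_cons h].
Qed.

Lemma spath_dist (V : zmodType) (el : X -> X -> V) x y p :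
  (forall v, v != root -> el (par v) v = el v (par v)) -> spath x p y ->
  \sum_(r <- pairmap el x p) r = \sum_(v in sep x y) el v (par v).
Proof.
move=> es; elim: p x => [|z p ih] x h.
  by case: h => _ /= -> _; rewrite big_nil big_pred0 // => v; rewrite inE eqxx.
have xy : x != y.
  by case: h => _ /= <- /andP [xp _]; apply: contraNneq xp => ->; rewrite mem_last.
have zE := spath_head h; rewrite /= big_cons (ih z (spath_cons h)) zE sep_nx //.
rewrite [RHS](big_setD1 _ (tog_sep xy)) /=; congr (_ + _).
have [t0 _ _ [[-> e2]|[e1 ->]] _] := nx_toggle xy; last by rewrite {1}e1.
by rewrite {1}e2 es.
Qed.

(** z is the lowest common ancestor of a and b: as long as the path has not reached it, the next
    step goes up. *)
Lemma spath_meet a b p z : spath a p b -> anc z a -> anc z b ->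
  (forall v, anc v a -> anc v b -> anc v z) -> z \in a :: p.
Proof.
elim: p a => [|c p ih] a h za zb hz.
  by case: h => _ /= ab _; rewrite inE (anc_anti za (hz a (anc_refl a) _)) // ab anc_refl.
have [->|az] := eqVneq z a; first by rewrite inE eqxx.
have ab : a != b.
  by case: h => _ /= <- /andP [xp _]; apply: contraNneq xp => ->; rewrite mem_last.
have nab : anc a b = false.
  by apply: contra_neqF az => ab'; apply: anc_anti => //; apply: hz => //; exact: anc_refl.
have [nE a0] := nx_up nab; have cE := spath_head h; rewrite nE in cE.
rewrite inE; apply/orP; right; apply: ih => //; first exact: spath_cons h.
  by move: za; rewrite (anc_par _ a0) cE (negbTE az).
by move=> v va vb; apply: hz => //; rewrite (anc_par _ a0) -cE va orbT.
Qed.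

Lemma spath_up a b p z : anc a b -> spath b p a -> (z \in b :: p) = anc a z && anc z b.
Proof.
elim: p b => [|c p ih] b ab h.
  case: h => _ /= ba _; rewrite inE ba.
  by apply/eqP/andP => [->|[h1 h2]]; [rewrite anc_refl|exact: anc_anti].
have nab : b != a.
  by case: h => _ /= <- /andP [xp _]; apply: contraNneq xp => ->; rewrite mem_last.
have nba : anc b a = false by apply: contra_neqF nab => ba; exact: anc_anti.
have [nE b0] := nx_up nba; have cE := spath_head h; rewrite nE in cE.
have ac : anc a c by move: ab; rewrite (anc_par _ b0) cE eq_sym (negbTE nab).
rewrite inE (ih _ ac (spath_cons h)) (anc_par z b0) cE.
by have [->|] := eqVneq z b; [rewrite ab|].
Qed.

Lemma spath_down a b p z : anc a b -> spath a p b -> (z \in a :: p) = anc a z && anc z b.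
Proof.
elim: p a => [|c p ih] a ab h.
  case: h => _ /= ba _; rewrite inE ba.
  by apply/eqP/andP => [->|[h1 h2]]; [rewrite anc_refl|exact: anc_anti].
have nab : a != b.
  by case: h => _ /= <- /andP [xp _]; apply: contraNneq xp => ->; rewrite mem_last.
have [c0 ca cb] := nx_down ab nab; have cE := spath_head h; rewrite -cE in c0 ca cb.
rewrite inE (ih _ cb (spath_cons h)).
have [->|za] := eqVneq z a; first by rewrite anc_refl ab.
rewrite /=; case zb : (anc z b); rewrite ?andbF // !andbT.
apply/idP/idP => [cz|az]; first by apply: anc_trans cz; rewrite -{1}ca; exact: par_anc.
have /orP [//|zc] := anc_total cb zb.
move: zc; rewrite (anc_par _ c0) ca => /orP [/eqP ->|za']; first exact: anc_refl.
by rewrite (anc_anti za' az) eqxx in za.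
Qed.

End RootedTree.

Section RootedPretree.
Variables (R : realType) (L : finType) (G : pretree R L).
Variables (root : node G) (par : node G -> node G) (rk : node G -> nat).
Hypothesis T : rooted (@adj R L G) root par rk.
Implicit Types x y : node G.

Lemma rooted_unique x y : exists! p, is_simple_path x y p.
Proof.
have [p [h _]] := spath_ex T x y; exists p; split; first exact: h.
by move=> p' h'; exact: (spath_uniq T h h').
Qed.

Lemma geodP x y : spath (@adj R L G) x (geod x y) y.
Proof.
have [p [h _]] := spath_ex T x y.
by apply: (@xgetPex _ [::] [set p | is_simple_path x y p]); exists p.
Qed.

Lemma branch_nx x y : x != y -> branch x y = nx par rk x y.
Proof. by move=> xy; rewrite /branch; have [q -> _] := spath_nx T xy (geodP x y). Qed.

Lemma branch_id x : branch x x = x.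
Proof. by rewrite /branch (spath_nil (geodP x x)). Qed.

Lemma dist_rooted x y : (forall v, v != root -> edge_len (par v) v = edge_len v (par v)) ->
  dist x y = \sum_(v in sep par rk x y) edge_len v (par v).
Proof. by move=> es; exact: (spath_dist T es (geodP x y)). Qed.

End RootedPretree.

(** * Marked trees rooted at an arbitrary node *)

Section TreeRooted.
Variables (R : realType) (L : finType) (G : marked_tree R L) (root : node G).
Implicit Types x y : node G.
Let e := @adj R L G.

Definition gpar x := if x == root then root else branch x root.
Definition grk x := size (geod x root).

Lemma tree_geodP x y : is_simple_path x y (geod x y).
Proof.
have [_ h _ _ _] := tree_valid G; have [p [hp _]] := h x y.
by apply: (@xgetPex _ [::] [set p | is_simple_path x y p]); exists p.
Qed.

Lemma tree_geod_eq x y p : is_simple_path x y p -> p = geod x y.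
Proof.
have [_ h _ _ _] := tree_valid G; have [p' [_ hp]] := h x y => hp'.
by rewrite -(hp _ hp') -(hp _ (tree_geodP x y)).
Qed.

Lemma tree_adj_sym x y : adj x y = adj y x.
Proof. by have [[h _] _ _ _ _] := tree_valid G. Qed.

(** Uniqueness of paths decides which of two neighbours x, y is the parent: if x lies on the path
    from y to the root, it is the next node there; otherwise y is the next node on the path from
    x. *)
Lemma tree_rooted : rooted e root gpar grk.
Proof.
have parE x : x != root -> exists q, geod x root = gpar x :: q /\ is_simple_path (gpar x) root q.
  move=> x0; have h := tree_geodP x root; rewrite /gpar (negbTE x0) /branch.
  case: (geod x root) h => [[_ /= xr _]|z q h]; first by rewrite xr eqxx in x0.
  by exists q; split=> //; exact: spath_cons h.
split.
- exact: tree_adj_sym.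
- by rewrite /grk -(@tree_geod_eq root root [::]).
- move=> x x0; have [q [qE qP]] := parE x x0; split.
    by have [h _ _] := tree_geodP x root; move: h; rewrite qE /= => /andP [].
  by rewrite /grk qE /= (tree_geod_eq qP).
move=> x y exy; have [[_ irr] _ _ _ _] := tree_valid G.
have xy : x != y by apply: contraTneq exy => ->; exact: irr.
have [p1 p2 p3] := tree_geodP y root.
have [xin|xnin] := boolP (x \in y :: geod y root); last first.
  have x0 : x != root by apply: contraNneq xnin => ->; rewrite -{1}p2; exact: mem_last.
  left; split=> //; have h : is_simple_path x root (y :: geod y root).
    by split=> //; [apply/andP; split|rewrite cons_uniq xnin].
  by have [q [qE _]] := parE x x0; move: (tree_geod_eq h); rewrite qE => -[].
move: xin; rewrite inE (negbTE xy) /= => xin.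
have y0 : y != root.
  apply: contraTneq xin => yr; rewrite yr -(@tree_geod_eq root root [::]) //.
right; split=> //; have [q [qE _]] := parE y y0.
have [s1 [s2 sE]] : exists s1 s2, geod y root = s1 ++ x :: s2.
  by case/splitPr: xin => s1 s2; exists s1, s2.
move: p1 p2 p3; rewrite sE => p1 p2 p3.
have h : is_simple_path y root (x :: s2).
  split=> /=.
  - move: p1; rewrite cat_path => /andP [_ /= /andP [_ ->]]; rewrite andbT.
    by rewrite tree_adj_sym.
  - by move: p2; rewrite last_cat.
  - move: p3; rewrite /= cat_uniq mem_cat negb_or => /andP [/andP [_ n1] /and3P [_ _ n2]].
    by rewrite n1.
by have := tree_geod_eq h; rewrite qE => -[].
Qed.

End TreeRooted.

(** * The vectors of splits of the labels *)

Section SplitVectors.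
Variables (R : realType) (L : finType).
Implicit Types (A B : {set L}) (i j : L).

Definition qt (d : L -> L -> R) : 'rV[R]_(qdim R L) :=
  (\row_k d (fst_end k) (snd_end k)) *m quot_mx R L.

Definition cutd A i j : R := ((i \in A) != (j \in A))%:R.

Definition vsplit A := qt (cutd A).

Lemma qt_ext (d d' : L -> L -> R) : (forall i j, i != j -> d i j = d' i j) -> qt d = qt d'.
Proof.
move=> h; rewrite /qt; congr (_ *m _); apply/rowP => k; rewrite !mxE; apply: h.
apply/eqP => e; move: (valP (enum_val k)); rewrite /fst_end /snd_end in e.
by rewrite e ltnn.
Qed.

Lemma qt_sum (I : Type) (s : seq I) (Q : pred I) (c : I -> R) (d : I -> L -> L -> R) :
  qt (fun i j => \sum_(t <- s | Q t) c t * d t i j) = \sum_(t <- s | Q t) c t *: qt (d t).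
Proof.
rewrite /qt; transitivity ((\sum_(t <- s | Q t) c t *: \row_k d t (fst_end k) (snd_end k)) *m quot_mx R L).
  by congr (_ *m _); apply/rowP => k; rewrite summxE mxE; apply: eq_bigr => t _; rewrite !mxE.
by rewrite mulmx_suml; apply: eq_bigr => t _; rewrite scalemxAl.
Qed.

Lemma split_pt A : pt0 (split_tree A : pretree R L) = vsplit A.
Proof.
apply: (@qt_ext (fun i j => dist (inr i : node (split_tree A : pretree R L)) (inr j)) (cutd A)) => i j _.
pose X := node (split_tree A : pretree R L).
pose par (x : X) : X := match x with inl _ => inl true | inr i => inl (i \in A) end.
pose rk (x : X) : nat := match x with inl b => ~~ b | inr i => (i \notin A).+1 end.
have T : rooted (@adj R L (split_tree A)) (inl true : X) par rk.
  split=> //.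
  - by move=> [b|k] [b'|k'] //=; rewrite eq_sym.
  - by move=> [[]|k] //= _; rewrite eqxx.
  - move=> [b|k] [b'|k'] //=.
    + by case: b; case: b' => //= _; [right|left].
    + by move=> /eqP ->; right.
    + by move=> /eqP ->; left.
rewrite (dist_rooted T); last by move=> [[]|k].
have ancE k : anc par rk (inl false : X) (inr k) = (k \notin A).
  by rewrite (anc_par T) //= /par; case: (k \in A); rewrite /anc /= ?eqxx.
rewrite big_mkcond (bigD1 (inl false : X)) //= big1 ?addr0; last first.
  move=> [[]|k] // _; last by rewrite if_same.
  by rewrite inE !(root_anc T) eqxx.
by rewrite inE !ancE /cutd; case: (i \in A); case: (j \in A).
Qed.

End SplitVectors.

(** * Vertices of a marked tree as clusters of labels *)

Section Clusters.
Variables (R : realType) (L : finType) (G : marked_tree R L) (r : L).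
Let root : node G := inr r.
Let par := gpar root.
Let rk := grk root.
Let T : rooted (@adj R L G) root par rk := tree_rooted root.
Notation anc := (anc par rk).
Implicit Types (u v : vert G) (x y c : node G) (i j : L).

(** The ends below v. They record the edge above v, as the side of its split that avoids [r]. *)
Definition cl v : {set L} := [set i | anc (inl v) (inr i)]%SET.
(** The vertex that carries the end [r]; the edge above it is this end and has no length. *)
Definition itop v := par (inl v) == root.
Definition kids v := [set c | (c != root) && (par c == inl v)]%SET.

Lemma end_nbr i : exists v, forall y, adj (inr i : node G) y = (y == inl v).
Proof. by have [_ _ h _ _] := tree_valid G; exact: h. Qed.

Lemma leaf_anc i y : i != r -> anc (inr i) y -> y = inr i.
Proof.
move=> ir iy; apply: contrapT => /eqP yi.
have [c0 cp cy] := nx_down T iy (contra_neq (@esym _ _ _) yi).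
have [v hv] := end_nbr i.
have i0 : (inr i : node G) != root by apply: contra ir => /eqP [->].
have [h1 r1] := r_par T i0; have [h2 r2] := r_par T c0.
move: h1 h2; rewrite cp [adj (nx _ _ _ _) _]tree_adj_sym !hv => /eqP e1 /eqP e2.
by move: r2; rewrite cp r1 e2 e1 => /eqP; rewrite -[X in X == _]addn0 -addn2 eqn_add2l.
Qed.

Lemma par_end i : i != r -> exists v, par (inr i) = inl v.
Proof.
move=> ir; have i0 : (inr i : node G) != root by apply: contra ir => /eqP [->].
have [v hv] := end_nbr i; have [h _] := r_par T i0; exists v.
by move: h; rewrite hv => /eqP.
Qed.

Lemma vert_root v : (inl v : node G) != root. Proof. by []. Qed.

Lemma adj_kids v y : adj (inl v) y = (y == par (inl v)) || (y \in kids v).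
Proof.
apply/idP/orP => [/(r_adj T) [[_ ->]|[y0 ve]]|[/eqP ->|]].
- by left.
- by right; rewrite inE y0 ve eqxx.
- by have [] := r_par T (vert_root v).
- by rewrite inE => /andP [y0 /eqP yv]; rewrite tree_adj_sym -yv; have [] := r_par T y0.
Qed.

Lemma valence_kids v : valence v = #|kids v|.+1.
Proof.
rewrite /valence; have -> : #|[set y | adj (inl v) y]| = #|par (inl v) |: kids v|.
  by apply: eq_card => y; rewrite in_setU1 -adj_kids; apply/idP/idP => [/set_mem|/mem_set].
rewrite cardsU1; have -> // : par (inl v) \notin kids v.
rewrite inE negb_and; apply/orP; have [->|p0] := eqVneq (par (inl v)) root; [by left|right].
apply/eqP => e; have [_ r1] := r_par T p0; have [_ r2] := r_par T (vert_root v).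
by move: r2; rewrite r1 e => /eqP; rewrite -[X in X == _]addn0 -addn2 eqn_add2l.
Qed.

Lemma kids_gt1 v : (1 < #|kids v|)%N.
Proof. by have [_ _ _ h _] := tree_valid G; have := h v; rewrite valence_kids. Qed.

Lemma kids_disj v c c' y : c \in kids v -> c' \in kids v -> anc c y -> anc c' y -> c = c'.
Proof.
rewrite !inE => /andP [c0 /eqP pc] /andP [c0' /eqP pc'] cy cy'.
have h a b : a != root -> par a = inl v -> b != root -> par b = inl v -> anc a b -> a = b.
  move=> a0 pa b0 pb; rewrite (anc_par T _ b0) pb -pa (anc_par_self T a0) orbF.
  by move/eqP.
by have /orP [/h->|/h->] := anc_total T cy cy'.
Qed.

Lemma kid_toward v y : anc (inl v) y -> y != inl v -> exists2 c, c \in kids v & anc c y.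
Proof.
move=> vy yv; have [c0 pc cy] := nx_down T vy (contra_neq (@esym _ _ _) yv).
by exists (nx par rk (inl v) y) => //; rewrite inE c0 pc eqxx.
Qed.

Lemma kid_anc v c : c \in kids v -> anc (inl v) c.
Proof. by rewrite inE => /andP [c0 /eqP <-]; exact: (par_anc T). Qed.

Lemma leaf_below x : exists i, anc x (inr i).
Proof.
pose y := [arg max_(y > x | anc x y) rk y].
have [xy ymax] : anc x y /\ forall z, anc x z -> (rk z <= rk y)%N.
  by rewrite /y; case: arg_maxnP => [|z h1 h2]; [exact: anc_refl|split].
case: y xy ymax => [v|i] xy ymax; last by exists i.
have /card_gt0P [c ck] : (0 < #|kids v|)%N by rewrite ltnW ?kids_gt1.
have := ymax c (anc_trans T xy (kid_anc ck)).
by move: ck; rewrite inE => /andP [c0 /eqP pc]; rewrite (r_par T c0).2 pc ltnn.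
Qed.

Lemma cl_root v : r \notin cl v.
Proof. by rewrite inE (anc_root T). Qed.

Lemma card_cl v : (1 < #|cl v|)%N.
Proof.
have /card_gt1P [c [c' [ck ck' cc]]] := kids_gt1 v.
have [[i ci] [j cj]] := (leaf_below c, leaf_below c').
apply/card_gt1P; exists i, j; split.
- by rewrite inE (anc_trans T (kid_anc ck)).
- by rewrite inE (anc_trans T (kid_anc ck')).
- by apply: contra_neq cc => ij; apply: (kids_disj ck ck' ci); rewrite ij.
Qed.

Lemma other_kid v c : exists2 c', c' \in kids v & c' != c.
Proof.
have /card_gt1P [a [b [ak bk ab]]] := kids_gt1 v.
have [ac|] := eqVneq a c; last by exists a.
by exists b => //; rewrite -ac eq_sym.
Qed.

Lemma card_clC v : ~~ itop v -> (1 < #|~: cl v|)%N.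
Proof.
rewrite /itop => nt; have vk : exists u, par (inl v) = inl u.
  case e : (par (inl v)) nt => [u|i] nt; first by exists u.
  have ir : i != r by apply: contra nt => /eqP ->.
  have := par_anc T (vert_root v); rewrite e => /(leaf_anc ir).
  by [].
have [u uE] := vk; have vu : inl v \in kids u by rewrite inE uE eqxx.
have [c ck cv] := other_kid u (inl v); have [i ci] := leaf_below c.
apply/card_gt1P; exists i, r; rewrite !inE; split.
- by apply: contra cv => vi; rewrite (kids_disj ck vu ci vi).
- by rewrite (anc_root T).
- apply: contraTneq ci => ->; rewrite (anc_root T).
  by move: ck; rewrite inE => /andP [].
Qed.

Lemma anc_cl u v : anc (inl u) (inl v) -> cl v \subset cl u.
Proof. by move=> uv; apply/subsetP => i; rewrite !inE; exact: (anc_trans T). Qed.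

(** Every vertex has at least two kids, so a proper descendant misses the ends below another kid;
    inclusion of clusters therefore reflects descent. *)
Lemma cl_anc u v : cl v \subset cl u -> anc (inl u) (inl v).
Proof.
move=> vu; have /card_gt0P [i iv] : (0 < #|cl v|)%N by rewrite ltnW ?card_cl.
have iu := subsetP vu _ iv; rewrite !inE in iv iu.
have /orP [//|vu'] := anc_total T iu iv.
have [->|uv] := eqVneq u v; first exact: anc_refl.
have [c ck cu] := kid_toward vu' (uv : inl u != inl v).
have [c' ck' cc] := other_kid v c; have [j cj] := leaf_below c'.
have : j \in cl u by apply: (subsetP vu); rewrite inE (anc_trans T (kid_anc ck')).
rewrite inE => uj; have := kids_disj ck ck' (anc_trans T cu uj) cj => e.
by rewrite e eqxx in cc.
Qed.

Lemma cl_inj : injective cl.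
Proof.
move=> u v uv; have [h1 h2] : anc (inl u) (inl v) /\ anc (inl v) (inl u).
  by split; apply: cl_anc; rewrite uv.
by have [] := anc_anti h1 h2.
Qed.

Definition compat (A B : {set L}) := [|| A \subset B, B \subset A | A :&: B == set0].

Lemma cl_compat u v : compat (cl u) (cl v).
Proof.
rewrite /compat; case: (set_0Vmem (cl u :&: cl v)) => [->|[i]]; first by rewrite eqxx !orbT.
rewrite !inE => /andP [ui vi].
by have /orP [/anc_cl ->|/anc_cl ->] := anc_total T ui vi; rewrite ?orbT.
Qed.

Lemma cl_top v : itop v -> cl v = ~: [set r].
Proof.
move=> /eqP vt; apply/setP => i; rewrite !inE; have [->|ir] := eqVneq i r.
  by rewrite (anc_root T).
have i0 : root != inr i by apply: contra_neq ir => -[].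
have [c0 cp ci] := nx_down T (root_anc T (inr i)) i0.
have [w hw] := end_nbr r.
have [h1 _] := r_par T c0; rewrite cp tree_adj_sym hw in h1.
have [h2 _] := r_par T (vert_root v); rewrite vt tree_adj_sym hw in h2.
by move: ci; rewrite (eqP h1) (eqP h2) => ->.
Qed.

Definition pv v : vert G := if par (inl v) is inl u then u else v.

Lemma pvP v : ~~ itop v -> par (inl v) = inl (pv v).
Proof.
rewrite /itop /pv; case e : (par (inl v)) => [u|i] // nt.
have ir : i != r by apply: contra nt => /eqP ->.
by have := par_anc T (vert_root v); rewrite e => /(leaf_anc ir).
Qed.

Lemma top_ex : exists v, itop v.
Proof.
have [w hw] := end_nbr r; exists w; rewrite /itop.
have : adj (inl w : node G) root by rewrite tree_adj_sym hw.
case/(r_adj T) => [[_ <-]|[h _]]; first exact: eqxx.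
by rewrite eqxx in h.
Qed.

Lemma edge_sum (V : zmodType) (F : node G -> V) :
  (forall i, F (inr i) = 0) -> (forall v, itop v -> F (inl v) = 0) ->
  \sum_x F x = \sum_(v | ~~ itop v) F (inl v).
Proof.
move=> F0 Ft; rewrite big_sumType /= [X in _ + X]big1 ?addr0 // (bigID itop) /=.
by rewrite big1 ?add0r.
Qed.

Lemma dist_cl (l : vert G -> vert G -> R) i j :
  (forall u v, adj (inl u : node G) (inl v) -> l u v = l v u) ->
  dist (inr i : node (with_len (G := G) l)) (inr j) =
  \sum_(v | ~~ itop v) l v (pv v) * cutd R (cl v) i j.
Proof.
move=> ls.
rewrite (@dist_rooted R L (with_len l) root par rk T); last first.
  move=> v v0; have [h _] := r_par T v0; rewrite -/par; move: h.
  by case: v v0 => [v|k] _; case: (par _) => [u|k'] //= /ls ->.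
rewrite big_mkcond edge_sum.
- apply: eq_bigr => v nt; rewrite inE /cutd !inE /= pvP //=.
  by case: eqP => _; rewrite ?mulr0 ?mulr1.
- by move=> k; rewrite if_same.
- by move=> v /eqP vt; rewrite -/par vt if_same.
Qed.

Lemma pt0_cl (l : vert G -> vert G -> R) :
  (forall u v, adj (inl u : node G) (inl v) -> l u v = l v u) ->
  pt0 (with_len (G := G) l) = \sum_(v | ~~ itop v) l v (pv v) *: vsplit R (cl v).
Proof.
move=> ls; rewrite -qt_sum; apply: (@qt_ext R L (fun i j => dist (inr i : node (with_len (G := G) l)) (inr j))) => i j _; exact: dist_cl.
Qed.

End Clusters.

(** * Laminar families and the fan of rational curves *)

Section PairFunctionals.
Variables (R : realType) (L : finType).
Implicit Types (i j a b : L) (d : L -> L -> R).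

Definition pcol a b : 'cV[R]_#|lpair L| :=
  \col_k ((fst_end k == a) && (snd_end k == b) || (fst_end k == b) && (snd_end k == a))%:R.

Lemma row_pcol d a b : a != b -> (forall i j, d i j = d j i) ->
  ((\row_k d (fst_end k) (snd_end k)) *m pcol a b) 0 0 = d a b.
Proof.
move=> ab ds; wlog lt : a b ab / (enum_rank a < enum_rank b)%N.
  move=> h; case: (ltngtP (enum_rank a) (enum_rank b)) => [lt|lt|/val_inj /enum_rank_inj e].
  - exact: h.
  - rewrite ds -(h b a) 1?eq_sym //; congr ((_ *m _) 0 0).
    by apply/colP => k; rewrite !mxE orbC.
  - by rewrite e eqxx in ab.
pose e : lpair L := exist (fun e : L * L => (enum_rank e.1 < enum_rank e.2)%N) (a, b) lt.
have k0E : val (enum_val (enum_rank e)) = (a, b) by rewrite enum_rankK.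
rewrite mxE (bigD1 (enum_rank e)) //= big1 ?addr0; last first.
  move=> k kk; rewrite !mxE.
  have [|_] := boolP ((fst_end k == a) && (snd_end k == b) || (fst_end k == b) && (snd_end k == a)); last by rewrite mulr0.
  case/orP => /andP [/eqP h1 /eqP h2].
    case/eqP: kk; apply/enum_val_inj/val_inj; rewrite k0E.
    by rewrite [LHS]surjective_pairing -[in LHS]/(fst_end k) h1 -[(val (enum_val k)).2]/(snd_end k) h2.
  have := valP (enum_val k); rewrite -[(val (enum_val k)).1]/(fst_end k) -[(val (enum_val k)).2]/(snd_end k).
  by rewrite h1 h2 ltnNge ltnW.
by rewrite !mxE /fst_end /snd_end k0E /= !eqxx mulr1.
Qed.

(** How functionals on the pairs descend to the quotient: the factorization of [cokermx] through
    [quot_mx] loses nothing of a functional that kills the rows of [Phi]. *)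
Lemma col_factor (phi : 'cV[R]_#|lpair L|) : Phi R L *m phi = 0 ->
  exists f, phi = quot_mx R L *m f.
Proof.
move=> h; pose C := cokermx (Phi R L).
suff e : phi = C *m (row_ebase (Phi R L) *m phi).
  exists (row_base C *m (row_ebase (Phi R L) *m phi)).
  have qC : quot_mx R L *m row_base C = C by exact: mulmx_base.
  by apply: (etrans e); rewrite -[in LHS]qC; exact: esym (mulmxA _ _ _).
have h1 : pid_mx (\rank (Phi R L)) *m (row_ebase (Phi R L) *m phi) = 0 :> 'cV_#|L|.
  move: h; rewrite -{1}[Phi R L]mulmx_ebase -2!mulmxA => h.
  have := congr1 (mulmx (invmx (col_ebase (Phi R L)))) h.
  by rewrite mulKmx ?col_ebase_unit // mulmx0 -mulmxA.
have h2 : pid_mx (\rank (Phi R L)) *m (row_ebase (Phi R L) *m phi) = 0 :> 'cV_#|lpair L|.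
  have -> : pid_mx (\rank (Phi R L)) = (pid_mx (\rank (Phi R L)) : 'M_(#|lpair L|, #|L|)) *m
      (pid_mx (\rank (Phi R L)) : 'M[R]_(#|L|, #|lpair L|)).
    by rewrite mul_pid_mx minnn; congr pid_mx; apply/esym/minn_idPr; exact: rank_leq_row.
  by rewrite -mulmxA h1 mulmx0.
rewrite /C /cokermx -mulmxA mulmxBl mul1mx h2 subr0 mulKmx //.
exact: row_ebase_unit.
Qed.

Lemma qt_functional (I : finType) (c : I -> R) (a b : I -> L) :
  (forall t, a t != b t) ->
  (forall i, \sum_t c t * ((i == a t)%:R + (i == b t)%:R) = 0) ->
  exists f, forall d, (forall i j, d i j = d j i) ->
    pairing (qt d) f = \sum_t c t * d (a t) (b t).
Proof.
move=> ab bal; pose phi := \sum_t c t *: pcol (a t) (b t).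
have phiE d : (forall i j, d i j = d j i) ->
    ((\row_k d (fst_end k) (snd_end k)) *m phi) 0 0 = \sum_t c t * d (a t) (b t).
  move=> ds; rewrite mulmx_sumr summxE; apply: eq_bigr => t _.
  by rewrite -scalemxAr mxE row_pcol.
have [|f fE] := @col_factor phi.
  apply/colP => i; rewrite [RHS]mxE -(bal (enum_val i)).
  rewrite -(phiE (fun x y => (enum_val i == x)%:R + (enum_val i == y)%:R)); last by move=> *; rewrite addrC.
  by rewrite !mxE; apply: eq_bigr => k _; rewrite !mxE.
by exists f => d ds; rewrite -phiE // /pairing /qt -mulmxA -fE.
Qed.

Lemma vsplitC (A : {set L}) : vsplit R (~: A) = vsplit R A.
Proof. by apply: qt_ext => i j _; rewrite /cutd !inE; case: (i \in A); case: (j \in A). Qed.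

(** The cut function of a single end is a row of [Phi]; the lengths of ends are thus invisible in
    the quotient. *)
Lemma vsplit1 i : vsplit R [set i] = 0 :> 'rV_(qdim R L).
Proof.
have Pq : Phi R L *m quot_mx R L = 0.
  apply: (row_free_inj (row_base_free (cokermx (Phi R L)))).
  by rewrite mul0mx -mulmxA mulmx_base mulmx_coker.
rewrite /vsplit /qt; set w := \row_k _.
have -> : w = row (enum_rank i) (Phi R L).
  apply/rowP => k; rewrite !mxE enum_rankK /cutd !inE ![_ == i]eq_sym.
  have := valP (enum_val k); rewrite -[(val (enum_val k)).1]/(fst_end k) -[(val (enum_val k)).2]/(snd_end k).
  by have [<-|ne] := eqVneq i (fst_end k); case: (eqVneq i (snd_end k)) => [<-|_];
    rewrite ?ltnn ?addr0 ?add0r.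
by rewrite -row_mul Pq row0.
Qed.

(** The four-point functional: it is 1 on splits ab|ce, -1 on splits ac|be and 0 on all other
    splits. On a tree its positive part is the length of the cross-ratio (ab|ce). *)
Definition quad a b c e (dd : L -> L -> R) : R := 2^-1 * (dd a c + dd b e - dd a b - dd c e).

Lemma quad_functional a b c e : a != c -> b != e -> a != b -> c != e ->
  exists f, forall dd, (forall i j, dd i j = dd j i) -> pairing (qt dd) f = quad a b c e dd.
Proof.
move=> ac bd ab cd.
pose aa (t : 'I_4) := tnth [tuple a; b; a; c] t.
pose bb (t : 'I_4) := tnth [tuple c; e; b; e] t.
pose cc (t : 'I_4) : R := tnth [tuple 2^-1; 2^-1; - 2^-1; - 2^-1] t.
have [||f fE] := @qt_functional 'I_4 cc aa bb.
- by case=> [[|[|[|[|//]]]]] lt; rewrite /aa /bb !(tnth_nth a).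
- by move=> i; rewrite !big_ord_recl big_ord0 /cc /aa /bb !(tnth_nth a) !(tnth_nth 0) /=; ring.
exists f => dd ds; rewrite fE // !big_ord_recl big_ord0 /cc /aa /bb !(tnth_nth a) !(tnth_nth 0) /= /quad.
ring.
Qed.

Lemma cutd_sym (A : {set L}) i j : cutd R A i j = cutd R A j i.
Proof. by rewrite /cutd eq_sym. Qed.

Lemma quad_cut a b c e (A : {set L}) : quad a b c e (cutd R A) =
  [&& (a \in A) == (b \in A), (c \in A) == (e \in A) & (a \in A) != (c \in A)]%:R -
  [&& (a \in A) == (c \in A), (b \in A) == (e \in A) & (a \in A) != (b \in A)]%:R.
Proof.
rewrite /quad /cutd; case: (a \in A); case: (b \in A); case: (c \in A); case: (e \in A) => /=; lra.
Qed.

Lemma lattice0_int f : (forall A : {set L}, pairing (vsplit R A) f \is a Num.int) ->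
  forall w, lattice0 w -> pairing w f \is a Num.int.
Proof.
move=> h w [z ->]; rewrite pairing_suml rpred_sum // => A _.
by rewrite -scaler_int pairingZl split_pt rpredM ?intr_int.
Qed.

Lemma quad_int a b c e (A : {set L}) : quad a b c e (cutd R A) \is a Num.int.
Proof. by rewrite quad_cut rpredB // intr_nat. Qed.

End PairFunctionals.

Section Laminar.
Local Open Scope set_scope.
Variables (L : finType) (r : L).
Implicit Types (A B C X : {set L}) (S T : {set {set L}}) (i j k : L).

(* A split of the labels is represented by its side that does not contain r. *)
Definition clus A := [&& r \notin A, (1 < #|A|)%N & (1 < #|~: A|)%N].

Definition laminar S := [forall A in S, clus A] && [forall A in S, forall B in S, compat A B].

Lemma lamP S : reflect ((forall A, A \in S -> clus A) /\
  (forall A B, A \in S -> B \in S -> compat A B)) (laminar S).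
Proof.
apply: (iffP andP) => -[h1 h2]; split.
- by move=> A; exact: (forall_inP h1).
- by move=> A B AS; exact: (forall_inP (forall_inP h2 A AS)).
- by apply/forall_inP.
- by apply/forall_inP => A AS; apply/forall_inP => B; exact: h2.
Qed.

Definition U : {set L} := ~: [set r].

(** The child of B containing i. In a laminar family the members around i form a chain, so their
    union is the largest one; adding i covers the case that there is none. *)
Definition chd S B i : {set L} := i |: \bigcup_(A in S | (i \in A) && (A \proper B)) A.

Definition chs S B : {set {set L}} := [set chd S B i | i in B].

Section Family.
Variable S : {set {set L}}.
Hypothesis lS : laminar S.

Lemma lam_clus A : A \in S -> clus A. Proof. by case/lamP: lS => h _; exact: h. Qed.

Lemma lam_compat A B i : A \in S -> B \in S -> i \in A -> i \in B -> (A \subset B) || (B \subset A).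
Proof.
case/lamP: lS => _ h AS BS iA iB; case/or3P: (h A B AS BS) => [->|->|/eqP e]; rewrite ?orbT //.
by have := in_set0 i; rewrite -e inE iA iB.
Qed.

Lemma clus_U A : clus A -> A \proper U.
Proof.
case/and3P => rA _ cA; rewrite properE; apply/andP; split.
  by apply/subsetP => i iA; rewrite !inE; apply: contra rA => /eqP <-.
apply/negP => UA; suff : (#|~: A| <= 1)%N by rewrite leqNgt cA.
rewrite -(cards1 r) subset_leq_card //; apply/subsetP => i; rewrite !inE.
by apply: contraR => ir; apply: (subsetP UA); rewrite !inE.
Qed.

Lemma UnS : U \notin S.
Proof. by apply/negP => /lam_clus /clus_U; rewrite properxx. Qed.

Lemma chd_mem B i : i \in chd S B i.
Proof. by rewrite setU11. Qed.

Lemma chdP B i : (chd S B i = [set i] /\ forall A, A \in S -> i \in A -> ~~ (A \proper B)) \/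
  [/\ chd S B i \in S, chd S B i \proper B & forall A, A \in S -> i \in A -> A \proper B -> A \subset chd S B i].
Proof.
case: (pickP (fun A => [&& A \in S, i \in A & A \proper B])) => [A0 h0|none]; last first.
  left; split; last by move=> A AS iA; apply/negP => AB; move: (none A); rewrite AS iA AB.
  by rewrite /chd big_pred0 ?setU0 // => A; exact: none.
right; pose M := [arg max_(A > A0 | [&& A \in S, i \in A & A \proper B]) #|A|].
have [/and3P [MS iM MB] mx] : [&& M \in S, i \in M & M \proper B] /\
    forall A, [&& A \in S, i \in A & A \proper B] -> (#|A| <= #|M|)%N.
  by rewrite /M; case: arg_maxnP.
have sub A : A \in S -> i \in A -> A \proper B -> A \subset M.
  move=> AS iA AB; case/orP: (lam_compat AS MS iA iM) => // MA.
  have := mx A; rewrite AS iA AB => /(_ isT) le.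
  by have /eqP -> : M == A by rewrite eqEcard MA le.
have -> : chd S B i = M.
  apply/eqP; rewrite eqEsubset; apply/andP; split.
    rewrite subUset sub1set iM /=; apply/bigcupsP => A /and3P [AS iA AB]; exact: sub.
  apply: subset_trans (subsetUr _ _).
  by apply: (bigcup_sup M); rewrite MS iM MB.
by split.
Qed.

Lemma chd_sub B i : i \in B -> chd S B i \subset B.
Proof.
by move=> iB; case: (chdP B i) => [[-> _]|[_ /proper_sub //]]; rewrite sub1set.
Qed.

Lemma chd_eq B i j : j \in chd S B i -> chd S B j = chd S B i.
Proof.
case: (chdP B i) => [[e _]|[CS CB Cmax]] jC; first by move: jC; rewrite e in_set1 => /eqP ->.
case: (chdP B j) => [[_ h]|[DS DB Dmax]]; first by have := h _ CS jC; rewrite CB.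
apply/eqP; rewrite eqEsubset (Dmax _ CS jC CB) andbT.
have jD := chd_mem B j; case/orP: (lam_compat CS DS jC jD) => CD.
  by apply: Cmax => //; exact: (subsetP CD) (chd_mem B i).
by [].
Qed.

Lemma chd_disj B i j k : k \in chd S B i -> k \in chd S B j -> chd S B i = chd S B j.
Proof. by move=> /chd_eq <- /chd_eq <-. Qed.

Lemma chd_max B i A : A \in S -> i \in A -> A \proper B -> A \subset chd S B i.
Proof.
move=> AS iA AB; case: (chdP B i) => [[_ h]|[_ _ h]]; last exact: h.
by have := h A AS iA; rewrite AB.
Qed.

(** The vertices of the tree of S: the top vertex has the cluster [U], which is not the cluster of a
    bounded edge. *)
Definition Sp := U |: S.

Lemma Sp_compat A B i : A \in Sp -> B \in Sp -> i \in A -> i \in B -> (A \subset B) || (B \subset A).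
Proof.
have h C D : C \in Sp -> D = U -> C \subset D.
  by move=> CS ->; case/setU1P: CS => [->|/lam_clus/clus_U/proper_sub].
move=> AS BS; case/setU1P: (AS) => [AU|AS']; first by rewrite (h B A) ?orbT.
case/setU1P: (BS) => [BU|BS']; first by rewrite (h A B).
exact: lam_compat.
Qed.

(* the possible children: the members of the family and the single ends *)
Definition elt C := (C \in S) || [exists i, (i != r) && (C == [set i])].

Lemma eltP C : elt C -> exists2 i, i \in C & i != r.
Proof.
case/orP => [CS|/existsP [i /andP [ir /eqP ->]]]; last by exists i => //; rewrite inE.
have /and3P [rC cC _] := lam_clus CS; have /card_gt0P [i iC] : (0 < #|C|)%N by exact: ltnW.
by exists i => //; apply: contra rC => /eqP <-.
Qed.

Hypothesis L3 : (2 < #|L|)%N.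

Lemma card_U : #|U| = #|L|.-1.
Proof. by rewrite /U cardsC1. Qed.

Lemma Sp_card B : B \in Sp -> (1 < #|B|)%N.
Proof. by case/setU1P => [->|/lam_clus /and3P []//]; rewrite card_U; case: #|L| L3. Qed.

Lemma Sp_root B : B \in Sp -> r \notin B.
Proof. by case/setU1P => [->|/lam_clus /and3P []//]; rewrite !inE eqxx. Qed.

Lemma elt_U C : elt C -> C \proper U.
Proof.
case/orP => [/lam_clus /clus_U //|/existsP [i /andP [ir /eqP ->]]].
rewrite properEcard sub1set !inE ir cards1 card_U /=; by case: #|L| L3 => [|[|[|]]].
Qed.

Lemma chd_elt B i : B \in Sp -> i \in B -> elt (chd S B i).
Proof.
move=> BS iB; case: (chdP B i) => [[-> _]|[CS _ _]]; last by rewrite /elt CS.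
apply/orP; right; apply/existsP; exists i; rewrite eqxx andbT.
by apply: contra (Sp_root BS) => /eqP <-.
Qed.

Lemma chd_proper B i : B \in Sp -> i \in B -> chd S B i \proper B.
Proof.
move=> BS iB; case: (chdP B i) => [[-> _]|[_ //]].
by rewrite properEcard sub1set iB cards1 Sp_card.
Qed.

Definition parS C := [arg min_(B < U | (B \in Sp) && (C \proper B)) #|B|].

Lemma parSP C : elt C -> [/\ parS C \in Sp, C \proper parS C &
  forall B, B \in Sp -> C \proper B -> parS C \subset B].
Proof.
move=> eC; have h0 : (U \in Sp) && (C \proper U) by rewrite setU11 elt_U.
rewrite /parS; case: arg_minnP => // M /andP [MS CM] mn; split=> // B BS CB.
have [i iC _] := eltP eC.
have iM := subsetP (proper_sub CM) _ iC; have iB := subsetP (proper_sub CB) _ iC.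
case/orP: (Sp_compat MS BS iM iB) => // BM.
have /eqP -> // : B == M; rewrite eqEcard BM mn //; by rewrite BS CB.
Qed.

Lemma chs_parS B C : B \in Sp -> (C \in chs S B) = elt C && (B == parS C).
Proof.
move=> BS; apply/imsetP/andP => [[i iB ->]|[eC /eqP BE]].
  have eC := chd_elt BS iB; split=> //; have [PS CP mn] := parSP eC.
  rewrite eqEsubset (mn B BS (chd_proper BS iB)) andbT.
  apply: contraT => nBP; have iP := subsetP (proper_sub CP) _ (chd_mem B i).
  have PB : parS (chd S B i) \proper B by rewrite properE nBP (mn B BS (chd_proper BS iB)).
  case/setU1P: PS => [PU|PS].
    by case/negP: nBP; rewrite PU; case/setU1P: BS => [->|/lam_clus/clus_U/proper_sub].
  by have := chd_max PS iP PB; rewrite (negbTE (proper_subn CP)).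
have [PS CP mn] := parSP eC; rewrite -BE in PS CP mn.
have [i iC ir] := eltP eC; have iB := subsetP (proper_sub CP) _ iC.
exists i => //; apply/eqP; rewrite eqEsubset; apply/andP; split.
  case/orP: eC iC => [CS iC|/existsP [j /andP [_ /eqP ->]]]; first exact: chd_max.
  by rewrite in_set1 => /eqP ->; rewrite sub1set chd_mem.
case: (chdP B i) => [[-> _]|[DS DB _]]; first by rewrite sub1set.
have CD : C \subset chd S B i \/ chd S B i \subset C.
  case/orP: eC iC => [CS iC|/existsP [j /andP [_ /eqP ->]]]; last first.
    by rewrite in_set1 => /eqP ->; left; rewrite sub1set chd_mem.
  by case/orP: (lam_compat CS DS iC (chd_mem B i)); [left|right].
case: CD => // CD; apply: contraT => nDC.
have := mn _ (setU1r _ DS); rewrite properE CD nDC => /(_ isT).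
by rewrite (negbTE (proper_subn DB)).
Qed.

Lemma chs_gt1 B : B \in Sp -> exists i j, [/\ i \in B, j \in B & chd S B i != chd S B j].
Proof.
move=> BS; have /card_gt0P [i iB] : (0 < #|B|)%N by exact: ltnW (Sp_card BS).
have := chd_proper BS iB; rewrite properE => /andP [_ /subsetPn [j jB jn]].
by exists i, j; split=> //; apply: contra jn => /eqP ->; exact: chd_mem.
Qed.

Lemma card_chs_gt1 B : B \in Sp -> (1 < #|chs S B|)%N.
Proof.
move=> BS; have [i [j [iB jB ne]]] := chs_gt1 BS.
by apply/card_gt1P; exists (chd S B i), (chd S B j); split=> //; exact: imset_f.
Qed.

Lemma card_elt : #|[set C | elt C]| = (#|S| + #|L|.-1)%N.
Proof.
have -> : [set C | elt C] = S :|: [set [set i] | i in U].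
  apply/setP => C; rewrite !inE; congr (_ || _); apply/existsP/imsetP => [[i /andP [ir /eqP ->]]|[i iU ->]].
    by exists i => //; rewrite !inE.
  by exists i; move: iU; rewrite !inE => ->; rewrite eqxx.
rewrite cardsU card_imset; last exact: set1_inj.
rewrite card_U (_ : _ :&: _ = set0) ?cards0 ?subn0 //.
apply/setP => C; rewrite !inE; apply/negP => /andP [CS /imsetP [i _ e]].
by have /and3P [_] := lam_clus CS; rewrite e cards1.
Qed.

Lemma card_Sp : #|Sp| = #|S|.+1.
Proof. by rewrite cardsU1 UnS. Qed.

Lemma sum_chs : (\sum_(B in Sp) #|chs S B| = #|S| + #|L|.-1)%N.
Proof.
rewrite -card_elt -[RHS]sum1_card [RHS](partition_big parS (mem Sp)) /=; last first.
  by move=> C; rewrite inE => /parSP [].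
apply: eq_bigr => B BS; rewrite -sum1_card; apply: eq_bigl => C.
by rewrite chs_parS // inE [parS C == B]eq_sym.
Qed.

(** Each member of S and each end other than [r] is the child of exactly one vertex. In terms of
    valences: the sum of val - 3 over all vertices is the codimension of the cone. *)
Lemma sum_excess : (\sum_(B in Sp) (#|chs S B| - 2) + #|S| = #|L| - 3)%N.
Proof.
have h : (\sum_(B in Sp) (#|chs S B| - 2) + #|Sp| * 2 = #|S| + #|L|.-1)%N.
  rewrite -sum_chs -sum_nat_const -big_split /=; apply: eq_bigr => B BS.
  by rewrite subnK // card_chs_gt1.
by move: h; rewrite card_Sp; lia.
Qed.

Definition minS A := [arg min_(B < U | (B \in Sp) && (A \subset B)) #|B|].

Lemma minSP A i : i \in A -> r \notin A -> [/\ minS A \in Sp, A \subset minS A &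
  forall B, B \in Sp -> A \subset B -> minS A \subset B].
Proof.
move=> iA rA; have h0 : (U \in Sp) && (A \subset U).
  rewrite setU11; apply/subsetP => j jA; rewrite !inE.
  by apply: contra rA => /eqP <-.
rewrite /minS; case: arg_minnP => // M /andP [MS AM] mn; split=> // B BS AB.
case/orP: (Sp_compat MS BS (subsetP AM _ iA) (subsetP AB _ iA)) => // BM.
have /eqP -> // : B == M; rewrite eqEcard BM mn //; by rewrite BS AB.
Qed.

Lemma chd_sup A B i j : A \in Sp -> B \in Sp -> chd S A i != chd S A j ->
  i \in A -> j \in A -> i \in B -> j \in B -> A \subset B.
Proof.
move=> AS BS ne iA jA iB jB; case/orP: (Sp_compat AS BS iA iB) => // BA.
apply: contraNT ne => nAB; apply/eqP/chd_disj; last exact: chd_mem.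
have BpA : B \proper A by rewrite properE BA.
case/setU1P: BS => [BU|BS]; last exact: (subsetP (chd_max BS iB BpA)).
case/negP: nAB; rewrite BU; case/setU1P: AS => [->|/lam_clus/clus_U/proper_sub] //.
Qed.

End Family.

Section LamFan.
Variable R : realType.
Hypothesis L3 : (2 < #|L|)%N.

Lemma clus_lattice A : clus A -> lattice0 (vsplit R A).
Proof.
case/and3P => _ cA cC; exists (fun I => (I == A)%:Z); rewrite (bigD1 A) /= ?cA //.
by rewrite eqxx mulr1z big1 ?addr0 ?split_pt // => I /andP [_ /negbTE ->]; rewrite mulr0z.
Qed.

Lemma lam_sub S T : T \subset S -> laminar S -> laminar T.
Proof.
move=> TS /lamP [h1 h2]; apply/lamP; split=> [A AT|A B AT BT].
  exact: h1 (subsetP TS _ AT).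
exact: h2 (subsetP TS _ AT) (subsetP TS _ BT).
Qed.

Lemma lam0 : laminar set0.
Proof. by apply/lamP; split=> [A|A B]; rewrite in_set0. Qed.

Lemma lam_quad S C i j m : laminar S -> C \in S ->
  quad i j r m (cutd R C) = [&& i \in C, j \in C & m \notin C]%:R - [&& j \in C, m \in C & i \notin C]%:R.
Proof.
move=> lS /(lam_clus lS) /and3P [/negbTE rC _ _]; rewrite quad_cut rC.
by case: (i \in C); case: (j \in C); case: (m \in C); rewrite /=; ring.
Qed.

Lemma quadf i j m : i != j -> i != r -> j != m -> m != r -> exists2 f : 'cV[R]_(qdim R L),
  integral (@lattice0 R L) f & forall C, pairing (vsplit R C) f = quad i j r m (cutd R C).
Proof.
move=> ij ir jm mr; rewrite eq_sym in mr.
have [f fE] := @quad_functional R L i j r m ir jm ij mr.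
have e C : pairing (vsplit R C) f = quad i j r m (cutd R C) by apply: fE => *; exact: cutd_sym.
by exists f => //; apply: lattice0_int => C; rewrite e quad_int.
Qed.

(** The coordinate of A is measured by the four-point functional of two ends i, j in different
    children of A, the end [r], and an end m of the parent of A outside A: among the members of S
    only A separates i, j from r, m, and none separates i, r from j, m. *)
Lemma lam_dual S A : laminar S -> A \in S -> exists2 f, integral (@lattice0 R L) f &
  forall B, B \in S -> pairing (vsplit R B) f = (B == A)%:R.
Proof.
move=> lS AS; have ASp : A \in Sp S by exact: setU1r.
have [i [j [iA jA ne]]] := chs_gt1 lS L3 ASp.
have [|PS AP mn] := parSP lS L3 (C := A); first by rewrite /elt AS.
have [m mP mA] : exists2 m, m \in parS S A & m \notin A.
  by move: AP; rewrite properE => /andP [_ /subsetPn].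
have rA : r \notin A := Sp_root lS ASp; have rP := Sp_root lS PS.
have nr k : k \in A -> k != r by move=> kA; apply: contra rA => /eqP <-.
have ij : i != j by apply: contra ne => /eqP ->.
have jm : j != m by apply: contra mA => /eqP <-.
have mr : m != r by apply: contra rP => /eqP <-.
have [f fi fE] := quadf ij (nr i iA) jm mr; exists f => // B BS.
have BSp : B \in Sp S by exact: setU1r.
rewrite fE (lam_quad _ _ _ lS BS).
have -> : [&& i \in B, j \in B & m \notin B] = (B == A).
  apply/and3P/eqP => [[iB jB mB]|->]; last by [].
  have AB := chd_sup lS ASp BSp ne iA jA iB jB.
  apply/eqP; rewrite eq_sym eqEsubset AB /=; apply: contraT => nBA.
  have PB : parS S A \subset B by apply: mn => //; rewrite properE AB.
  by rewrite (subsetP PB _ mP) in mB.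
have -> : [&& j \in B, m \in B & i \notin B] = false.
  apply/negP => /and3P [jB mB iB]; case/orP: (Sp_compat lS ASp BSp jA jB) => /subsetP h.
    by rewrite h in iB.
  by rewrite h in mA.
by rewrite subr0.
Qed.

(** Four-point functionals detect the members of S at a point of the open cone, so the point
    determines S. If A is not in S, let B be the least vertex cluster around A: two ends of A in
    different children of B and an end of B outside A give a value that is not positive. *)
Lemma lam_char S a A : laminar S -> (forall B, B \in S -> 0 < a B) -> clus A ->
  A \in S <-> forall i j m, i \in A -> j \in A -> i != j -> m \notin A -> m != r ->
    0 < \sum_(C in S) a C * quad i j r m (cutd R C).
Proof.
move=> lS pa cA; have /and3P [rA cA1 _] := cA; split=> [AS i j m iA jA ij mA mr|h].
  have ASp : A \in Sp S by exact: setU1r.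
  have nn C : C \in S -> 0 <= a C * quad i j r m (cutd R C).
    move=> CS; apply: mulr_ge0; first exact/ltW/pa.
    rewrite (lam_quad _ _ _ lS CS); have -> : [&& j \in C, m \in C & i \notin C] = false.
      apply/negP => /and3P [jC mC iC].
      case/orP: (lam_compat lS AS CS jA jC) => /subsetP s.
        by rewrite s in iC.
      by rewrite s in mA.
    by rewrite subr0 ler0n.
  rewrite (bigD1 A) //=; apply: ltr_wpDr; first by apply: sumr_ge0 => C /andP [CS _]; exact: nn.
  by rewrite (lam_quad _ _ _ lS AS) iA jA mA /= andbF subr0 mulr1 pa.
have /card_gt0P [i iA] : (0 < #|A|)%N by exact: ltnW.
have [BS AB mn] := minSP lS iA rA; set B := minS S A in BS AB mn.
have iB := subsetP AB _ iA.
have [e|nAB] := eqVneq A B.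
  case/setU1P: BS => [BU|]; last by rewrite -e.
  by have := clus_U cA; rewrite e BU properxx.
have pAB : A \proper B by rewrite properEneq nAB AB.
have [m mB mA] : exists2 m, m \in B & m \notin A.
  by move: pAB; rewrite properE => /andP [_ /subsetPn].
have /subsetPn [j jA jD] : ~~ (A \subset chd S B i).
  apply/negP => AD; case: (chdP lS B i) => [[e _]|[DS DB _]].
    by have := leq_trans cA1 (subset_leq_card AD); rewrite e cards1.
  by have := mn _ (setU1r _ DS) AD; rewrite (negbTE (proper_subn DB)).
have ij : i != j by apply: contra jD => /eqP <-; exact: chd_mem.
have mr : m != r by apply: contra (Sp_root lS BS) => /eqP <-.
have := h i j m iA jA ij mA mr; rewrite ltNge => /negP []; apply: sumr_le0 => C CS.
apply: mulr_ge0_le0; first exact/ltW/pa.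
rewrite (lam_quad _ _ _ lS CS); have -> : [&& i \in C, j \in C & m \notin C] = false.
  apply/negP => /and3P [iC jC mC].
  case/orP: (Sp_compat lS BS (setU1r _ CS) iB iC) => CB.
    by rewrite (subsetP CB _ mB) in mC.
  have CpB : C \proper B.
    rewrite properEneq CB andbT; apply: contra mC => /eqP ->; exact: mB.
  by have /subsetP/(_ j jC) := chd_max lS CS iC CpB; rewrite (negbTE jD).
by rewrite sub0r oppr_le0 ler0n.
Qed.

Lemma lam_uniq S T (a b : {set L} -> R) : laminar S -> laminar T ->
  (forall B, B \in S -> 0 < a B) -> (forall B, B \in T -> 0 < b B) ->
  \sum_(A in S) a A *: vsplit R A = \sum_(A in T) b A *: vsplit R A -> S = T.
Proof.
move=> lS lT pa pb e.
have eq i j m : i != j -> i != r -> j != m -> m != r ->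
    \sum_(C in S) a C * quad i j r m (cutd R C) = \sum_(C in T) b C * quad i j r m (cutd R C).
  move=> ij ir jm mr; have [f _ fE] := quadf ij ir jm mr.
  transitivity (pairing (\sum_(A in S) a A *: vsplit R A) f).
    by rewrite pairing_suml; apply: eq_bigr => C _; rewrite pairingZl fE.
  by rewrite e pairing_suml; apply: eq_bigr => C _; rewrite pairingZl fE.
have nr A k : clus A -> k \in A -> k != r by move=> /and3P [rA _ _] kA; apply: contra rA => /eqP <-.
have nm (A : {set L}) j m : j \in A -> m \notin A -> j != m by move=> jA; apply: contra => /eqP <-.
apply/setP => A; apply/idP/idP => AS.
  have cA := lam_clus lS AS; apply/(lam_char lT pb cA) => i j m iA jA ij mA mr.
  rewrite -(eq i j m ij (nr A i cA iA) (nm A j m jA mA) mr); move/(lam_char lS pa cA): AS => h; exact: h.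
have cA := lam_clus lT AS; apply/(lam_char lS pa cA) => i j m iA jA ij mA mr.
rewrite (eq i j m ij (nr A i cA iA) (nm A j m jA mA) mr); move/(lam_char lT pb cA): AS => h; exact: h.
Qed.

(** A vertex with three children is 4-valent; joining the two children other than X by a new edge
    resolves it. *)
Lemma lam_ext S A B X : laminar S -> B \in Sp S -> #|chs S B| = 3 -> X \in chs S B -> A = B :\: X ->
  (A \notin S) && laminar (A |: S).
Proof.
move=> lS BS c3 XB AE.
have XE : X \in chs S B by [].
case/imsetP: (XB) => x xB Xx.
have ch i k : k \in chd S B i -> i \in B -> (k \in X) = (chd S B i == X).
  move=> ki iB; rewrite Xx; apply/idP/eqP => [kx|e]; last by rewrite -e.
  exact: chd_disj lS _ _ _ _ ki kx.
have [i [j [iB jB iX jX ij]]] : exists i j, [/\ i \in B, j \in B, chd S B i != X, chd S B j != X & chd S B i != chd S B j].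
  have : (1 < #|chs S B :\ X|)%N by move: c3; rewrite (cardsD1 X) XE add1n => /eqP; rewrite eqSS => /eqP ->.
  case/card_gt1P => Y [Z [/setD1P [YX /imsetP [i iB YE]] /setD1P [ZX /imsetP [j jB ZE]] YZ]].
  by exists i, j; rewrite -YE -ZE.
have mA k : (k \in A) = (k \in B) && (k \notin X) by rewrite AE inE andbC.
have iA : i \in A by rewrite mA iB (ch i) ?chd_mem.
have jA : j \in A by rewrite mA jB (ch j) ?chd_mem.
have xA : x \notin A by rewrite mA Xx chd_mem andbF.
have neij : i != j by apply: contra ij => /eqP ->.
have AB : A \subset B by rewrite AE subsetDl.
have rA : r \notin A by apply: contra (Sp_root lS BS) => /(subsetP AB).
have cA : clus A.
  rewrite /clus rA /=; apply/andP; split; first by apply/card_gt1P; exists i, j.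
  apply/card_gt1P; exists r, x; rewrite !inE; split=> //.
  by apply: contra (Sp_root lS BS) => /eqP ->.
have AnS : A \notin S.
  apply/negP => AS; have := chd_sup lS BS (setU1r _ AS) ij iB jB iA jA.
  by move/subsetP/(_ x xB); rewrite (negbTE xA).
rewrite AnS; apply/lamP; split=> [D /setU1P [->//|/(lam_clus lS)//]|].
have cD D : D \in S -> compat A D.
  move=> DS; rewrite /compat; have [e|] := eqVneq (A :&: D) set0; first by rewrite !orbT.
  case/set0Pn => k; rewrite inE => /andP [kA kD].
  have kB := subsetP AB _ kA.
  case/orP: (Sp_compat lS BS (setU1r _ DS) kB kD) => BD.
    by rewrite (subset_trans AB BD).
  have [BD'|nBD] := boolP (B \subset D); first by rewrite (subset_trans AB BD').
  have DpB : D \proper B by rewrite properE BD.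
  have Dk := chd_max lS DS kD DpB; apply/orP; right; apply/orP; left.
  apply: (subset_trans Dk); apply/subsetP => t tk.
  rewrite mA (subsetP (chd_sub lS kB)) //= (ch k) // -(ch k k) ?chd_mem //.
  by move: kA; rewrite mA => /andP [].
move=> C D /setU1P [->|CS] /setU1P [->|DS].
- by rewrite /compat subxx.
- exact: cD.
- by have := cD _ CS; rewrite /compat setIC; case/or3P => ->; rewrite ?orbT.
- by case/lamP: lS => _; apply.
Qed.

Lemma lam_extE S A : laminar S -> A \notin S -> laminar (A |: S) ->
  exists B X, [/\ B \in Sp S, (2 < #|chs S B|)%N, X \in chs S B & (#|chs S B| = 3 -> A = B :\: X)].
Proof.
move=> lS AnS lA; have AA : A \in A |: S by exact: setU11.
have cA := lam_clus lA AA; have /and3P [rA cA1 _] := cA.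
have /card_gt0P [i iA] : (0 < #|A|)%N by exact: ltnW.
have [BS AB mn] := minSP lS iA rA; set B := minS S A in BS AB mn.
have nAB : A != B.
  apply/eqP => e; case/setU1P: BS => [BU|BS]; last by rewrite e BS in AnS.
  by have := clus_U cA; rewrite e BU properxx.
have [m mB mA] : exists2 m, m \in B & m \notin A.
  have : A \proper B by rewrite properEneq nAB AB.
  by rewrite properE => /andP [_ /subsetPn].
have chA k : k \in A -> chd S B k \subset A.
  move=> kA; case: (chdP lS B k) => [[-> _]|[DS DB _]]; first by rewrite sub1set.
  case/orP: (lam_compat lA AA (setU1r _ DS) kA (chd_mem _ _ _)) => // AD.
  by have := mn _ (setU1r _ DS) AD; rewrite (negbTE (proper_subn DB)).
have /subsetPn [j jA jD] : ~~ (A \subset chd S B i).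
  apply/negP => AD; case: (chdP lS B i) => [[e _]|[DS DB _]].
    by have := leq_trans cA1 (subset_leq_card AD); rewrite e cards1.
  by have := mn _ (setU1r _ DS) AD; rewrite (negbTE (proper_subn DB)).
have iB := subsetP AB _ iA; have jB := subsetP AB _ jA.
have ne1 : chd S B j != chd S B i by apply: contra jD => /eqP <-; exact: chd_mem.
have nem k : k \in A -> chd S B m != chd S B k.
  by move=> kA; apply: contra mA => /eqP e; apply: (subsetP (chA k kA)); rewrite -e chd_mem.
pose T := [set chd S B m; chd S B j; chd S B i].
have cT : #|T| = 3 by rewrite /T -setUA !cardsU1 cards1 !inE !negb_or !nem // ne1.
have TB : T \subset chs S B by rewrite !subUset !sub1set !imset_f.
exists B, (chd S B m); split=> //; first by apply: leq_trans (subset_leq_card TB); rewrite cT.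
  exact: imset_f.
move=> c3; apply/eqP; rewrite eqEsubset; apply/andP; split; apply/subsetP => k.
  move=> kA; rewrite inE (subsetP AB _ kA) andbT.
  by apply: contra (nem k kA) => /(chd_eq lS) ->.
rewrite inE => /andP [kX kB].
have /eqP TE : T == chs S B by rewrite eqEcard TB cT c3.
have : chd S B k \in T by rewrite TE imset_f.
rewrite !inE => /orP [/orP [/eqP e|/eqP e]|/eqP e].
- by rewrite -e chd_mem in kX.
- by apply: (subsetP (chA j jA)); rewrite -e chd_mem.
- by apply: (subsetP (chA i iA)); rewrite -e chd_mem.
Qed.

(** The relation behind balancing, valid already for cut functions: the three pairings of the four
    branches X, Y, Z and the complement of B sum to the four splits of single branches. *)
Lemma vsplit_sum3 (B X Y Z : {set L}) :
  (forall k, [&& (k \in B) == [|| k \in X, k \in Y | k \in Z], ~~ ((k \in X) && (k \in Y)),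
     ~~ ((k \in X) && (k \in Z)) & ~~ ((k \in Y) && (k \in Z))]) ->
  vsplit R (B :\: X) + vsplit R (B :\: Y) + vsplit R (B :\: Z) =
  vsplit R X + vsplit R Y + vsplit R Z + vsplit R B.
Proof.
move=> h; have qtD (d d' : L -> L -> R) : qt d + qt d' = qt (fun i j => d i j + d' i j).
  by rewrite /qt -mulmxDl; congr (_ *m _); apply/rowP => k; rewrite !mxE.
rewrite /vsplit !qtD; apply: qt_ext => i j _; rewrite /cutd !inE.
case/and4P: (h i) => /eqP -> h1 h2 h3; case/and4P: (h j) => /eqP -> h4 h5 h6; move: h1 h2 h3 h4 h5 h6.
case: (i \in X); case: (i \in Y); case: (i \in Z) => // _ _ _;
case: (j \in X); case: (j \in Y); case: (j \in Z) => // _ _ _ /=; ring.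
Qed.

Lemma vsplit_elt S C : C \notin S -> C \in U |: [set C | elt S C] -> vsplit R C = 0.
Proof.
move=> CS /setU1P [->|]; first by rewrite /U vsplitC vsplit1.
by rewrite inE /elt (negbTE CS) => /existsP [i /andP [_ /eqP ->]]; rewrite vsplit1.
Qed.

Lemma lam_bal T : laminar T -> (#|T|.+1 = #|L| - 3)%N -> exists a : {set L} -> R,
  \sum_(A | (A \notin T) && laminar (A |: T)) vsplit R A = \sum_(A in T) a A *: vsplit R A.
Proof.
move=> lT cT; have := sum_excess lT L3; rewrite -cT => ex.
have s1 : (\sum_(B in Sp T) (#|chs T B| - 2) = 1)%N by lia.
have [B BT cB] : exists2 B, B \in Sp T & (2 < #|chs T B|)%N.
  apply/exists_inP; apply: contraT => /exists_inPn h; move: s1; rewrite big1 // => B BS.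
  by have := h B BS; lia.
move: s1; rewrite (bigD1 B) //= => s1.
have c3 : #|chs T B| = 3.
  have : (#|chs T B| - 2 <= 1)%N by exact: leq_trans (leq_addr _ _) (eq_leq s1).
  by rewrite leq_subLR => h; apply/eqP; rewrite eqn_leq h cB.
have un D : D \in Sp T -> (2 < #|chs T D|)%N -> D = B.
  move=> DS cD; apply/eqP; apply: contraT => DB.
  have : (#|chs T D| - 2 <= 0)%N by move: s1; rewrite (bigD1 D) /= ?DS // c3 (_ : 3 - 2 = 1)%N // => /eqP; rewrite -[X in _ == X]addn0 eqn_add2l addn_eq0 => /andP [/eqP ->].
  by rewrite leqNgt subn_gt0 cD.
have /card_gt0P [X XB] : (0 < #|chs T B|)%N by rewrite c3.
have /eqP/cards2P [Y [Z [YZ YZE]]] : #|chs T B :\ X| = 2 by rewrite (cardsD1 X) XB in c3; case: c3.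
have chE : chs T B = X |: [set Y; Z] by rewrite -YZE setD1K.
have YB : Y \in chs T B by rewrite chE !inE eqxx orbT.
have ZB : Z \in chs T B by rewrite chE !inE eqxx !orbT.
have XY : X \notin [set Y; Z] by rewrite -YZE !inE eqxx.
have dis P Q k : P \in chs T B -> Q \in chs T B -> k \in P -> k \in Q -> P = Q.
  by move=> /imsetP [i _ ->] /imsetP [j _ ->]; exact: chd_disj.
have sub P : P \in chs T B -> P \subset B by case/imsetP => i iB ->; exact: chd_sub.
have XY' : X != Y by apply: contra XY => /eqP ->; rewrite !inE eqxx.
have XZ' : X != Z by apply: contra XY => /eqP ->; rewrite !inE eqxx orbT.
have inj : {in chs T B &, injective (fun P => B :\: P)}.
  have cc P : P \in chs T B -> B :\: (B :\: P) = P.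
    by move=> PB; rewrite setDDr setDv set0U; apply/setIidPr; exact: sub.
  by move=> P Q PB QB /= e; rewrite -(cc P PB) e cc.
have sE : \sum_(A | (A \notin T) && laminar (A |: T)) vsplit R A = \sum_(A in [set B :\: P | P in chs T B]) vsplit R A.
  apply: eq_bigl => A; apply/andP/imsetP => [[AT lA]|[P PB ->]].
    have [B' [P [B'S cB' PB e]]] := lam_extE lT AT lA.
    have BE := un _ B'S cB'; subst B'; exists P => //; exact: e.
  by apply/andP; exact: (lam_ext lT BT c3 PB).
have s3 (g : {set L} -> 'rV[R]_(qdim R L)) : \sum_(P in chs T B) g P = g X + g Y + g Z.
  by rewrite chE big_setU1 //= big_setU1 ?inE //= big_set1 addrA.
have key := @vsplit_sum3 B X Y Z.
have {}key : vsplit R (B :\: X) + vsplit R (B :\: Y) + vsplit R (B :\: Z) =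
    vsplit R X + vsplit R Y + vsplit R Z + vsplit R B.
  apply: key => k; apply/and4P; split.
  - apply/eqP; apply/idP/or3P => [kB|[k1|k1|k1]].
    + have : chd T B k \in chs T B by exact: imset_f.
      rewrite chE !inE => /or3P [] /eqP <-; [apply: Or31|apply: Or32|apply: Or33]; exact: chd_mem.
    + exact: (subsetP (sub _ XB)).
    + exact: (subsetP (sub _ YB)).
    + exact: (subsetP (sub _ ZB)).
  - by apply: contra XY' => /andP [k1 k2]; apply/eqP; exact: dis XB YB k1 k2.
  - by apply: contra XZ' => /andP [k1 k2]; apply/eqP; exact: dis XB ZB k1 k2.
  - by apply: contra YZ => /andP [k1 k2]; apply/eqP; exact: dis YB ZB k1 k2.
have term C : C \in U |: [set C | elt T C] -> vsplit R C = \sum_(A in T) (A == C)%:R *: vsplit R A.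
  move=> CE; have [CT|CT] := boolP (C \in T).
    rewrite (bigD1 C) //= eqxx scale1r big1 ?addr0 // => A /andP [_ /negbTE ->].
    by rewrite scale0r.
  rewrite (vsplit_elt CT CE) big1 // => A AT; case: eqVneq => [e|]; last by rewrite scale0r.
  by rewrite -e AT in CT.
have tch P : P \in chs T B -> P \in U |: [set C | elt T C].
  by rewrite chs_parS // => /andP [e _]; rewrite !inE e orbT.
have tB : B \in U |: [set C | elt T C].
  by case/setU1P: BT => [->|BT]; rewrite !inE ?eqxx // /elt BT orbT.
exists (fun A => (A == X)%:R + (A == Y)%:R + (A == Z)%:R + (A == B)%:R).
rewrite sE big_imset //= s3 key (term X (tch X XB)) (term Y (tch Y YB)) (term Z (tch Z ZB)) (term B tB).
by rewrite -!big_split /=; apply: eq_bigr => A _; rewrite !scalerDl.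
Qed.

Lemma lam_fan : fan (#|L| - 3) (@lattice0 R L) (@vsplit R L) set0 laminar.
Proof.
split.
- by move=> S _; rewrite sub0set.
- exact: lam0.
- by move=> S T _; exact: lam_sub.
- by move=> S lS; rewrite -(sum_excess lS L3) leq_addl.
- exact: lam_dual.
- by move=> S A lS /(lam_clus lS) /clus_lattice.
- exists (fun=> 0); rewrite big1 // => A _; exact: mulr0z.
- move=> x y [a ->] [b ->]; exists (fun A => a A - b A); rewrite -sumrB.
  by apply: eq_bigr => A _; rewrite mulrzBr.
- move=> S T a b lS lT pa pb; apply: lam_uniq => // B BS.
    by apply: pa; rewrite setD0.
  by apply: pb; rewrite setD0.
- exact: lam_bal.
Qed.

End LamFan.

End Laminar.

(** * The tree of a laminar family *)

Section TreeOfLaminar.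
Local Open Scope set_scope.
Variables (R : realType) (L : finType) (r : L) (S : {set {set L}}) (a : {set L} -> R).
Hypothesis lS : laminar r S.
Hypothesis L3 : (2 < #|L|)%N.
Hypothesis a0 : forall B, B \in S -> 0 < a B.
Implicit Types (A B C : {set L}) (i j k : L).

Definition lvert : finType := {B : {set L} | B \in Sp r S}.

Definition mkv B (BS : B \in Sp r S) : lvert := exist (fun B => B \in Sp r S) B BS.

Definition to_vert B : lvert + L := if insub B is Some v then inl v else inr r.

Definition lpar (x : lvert + L) : lvert + L :=
  match x with
  | inl B => if val B == U r then inr r else to_vert (parS r S (val B))
  | inr i => if i == r then inr r else to_vert (parS r S [set i])
  end.

Definition sset (x : lvert + L) : {set L} :=
  match x with inl B => val B | inr i => [set i] end.

Definition lrk (x : lvert + L) : nat :=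
  if x == inr r then 0 else #|[set C in Sp r S | sset x \proper C]|.+1.

(** Adjacent vertices have nested clusters, so the intersection in [len] is the lower cluster, and
    lengths are symmetric. *)
Definition tree_of_lam : pretree R L :=
  {| vert := lvert;
     adj := fun x y : (lvert + L)%type => (x != inr r) && (y == lpar x) || (y != inr r) && (x == lpar y);
     len := fun B C : lvert => a (val B :&: val C) |}.

Notation Tr := tree_of_lam.
Notation root := (inr r : lvert + L).

Lemma to_vertE B (BS : B \in Sp r S) : to_vert B = inl (mkv BS).
Proof. by rewrite /to_vert (insubT (fun B => B \in Sp r S) BS). Qed.

Lemma sset_elt x : x != root -> (x = to_vert (U r)) \/ (elt r S (sset x) /\ lpar x = to_vert (parS r S (sset x))).
Proof.
case: x => [B|i] /= ir.
  have [e|ne] := eqVneq (val B) (U r).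
    by left; rewrite -e (to_vertE (valP B)); congr inl; exact: val_inj.
  right; split=> //; have := valP B; rewrite in_setU1 (negbTE ne) /= => BS.
  by rewrite /elt BS.
have ir' : i != r by apply: contra ir => /eqP ->.
by right; rewrite (negbTE ir'); split=> //; apply/orP; right; apply/existsP; exists i; rewrite ir' eqxx.
Qed.

Lemma USp : U r \in Sp r S. Proof. exact: setU11. Qed.

Lemma lpar_U : lpar (to_vert (U r)) = root.
Proof. by rewrite (to_vertE USp) /= eqxx. Qed.

Lemma Sp_U B : B \in Sp r S -> B \subset U r.
Proof. by case/setU1P => [->|/(lam_clus lS)/clus_U/proper_sub]. Qed.

Lemma lpar_rk x : x != root -> lrk x = (lrk (lpar x)).+1.
Proof.
move=> xr; rewrite {1}/lrk (negbTE xr); congr _.+1.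
case: (sset_elt xr) => [->|[ex ->]].
  rewrite lpar_U /lrk eqxx; apply/eqP; rewrite cards_eq0; apply/eqP/setP => C.
  rewrite inE in_set0 (to_vertE USp) /=; apply/negP => /andP [CS UC].
  by have := Sp_U CS; rewrite (negbTE (proper_subn UC)).
have [PS xP mn] := parSP lS L3 ex; rewrite (to_vertE PS) /lrk /=.
set T := [set C in Sp r S | parS r S (sset x) \proper C].
have -> : [set C in Sp r S | sset x \proper C] = parS r S (sset x) |: T.
  apply/setP => C; rewrite !inE; have [->|ne] := eqVneq C (parS r S (sset x)).
    by move: (PS); rewrite in_setU1 => ->; rewrite xP.
  rewrite /=; case CS : (_ || _) => //=; have {}CS : C \in Sp r S by rewrite !inE CS.
  apply/idP/idP => h; last exact: proper_trans xP h.
  by rewrite properEneq eq_sym ne mn.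
by rewrite cardsU1 !inE properxx andbF.
Qed.

Lemma lam_rooted : rooted (@adj R L Tr) root lpar lrk.
Proof.
split=> [x y||x xr|x y].
- by rewrite /= orbC.
- by rewrite /lrk eqxx.
- by rewrite /= xr eqxx lpar_rk.
- by case/orP => /andP [h /eqP ->]; [left|right].
Qed.

Notation anc := (anc lpar lrk).

Lemma lam_anc (v : lvert) y : y != root -> anc (inl v) y = (sset y \subset val v).
Proof.
move: y; apply: (tree_ind lam_rooted) => [|y yr IH _]; first by rewrite eqxx.
rewrite (anc_par lam_rooted) //; case: (sset_elt yr) => [yU|[ey py]].
  rewrite {2}yU lpar_U (anc_root lam_rooted) orbF yU (to_vertE USp) /=.
  apply/eqP/idP => [[->]//|UB]; congr inl; apply/val_inj/eqP.
  by rewrite /= eqEsubset UB (Sp_U (valP v)).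
have [PS xP mn] := parSP lS L3 ey; rewrite py in IH *; rewrite (to_vertE PS) in IH *.
rewrite IH //=; apply/orP/idP => [[/eqP <- //|h]|h].
  exact: subset_trans (proper_sub xP) h.
have [e|ne] := eqVneq (sset y) (val v); last first.
  by right; apply: mn; [exact: valP|rewrite properEneq ne h].
left; apply/eqP; case: y yr ey py PS xP mn IH h e => [B|i] /= _ _ _ _ _ _ _ _ e.
  by congr inl; apply/val_inj.
by have := Sp_card lS L3 (valP v); rewrite (_ : val v = [set i]) // cards1.
Qed.

Lemma lam_ancE (v : lvert) i : anc (inl v) (inr i) = (i \in val v).
Proof.
have [->|ir] := eqVneq i r.
  by rewrite (anc_root lam_rooted) (negbTE (Sp_root lS (valP v))).
by rewrite lam_anc ?sub1set //; apply: contra ir => /eqP [->].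
Qed.

Lemma lpar_vert x : x != root -> x != to_vert (U r) -> exists v, lpar x = inl v.
Proof.
move=> xr xU; case: (sset_elt xr) => [e|[ey ->]]; first by rewrite e eqxx in xU.
by have [PS _ _] := parSP lS L3 ey; rewrite (to_vertE PS); eexists.
Qed.

Lemma lam_kid (v : lvert) i : i \in val v -> exists y, [/\ y != root, lpar y = inl v & sset y = chd S (val v) i].
Proof.
move=> iv; have ei := chd_elt lS (valP v) iv.
have ch : chd S (val v) i \in chs S (val v) by exact: imset_f.
move: ch; rewrite (chs_parS lS L3 _ (valP v)) => /andP [_ /eqP pv].
have lv : to_vert (val v) = inl v by rewrite (to_vertE (valP v)); congr inl; exact: val_inj.
case/orP: (ei) => [CS|/existsP [j /andP [jr /eqP cj]]].
  have CSp : chd S (val v) i \in Sp r S by exact: setU1r.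
  exists (inl (mkv CSp)); split=> //=.
  by rewrite (negbTE (proper_neq (elt_U lS L3 ei))) -pv.
exists (inr j); split=> /=; first by apply: contra jr => /eqP [->].
  by rewrite (negbTE jr) -cj -pv.
by rewrite cj.
Qed.

Lemma tree_of_lamP : is_marked_tree Tr.
Proof.
have rsym := r_sym lam_rooted.
split.
- split=> // x; apply/negP; have h y : y != root -> y == lpar y = false.
    move=> yr; apply/eqP => e; have := lpar_rk yr; rewrite -e => /eqP.
    by rewrite -{1}[lrk y]addn0 -addn1 eqn_add2l.
  by rewrite /= => /orP [] /andP [xr]; rewrite h.
- by move=> x y; exact: (@rooted_unique _ _ Tr _ _ _ lam_rooted).
- move=> i; have [->|ir] := eqVneq i r.
    exists (mkv USp) => y /=; rewrite eqxx /=; apply/andP/eqP => [[yr /eqP e]|->].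
      have [->|yU] := eqVneq y (to_vert (U r)); first by rewrite (to_vertE USp).
      by have [v pv] := lpar_vert yr yU; rewrite pv in e.
    by rewrite /= eqxx.
  have ir' : inr i != root by apply: contra ir => /eqP [->].
  have iU : inr i != to_vert (U r) by rewrite (to_vertE USp).
  have [v pv] := lpar_vert ir' iU; exists v => y; rewrite /= in pv *; rewrite ir' pv /=.
  apply/orP/eqP => [[/eqP //|/andP [yr /eqP e]]|->]; last by left.
  case: (eqVneq y (to_vert (U r))) e => [->|yU]; first by rewrite lpar_U => -[] e; rewrite e eqxx in ir.
  by have [w ->] := lpar_vert yr yU.
- move=> v; have [i [j [iv jv ij]]] := chs_gt1 lS L3 (valP v).
  have [y [yr py sy]] := lam_kid iv; have [z [zr pz sz]] := lam_kid jv.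
  have lt w : w != root -> lpar w = inl v -> w != lpar (inl v).
    move=> wr pw; apply/eqP => e; have := lpar_rk wr; rewrite pw.
    by rewrite (lpar_rk (x := inl v)) // -e => /eqP; lia.
  have yz : y != z by apply: contra ij => /eqP e; rewrite -sy -sz e.
  have sub : [set lpar (inl v); y; z] \subset [set x | adj (inl v : node Tr) x]%SET.
    apply/subsetP => x; rewrite !inE => /orP [/orP [] /eqP ->|/eqP ->].
    + by rewrite /= eqxx.
    + by rewrite /= yr py eqxx orbT.
    + by rewrite /= zr pz eqxx orbT.
  have c3 : #|[set lpar (inl v); y; z]| = 3.
    rewrite -setUA !cardsU1 cards1 !inE (negbTE yz) orbC negb_or.
    by rewrite ![lpar _ == _]eq_sym !lt.
  apply: leq_trans (_ : _ <= #|[set x | adj (inl v : node Tr) x]%SET|)%N _.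
    by apply: leq_trans (subset_leq_card sub); rewrite c3.
  rewrite /valence; apply: eq_leq; apply: eq_card => x; by apply/idP/idP; rewrite inE; [move=> h; apply/mem_set|move/set_mem].
- move=> u v uv; split; last by rewrite /= setIC.
  have h (x y : lvert) : inl y == lpar (inl x) -> 0 < a (val x :&: val y).
    move=> /eqP e; case: (sset_elt (x := inl x)) => // [xU|[ex px]]; first by rewrite xU lpar_U in e.
    have [PS xP mn] := parSP lS L3 ex.
    have -> : val y = parS r S (val x) by move: e; rewrite px (to_vertE PS) => -[->].
    rewrite (setIidPl (proper_sub xP)); apply: a0.
    have := valP x; rewrite in_setU1 => /orP [/eqP xU|//].
    by have := elt_U lS L3 ex; rewrite /= xU properxx.
  case/orP: uv => /andP [_]; first exact: h.
  by rewrite /= setIC; exact: h.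
Qed.

(** Serves two kinds of lengths: arbitrary ones, for the closed cone, and those prescribed on
    clusters, for a given point. Hence coefficients that are values of [l] and that agree with [c]
    whenever [l] comes from [c]. *)
Lemma lam_pt0 (l : lvert -> lvert -> R) : (forall u v, l u v = l v u) ->
  exists b, (forall B, B \in S -> exists u v, b B = l u v) /\
    (forall c, (forall u v, l u v = c (val u :&: val v)) -> forall B, B \in S -> b B = c B) /\
  pt0 (with_len (G := Tr) l) = \sum_(B in S) b B *: vsplit R B.
Proof.
move=> ls; pose Tl := with_len (G := Tr) l.
have Trt : rooted (@adj R L Tl) root lpar lrk := lam_rooted.
pose b B := edge_len (to_vert B : node Tl) (lpar (to_vert B)).
have bE B : B \in S -> exists u v, [/\ b B = l u v, val u = B & B \subset val v].
  move=> BS; have BSp : B \in Sp r S by exact: setU1r.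
  have BU : B != U r by apply: contra (UnS lS) => /eqP <-.
  have eB : elt r S B by rewrite /elt BS.
  have [PS xP mn] := parSP lS L3 eB.
  rewrite /b (to_vertE BSp) /= (negbTE BU) (to_vertE PS).
  by exists (mkv BSp), (mkv PS); split=> //; exact: proper_sub.
exists b; split; first by move=> B /bE [u [v [-> _ _]]]; exists u, v.
split.
  by move=> c la B /bE [u [v [-> uB Bv]]]; rewrite la uB (setIidPl Bv).
rewrite -qt_sum; apply: (@qt_ext R L (fun i j => dist (inr i : node Tl) (inr j))) => i j _.
have el (x y : node Tl) : edge_len x y = edge_len y x by case: x y => [u|k] [v|k'] //=; rewrite ls.
rewrite (dist_rooted Trt) //.
rewrite big_mkcond big_sumType /= [X in _ + X]big1 ?addr0; last by move=> k _; case: ifP.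
transitivity (\sum_(B in Sp r S) if B == U r then 0 else b B * cutd R B i j).
  rewrite [RHS]big_sub; apply: eq_bigr => v _; rewrite inE !lam_ancE.
  have -> : b (val v) = edge_len (inl v : node Tl) (lpar (inl v)).
    by rewrite /b; have -> : to_vert (val v) = inl v by rewrite (to_vertE (valP v)); congr inl; exact: val_inj.
  rewrite /cutd /=; case: (sval v == U r) => /=; first by case: ifP.
  by case: (i \in sval v); case: (j \in sval v); rewrite /= ?mulr1 ?mulr0.
rewrite big_setU1 ?(UnS lS) //= eqxx add0r; apply: eq_bigr => B BS.
by rewrite (negbTE (_ : B != U r)) //; apply: contra (UnS lS) => /eqP <-.
Qed.

End TreeOfLaminar.

(** * Combinatorial types and the cones of the fan *)

Section MarkedTrees.
Variables (R : realType) (L : finType) (r : L).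
Hypothesis L3 : (2 < #|L|)%N.
Implicit Types (G : marked_tree R L) (S : {set {set L}}) (b : {set L} -> R).

Definition Scl G : {set {set L}} := [set cl (G := G) r v | v in [pred v | ~~ itop (G := G) r v]]%SET.

Lemma Scl_lam G : laminar r (Scl G).
Proof.
apply/lamP; split=> [A /imsetP [v vt ->]|A B /imsetP [u _ ->] /imsetP [v _ ->]]; last exact: cl_compat.
by rewrite /clus cl_root card_cl card_clC.
Qed.

Lemma cl_Scl G v : (cl (G := G) r v \in Scl G) = ~~ itop (G := G) r v.
Proof.
apply/imsetP/idP => [[u ut /cl_inj ->]|vt]; first exact: ut.
by exists v.
Qed.

Lemma Scl_sum G (V : nmodType) (F : {set L} -> V) :
  \sum_(A in Scl G) F A = \sum_(v | ~~ itop (G := G) r v) F (cl r v).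
Proof. by rewrite big_imset //= => u v _ _ /cl_inj. Qed.

Lemma with_lenE (G : pretree R L) : with_len (@len R L G) = G. Proof. by case: G. Qed.

Lemma len_sym G u v : adj (inl u : node G) (inl v) -> len u v = len v u.
Proof. by have [_ _ _ _ h] := tree_valid G; case/h. Qed.

Lemma pt0_tree G : pt0 G = \sum_(v | ~~ itop (G := G) r v) len v (pv r v) *: vsplit R (cl r v).
Proof. by rewrite -{1}[tree_data G]with_lenE (pt0_cl r (@len_sym G)). Qed.

Lemma pv_adj G v : ~~ itop (G := G) r v -> adj (inl v : node G) (inl (pv r v)).
Proof. by move=> vt; rewrite -(pvP vt); have [] := r_par (tree_rooted (inr r)) (vert_root r v). Qed.

Lemma cl_pv G v : ~~ itop (G := G) r v -> cl r v \subset cl r (pv r v).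
Proof.
move=> vt; apply: anc_cl; rewrite -(pvP vt).
exact: par_anc (tree_rooted (inr r)) _ (vert_root r v).
Qed.

Lemma pt0_pos G : exists b, (forall A, A \in Scl G -> 0 < b A) /\
  pt0 G = \sum_(A in Scl G) b A *: vsplit R A.
Proof.
pose b A := \sum_(v | cl (G := G) r v == A) len v (pv r v).
have bE (v : vert G) : b (cl r v) = len v (pv r v).
  rewrite /b (bigD1 v) //= big1 ?addr0 // => u /andP [/eqP /cl_inj -> ].
  by rewrite eqxx.
exists b; split=> [A /imsetP [v vt ->]|].
  by rewrite bE; have [_ _ _ _ h] := tree_valid G; have [] := h _ _ (pv_adj vt).
by rewrite Scl_sum pt0_tree; apply: eq_bigr => v _; rewrite bE.
Qed.

Definition cone_of S : set 'rV[R]_(qdim R L) :=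
  [set y | exists b, (forall A, A \in S -> 0 <= b A) /\ y = \sum_(A in S) b A *: vsplit R A].

Lemma cone_cl G : cone G = cone_of (Scl G).
Proof.
apply/seteqP; split=> y.
  move=> [l [l0 ->]]; pose b A := \sum_(v | cl (G := G) r v == A) l v (pv r v).
  have bE (v : vert G) : b (cl r v) = l v (pv r v).
    rewrite /b (bigD1 v) //= big1 ?addr0 // => u /andP [/eqP /cl_inj -> ].
    by rewrite eqxx.
  exists b; split=> [A /imsetP [v vt ->]|]; first by rewrite bE; case: (l0 v (pv r v)).
  rewrite (pt0_cl r) ?Scl_sum; last by move=> u v _; case: (l0 u v).
  by apply: eq_bigr => v _; rewrite bE.
(* [cone] asks for nonnegative lengths on all pairs of vertices, adjacent or not, hence the maximum
   with 0. *)
move=> [b [b0 ->]]; pose l (u v : vert G) := Num.max 0 (b (cl (G := G) r u :&: cl (G := G) r v)).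
have ls u v : l u v = l v u by rewrite /l setIC.
exists l; split=> [u v|]; first by rewrite ls le_max lexx.
rewrite (pt0_cl r) // Scl_sum; apply: eq_bigr => v vt.
rewrite /l (setIidPl (cl_pv vt)) max_r // b0 //.
by rewrite cl_Scl.
Qed.

Lemma cone_lam S (lS : laminar r S) (a : {set L} -> R) (a0 : forall B, B \in S -> 0 < a B) :
  cone (tree_of_lam r S a) = cone_of S.
Proof.
apply/seteqP; split=> y.
  move=> [l [l0 ->]]; have [|b [b1 [_ ->]]] := lam_pt0 a lS L3 (l := l).
    by move=> u v; case: (l0 u v).
  by exists b; split=> // A /b1 [u [v ->]]; case: (l0 u v).
move=> [c [c0 ->]]; pose l (u v : lvert r S) := Num.max 0 (c (val u :&: val v)).
have ls u v : l u v = l v u by rewrite /l setIC.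
exists l; split=> [u v|]; first by rewrite ls le_max lexx.
have [b [_ [b2 ->]]] := lam_pt0 a lS L3 ls.
apply: eq_bigr => A AS; rewrite (b2 (fun A => Num.max 0 (c A))) // max_r //.
exact: c0.
Qed.

Lemma pt0_lam S (lS : laminar r S) (a : {set L} -> R) (a0 : forall B, B \in S -> 0 < a B) :
  pt0 (tree_of_lam r S a) = \sum_(B in S) a B *: vsplit R B.
Proof.
have [|b [_ [b2 e]]] := lam_pt0 a lS L3 (l := fun u v => a (val u :&: val v)).
  by move=> u v; rewrite setIC.
by rewrite -[LHS]/(pt0 (with_len (G := tree_of_lam r S a) (fun u v => a (val u :&: val v)))) e;
  apply: eq_bigr => B BS; rewrite (b2 a).
Qed.

Notation P0 := (P (@vsplit R L) set0 (laminar r) [::]).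
Notation inM0 := (inM (@vsplit R L) set0 (laminar r)).
Notation supp0 := (supp (@vsplit R L) set0 (laminar r)).
Let F0 := lam_fan r R L3.

Lemma P0_cone x : inM0 x -> P0 x = cone_of (supp0 x).
Proof.
move=> xM; apply/seteqP; split=> y.
  move=> [yM yx _]; have [_ {1}->] := crdP F0 yM; set c := crd _ _ _ _ y.
  exists c; split=> [A _|]; first by apply: crd_ge0 F0 _ _ yM _; rewrite in_set0.
  rewrite /comb [RHS](bigID (mem (supp0 y))) /= [X in _ + X]big1 ?addr0; last first.
    by move=> A /andP [_ Ay]; rewrite /c /crd (negbTE Ay) scale0r.
  by apply: eq_bigl => A; have [/(subsetP yx) ->|] := boolP (A \in supp0 y); rewrite ?andbF.
move=> [b [b0 ye]].
have [|yM yS] := inM_comb F0 (sup_good xM) _ ye.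
  by move=> A; rewrite setD0; exact: b0.
split=> //; rewrite yS; apply/subsetP => A; rewrite !inE => /andP [] //.
Qed.

Lemma M0_cells : cells (M0 R L) = [set s | exists2 x, inM0 x & s = P0 x].
Proof.
apply/seteqP; split=> s.
  move=> [G ->]; rewrite cone_cl; pose x := \sum_(A in Scl G) (1 : R) *: vsplit R A.
  have [||xM xS] := sup_eq F0 (S := Scl G) (a := fun=> 1) (x := x) (Scl_lam G) => //.
  by rewrite /=; exists x => //; rewrite P0_cone // xS.
move=> [x xM ->]; have lS := sup_good xM.
have a0 : forall B, B \in supp0 x -> 0 < (fun=> 1 : R) B by move=> B _; exact: ltr01.
exists (MarkedTree (tree_of_lamP lS L3 a0)).
by rewrite P0_cone // -(cone_lam lS a0).
Qed.

End MarkedTrees.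

(** * The product of a fan with a vector space *)

Section LiftFan.
Local Open Scope set_scope.
Variables (R : realType) (m N p : nat) (Lam : set 'rV[R]_m).
Variables (J : finType) (q : J -> 'rV[R]_m) (good : {set J} -> bool).
Hypothesis F : fan N Lam q set0 good.
Local Notation JL := (J + 'I_p)%type.

Definition ql (x : JL) : 'rV[R]_(m + p) :=
  match x with inl A => row_mx (q A) 0 | inr k => row_mx 0 (delta_mx 0 k) end.

Definition Jl : {set JL} := [set x | if x is inr _ then true else false].

Definition prj (S : {set JL}) : {set J} := [set A | inl A \in S].

Definition goodl (S : {set JL}) := (Jl \subset S) && good (prj S).

Definition laml : set 'rV[R]_(m + p) :=
  [set x | Lam (lsubmx x) /\ forall k, rsubmx x 0 k \is a Num.int].

Lemma pairing_row (u : 'rV[R]_m) (v : 'rV[R]_p) f g :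
  pairing (row_mx u v) (col_mx f g) = pairing u f + pairing v g.
Proof. by rewrite /pairing mul_row_col mxE. Qed.

Lemma comb_lift (S : {set JL}) (a : JL -> R) :
  comb ql S a = row_mx (comb q (prj S) (a \o inl)) (\row_k (if inr k \in S then a (inr k) else 0)).
Proof.
rewrite -[LHS]hsubmxK /comb !linear_sum /=; congr row_mx.
  rewrite big_mkcond big_sumType /= [X in _ + X]big1 ?addr0 => [|k _]; last first.
    by rewrite linearZ /= row_mxKl scaler0 if_same.
  rewrite -big_mkcond; apply: eq_big => [A|A _]; first by rewrite inE.
  by rewrite linearZ /= row_mxKl.
rewrite big_mkcond big_sumType /= [X in X + _]big1 ?add0r => [|k _]; last first.
  by rewrite linearZ /= row_mxKr scaler0 if_same.
apply/rowP => k; rewrite summxE (bigD1 k) //= big1 ?addr0 => [|j jk].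
  by rewrite linearZ /= row_mxKr; case: ifP => kS; rewrite !mxE kS ?eqxx ?mulr1.
by rewrite linearZ /= row_mxKr; case: ifP => _; rewrite !mxE // eqxx eq_sym (negbTE jk) mulr0.
Qed.

Lemma Jl_in k : inr k \in Jl. Proof. by rewrite inE. Qed.

Lemma goodl_in S k : goodl S -> inr k \in S.
Proof. by case/andP => /subsetP h _; apply: h; exact: Jl_in. Qed.

Lemma prj_inj S T : goodl S -> goodl T -> prj S = prj T -> S = T.
Proof.
move=> gS gT e; apply/setP => -[A|k]; last by rewrite !goodl_in.
by have := congr1 (fun X : {set J} => A \in X) e; rewrite !inE.
Qed.

Lemma card_prj S : goodl S -> #|S| = (#|prj S| + p)%N.
Proof.
move=> gS; rewrite -sum1_card big_mkcond big_sumType /= -!big_mkcond -[#|prj S|]sum1_card; congr addn.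
  by apply: eq_bigl => A; rewrite inE.
rewrite (eq_bigl xpredT); first by rewrite sum1_card card_ord.
by move=> k; exact: goodl_in.
Qed.

Definition lift_set (S : {set J}) : {set JL} := Jl :|: [set inl A | A in S].

Lemma lift_setK S : prj (lift_set S) = S.
Proof.
apply/setP => A; rewrite !inE /=; apply/imsetP/idP => [[B BS [->]] //|AS].
by exists A.
Qed.

Lemma goodl_lift S : goodl (lift_set S) = good S.
Proof. by rewrite /goodl lift_setK subsetUl. Qed.

Lemma lift_fan : fan (N + p) laml ql Jl goodl.
Proof.
have prjS (S T : {set JL}) : T \subset S -> prj T \subset prj S.
  by move=> /subsetP h; apply/subsetP => A; rewrite !inE; exact: h.
split.
- by move=> S /andP [].
- rewrite /goodl subxx /=; have -> : prj Jl = set0 by apply/setP => A; rewrite !inE.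
  exact: fan_zero F.
- move=> S T JT TS /andP [_ gS]; rewrite /goodl JT /=.
  by apply: (fan_down F _ (prjS _ _ TS)) => //; rewrite sub0set.
- by move=> S gS; rewrite (card_prj gS) leq_add2r; apply: (fan_dim F); case/andP: gS.
- move=> S [A|k] gS AS.
    have [_ gP] := andP gS; have AP : A \in prj S by rewrite inE.
    have [f f1 f2] := fan_dual F gP AP; exists (col_mx f 0).
      by move=> w [w1 w2]; rewrite -[w]hsubmxK pairing_row [X in _ + X]pairing0r addr0; exact: f1.
    move=> [B|k] BS; rewrite /= pairing_row [X in _ + X]pairing0r addr0; last exact: pairing0l.
    by rewrite f2 // inE.
  exists (col_mx 0 (delta_mx k 0)).
    move=> w [w1 w2]; rewrite -[w]hsubmxK pairing_row [X in X + _]pairing0r add0r.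
    rewrite /pairing mxE (bigD1 k) //= big1 ?addr0 ?mxE ?eqxx ?mulr1 // => [|j jk]; first by have := w2 k; rewrite !mxE.
    by rewrite !mxE (negbTE jk) mulr0.
  move=> [B|j] BS; rewrite /= pairing_row [X in X + _]pairing0r add0r; first exact: pairing0l.
  rewrite /pairing mul_delta_mx_cond; case: (eqVneq j k) => [->|ne]; first by rewrite eqxx mulr1n mxE !eqxx.
  by rewrite mulr0n mxE; case: eqVneq => // -[e]; rewrite e eqxx in ne.
- move=> S [A|k] gS AS /=.
    split=> [|k]; rewrite ?row_mxKl ?row_mxKr ?mxE //.
    by apply: (fan_lat F (S := prj S)); [case/andP: gS|rewrite inE].
  split=> [|j]; rewrite ?row_mxKl ?row_mxKr; first exact: fan_lat0 F.
  by rewrite mxE intr_nat.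
- by split=> [|k]; rewrite ?linear0 ?mxE //; exact: fan_lat0 F.
- move=> x y [x1 x2] [y1 y2]; split=> [|k]; rewrite linearB /=; first exact: fan_latB F _ _ _ _.
  by rewrite !mxE; have := x2 k; have := y2 k; rewrite !mxE => h1 h2; exact: rpredB.
- move=> S T a b gS gT pa pb; rewrite !comb_lift => /eq_row_mx [e _]; apply: prj_inj => //.
  have [_ gS'] := andP gS; have [_ gT'] := andP gT.
  apply: (fan_uniq F gS' gT' _ _ e) => A; rewrite setD0 inE => AS.
    by apply: pa; rewrite !inE.
  by apply: pb; rewrite !inE.
- move=> T gT cT; have [_ gT'] := andP gT.
  have c' : #|prj T|.+1 = N by move: cT; rewrite (card_prj gT) -addSn => /addIn.
  have [a aE] := fan_bal F gT' c'.
  exists (fun x => if x is inl A then a A else 0); rewrite comb_lift.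
  rewrite [X in row_mx _ X](_ : _ = 0); last by apply/rowP => k; rewrite !mxE if_same.
  rewrite (_ : comb q _ _ = comb q (prj T) a) // -aE.
  rewrite big_mkcond big_sumType /= -!big_mkcond /= [X in _ + X]big_pred0 ?addr0; last first.
    by move=> k; rewrite goodl_in.
  rewrite (eq_bigl (fun A => (A \notin prj T) && good (A |: prj T))); last first.
    move=> A; rewrite inE; congr (_ && _); rewrite /goodl.
    have -> : prj (inl A |: T) = A |: prj T by apply/setP => B; rewrite !inE.
    by case/andP: gT => JT _; rewrite (subset_trans JT (subsetUr _ _)).
  elim/big_rec2: _ => [|A x y _ ->]; first by rewrite row_mx0.
  by rewrite add_row_mx addr0.
Qed.

Notation inMl := (inM ql Jl goodl).
Notation suppl := (supp ql Jl goodl).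

Lemma inM_lift x : inM q set0 good (lsubmx x) ->
  inMl x /\ suppl x = lift_set (supp q set0 good (lsubmx x)).
Proof.
move=> xM; have [pc xc] := crdP F xM; set c := crd _ _ _ _ (lsubmx x) in pc xc.
apply: (sup_eq lift_fan (a := fun y => match y with inl A => c A | inr k => rsubmx x 0 k end)).
- by rewrite goodl_lift; exact: sup_good.
- move=> [A|k]; rewrite !inE //= => /imsetP [B BS [->]].
  by apply: pc; rewrite setD0.
- rewrite comb_lift lift_setK -[LHS]hsubmxK; congr row_mx; first exact: xc.
  by apply/rowP => k; rewrite !mxE !inE /=.
Qed.

Lemma inM_proj x : inMl x -> inM q set0 good (lsubmx x).
Proof.
move=> xM; have [pc xc] := crdP lift_fan xM; have /andP [_ gS] := sup_good xM.
have [] // := sup_eq F (x := lsubmx x) gS (a := crd laml ql Jl goodl x \o inl).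
  by move=> A; rewrite setD0 inE => AS; apply: pc; rewrite !inE.
by rewrite {1}xc comb_lift row_mxKl.
Qed.

Lemma prj_supp x : inMl x -> prj (suppl x) = supp q set0 good (lsubmx x).
Proof. by move=> /inM_proj /inM_lift [_ ->]; rewrite lift_setK. Qed.

Lemma P_lift x : inMl x -> P ql Jl goodl [::] x =
  [set y | P q set0 good [::] (lsubmx x) (lsubmx y)]%classic.
Proof.
move=> xM; apply/seteqP; split=> y /=.
  move=> [yM yx _]; split=> //; first exact: inM_proj.
  rewrite -!prj_supp //; apply/subsetP => A; rewrite !inE; exact: (subsetP yx).
move=> [yM yx _]; have [yM' ys] := inM_lift yM; have [_ xs] := inM_lift (inM_proj xM).
split=> //; rewrite ys xs.
by apply: setUS; exact: imsetS.
Qed.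

End LiftFan.

Lemma anc_eq (X : finType) (par : X -> X) (rk : X -> nat) x y :
  anc par rk x y -> (rk y <= rk x)%N -> x = y.
Proof. by rewrite /anc -subn_eq0 => /andP [_ /eqP e] /eqP s; rewrite s in e. Qed.

Lemma no_SS (n : nat) : n <> n.+2. Proof. by elim: n => // n IH [] /IH. Qed.

Lemma nx_par (X : finType) (e : rel X) root par rk x c y : rooted e root par rk ->
  c != root -> par c = x -> anc par rk c y -> nx par rk x y = c.
Proof.
move=> T cr cx cy; have xc : anc par rk x c by rewrite -cx; exact: par_anc T _ cr.
have xy := anc_trans T xc cy.
have low d : par d = x -> d != root -> ~~ anc par rk d x.
  by move=> dx dr; rewrite -dx (anc_par_self T dr).
have ne : x != y.
  by apply: contraTneq cy => <-; exact: low.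
have [nr nx_x ny] := nx_down T xy ne; set n := nx _ _ _ _ in nr nx_x ny *.
case/orP: (anc_total T ny cy) => h.
  by move: h; rewrite (anc_par T) // cx (negbTE (low n nx_x nr)) orbF => /eqP.
by move: h; rewrite (anc_par T) // nx_x (negbTE (low c cx cr)) orbF => /eqP.
Qed.

(** * Forgetful maps *)

Section Forgetful.
Local Open Scope set_scope.
Variables (R : realType) (L K : finType) (b : K -> L) (k0 : K) (G : marked_tree R L).
Hypothesis bI : injective b.
Notation root := (inr (b k0) : node G).
Notation par := (gpar root).
Notation rk := (grk root).
Let T : rooted (@adj R L G) root par rk := tree_rooted root.
Notation anG := (anc par rk).
Notation kids := (kids (G := G) (b k0)).
Notation FT := (ft b G).
Notation fn := (@ft_node R L K b G).
Implicit Types (v u : vert G) (c : node G) (x y z : node FT) (k : K).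

Lemma kids_nx v c (y : node G) : c \in kids v -> anG c y -> nx par rk (inl v) y = c.
Proof.
move=> cv cy; have vy : anG (inl v) y := anc_trans T (kid_anc cv) cy.
have ne : inl v != y.
  apply/eqP => e; subst y; have := anc_anti cy (kid_anc cv) => e.
  move: cv; rewrite e inE => /andP [_ /eqP p].
  by have [_] := r_par T (vert_root (b k0) v); rewrite p => /eqP; rewrite -addn1 -{1}[grk _ _]addn0 eqn_add2l.
have [n1 n2 n3] := nx_down T vy ne; apply: (kids_disj (v := v) _ cv n3 cy).
by rewrite inE n1 n2 eqxx.
Qed.

Lemma kid_par v c : c \in kids v -> c != par (inl v).
Proof.
rewrite inE => /andP [dr /eqP pd]; apply/eqP => e.
have [_ h1] := r_par T dr; have [_ h2] := r_par T (vert_root (b k0) v).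
by move: h2; rewrite -e h1 pd => /eqP; rewrite -addn2 -{1}[grk _ _]addn0 eqn_add2l.
Qed.

Lemma nx_kid v (y : node G) : anG (inl v) y -> inl v != y ->
  nx par rk (inl v) y \in kids v /\ anG (nx par rk (inl v) y) y.
Proof.
by move=> vy ne; have [n1 n2 n3] := nx_down T vy ne; rewrite inE n1 n2 eqxx.
Qed.

Lemma kid_above v c (y : node G) : c \in kids v -> y = inl v -> anG c y = false.
Proof.
move=> cv ->; apply/negP => h; have e := anc_anti h (kid_anc cv).
move: cv; rewrite e inE => /andP [_ /eqP p].
by have [_] := r_par T (vert_root (b k0) v); rewrite p => /eqP; rewrite -addn1 -{1}[grk _ _]addn0 eqn_add2l.
Qed.

Lemma top_anc v (y : node G) : itop (G := G) (b k0) v -> y != root -> anG (inl v) y.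
Proof.
move=> vt yr; have [i yi] := leaf_below (b k0) y.
have ir : i != b k0 by apply: contra yr => /eqP e; move: yi; rewrite e (anc_root T).
have vi : anG (inl v) (inr i).
  by have := cl_top vt; move/setP/(_ i); rewrite !inE ir.
case/orP: (anc_total T vi yi) => // yv; move: yv.
rewrite (anc_par T) ?vert_root // (eqP vt) (anc_root T) (negbTE yr) orbF.
by move/eqP => ->; exact: anc_refl _ _ _.
Qed.

(** The deepest vertex above both nodes: if both were below the same kid, this kid would be deeper,
    or an end equal to both. *)
Lemma lca (x y : node G) : x != root -> y != root -> ~~ anG x y -> ~~ anG y x ->
  exists v c c', [/\ c \in kids v, c' \in kids v, c != c', anG c x & anG c' y].
Proof.
move=> xr yr nxy nyx; have [t tt] := top_ex G (b k0).
have h0 : anG (inl t) x && anG (inl t) y by rewrite !top_anc.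
pose v := [arg max_(v > t | anG (inl v) x && anG (inl v) y) rk (inl v : node G)].
have [/andP [vx vy] mx] : anG (inl v) x && anG (inl v) y /\
    forall u, anG (inl u) x && anG (inl u) y -> (rk (inl u : node G) <= rk (inl v : node G))%N.
  by rewrite /v; case: arg_maxnP.
have [|c cv cx] := kid_toward vx; first by apply: contra nxy => /eqP ->.
have [|c' cv' cy] := kid_toward vy; first by apply: contra nyx => /eqP ->.
exists v, c, c'; split=> //; apply/eqP => e; subst c'.
have cr : c != root by move: cv; rewrite inE => /andP [].
case: c cv cv' cx cy cr => [u|i] cv _ cx cy cr.
  have := mx u; rewrite cx cy => /(_ isT).
  have [_] := r_par T (vert_root (b k0) u); move: cv; rewrite inE => /andP [_ /eqP ->] ->.
  by rewrite ltnn.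
have ir : i != b k0 by apply: contra cr => /eqP ->.
have ex := leaf_anc ir cx; have ey := leaf_anc ir cy; move: nxy; rewrite ex ey.
by rewrite anc_refl.
Qed.

Lemma branchE v i : branch (inl v : node G) (inr i) = nx par rk (inl v) (inr i).
Proof. by rewrite (branch_nx T). Qed.

(** The root is itself a retained end, so the upward branch always counts; a vertex remains if in
    addition two of its kids lead to retained ends. *)
Lemma remainsP v : reflect (exists k k' c c', [/\ c \in kids v, c' \in kids v, c != c',
    anG c (inr (b k)) & anG c' (inr (b k'))]) (remains b v).
Proof.
rewrite /remains; set I := [set _ | _ in _]; have br k : nx par rk (inl v) (inr (b k)) \in I.
  by rewrite -branchE; exact: imset_f.
have pE : nx par rk (inl v) root = par (inl v).
  by have [] // := @nx_up _ _ _ _ _ T (inl v) root; rewrite (anc_root T).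
have pI : par (inl v) \in I by rewrite -pE br.
have dn (y : node G) : y \in I -> y != par (inl v) -> exists k, y \in kids v /\ anG y (inr (b k)).
  case/imsetP => k _ ->; rewrite branchE => np; exists k.
  case vk : (anG (inl v) (inr (b k))); last first.
    by have [e _] := nx_up T vk; rewrite e eqxx in np.
  by have [n1 n2 n3] := nx_down T vk isT; rewrite inE n1 n2 eqxx.
apply: (iffP idP) => [I3|[k [k' [c [c' [cv cv' cc ck ck']]]]]].
  have : (1 < #|I :\ par (inl v)|)%N by move: I3; rewrite (cardsD1 (par (inl v))) pI.
  case/card_gt1P => c [c' [/setD1P [cp cI] /setD1P [cp' cI'] cc]].
  have [k [cv ck]] := dn c cI cp; have [k' [cv' ck']] := dn c' cI' cp'.
  by exists k, k', c, c'.
have cI : c \in I by rewrite -(kids_nx cv ck) br.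
have cI' : c' \in I by rewrite -(kids_nx cv' ck') br.
have : [set par (inl v); c; c'] \subset I by rewrite !subUset !sub1set pI cI cI'.
move/subset_leq_card; apply: leq_trans.
by rewrite -setUA !cardsU1 cards1 !inE negb_or ![par _ == _]eq_sym !(@kid_par v) // cc.
Qed.

Lemma fn_inj : injective fn.
Proof. by move=> [u|k] [v|k'] //= [] e; [congr inl; exact: val_inj|congr inr; exact: bI]. Qed.

Lemma fn_end x : exists k, anG (fn x) (inr (b k)).
Proof.
case: x => [v|k] /=; last by exists k; exact: anc_refl _ _ _.
have /remainsP [k [_ [c [_ [cv _ _ ck _]]]]] := valP v.
by exists k; refine (anc_trans T (kid_anc cv) ck).
Qed.

Definition froot : node FT := inr k0.

Lemma fn_root x : (fn x == root) = (x == froot).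
Proof. by rewrite -[root]/(fn froot) (inj_eq fn_inj). Qed.

Definition fsub y x := anG (fn y) (fn x) && (y != x).

(** The lowest retained node strictly above x. *)
Definition fpar x := if x == froot then froot else [arg max_(y > froot | fsub y x) rk (fn y)].

Definition frk x := #|[set y | fsub y x]|.

Lemma fparP x : x != froot -> fsub (fpar x) x /\ forall y, fsub y x -> anG (fn y) (fn (fpar x)).
Proof.
move=> xr; rewrite /fpar (negbTE xr).
have h0 : fsub froot x by rewrite /fsub (root_anc T) eq_sym.
case: arg_maxnP => // p ps mx; split=> // y ys.
have /andP [py _] := ps; have /andP [yx _] := ys.
case/orP: (anc_total T py yx) => // h.
by rewrite (anc_eq h (mx y ys)); exact: anc_refl.
Qed.

Lemma frk_par x : x != froot -> frk x = (frk (fpar x)).+1.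
Proof.
move=> xr; have [/andP [px pn] mx] := fparP xr; rewrite /frk.
have -> : [set y | fsub y x] = fpar x |: [set y | fsub y (fpar x)].
  apply/setP => y; rewrite !inE; apply/idP/orP => [ys|[/eqP ->|/andP [yp yn]]].
  - by have [->|ne] := eqVneq y (fpar x); [left|right; rewrite /fsub mx].
  - by rewrite /fsub px.
  rewrite /fsub (anc_trans T yp px) /=; apply: contra yn => /eqP e; subst y.
  by apply/eqP/fn_inj; exact: anc_anti yp px.
by rewrite cardsU1 inE /fsub eqxx andbF.
Qed.

Lemma fsub_vert y z : fsub y z -> y != froot -> exists u : ft_vert b G, y = inl u.
Proof.
case: y => [u|k] h yr; first by exists u.
case/andP: h => h ne; case/eqP: ne; apply: fn_inj; apply/esym/(leaf_anc _ h).
by rewrite (inj_eq bI); apply: contra yr => /eqP ->.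
Qed.

Lemma fpar_eq x y : x != y -> anG (fn x) (fn y) ->
  (forall u : ft_vert b G, fsub x (inl u) -> fsub (inl u) y -> false) -> fpar y = x.
Proof.
move=> xy axy none; have yr : y != froot.
  apply/eqP => e; move: axy; rewrite e /= (anc_root T) fn_root => /eqP e'.
  by rewrite e e' eqxx in xy.
have [ps mx] := fparP yr; have xs : fsub x y by rewrite /fsub axy.
have xp := mx x xs; apply/eqP; rewrite eq_sym; apply: contraT => ne.
have xp' : fsub x (fpar y) by rewrite /fsub xp.
have [|u pu] := fsub_vert ps; last by rewrite pu in xp' ps; rewrite (none u).
apply/eqP => pr; case/andP: xp'; rewrite pr /= (anc_root T) fn_root => /eqP ->.
by rewrite eqxx.
Qed.

(** Between a node and an ancestor, adjacency in [ft] says that no remaining vertex lies strictly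
    between them, so that the ancestor is [fpar]. The path between incomparable nodes passes through
    their lowest common ancestor, which remains and blocks it. *)
Lemma ft_adjE x y : adj x y = (x != froot) && (y == fpar x) || (y != froot) && (x == fpar y).
Proof.
have [->|xy] := eqVneq x y.
  rewrite /= eqxx /=; have [//|yr] := eqVneq y froot; rewrite orbb /=.
  by apply/esym/eqP => e; have [/andP [_]] := fparP yr; rewrite -e eqxx.
have sp := geodP T (fn x) (fn y); have nf : fn x != fn y by rewrite (inj_eq fn_inj).
have notr z w : anG (fn z) (fn w) -> z != w -> w != froot.
  move=> h ne; apply/eqP => e; move: h; rewrite e /= (anc_root T) fn_root => /eqP e'.
  by rewrite e e' eqxx in ne.
have [axy|nxy] := boolP (anG (fn x) (fn y)).
  have yr := notr _ _ axy xy; have -> : (y == fpar x) = false.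
    have [e|xr] := eqVneq x froot; first by rewrite e /fpar eqxx (negbTE yr).
    apply/negP => /eqP e; have [/andP [h _] _] := fparP xr.
    rewrite -e in h; by case/eqP: nf; exact: anc_anti axy h.
  rewrite andbF /= yr /= xy /=; apply/allP/eqP => [h|e z zp].
    apply/esym/fpar_eq => // u /andP [h1 n1] /andP [h2 n2].
    have : fn (inl u) \in geod (fn x) (fn y).
      have := spath_down T (fn (inl u)) axy sp; rewrite h1 h2 in_cons (inj_eq fn_inj) [_ == x]eq_sym.
      by rewrite (negbTE n1).
    by move/h; rewrite (inj_eq fn_inj) (negbTE n2) /= (valP u).
  have := spath_down T z axy sp; rewrite in_cons zp orbT => /esym /andP [h1 h2].
  have [//|zy] := eqVneq z (fn y); rewrite /=; case: z zp h1 h2 zy => // u up h1 h2 uy.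
  apply/negP => ru; pose w : node FT := inl (exist _ u ru : ft_vert b G).
  have wy : fsub w y by rewrite /fsub h2 /=; apply: contra uy => /eqP <-.
  have [_ mx] := fparP yr; have := mx w wy; rewrite -e => h3.
  have [_ _ /andP [xn _]] := sp; case/negP: xn.
  exact: (eq_ind_r (fun t => t \in _) up (anc_anti h1 h3)).
have [ayx|nyx] := boolP (anG (fn y) (fn x)).
  have yx : y != x by rewrite eq_sym.
  have xr := notr _ _ ayx yx; have -> : (x == fpar y) = false.
    have [e|yr] := eqVneq y froot; first by rewrite e /fpar eqxx (negbTE xr).
    apply/negP => /eqP e; have [/andP [h _] _] := fparP yr.
    rewrite -e in h; by case/eqP: nf; exact: anc_anti h ayx.
  rewrite andbF orbF /= xr /= xy /=; apply/allP/eqP => [h|e z zp].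
    apply/esym/fpar_eq => // u /andP [h1 n1] /andP [h2 n2].
    have : fn (inl u) \in geod (fn x) (fn y).
      have := spath_up T (fn (inl u)) ayx sp; rewrite h1 h2 in_cons (inj_eq fn_inj).
      by rewrite (negbTE n2).
    by move/h; rewrite (inj_eq fn_inj) [_ == y]eq_sym (negbTE n1) /= (valP u).
  have := spath_up T z ayx sp; rewrite in_cons zp orbT => /esym /andP [h1 h2].
  have [//|zy] := eqVneq z (fn y); rewrite /=; case: z zp h1 h2 zy => // u up h1 h2 uy.
  apply/negP => ru; pose w : node FT := inl (exist _ u ru : ft_vert b G).
  have wx : fsub w x.
    rewrite /fsub h2 /=; apply/eqP => e'; have [_ _ /andP [xn _]] := sp; case/negP: xn.
    exact: (eq_ind_r (fun t => t \in _) up (congr1 fn (esym e'))).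
  have [_ mx] := fparP xr; have := mx w wx; rewrite -e => h3.
  by case/eqP: uy; exact: anc_anti h3 h1.
have nr z w : ~~ anG (fn z) (fn w) -> fn z != root.
  by apply: contra => /eqP ->; exact: root_anc T _.
have [v [c [c' [cv cv' cc cx cy]]]] := lca (nr _ _ nxy) (nr _ _ nyx) nxy nyx.
have [k xk] := fn_end x; have [k' yk] := fn_end y.
have rv : remains b v.
  apply/remainsP; exists k, k', c, c'; split=> //; [refine (anc_trans T cx xk)|refine (anc_trans T cy yk)].
have -> : adj x y = false.
  rewrite /= xy /=; apply/negP => /allP h.
  have vx := anc_trans T (kid_anc cv) cx; have vy := anc_trans T (kid_anc cv') cy.
  have low (u : node G) : anG u (fn x) -> anG u (fn y) -> anG u (inl v).
    move=> ux uy; case/orP: (anc_total T ux vx) => // vu.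
    have [<-|ne] := eqVneq (inl v) u; first exact: anc_refl.
    have [|d dv du] := kid_toward vu; first by rewrite eq_sym.
    case/eqP: cc; rewrite -(kids_disj dv cv (anc_trans T du ux) cx).
    exact: kids_disj dv cv' (anc_trans T du uy) cy.
  have := spath_meet T sp vx vy low; rewrite in_cons; case/orP.
  - by move/eqP => e; move: nxy; rewrite -e vy.
  - by move/h; rewrite rv orbF => /eqP e; move: nyx; rewrite -e vx.
symmetry; apply/negP => /orP [/andP [xr /eqP e]|/andP [yr /eqP e]].
  by have [/andP [h _] _] := fparP xr; rewrite -e in h; rewrite h in nyx.
by have [/andP [h _] _] := fparP yr; rewrite -e in h; rewrite h in nxy.
Qed.

Lemma ft_rooted : rooted (@adj R K FT) froot fpar frk.
Proof.
split=> [x y||x xr|x y].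
- by rewrite !ft_adjE orbC.
- apply/eqP; rewrite cards_eq0; apply/eqP/setP => y; rewrite !inE /fsub /= (anc_root T) fn_root.
  by case: eqVneq => //= _; rewrite andbF.
- by rewrite ft_adjE xr eqxx frk_par.
- by rewrite ft_adjE => /orP [] /andP [h /eqP ->]; [left|right].
Qed.

Lemma ft_anc x y : anc fpar frk x y = anG (fn x) (fn y).
Proof.
move: y; apply: (tree_ind ft_rooted) => [|y yr IH].
  by rewrite (anc_root ft_rooted) /= (anc_root T) fn_root.
rewrite (anc_par ft_rooted) // IH; have [/andP [py pn] mx] := fparP yr.
apply/orP/idP => [[/eqP ->|h]|h]; first exact: anc_refl _ _ _.
  refine (anc_trans T h py).
have [->|ne] := eqVneq x y; [by left|right].
by apply: mx; rewrite /fsub h.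
Qed.

(** Neighbours of v correspond to the branches at v with a retained end. Two neighbours in one
    downward branch would have a remaining vertex above them in that branch, so one of them could
    not have v as parent. *)
Lemma ft_valence (v : ft_vert b G) :
  valence (v : vert FT) = #|[set branch (inl (val v) : node G) (inr (b k)) | k : K]|.
Proof.
set I := [set _ | _ in _]; pose phi (y : node FT) := nx par rk (inl (val v)) (fn y).
pose N := [set y : node FT | adj (inl v : node FT) y].
have vr : inl v != froot by [].
have NE (y : node FT) : (y \in N) = (y == fpar (inl v)) || (y != froot) && (inl v == fpar y).
  by rewrite inE ft_adjE vr.
have [/andP [pv pvn] pmx] := fparP vr.
have phip : phi (fpar (inl v)) = par (inl (val v)).
  have [] // := @nx_up _ _ _ _ _ T (inl (val v)) (fn (fpar (inl v))).
  apply/negP => h; case/eqP: pvn; apply: fn_inj; exact: anc_anti pv h.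
have phik (y : node FT) : y != froot -> inl v == fpar y ->
    [/\ anG (inl (val v)) (fn y), inl v != y, phi y \in kids (val v) & anG (phi y) (fn y)].
  move=> yr /eqP e; have [/andP [py pn] _] := fparP yr; rewrite -e in py pn.
  have ne : inl (val v) != fn y by rewrite -[inl (val v)]/(fn (inl v)) (inj_eq fn_inj).
  by have [n1 n2] := nx_kid py ne.
have one (y y' : node FT) : y != froot -> y' != froot -> inl v == fpar y -> inl v == fpar y' ->
    anG (fn y) (fn y') -> y = y'.
  move=> yr yr' e e' h; apply/eqP; apply: contraT => ne.
  have [_ mx] := fparP yr'; have [vy vn _ _] := phik y yr e.
  have := mx y; rewrite /fsub h ne => /(_ isT); rewrite -(eqP e') => yv.
  by case/eqP: vn; apply: fn_inj; exact: anc_anti vy yv.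
have inj : {in N &, injective phi}.
  move=> y y'; rewrite !NE => /orP [/eqP ->|/andP [yr e]] /orP [/eqP ->|/andP [yr' e']] //.
  - rewrite phip => h; have [_ _ k1 _] := phik y' yr' e'.
    by have := kid_par k1; rewrite -h eqxx.
  - rewrite phip => h; have [_ _ k1 _] := phik y yr e.
    by have := kid_par k1; rewrite h eqxx.
  have [vy vn kc cy] := phik y yr e; have [vy' vn' kc' cy'] := phik y' yr' e' => h.
  have [a1|n1] := boolP (anG (fn y) (fn y')); first exact: one.
  have [a2|n2] := boolP (anG (fn y') (fn y)); first by apply/esym/one.
  have fr (z : node FT) : z != froot -> fn z != root by rewrite fn_root.
  have [u [d [d' [du du' dd dy dy']]]] := lca (fr y yr) (fr y' yr') n1 n2.
  have [k yk] := fn_end y; have [k' yk'] := fn_end y'.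
  have ru : remains b u.
    apply/remainsP; exists k, k', d, d'; split=> //; [refine (anc_trans T dy yk)|refine (anc_trans T dy' yk')].
  pose w : node FT := inl (exist _ u ru : ft_vert b G).
  have uy : anG (inl u) (fn y) := anc_trans T (kid_anc du) dy.
  have wy : fsub w y.
    rewrite /fsub uy /=; apply/eqP => wE; have := anc_trans T (kid_anc du') dy'.
    by rewrite -[inl u]/(fn w) wE (negbTE n1).
  have [_ mx] := fparP yr; have uv := mx w wy; rewrite -(eqP e) in uv.
  have cy2 : anG (phi y) (fn y') by rewrite h.
  case/orP: (anc_total T cy uy) => hc.
    by have := anc_trans T hc uv; rewrite (kid_above kc).
  have [|g gu gc] := kid_toward hc.
    by apply/eqP => ec; have := uv; rewrite -[fn w]/(inl u) -ec (kid_above kc).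
  case/eqP: dd; rewrite -(kids_disj gu du (anc_trans T gc cy) dy).
  exact: (kids_disj gu du' (anc_trans T gc cy2) dy').
rewrite /valence; have -> : #|[set y | adj (inl v : node FT) y]%classic| = #|N|.
  by apply: eq_card => y; rewrite [RHS]inE; apply/idP/idP => [/set_mem|/mem_set].
rewrite -(card_in_imset inj); apply: eq_card => c; apply/imsetP/imsetP.
  move=> [y]; rewrite NE => /orP [/eqP -> ->|/andP [yr e] ->].
    by exists k0.
  have [vy vn kc cy] := phik y yr e; have [k yk] := fn_end y; exists k => //.
  by rewrite branchE (kids_nx kc (anc_trans T cy yk)).
move=> [k _ ->]; rewrite branchE; case vk : (anG (inl (val v)) (inr (b k))); last first.
  exists (fpar (inl v)); first by rewrite NE eqxx.
  by rewrite phip; have [] := nx_up T vk.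
pose Q (y : node FT) := [&& anG (inl (val v)) (fn y), inl v != y & anG (fn y) (inr (b k))].
have Q0 : Q (inr k) by rewrite /Q vk anc_refl.
have [y /and3P [vy vny yk] mn] : exists2 y, Q y & forall z, Q z -> (rk (fn y) <= rk (fn z))%N.
  by case: (arg_minnP (fun y => rk (fn y)) Q0) => y Qy mn; exists y.
have yr : y != froot.
  by apply/eqP => e; move: vy; rewrite e /= (anc_root T).
have py : fpar y = inl v.
  apply: fpar_eq => // u /andP [vu nvu] /andP [uy nuy].
  have := mn (inl u); rewrite /Q vu nvu (anc_trans T uy yk) => /(_ isT) le.
  by case/eqP: nuy; apply: fn_inj; exact: anc_eq uy le.
exists y; first by rewrite NE yr py eqxx orbT.
have [|_ _ kc cy] := phik y yr; first by rewrite py.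
by rewrite (kids_nx kc (anc_trans T cy yk)).
Qed.

End Forgetful.

(** * The length of a cross-ratio as a four-point functional *)

Section Ell.
Local Open Scope set_scope.
Variables (R : realType) (L : finType) (b : 'I_4 -> L) (G : marked_tree R L).
Hypothesis bI : injective b.
Notation root := (inr (b 0) : node G).
Notation par := (gpar root).
Notation rk := (grk root).
Let T : rooted (@adj R L G) root par rk := tree_rooted root.
Notation anG := (anc par rk).
Notation kids := (kids (G := G) (b 0)).
Notation FT := (ft b G).
Notation fn := (@ft_node R L _ b G).
Notation fpar := (@fpar R L _ b 0 G).
Notation frk := (@frk R L _ b 0 G).
Let TF : rooted (@adj R _ FT) (@froot R L _ b 0 G) fpar frk   := @ft_rooted R L _ b 0 G bI.
Implicit Types (v u w : vert G) (c : node G).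

(** The edge above v separates [b 2], [b 3] from [b 1] and from the root end [b 0]. *)
Definition Wp v := [&& b 2 \in cl (b 0) v, b 3 \in cl (b 0) v & b 1 \notin cl (b 0) v].

Lemma Wp_ntop v : Wp v -> ~~ itop (G := G) (b 0) v.
Proof.
move=> /and3P [_ _ h]; apply: contra h => vt; rewrite (cl_top vt) !inE (inj_eq bI) //.
Qed.

Lemma remains_other v c : remains b v -> c \in kids v ->
  exists k, b k \in cl (b 0) v /\ ~~ anG c (inr (b k)).
Proof.
move=> /(@remainsP R L _ b 0 G _) [k [k' [d [d' [dv dv' dd dk dk']]]]] cv.
have [e|ne] := eqVneq c d.
  exists k'; rewrite inE (anc_trans T (kid_anc dv') dk'); split=> //.
  by apply/negP => ck; case/eqP: dd; rewrite -e; exact: (kids_disj cv dv' ck dk').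
exists k; rewrite inE (anc_trans T (kid_anc dv) dk); split=> //.
by apply/negP => ck; case/eqP: ne; exact: (kids_disj cv dv ck dk).
Qed.

Lemma I4_ind (Q : 'I_4 -> Prop) : Q 0 -> Q 1 -> Q 2 -> Q 3 -> forall k, Q k.
Proof.
move=> q0 q1 q2 q3 [[|[|[|[|//]]]] lt].
- by rewrite (_ : Ordinal lt = 0) //; exact: val_inj.
- by rewrite (_ : Ordinal lt = 1) //; exact: val_inj.
- by rewrite (_ : Ordinal lt = 2) //; exact: val_inj.
- by rewrite (_ : Ordinal lt = 3) //; exact: val_inj.
Qed.

Lemma clE k v : (b k \in cl (b 0) v) = anG (inl v) (inr (b k)).
Proof. by rewrite inE. Qed.

Lemma cl_b0 v : (b 0 \in cl (G := G) (b 0) v) = false.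
Proof. by apply/negbTE; exact: cl_root. Qed.

Lemma kid_rk v u : inl u \in kids v -> (rk (inl v : node G) < rk (inl u : node G))%N.
Proof.
by rewrite inE => /andP [ur /eqP pu]; have [_ ->] := r_par T ur; rewrite pu.
Qed.

Definition ell_cond (u v : ft_vert b G) := [&& adj (inl u : node FT) (inl v),
  branch (inl v : node FT) (inr 0) == inl u, branch (inl v : node FT) (inr 1) == inl u,
  branch (inl u : node FT) (inr 2) == inl v & branch (inl u : node FT) (inr 3) == inl v].

Lemma ell_condE (u v : ft_vert b G) : ell_cond u v = (fpar (inl v) == inl u) && Wp (val v).
Proof.
have vr (w : ft_vert b G) : (inl w : node FT) != @froot R L _ b 0 G by [].
have nor (u' v' : ft_vert b G) : fpar (inl v') = inl u' -> fpar (inl u') = inl v' -> False.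
  move=> e1 e2; have [_ h1] := r_par TF (vr v'); have [_ h2] := r_par TF (vr u').
  by rewrite e1 in h1; rewrite e2 in h2; rewrite h2 in h1; case: (no_SS h1).
have brn (w : ft_vert b G) k : branch (inl w : node FT) (inr k) = nx fpar frk (inl w) (inr k).
  by rewrite (branch_nx TF).
have an (w : ft_vert b G) k : anc fpar frk (inl w) (inr k) = (b k \in cl (b 0) (val w)).
  by rewrite (@ft_anc R L _ b 0 G bI) clE.
have up (w : ft_vert b G) k : b k \notin cl (b 0) (val w) -> branch (inl w : node FT) (inr k) = fpar (inl w).
  by move=> h; rewrite brn; have [] := @nx_up _ _ _ _ _ TF (inl w) (inr k); rewrite ?an ?(negbTE h).
have dn (w : ft_vert b G) k : b k \in cl (b 0) (val w) -> fpar (branch (inl w : node FT) (inr k)) = inl w /\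
    anc fpar frk (branch (inl w : node FT) (inr k)) (inr k).
  by move=> h; rewrite brn; have [|//|] := @nx_down _ _ _ _ _ TF (inl w) (inr k); rewrite ?an.
have b0v : branch (inl v : node FT) (inr 0) = fpar (inl v) by rewrite up ?cl_b0.
apply/and5P/andP => [[_ h0 /eqP h1 /eqP h2 /eqP h3]|[/eqP pv /and3P [w2 w3 w1]]].
  rewrite b0v in h0; split=> //; apply/and3P; split.
  - have k2 : b 2 \in cl (b 0) (val u).
      by apply: contraT => /up e; case: (nor u v (eqP h0)); rewrite -e.
    by have [_] := dn _ _ k2; rewrite h2 an.
  - have k3 : b 3 \in cl (b 0) (val u).
      by apply: contraT => /up e; case: (nor u v (eqP h0)); rewrite -e.
    by have [_] := dn _ _ k3; rewrite h3 an.
  - by apply/negP => /dn []; rewrite h1 => e _; case: (nor u v (eqP h0)).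
have kid k : b k \in cl (b 0) (val v) -> branch (inl u : node FT) (inr k) == inl v.
  by move=> h; rewrite brn (nx_par TF (vr v) pv) // an.
split; rewrite ?kid ?b0v ?pv ?eqxx //.
- by rewrite (@ft_adjE R L _ b 0 G bI) /= pv eqxx orbT.
- by rewrite up // pv.
Qed.

Lemma I4_neq : [/\ (1 != 0 :> 'I_4), (2 != 0 :> 'I_4), (3 != 0 :> 'I_4) & (2 != 3 :> 'I_4)].
Proof. by []. Qed.

(** These edges form the path between two remaining vertices: [v0], below the lowest such edge,
    where [b 2] and [b 3] part, and [t], where [b 1] leaves the way from the root to [v0]. The
    double sum of [ell] has the single term at [t], [v0]. *)
Lemma ell_pos : (exists v, Wp v) ->
  ell FT = \sum_(v | Wp v) len v (pv (b 0) v).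
Proof.
move=> [w0 Ww0]; have [v0 W0 mx0] : exists2 v0, Wp v0 & forall v, Wp v -> (rk (inl v : node G) <= rk (inl v0 : node G))%N.
  by case: (arg_maxnP (fun v => rk (inl v : node G)) Ww0) => v Wv mx; exists v.
have /and3P [w2 w3 w1] := W0; rewrite !clE in w2 w3 w1.
have [n10 n20 n30 n23] := I4_neq.
have b1r : inr (b 1) != root by apply: contraNneq n10 => -[] /bI.
have [t /andP [t1 tv] mxt] : exists2 t, anG (inl t) (inr (b 1)) && anG (inl t) (inl v0) &
    forall v, anG (inl v) (inr (b 1)) && anG (inl v) (inl v0) -> (rk (inl v : node G) <= rk (inl t : node G))%N.
  have [s st] := top_ex G (b 0).
  have h0 : anG (inl s) (inr (b 1)) && anG (inl s) (inl v0) by rewrite !(top_anc st).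
  by case: (@arg_maxnP _ s (fun v => anG (inl v) (inr (b 1)) && anG (inl v) (inl v0)) (fun v => rk (inl v : node G)) h0) => v hv mx; exists v.
have tnv : inl v0 != inl t :> node G by apply: contraNneq w1 => ->.
have Wv0 v : Wp v -> anG (inl v) (inl v0).
  move=> Wv; have /and3P [h2 _ _] := Wv; rewrite clE in h2.
  by case/orP: (anc_total T h2 w2) => // h; rewrite (anc_eq h (mx0 v Wv)) anc_refl.
have leafk (c : L) k : inr c != root -> anG (inr c) (inr (b k)) -> b k = c.
  move=> cr h; have ir : c != b 0 by apply: contraNneq cr => ->.
  by case: (leaf_anc ir h).
have kr v c : c \in kids v -> c != root by rewrite inE => /andP [].
have rv0 : remains b v0.
  have [c cv c2] := kid_toward w2 isT; have [d dv d3] := kid_toward w3 isT.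
  apply/(@remainsP R L _ b 0 G _); exists 2, 3, c, d; split=> //; apply/eqP => e; subst d.
  case: c cv c2 d3 {dv} => [u|i] cv c2 d3.
    have Wu : Wp u.
      rewrite /Wp !clE c2 d3 /=; by apply: contra w1 => h; refine (anc_trans T (kid_anc cv) h).
    by have := leq_trans (kid_rk cv) (mx0 u Wu); rewrite ltnn.
  have ir := kr _ _ cv; have e2 := leafk _ _ ir c2; have e3 := leafk _ _ ir d3.
  by case/eqP: n23; apply: bI; rewrite e2 e3.
have rt : remains b t.
  have [c ct cv0] := kid_toward tv tnv; have [d dt d1] := kid_toward t1 isT.
  apply/(@remainsP R L _ b 0 G _); exists 2, 1, c, d; split=> //; last by refine (anc_trans T cv0 w2).
  apply/eqP => e; subst d; case: c ct cv0 d1 {dt} => [u|i] ct cv0 d1.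
    have := mxt u; rewrite d1 cv0 => /(_ isT) le.
    by have := leq_trans (kid_rk ct) le; rewrite ltnn.
  have ir := kr _ _ ct; suff : inl v0 = inr i :> node G by [].
  by apply: leaf_anc cv0; apply: contraNneq ir => ->.
pose v' : ft_vert b G := exist _ v0 rv0; pose t' : ft_vert b G := exist _ t rt.
have pvt : fpar (inl v') = inl t'.
  apply: fpar_eq => //; first by apply: contraNneq tnv => -[->].
  move=> u /andP [tu ntu] /andP [uv nuv] /=.
  have unv : inl v0 != inl (val u) :> node G.
    apply: contraNneq nuv => -[e]; apply/eqP; congr inl; exact: val_inj.
  have [c cu cv] := kid_toward uv unv.
  have [k [ku kc]] := remains_other (valP u) cu.
  have nk : k = 1.
    move: k ku kc; apply: I4_ind => //; first by rewrite cl_b0.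
      by rewrite (anc_trans T cv w2).
    by rewrite (anc_trans T cv w3).
  have := mxt (val u); rewrite uv -clE -nk ku => /(_ isT) le.
  case/eqP: ntu; congr inl; apply/val_inj; have := anc_eq tu le; by case.
have sing v (rv : remains b v) : Wp v -> v = v0.
  move=> Wv; have vv := Wv0 v Wv; apply/eqP; apply: contraT => ne.
  have [|c cv cv0] := kid_toward vv; first by apply: contraNneq ne => -[->].
  have [k [kv kc]] := remains_other rv cv; have /and3P [_ _ v1] := Wv.
  case/negP: kc; move: k kv; apply: I4_ind; first by rewrite cl_b0.
  - by rewrite (negbTE v1).
  - by move=> _; refine (anc_trans T cv0 w2).
  - by move=> _; refine (anc_trans T cv0 w3).
rewrite /ell (bigD1 t') //= [X in _ + X]big1 ?addr0; last first.
  move=> u ut; apply: big1 => v; rewrite -/(ell_cond u v) ell_condE => /andP [/eqP pv /(sing _ (valP v)) e].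
  case/eqP: ut; have ev : v = v' by apply: val_inj.
  by move: pv; rewrite ev pvt => -[].
rewrite (bigD1 v') /=; last by rewrite -/(ell_cond t' v') ell_condE pvt eqxx.
rewrite [X in _ + X]big1 ?addr0; last first.
  move=> v /andP []; rewrite -/(ell_cond t' v) ell_condE => /andP [_ /(sing _ (valP v)) e] /eqP [].
  exact: val_inj.
rewrite (dist_rooted T); last first.
  move=> x xr; have [h _] := r_par T xr; move: h; case: x xr => [v|i] _.
    by case: (par (inl v)) => [u|j] //= h; apply/esym/len_sym.
  by case: (par (inr i)).
rewrite big_mkcond big_sumType /= [X in _ + X]big1 ?addr0; last first.
  move=> i _; rewrite inE; have [->|ir] := eqVneq i (b 0); first by rewrite !(root_anc T) eqxx.
  have h u : anG (inr i) (inl u) = false by apply/negP => /(leaf_anc ir).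
  by rewrite !h.
rewrite -big_mkcond; apply: eq_big => [v|v Wv].
  rewrite inE; case vt : (anG (inl v) (inl t)).
    rewrite (anc_trans T vt tv) eqxx; apply/esym/negP => /and3P [_ _].
    by rewrite clE (anc_trans T vt t1).
  apply/idP/idP => [vv|/Wv0 -> //]; have {}vv : anG (inl v) (inl v0) by case: (anG (inl v) (inl v0)) vv.
  rewrite /Wp !clE (anc_trans T vv w2) (anc_trans T vv w3) /=; apply/negP => v1.
  have := mxt v; rewrite v1 vv => /(_ isT) le.
  case/orP: (anc_total T vv tv) => h; first by rewrite h in vt.
  by rewrite (anc_eq h le) anc_refl in vt.
have Wv' : Wp v.
  move: Wv; rewrite inE => Wv; case vt : (anG (inl v) (inl t)).
    by move: Wv; rewrite vt (anc_trans T vt tv).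
  have vv : anG (inl v) (inl v0) by move: Wv; rewrite vt; case: (anG _ _).
  rewrite /Wp !clE (anc_trans T vv w2) (anc_trans T vv w3) /=; apply/negP => v1.
  have := mxt v; rewrite v1 vv => /(_ isT) le.
  case/orP: (anc_total T vv tv) => h; first by rewrite h in vt.
  by rewrite (anc_eq h le) anc_refl in vt.
by rewrite (pvP (Wp_ntop Wv')).
Qed.

Lemma ell_zero : (forall v, ~~ Wp v) -> ell FT = 0.
Proof.
move=> none; rewrite /ell big1 // => u _; apply: big1 => v.
by rewrite -/(ell_cond u v) ell_condE (negbTE (none _)) andbF.
Qed.

Definition dd i j := dist (inr i : node G) (inr j).

Lemma quad_dist (a c e f : L) : quad a c e f dd =
  \sum_(v | ~~ itop (G := G) (b 0) v) len v (pv (b 0) v) * quad a c e f (cutd R (cl (b 0) v)).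
Proof.
have dE i j : dd i j = \sum_(v | ~~ itop (G := G) (b 0) v) len v (pv (b 0) v) * cutd R (cl (b 0) v) i j.
  rewrite -(@dist_cl R L G (b 0) (@len _ _ G) i j (@len_sym R L G)) /dd.
  by case: G => -[].
rewrite /quad !dE -!sumrN -!big_split /= mulr_sumr; apply: eq_bigr => v _; ring.
Qed.

(** The edges of one tree cannot realize both splits 01|23 and 02|13, so all terms of the four-point
    sum have the same sign. *)
Lemma ell_ft : ell FT = Num.max (quad (b 0) (b 1) (b 2) (b 3) dd) 0.
Proof.
have len0 v : ~~ itop (G := G) (b 0) v -> 0 <= len v (pv (b 0) v).
  by move=> /pv_adj h; have [_ _ _ _ /(_ _ _ h) [/ltW]] := tree_valid G.
rewrite quad_dist; case: (pselect (exists v, Wp v)) => [ex|nex].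
  rewrite (ell_pos ex) [X in Num.max X _](bigID Wp) /= [X in Num.max (_ + X)]big1 ?addr0; last first.
    move=> v /andP [_ nW]; rewrite quad_cut cl_b0.
    have [w /and3P [w2 w3 w1]] := ex.
    have -> : [&& false == (b 1 \in cl (b 0) v), (b 2 \in cl (b 0) v) == (b 3 \in cl (b 0) v)
        & false != (b 2 \in cl (b 0) v)] = false.
      by apply: contraNF nW; rewrite /Wp; case: (b 1 \in _); case: (b 2 \in _); case: (b 3 \in _).
    have -> : [&& false == (b 2 \in cl (b 0) v), (b 1 \in cl (b 0) v) == (b 3 \in cl (b 0) v)
        & false != (b 1 \in cl (b 0) v)] = false.
      apply/negP => /and3P [h2 h3 h1]; have v1 : b 1 \in cl (b 0) v by move: h1; case: (_ \in _).
      have v2 : b 2 \notin cl (b 0) v by rewrite -(eqP h2).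
      have v3 : b 3 \in cl (b 0) v by rewrite -(eqP h3).
      rewrite !clE in w2 w3 w1 v2 v1 v3.
      case/orP: (anc_total T w3 v3) => h; first by rewrite (anc_trans T h v1) in w1.
      by rewrite (anc_trans T h w2) in v2.
    by rewrite subrr mulr0.
  rewrite max_l.
    apply: eq_big => [v|v Wv]; first by have [/Wp_ntop ->|] := boolP (Wp v); rewrite ?andbF.
    have /and3P [v2 v3 v1] := Wv; rewrite quad_cut cl_b0 v2 v3 (negbTE v1) /=.
    by rewrite subr0 mulr1.
  apply: sumr_ge0 => v /andP [vt Wv]; apply: mulr_ge0; first exact: len0.
  have /and3P [v2 v3 v1] := Wv; rewrite quad_cut cl_b0 v2 v3 (negbTE v1) /=.
  by rewrite subr0.
have none v : ~~ Wp v by apply/negP => Wv; apply: nex; exists v.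
rewrite ell_zero // max_r //; apply: sumr_le0 => v vt; apply: mulr_ge0_le0; first exact: len0.
rewrite quad_cut cl_b0; have := none v; rewrite /Wp.
by case: (b 1 \in _); case: (b 2 \in _); case: (b 3 \in _) => //= _; rewrite ?subrr ?sub0r ?oppr_le0.
Qed.

End Ell.

(** * Evaluation maps and the equality of the degrees *)

Section Balancing.
Variables (R : realType) (n d : nat) (Delta : 'I_d -> 'rV[int]_2).
Hypothesis D0 : \sum_k Delta k = 0.
Notation E := (ends n d).
Notation x0 := (inl ord0 : E).
Implicit Types (A B : {set E}).

(** By balancing, the direction of an edge pointing to the side with the ends A. *)
Definition dsum A : 'rV[int]_2 := \sum_(k | inr k \in A) Delta k.

Lemma dsumC : dsum (~: [set x0])%SET = 0.
Proof. by rewrite -[RHS]D0; apply: eq_bigl => k; rewrite !inE. Qed.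

Lemma dsum1 (i : E) : dsum [set i]%SET = if i is inr k then Delta k else 0.
Proof.
case: i => [i|k]; first by rewrite /dsum big_pred0 // => k; rewrite inE.
rewrite /dsum (bigD1 k) ?inE //= big1 ?addr0 // => j /andP [].
by rewrite inE => /eqP [->]; rewrite eqxx.
Qed.

Section Tree.
Variable G : marked_tree R E.
Notation root := (inr x0 : node G).
Notation par := (gpar root).
Notation rk := (grk root).
Let T : rooted (@adj R E G) root par rk := tree_rooted root.
Notation anG := (anc par rk).
Notation kids := (kids (G := G) x0).
Implicit Types (v u : vert G) (c x y : node G).

Definition clN x : {set E} := [set i | anG x (inr i)]%SET.

Lemma clN_end i : i != x0 -> clN (inr i) = [set i]%SET.
Proof.
move=> ir; apply/setP => j; rewrite !inE; apply/idP/eqP => [h|->]; last exact: anc_refl.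
by case: (leaf_anc ir h).
Qed.

Lemma dsum_kids v : \sum_(c in kids v) dsum (clN c) = dsum (clN (inl v)).
Proof.
rewrite /dsum (exchange_big_dep (fun k => inr k \in clN (inl v))) /=; last first.
  move=> c k cv; rewrite !inE => ck; refine (anc_trans T (kid_anc cv) ck).
apply: eq_bigr => k; rewrite inE => vk.
have [c cv ck] := kid_toward vk isT.
rewrite (big_pred1 c) // => c' /=; rewrite [_ \in clN _]inE; apply/andP/eqP => [[cv' ck']|->] //.
exact: kids_disj cv' cv ck' ck.
Qed.

Lemma adj_sum (V : zmodType) v (F : node G -> V) :
  \sum_(x | adj (inl v) x) F x = F (par (inl v)) + \sum_(c in kids v) F c.
Proof.
rewrite (bigD1 (par (inl v))) /=; last by rewrite (adj_kids x0) eqxx.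
congr (_ + _); apply: eq_bigl => c; rewrite (adj_kids x0).
case: (eqVneq c (par (inl v))) => [->|_]; rewrite ?andbT ?andbF //=.
apply/esym/negP; rewrite inE => /andP [pr /eqP pp].
have [_ h1] := r_par T pr; have [_ h2] := r_par T (vert_root x0 v).
rewrite pp in h1; rewrite h1 in h2; exact: no_SS h2.
Qed.

(** The positions forced by the directions [dsum]: start with [p0] at the top vertex and add the
    edges on the way down to v. *)
Definition ppos (p0 : 'rV[R]_2) v : 'rV[R]_2 := p0 +
  \sum_(u | ~~ itop (G := G) x0 u && anG (inl u) (inl v)) len u (pv x0 u) *: vecR R (dsum (cl x0 u)).

Lemma ppos_top p0 v : itop (G := G) x0 v -> ppos p0 v = p0.
Proof.
move=> vt; rewrite /ppos big1 ?addr0 // => u /andP [ut uv]; case/negP: ut.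
move: uv; rewrite (anc_par T) ?vert_root // (eqP vt) (anc_root T) orbF => /eqP [->].
exact: vt.
Qed.

Lemma ppos_step p0 v : ~~ itop (G := G) x0 v ->
  ppos p0 v = ppos p0 (pv x0 v) + len v (pv x0 v) *: vecR R (dsum (cl x0 v)).
Proof.
move=> vt; rewrite /ppos (bigD1 v) /=; last by rewrite vt anc_refl.
rewrite -addrA; congr (_ + _); rewrite addrC; congr (_ + _); apply: eq_bigl => u.
rewrite [anG (inl u) (inl v)](anc_par T) ?vert_root // (pvP vt).
case: eqVneq => [[->]|ne] /=.
  rewrite eqxx andbF -(pvP vt) (anc_par_self T) ?andbF //.
have uv : u != v by apply: contraNneq ne => ->.
by rewrite uv andbT.
Qed.

Lemma ppos_end p0 v i : adj (inl v : node G) (inr i) ->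
  ppos p0 v = p0 + \sum_(u | ~~ itop (G := G) x0 u && (i \in cl x0 u)) len u (pv x0 u) *: vecR R (dsum (cl x0 u)).
Proof.
have [->|ir] := eqVneq i x0.
  rewrite (adj_kids x0) => /orP [/eqP e|]; last by rewrite inE => /andP []; rewrite eqxx.
  rewrite ppos_top; last by rewrite /itop -e.
  by rewrite big1 ?addr0 // => u /andP [_]; rewrite (negbTE (cl_root _ _)).
rewrite (adj_kids x0) => /orP [/eqP e|].
  have [h _] := r_par T (vert_root x0 v); have ir' : inr i != root by apply: contraNneq ir => -[->].
  have : anG (inr i) (inl v) by rewrite e; exact: par_anc T _ (vert_root x0 v).
  by move/(leaf_anc ir).
rewrite inE => /andP [ir' /eqP pi]; rewrite /ppos; congr (_ + _); apply: eq_bigl => u.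
by rewrite inE [anG (inl u) (inr i)](anc_par T) // pi.
Qed.

Lemma end_vert i : exists v, adj (inl v : node G) (inr i) /\ forall v', adj (inl v' : node G) (inr i) = (v' == v).
Proof.
have [v vE] := end_nbr G i; exists v; split=> [|v']; first by rewrite tree_adj_sym vE.
by rewrite tree_adj_sym vE; apply/eqP/eqP => [[]|->].
Qed.

End Tree.

Lemma vecR_inj : injective (vecR R : 'rV[int]_2 -> 'rV[R]_2).
Proof.
move=> u v /rowP h; apply/rowP => i; have := h i; rewrite !mxE => /eqP.
by rewrite eqr_int => /eqP.
Qed.

Section Curve.
Variable C : tcurve R n Delta.
Notation root := (inr x0 : node C).
Notation par := (gpar root).
Notation rk := (grk root).
Let T : rooted (@adj R E C) root par rk := tree_rooted root.

Lemma dir_anti (u v : vert C) : adj (inl u : node C) (inl v) ->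
  dir (inl u : node C) (inl v) = - dir (inl v : node C) (inl u).
Proof.
move=> uv; have vu : adj (inl v : node C) (inl u) by rewrite tree_adj_sym.
have := tcurve_edge uv; rewrite (tcurve_edge vu) (len_sym uv) -addrA => /eqP.
rewrite -subr_eq0 opprD addNKr oppr_eq0 -scalerDr scaler_eq0 => /orP [/eqP e|/eqP e].
  by have [_ _ _ _ /(_ _ _ vu) []] := tree_valid C; rewrite e ltxx.
apply/eqP; rewrite -subr_eq0 opprK; apply/eqP/vecR_inj; rewrite addrC /vecR map_mxD -[RHS]/(map_mx _ _).
by rewrite e; apply/rowP => i; rewrite !mxE.
Qed.

(** Induction from the ends towards the root: balancing at v expresses the direction of the upward
    edge by those of the downward edges. *)
Lemma dir_down v : dir (inl v : node C) (par (inl v)) = - dsum (cl x0 v).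
Proof.
have [m] := ubnP #|cl x0 v|; elim: m v => // m IH v; rewrite ltnS => vm.
have := tcurve_balanced v; rewrite adj_sum => /eqP; rewrite addr_eq0 => /eqP ->; congr (- _).
rewrite -[cl x0 v]/(clN (inl v)) -dsum_kids; apply: eq_bigr => -[u|i] uv; last first.
  have ir : i != x0 by move: uv; rewrite inE => /andP [h _]; apply: contraNneq h => ->.
  rewrite clN_end // dsum1.
  have ad : adj (inl v : node C) (inr i) by rewrite (adj_kids x0) uv orbT.
  by case: i ad {uv ir} => [i|k] ad; [exact: tcurve_contracted|exact: tcurve_end].
have ad : adj (inl v : node C) (inl u) by rewrite (adj_kids x0) uv orbT.
have pu : par (inl u) = inl v by move: uv; rewrite inE => /andP [_ /eqP].
rewrite dir_anti // -pu IH ?opprK //; apply: leq_trans vm; apply: proper_card.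
rewrite properEneq; apply/andP; split.
  by apply/negP => /eqP /cl_inj e; have := kid_above (b := fun _ : unit => x0) (k0 := tt) uv erefl; rewrite e anc_refl.
exact: anc_cl (kid_anc uv).
Qed.

Lemma pos_ppos v : @pos R n d Delta C v = ppos (ev ord0 C) v.
Proof.
have [v0 [a0 e0]] := end_vert C x0.
have ev0 : ev ord0 C = pos v0.
  rewrite /ev; case: pickP => [v'|/(_ v0)]; last by rewrite a0.
  by rewrite e0 => /eqP ->.
have t0 : itop (G := C) x0 v0.
  move: a0; rewrite (adj_kids x0) => /orP [/eqP e|]; first by rewrite /itop -e.
  by rewrite inE => /andP []; rewrite eqxx.
suff h : forall x : node C, forall v, x = inl v -> @pos R n d Delta C v = ppos (ev ord0 C) v by exact: h erefl.
apply: (tree_ind T) => [//|x xr IH {}v xv]; subst x.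
have [vt|vt] := boolP (itop (G := C) x0 v).
  rewrite ppos_top // ev0; congr pos.
  by apply/eqP; rewrite -e0 (adj_kids x0) [par _](eqP vt) eqxx.
rewrite (ppos_step _ vt) -(IH _ (pvP vt)).
rewrite (tcurve_edge (u := pv x0 v)); last by rewrite tree_adj_sym pv_adj.
rewrite (len_sym (pv_adj vt)) dir_anti; last by rewrite tree_adj_sym pv_adj.
by rewrite -(pvP vt) dir_down opprK.
Qed.

Lemma ev_sum i : ev i C = ev ord0 C +
  \sum_(u | ~~ itop (G := C) x0 u && (inl i \in cl x0 u)) len u (pv x0 u) *: vecR R (dsum (cl x0 u)).
Proof.
have [v [av ve]] := end_vert C (inl i).
have -> : ev i C = pos v.
  rewrite /ev; case: pickP => [v'|/(_ v)]; last by rewrite av.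
  by rewrite ve => /eqP ->.
by rewrite pos_ppos (ppos_end _ av).
Qed.

End Curve.

Section Existence.
Variables (G : marked_tree R E) (p0 : 'rV[R]_2).
Notation root := (inr x0 : node G).
Notation par := (gpar root).
Notation rk := (grk root).
Let T : rooted (@adj R E G) root par rk := tree_rooted root.

Definition edir (x y : node G) : 'rV[int]_2 :=
  if (y != root) && (x == par y) then dsum (clN y) else - dsum (clN x).

Lemma edir_par v : edir (inl v) (par (inl v)) = - dsum (cl x0 v).
Proof.
rewrite /edir; case: ifP => // /andP [pr /eqP pp].
have [_ h1] := r_par T pr; have [_ h2] := r_par T (vert_root x0 v).
by rewrite -pp in h1; rewrite h1 in h2; case: (no_SS h2).
Qed.

Lemma edir_kid v c : c \in kids (G := G) x0 v -> edir (inl v) c = dsum (clN c).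
Proof. by rewrite inE /edir [_ == inl v]eq_sym => ->. Qed.

Lemma edir_edge u v : adj (inl u : node G) (inl v) ->
  ppos p0 v = ppos p0 u + len u v *: vecR R (edir (inl u) (inl v)).
Proof.
move=> uv; case: (r_adj T uv) => -[xr e].
  have ut : ~~ itop (G := G) x0 u by rewrite /itop -e.
  have pe : pv x0 u = v by have := pvP ut; rewrite -e => -[].
  rewrite (ppos_step _ ut) pe e edir_par.
  have -> (w : 'rV[int]_2) : vecR R (- w) = - vecR R w by rewrite /vecR map_mxN.
  by rewrite scalerN addrK.
have vt : ~~ itop (G := G) x0 v by rewrite /itop -e.
have pe : pv x0 v = u by have := pvP vt; rewrite -e => -[].
by rewrite (ppos_step _ vt) pe edir_kid ?(len_sym uv) // inE -e eqxx.
Qed.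

Lemma edir_balanced v : \sum_(x : node G | adj (inl v) x) edir (inl v) x = 0.
Proof.
rewrite adj_sum edir_par (eq_bigr (fun c => dsum (clN c))); last exact: edir_kid.
by rewrite dsum_kids addNr.
Qed.

Lemma edir_end v i : adj (inl v : node G) (inr i) -> edir (inl v) (inr i) = dsum [set i]%SET.
Proof.
have [->|ir] := eqVneq i x0.
  rewrite (adj_kids x0) => /orP [/eqP e|]; last by rewrite inE => /andP []; rewrite eqxx.
  have vt : itop (G := G) x0 v by rewrite /itop -e.
  by rewrite e edir_par (cl_top vt) dsumC dsum1 oppr0.
rewrite (adj_kids x0) => /orP [/eqP e|iv]; last by rewrite edir_kid // clN_end.
have : anc par rk (inr i) (inl v) by rewrite e; exact: par_anc T _ (vert_root x0 v).
by move/(leaf_anc ir).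
Qed.

Lemma edir_contracted v (i : 'I_n.+1) : adj (inl v : node G) (inr (inl i)) -> edir (inl v) (inr (inl i)) = 0.
Proof. by move/edir_end ->; rewrite dsum1. Qed.

Lemma edir_degree v (k : 'I_d) : adj (inl v : node G) (inr (inr k)) -> edir (inl v) (inr (inr k)) = Delta k.
Proof. by move/edir_end ->; rewrite dsum1. Qed.

Definition curve_on : tcurve R n Delta :=
  Tcurve edir_edge edir_balanced edir_contracted edir_degree.

Lemma ev_curve_on : ev ord0 curve_on = p0.
Proof.
have [v0 [a0 e0]] := end_vert G x0.
rewrite /ev; case: pickP => [v'|/(_ v0)]; last by rewrite a0.
rewrite e0 => /eqP ->; rewrite /= (ppos_end _ a0) big1 ?addr0 // => u /andP [_].
by rewrite (negbTE (cl_root _ _)).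
Qed.

End Existence.

End Balancing.

(** * Evaluations and cross-ratios as linear functionals *)

Section Functionals.
Variables (R : realType) (n d : nat) (Delta : 'I_d -> 'rV[int]_2).
Hypothesis D0 : \sum_k Delta k = 0.
Hypothesis d2 : (1 < d)%N.
Notation E := (ends n d).
Notation x0 := (inl ord0 : E).
Notation W := 'rV[R]_(qdim R E + 2).
Implicit Types (A B : {set E}) (w x y : W).

Lemma card_ends : #|E| = (n.+1 + d)%N.
Proof. by rewrite card_sum !card_ord. Qed.

Lemma ends3 : (2 < #|E|)%N.
Proof. by rewrite card_ends; lia. Qed.

Definition qM := @ql R _ 2 _ (@vsplit R E).
Definition JM := @Jl 2 {set E}.
Definition goodM := @goodl 2 {set E} (laminar x0).
Notation inMM := (inM qM JM goodM).
Notation suppM := (supp qM JM goodM).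

Lemma FM : fan (#|E| - 3 + 2) (@lattice R n d) qM JM goodM.
Proof. exact (lift_fan 2 (lam_fan x0 R ends3)). Qed.

(** Differences of positions are read off from distances: take half the sum over the unbounded ends
    j of [Delta j] times (d(x0, j) - d(i, j)). Because the [Delta j] sum to 0, this kills the rows
    of [Phi], and the factor 1/2 does not spoil integrality on splits. *)
Lemma ev_functional (i : 'I_n.+1) (k : 'I_2) : exists2 f : 'cV[R]_(qdim R E),
  integral (@lattice0 R E) f &
  forall A, x0 \notin A -> pairing (vsplit R A) f = ((inl i : E) \in A)%:R * vecR R (dsum Delta A) 0 k.
Proof.
pose c (t : bool * 'I_d) : R := (if t.1 then 2^-1 else - 2^-1) * (Delta t.2 0 k)%:~R.
pose a (t : bool * 'I_d) : E := if t.1 then x0 else inl i.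
pose b (t : bool * 'I_d) : E := inr t.2.
have sum2 (F : bool * 'I_d -> R) : \sum_t F t = \sum_j F (true, j) + \sum_j F (false, j).
  rewrite (eq_bigr (fun t => F (t.1, t.2))); last by case.
  by rewrite -(pair_bigA _ (fun u v => F (u, v))) /= big_bool.
have S0 : \sum_j (Delta j 0 k)%:~R = 0 :> R.
  by rewrite -(rmorph_sum (intmul 1)) /= -summxE D0 mxE.
have [||f fE] := @qt_functional R E _ c a b.
- by move=> [[] j].
- move=> j; rewrite sum2 /c /a /b /= -big_split /=.
  transitivity (\sum_t (2^-1 * ((j == x0)%:R - (j == inl i)%:R) * (Delta t 0 k)%:~R : R)).
    by apply: eq_bigr => t _; ring.
  by rewrite -mulr_sumr S0 mulr0.
have dsE A : vecR R (dsum Delta A) 0 k = \sum_j ((inr j : E) \in A)%:R * (Delta j 0 k)%:~R.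
  rewrite mxE summxE rmorph_sum /= big_mkcond /=; apply: eq_bigr => j _.
  by case: ifP; rewrite ?mul1r ?mul0r.
have key A : x0 \notin A -> pairing (vsplit R A) f = ((inl i : E) \in A)%:R * vecR R (dsum Delta A) 0 k.
  move=> rA; rewrite fE; last exact: cutd_sym.
  rewrite sum2 /c /a /b /cutd /= (negbTE rA) dsE -big_split mulr_sumr /=.
  case: ((inl i : E) \in A).
    transitivity (\sum_j ((((inr j : E) \in A)%:R - 2^-1) * (Delta j 0 k)%:~R : R)).
      by apply: eq_bigr => j _; case: (_ \in _) => /=; field.
    rewrite (eq_bigr (fun j => ((inr j : E) \in A)%:R * (Delta j 0 k)%:~R - 2^-1 * (Delta j 0 k)%:~R)); last first.
      by move=> j _; ring.
    rewrite big_split /= sumrN -mulr_sumr S0 mulr0 subr0.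
    by apply: eq_bigr => j _; ring.
  by apply: eq_bigr => j _; rewrite [false%:R]mulr0n mul0r !mulNr subrr.
exists f => //; apply: lattice0_int => A; wlog rA : A / x0 \notin A.
  move=> h; have [rA|rA] := boolP (x0 \in A); last exact: h.
  by rewrite -vsplitC; apply: h; rewrite inE rA.
by rewrite key // mxE; apply: rpredM; rewrite ?intr_int // intr_nat.
Qed.

Definition evf (i : 'I_n.+1) (k : 'I_2) : 'cV[R]_(qdim R E + 2) :=
  col_mx (xget 0 [set f | integral (@lattice0 R E) f /\ forall A, x0 \notin A ->
    pairing (vsplit R A) f = ((inl i : E) \in A)%:R * vecR R (dsum Delta A) 0 k]) (delta_mx k 0).

Lemma pairing_delta (v : 'rV[R]_2) k : pairing v (delta_mx k 0) = v 0 k.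
Proof.
rewrite /pairing mxE (bigD1 k) //= big1 ?addr0 ?mxE ?eqxx ?mulr1 // => j jk.
by rewrite mxE (negbTE jk) mulr0.
Qed.

Lemma evfP i k : integral (@lattice R n d) (evf i k) /\ forall A v, x0 \notin A ->
  pairing (row_mx (vsplit R A) v) (evf i k) = ((inl i : E) \in A)%:R * vecR R (dsum Delta A) 0 k + v 0 k.
Proof.
have [f f1 f2] := ev_functional i k.
have [g1 g2] := xgetPex 0 (ex_intro [set f | integral (@lattice0 R E) f /\ forall A, x0 \notin A ->
    pairing (vsplit R A) f = ((inl i : E) \in A)%:R * vecR R (dsum Delta A) 0 k] f (conj f1 f2)).
rewrite /evf; split=> [w [w1 w2]|A v rA].
  by rewrite -[w]hsubmxK pairing_row pairing_delta rpredD //; exact: g1.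
by rewrite pairing_row pairing_delta g2.
Qed.

Definition crf (b : 'I_4 -> E) : 'cV[R]_(qdim R E + 2) :=
  col_mx (xget 0 [set f | forall dd, (forall i j, dd i j = dd j i) ->
    pairing (qt dd) f = quad (b 0) (b 1) (b 2) (b 3) dd]) 0.

Lemma quadfP (L : finType) (b : 'I_4 -> L) : injective b -> exists f : 'cV[R]_(qdim R L),
  forall dd, (forall i j, dd i j = dd j i) -> pairing (qt dd) f = quad (b 0) (b 1) (b 2) (b 3) dd.
Proof. by move=> bI; apply: quad_functional; rewrite (inj_eq bI). Qed.

Lemma crfP b : injective b -> integral (@lattice R n d) (crf b) /\
  forall dd v, (forall i j, dd i j = dd j i) -> pairing (row_mx (qt dd) v) (crf b) = quad (b 0) (b 1) (b 2) (b 3) dd.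
Proof.
move=> bI; have g := xgetPex 0 (quadfP bI).
have key dd v : (forall i j, dd i j = dd j i) -> pairing (row_mx (qt dd) v) (crf b) = quad (b 0) (b 1) (b 2) (b 3) dd.
  by move=> ds; rewrite /crf pairing_row [X in _ + X]pairing0r addr0 g.
split=> // w [w1 w2]; rewrite -[w]hsubmxK /crf pairing_row [X in _ + X]pairing0r addr0.
apply: lattice0_int w1 => A; rewrite g; last exact: cutd_sym.
exact: quad_int.
Qed.

Lemma dist_sym (L : finType) (G : marked_tree R L) (r : L) i j :
  dist (inr i : node G) (inr j) = dist (inr j : node G) (inr i).
Proof.
have dE a c : dist (inr a : node G) (inr c) =
    \sum_(v | ~~ itop (G := G) r v) len v (pv r v) * cutd R (cl r v) a c.
  rewrite -(@dist_cl R L G r (@len _ _ G) a c (@len_sym R L G)).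
  by case: G => -[].
by rewrite !dE; apply: eq_bigr => v _; rewrite cutd_sym.
Qed.

Lemma pt_inM (C : tcurve R n Delta) : inMM (pt C) /\ prj (suppM (pt C)) = Scl x0 C.
Proof.
have [b [b0 pE]] := pt0_pos x0 C.
have [||xM xS] := sup_eq (lam_fan x0 R ends3) (S := Scl x0 C) (a := b) (x := pt0 C) (Scl_lam _ _) => //.
  by move=> A; rewrite setD0; exact: b0.
have [|h hS] := inM_lift (p := 2) (lam_fan x0 R ends3) (x := pt C); first by rewrite row_mxKl.
by split=> //; rewrite hS lift_setK row_mxKl.
Qed.

(** On the support of the fan, [descend] therefore never falls back on its default value. *)
Lemma ex_curve x : inMM x -> exists C : tcurve R n Delta, pt C = x.
Proof.
move=> xM; have yM := inM_proj (lam_fan x0 R ends3) xM.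
have [pc xc] := crdP (lam_fan x0 R ends3) yM; set c := crd _ _ _ _ _ in pc xc.
have lS := sup_good yM; set S := supp _ _ _ _ in pc xc lS.
have c0 B : B \in S -> 0 < c B by move=> BS; apply: pc; rewrite setD0.
exists (curve_on D0 (MarkedTree (tree_of_lamP lS ends3 c0)) (rsubmx x)).
rewrite /pt ev_curve_on -[RHS]hsubmxK; congr row_mx.
exact: etrans (pt0_lam ends3 lS c0) (esym xc).
Qed.

Lemma pt_ev (C : tcurve R n Delta) i k : pairing (pt C) (evf i k) = ev i C 0 k.
Proof.
have [_ h] := evfP i k.
rewrite (ev_sum C i) mxE summxE addrC.
rewrite /pt (pt0_tree x0).
rewrite [row_mx _ _](_ : _ = \sum_(v | ~~ itop (G := C) x0 v) len v (pv x0 v) *: row_mx (vsplit R (cl x0 v)) 0 + row_mx 0 (ev ord0 C)); last first.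
  rewrite (eq_bigr (fun v => row_mx (len v (pv x0 v) *: vsplit R (cl x0 v)) 0)); last first.
    by move=> v _; rewrite scale_row_mx scaler0.
  elim/big_rec2: _ => [|v y z _ e]; first by rewrite add0r.
  by rewrite -addrA -e add_row_mx add0r.
rewrite pairingDl pairing_suml; congr (_ + _); last first.
  have -> : row_mx 0 (ev ord0 C) = row_mx (vsplit R set0) (ev ord0 C) :> W.
    congr row_mx; rewrite /vsplit (qt_ext (d' := fun _ _ => 0)); last first.
      by move=> a c _; rewrite /cutd !inE eqxx.
    by rewrite /qt (_ : \row__ 0 = 0) ?mul0mx //; apply/rowP => a; rewrite !mxE.
  by rewrite h ?inE // mul0r add0r.
rewrite big_mkcondr /=; apply: eq_bigr => v vt.
rewrite pairingZl h; last exact: cl_root.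
rewrite [(0 : 'rV_2) 0 k]mxE addr0; case: ifP => _; last by rewrite mul0r mulr0.
by rewrite mul1r [RHS]mxE.
Qed.

Lemma pt_cr (C : tcurve R n Delta) b : injective b -> ell (ft b C) = Num.max (pairing (pt C) (crf b)) 0.
Proof.
move=> bI; have [_ h] := crfP bI; rewrite ell_ft //; congr Num.max.
rewrite -(h (dd C) (ev ord0 C)) // => i j; exact: dist_sym x0 _ _.
Qed.

Lemma descend_eq (m : nat) (T : Type) (q : T -> 'rV[R]_m) (F : T -> R) (g : 'rV[R]_m -> R) (x : 'rV[R]_m) :
  (forall C, F C = g (q C)) -> (exists C, q C = x) -> descend q F x = g x.
Proof.
move=> FE [C Cx]; rewrite /descend.
have ex : exists r, (exists C : T, q C = x /\ F C = r) by exists (F C), C.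
by have [C' [C'x <-]] := xgetPex 0 ex; rewrite FE C'x.
Qed.

Lemma ev_funE i k x : inMM x -> ev_fun Delta i k x = pairing x (evf i k).
Proof.
move=> /ex_curve ex; apply: (descend_eq (g := fun x => pairing x (evf i k))) => // C.
by rewrite pt_ev.
Qed.

Lemma ft_funE b x : injective b -> inMM x -> ft_fun Delta b x = Num.max (pairing x (crf b)) 0.
Proof.
move=> bI /ex_curve ex; apply: (descend_eq (g := fun x => Num.max (pairing x (crf b)) 0)) => // C.
exact: pt_cr.
Qed.

End Functionals.

(** * Functionals of constant sign on cones *)

Section ConeSigns.
Variables (R : realType) (m N : nat) (Lam : set 'rV[R]_m).
Variables (J : finType) (q : J -> 'rV[R]_m) (J0 : {set J}) (good : {set J} -> bool).
Hypothesis F : fan N Lam q J0 good.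
Notation inM := (inM q J0 good).
Notation supp := (supp q J0 good).
Notation crd := (crd Lam q J0 good).

Lemma pairing_crd x L : inM x -> pairing x L = \sum_(B in supp x) crd x B * pairing (q B) L.
Proof.
move=> xM; have [_ {1}->] := crdP F xM; rewrite pairing_suml.
by apply: eq_bigr => B _; rewrite pairingZl.
Qed.

Lemma sign_pos x y L : inM x -> inM y -> supp y \subset supp x ->
  (forall B, B \in J0 -> pairing (q B) L = 0) ->
  (forall B, B \in supp x -> 0 <= pairing (q B) L) ->
  (pairing x L <= 0 -> pairing y L <= 0) /\ (0 <= pairing x L -> 0 <= pairing y L).
Proof.
move=> xM yM yx L0 Lp; have [pc _] := crdP F xM.
have nn z B : inM z -> B \in supp x -> 0 <= crd z B * pairing (q B) L.
  move=> zM Bx; have [B0|B0] := boolP (B \in J0); first by rewrite L0 // mulr0.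
  by apply: mulr_ge0; [exact: (crd_ge0 F)|exact: Lp].
have y0 : 0 <= pairing y L.
  rewrite pairing_crd //; apply: sumr_ge0 => B By; exact: nn yM (subsetP yx _ By).
split=> // x0; have {x0} xz : pairing x L = 0.
  by apply/eqP; rewrite eq_le x0 pairing_crd // sumr_ge0 // => B; exact: nn.
move: xz; rewrite pairing_crd // => /psumr_eq0P xz.
rewrite pairing_crd // big1 // => B By; have Bx := subsetP yx _ By.
have := xz (fun B => nn x B xM) B Bx => /eqP; rewrite mulf_eq0 => /orP [/eqP c0|/eqP ->]; last by rewrite mulr0.
have [B0|B0] := boolP (B \in J0); first by rewrite L0 // mulr0.
by have := pc B; rewrite inE B0 Bx c0 ltxx => /(_ isT).
Qed.

Lemma sign_const x y L : inM x -> inM y -> supp y \subset supp x ->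
  (forall B, B \in J0 -> pairing (q B) L = 0) ->
  (forall B, B \in supp x -> 0 <= pairing (q B) L) \/ (forall B, B \in supp x -> pairing (q B) L <= 0) ->
  (pairing x L <= 0 -> pairing y L <= 0) /\ (0 <= pairing x L -> 0 <= pairing y L).
Proof.
move=> xM yM yx L0 [h|h]; first exact: sign_pos.
have Nr (z : 'rV[R]_m) : pairing z (- L) = - pairing z L by rewrite pairingNr.
have [||h1 h2] := sign_pos (L := - L) xM yM yx.
- by move=> B B0; rewrite Nr L0 ?oppr0.
- by move=> B Bx; rewrite Nr oppr_ge0 h.
by move: h1 h2; rewrite !Nr !oppr_le0 !oppr_ge0.
Qed.

End ConeSigns.

(** Splits of a laminar family are compatible, whereas a split 01|23 is incompatible with a split
    02|13. Compatibility restricts the membership patterns of the four labels, and the finitely many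
    cases are checked. *)
Lemma quad_sign (R : realType) (L : finType) (r : L) (S : {set {set L}}) (b : 'I_4 -> L) :
  laminar r S -> let s A : R := quad (b 0) (b 1) (b 2) (b 3) (cutd R A) in
  (forall A, A \in S -> 0 <= s A) \/ (forall A, A \in S -> s A <= 0).
Proof.
move=> lS s; case: (pselect (forall A, A \in S -> s A <= 0)); first by right.
move/existsNP => [A /not_implyP [AS /negP]]; rewrite -ltNge => sA; left=> B BS.
case/lamP: lS => lc /(_ A B AS BS) cAB.
have /and3P [rA _ _] := lc A AS; have /and3P [rB _ _] := lc B BS.
rewrite leNgt; apply/negP => sB; move: sA sB; rewrite /s !quad_cut.
have sub (X Y : {set L}) i : X \subset Y -> (i \in X) ==> (i \in Y).
  by move=> /subsetP h; apply/implyP; exact: h.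
have {cAB} : [\/ (forall i, (i \in A) ==> (i \in B)), (forall i, (i \in B) ==> (i \in A)) |
    forall i, ~~ ((i \in A) && (i \in B))].
  case/or3P: cAB => [h|h|/eqP h]; [apply: Or31|apply: Or32|apply: Or33] => i; try exact: sub.
  by have := in_set0 i; rewrite -h inE => ->.
have n10 : (1%:R - 0%:R < 0 :> R) = false by rewrite subr0 ltr10.
case=> h; move: (h (b 0)) (h (b 1)) (h (b 2)) (h (b 3)); clear;
case: (b 0 \in A); case: (b 1 \in A); case: (b 2 \in A); case: (b 3 \in A);
case: (b 0 \in B); case: (b 1 \in B); case: (b 2 \in B); case: (b 3 \in B) => //= _ _ _ _; lra.
Qed.

(** * Equality of the degrees *)

Section PartOne.
Variables (R : realType) (n d l : nat) (Delta : 'I_d -> 'rV[int]_2).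
Variables (p : 'I_n.+1 -> 'rV[R]_2) (lam : 'I_l -> cross_ratio R (ends n d)).
Hypothesis Dg : is_degree R Delta.
Hypothesis nl : (n.+1 + l = d.-1)%N.
Notation E := (ends n d).
Notation x0 := (inl ord0 : E).
Notation W := 'rV[R]_(qdim R E + 2).
Notation qM := (@qM R n d).
Notation JM := (@JM n d).
Notation goodM := (@goodM n d).
Notation inMM := (inM qM JM goodM).
Notation suppM := (supp qM JM goodM).
Notation NM := (#|E| - 3 + 2)%N.
Notation inv := (inv NM (@lattice R n d) qM JM goodM).

Lemma deg0 : \sum_k Delta k = 0. Proof. by case: Dg. Qed.

Lemma deg2 : (1 < d)%N.
Proof. by case: Dg => _ _ /eqP <-; exact: rank_leq_row. Qed.

Let FMh := FM R n deg2.

(** The dimension equals the number of conditions: two for each marked point and one for each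
    cross-ratio. *)
Lemma NM_E : NM = (2 * n.+1 + l)%N.
Proof. by rewrite card_ends; have := deg2; lia. Qed.

Lemma crf_sign b x y : injective b -> inMM x -> inMM y -> suppM y \subset suppM x ->
  (pairing x (crf R b) <= 0 -> pairing y (crf R b) <= 0) /\
  (0 <= pairing x (crf R b) -> 0 <= pairing y (crf R b)).
Proof.
move=> bI xM yM yx; have [_ h] := crfP R bI.
have qA A : pairing (qM (inl A)) (crf R b) = quad (b 0) (b 1) (b 2) (b 3) (cutd R A).
  by rewrite /= h // => i j; exact: cutd_sym.
have qk k : pairing (qM (inr k)) (crf R b) = 0.
  by rewrite /= /crf pairing_row pairing0l pairing0r addr0.
apply: (sign_const FMh) => //; first by move=> [A|k]; rewrite ?inE //.
have /andP [_ lS] := sup_good xM.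
case: (quad_sign R b lS) => s; [left|right] => -[A|k] Ax; rewrite ?qk // qA; apply: s; by rewrite inE.
Qed.

Fixpoint ev_conds (s : seq 'I_n.+1) : seq ('cV[R]_(qdim R E + 2) * R) :=
  if s is i :: s' then rcons (rcons (ev_conds s') (evf R Delta i 0, p i 0 0)) (evf R Delta i 1, p i 0 1)
  else [::].

Lemma size_ev_conds s : size (ev_conds s) = (2 * size s)%N.
Proof. by elim: s => //= i s IH; rewrite !size_rcons IH mulnS. Qed.

Definition cr_conds (len' : 'I_l -> R) (s : seq 'I_l) : seq ('cV[R]_(qdim R E + 2) * R) :=
  rev [seq (crf R (cr_lab (lam j)), len' j) | j <- s].

Lemma M_inv : inv (M R n d) [::].
Proof.
apply: (fan_inv FMh) => //; have -> : cells (M R n d) = [set s | exists2 c, cells (M0 R E) c & s = [set x : W | c (lsubmx x)]] by [].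
rewrite (@M0_cells R E x0 (ends3 n deg2)).
apply/seteqP; split=> s.
  move=> [c [x xM ->] ->]; pose y : W := row_mx x 0.
  have [|yM _] := inM_lift (p := 2) (lam_fan x0 R (ends3 n deg2)) (x := y); first by rewrite row_mxKl.
  by exists y => //; rewrite (P_lift (lam_fan x0 R (ends3 n deg2)) yM) row_mxKl.
move=> [x xM ->]; rewrite (P_lift (lam_fan x0 R (ends3 n deg2)) xM).
eexists; last by reflexivity.
have yM := inM_proj (lam_fan x0 R (ends3 n deg2)) xM.
by exists (lsubmx x).
Qed.

Lemma wdim_ev_cut i q0 (Y : wcomplex R (qdim R E + 2)) : wdim (ev_cut Delta i q0 Y) = (wdim Y - 2)%N.
Proof. by rewrite /= -subn2. Qed.

Lemma ev_inv Y Ls s : inv Y Ls -> (2 * size s <= wdim Y)%N ->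
  inv (foldr (fun i => ev_cut Delta i (p i)) Y s) (Ls ++ ev_conds s) /\
  wdim (foldr (fun i => ev_cut Delta i (p i)) Y s) = (wdim Y - 2 * size s)%N.
Proof.
move=> iY; elim: s => [|i s IH] sz; first by rewrite cats0 subn0.
have [|iZ wZ] := IH; first by move: sz => /=; lia.
set Z := foldr _ _ s in iZ wZ *.
have w2 : (1 < wdim Z)%N by rewrite wZ; move: sz => /=; lia.
split; last by rewrite [LHS]wdim_ev_cut wZ /=; lia.
rewrite /= -!rcons_cat.
have ce j k c y : inMM y -> Num.max (ev_fun Delta j k y) c = Num.max (pairing y (evf R Delta j k)) c /\
    ((ev_fun Delta j k y <= c) = (pairing y (evf R Delta j k) <= c)) /\
    ((c <= ev_fun Delta j k y) = (c <= pairing y (evf R Delta j k))).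
  by move=> yM; rewrite (ev_funE deg0 deg2 j k yM).
have ci (Y' : wcomplex R _) Ls' k c : inv Y' Ls' -> (0 < wdim Y')%N ->
    inv (cut (@lattice R n d) (ev_fun Delta i k) c Y') (rcons Ls' (evf R Delta i k, c)).
  move=> iY' w'; apply: (cut_inv FMh iY') => //.
  - by have [] := evfP R deg0 i k.
  - by move=> y yM; have [] := ce i k c y yM.
  - by move=> y yM; have [] := ce i k c y yM.
by apply: (ci) => //=; [apply: (ci) => //; lia|lia].
Qed.

(** At a positive level, max(a, 0) cannot be told from a; this is why positive lengths let the
    linear functional replace [ell]. *)
Lemma max_le_eq (a c : R) : 0 < c -> [/\ Num.max (Num.max a 0) c = Num.max a c,
  (Num.max a 0 <= c) = (a <= c) & (c <= Num.max a 0) = (c <= a)].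
Proof.
move=> c0; split.
- by rewrite -maxA (max_r (ltW c0)).
- by rewrite ge_max (ltW c0) andbT.
- by rewrite le_max [c <= 0]leNgt c0 orbF.
Qed.

Lemma cr_inv Y Ls s : inv Y Ls -> (size s <= wdim Y)%N ->
  inv (foldr (fun j => cr_cut Delta (lam j)) Y s) (Ls ++ cr_conds (fun j => cr_len (lam j)) s) /\
  wdim (foldr (fun j => cr_cut Delta (lam j)) Y s) = (wdim Y - size s)%N.
Proof.
move=> iY; elim: s => [|j s IH] sz; first by rewrite cats0 subn0.
have [|iZ wZ] := IH; first exact: ltnW.
set Z := foldr _ _ s in iZ wZ *; have w2 : (0 < wdim Z)%N by rewrite wZ subn_gt0.
split; last by rewrite /= -/Z wZ subnS.
rewrite /cr_conds /= rev_cons -rcons_cat -/(cr_conds _ _).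
have bI := @cr_lab_inj _ _ (lam j); have c0 := cr_len_gt0 (lam j).
have ce y : inMM y -> [/\ Num.max (ft_fun Delta (cr_lab (lam j)) y) (cr_len (lam j)) =
      Num.max (pairing y (crf R (cr_lab (lam j)))) (cr_len (lam j)),
    (ft_fun Delta (cr_lab (lam j)) y <= cr_len (lam j)) = (pairing y (crf R (cr_lab (lam j))) <= cr_len (lam j)) &
    (cr_len (lam j) <= ft_fun Delta (cr_lab (lam j)) y) = (cr_len (lam j) <= pairing y (crf R (cr_lab (lam j))))].
  by move=> yM; rewrite (ft_funE deg0 deg2 bI yM); exact: max_le_eq.
apply: (cut_inv FMh iZ) => //.
- by have [] := crfP R bI.
- by move=> y yM; have [] := ce y yM.
- by move=> y yM; have [_ h1 h2] := ce y yM.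
Qed.

Lemma div_cr_inv Y Ls s : inv Y Ls -> (size s <= wdim Y)%N ->
  inv (foldr (fun j => cr_div Delta (lam j)) Y s) (Ls ++ cr_conds (fun=> 0) s) /\
  wdim (foldr (fun j => cr_div Delta (lam j)) Y s) = (wdim Y - size s)%N.
Proof.
move=> iY; elim: s => [|j s IH] sz; first by rewrite cats0 subn0.
have [|iZ wZ] := IH; first exact: ltnW.
set Z := foldr _ _ s in iZ wZ *; have w2 : (0 < wdim Z)%N by rewrite wZ subn_gt0.
split; last by rewrite /= -/Z wZ subnS.
rewrite /cr_conds /= rev_cons -rcons_cat -/(cr_conds _ _).
have bI := @cr_lab_inj _ _ (lam j).
apply: (div_inv FMh iZ) => //.
- by have [] := crfP R bI.
- by move=> y yM; rewrite (ft_funE deg0 deg2 bI yM).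
- by move=> x y xM yM yx; exact: crf_sign.
Qed.

Definition evL := ev_conds (enum 'I_n.+1).

Lemma ev_prod_inv : inv (ev_prod Delta p (M R n d)) evL /\ wdim (ev_prod Delta p (M R n d)) = l.
Proof.
have [] := @ev_inv _ _ (enum 'I_n.+1) M_inv.
  by rewrite size_enum_ord /= -/(NM) NM_E leq_addr.
by rewrite /= -/(NM) size_enum_ord NM_E addKn.
Qed.

Lemma cycle_inv : inv (Defs.cycle Delta p lam) (evL ++ cr_conds (fun j => cr_len (lam j)) (enum 'I_l)) /\
  wdim (Defs.cycle Delta p lam) = 0%N.
Proof.
have [iE wE] := ev_prod_inv; have [|h ->] := cr_inv (s := enum 'I_l) iE; first by rewrite size_enum_ord wE.
by rewrite wE size_enum_ord subnn.
Qed.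

Lemma cycle_degen_inv : inv (cycle_degen Delta p lam) (evL ++ cr_conds (fun=> 0) (enum 'I_l)) /\
  wdim (cycle_degen Delta p lam) = 0%N.
Proof.
have [iE wE] := ev_prod_inv; have [|h ->] := div_cr_inv (s := enum 'I_l) iE; first by rewrite size_enum_ord wE.
by rewrite wE size_enum_ord subnn.
Qed.

Lemma conds_fst len' : map fst (evL ++ cr_conds len' (enum 'I_l)) =
  map fst evL ++ rev [seq crf R (cr_lab (lam j)) | j <- enum 'I_l].
Proof. by rewrite map_cat /cr_conds map_rev -map_comp. Qed.

(** Both cycles use the same functionals in the same order, and [deg_inv] forgets the constants. *)
Lemma N_eq : N Delta p lam = N_degen Delta p lam.
Proof.
have [i1 w1] := cycle_inv; have [i2 w2] := cycle_degen_inv.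
by rewrite /N /N_degen (deg_inv FMh i1 w1) (deg_inv FMh i2 w2) !conds_fst.
Qed.

End PartOne.

(** * Local degrees along a product of stars *)

Section SeqDet.
Variable R : realType.

Definition ndet n (M : seq (seq R)) : R := \det (\matrix_(i < n, j < n) nth 0 (nth [::] M i) j).

(** Determinants indexed by lists: permuting, mapping and concatenating index lists then replace
    reindexings of ordinals. *)
Definition sdet (X Y : Type) (e : X -> Y -> R) (xs : seq X) (ys : seq Y) : R :=
  ndet (size xs) [seq [seq e x y | y <- ys] | x <- xs].

Lemma ndet0 M : ndet 0 M = 1. Proof. exact: det_mx00. Qed.

Lemma sdetE (X Y : Type) (e : X -> Y -> R) x0 y0 xs ys n : size xs = n -> size ys = n ->
  sdet e xs ys = \det (\matrix_(i < n, j < n) e (nth x0 xs i) (nth y0 ys j)).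
Proof.
move=> sx sy; rewrite /sdet /ndet sx; congr (\det _); apply/matrixP => i j; rewrite !mxE.
by rewrite (nth_map x0) ?sx // (nth_map y0) ?sy.
Qed.

Lemma sdet_tr (X Y : Type) (e : X -> Y -> R) xs ys : size xs = size ys ->
  sdet e xs ys = sdet (fun y x => e x y) ys xs.
Proof.
case: xs ys => [|x xs] [|y ys] // sz.
rewrite (sdetE e x y sz erefl) (sdetE _ y x erefl sz) -det_tr; congr (\det _).
by apply/matrixP => i j; rewrite !mxE.
Qed.

Lemma sdet_perml (X : eqType) (Y : Type) (e : X -> Y -> R) xs xs' ys : perm_eq xs xs' ->
  `|sdet e xs ys| = `|sdet e xs' ys|.
Proof.
move=> pe; have /tuple_permP [p sp] : perm_eq xs (in_tuple xs') by [].
case: xs' pe p sp => [|x0 xs'] pe p sp; first by rewrite (perm_nilP pe).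
rewrite /sdet (perm_size pe) /ndet.
set M := [seq _ | x <- x0 :: xs'].
have -> : \matrix_(i < size (x0 :: xs'), j < size (x0 :: xs'))
     nth 0 (nth [::] [seq [seq e x y | y <- ys] | x <- xs] i) j =
   row_perm p (\matrix_(i < size (x0 :: xs'), j < size (x0 :: xs')) nth 0 (nth [::] M i) j).
  apply/matrixP => i j; rewrite !mxE; congr (nth 0 _ j).
  rewrite (nth_map x0) ?(perm_size pe) // /M (nth_map x0) //.
  suff -> : nth x0 xs i = nth x0 (x0 :: xs') (p i) by [].
  by rewrite sp -tnth_nth tnth_mktuple (tnth_nth x0).
by rewrite row_permE det_mulmx det_perm normrM normr_sign mul1r.
Qed.

Lemma sdet_permr (X : Type) (Y : eqType) (e : X -> Y -> R) xs ys ys' : size xs = size ys ->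
  perm_eq ys ys' -> `|sdet e xs ys| = `|sdet e xs ys'|.
Proof.
move=> sz pe; rewrite (sdet_tr e sz) [in RHS]sdet_tr -?(perm_size pe) //.
exact: sdet_perml.
Qed.

Lemma eq_sdet (X Y : eqType) (e e' : X -> Y -> R) xs ys :
  (forall x y, x \in xs -> y \in ys -> e x y = e' x y) -> sdet e xs ys = sdet e' xs ys.
Proof.
move=> h; rewrite /sdet; congr (ndet _ _); apply/eq_in_map => x xx; apply/eq_in_map => y yy.
exact: h.
Qed.

Lemma sdet_mapl (X X' Y : Type) (f : X' -> X) (e : X -> Y -> R) xs ys :
  sdet e [seq f x | x <- xs] ys = sdet (fun x y => e (f x) y) xs ys.
Proof. by rewrite /sdet size_map -map_comp. Qed.

Lemma sdet_mapr (X Y Y' : Type) (f : Y' -> Y) (e : X -> Y -> R) xs ys :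
  sdet e xs [seq f y | y <- ys] = sdet (fun x y => e x (f y)) xs ys.
Proof. by rewrite /sdet; congr (ndet _ _); apply: eq_map => x; rewrite -map_comp. Qed.

Lemma sdet_block (X Y : eqType) (e : X -> Y -> R) xs xs' ys ys' : size xs = size ys -> size xs' = size ys' ->
  (forall x y, x \in xs -> y \in ys' -> e x y = 0) ->
  sdet e (xs ++ xs') (ys ++ ys') = sdet e xs ys * sdet e xs' ys'.
Proof.
move=> s1 s2; case: xs' ys' s2 => [|x0 xs'] [|y0 ys'] // s2 z.
  by rewrite !cats0 [X in _ * X]ndet0 mulr1.
have sx : size (xs ++ x0 :: xs') = (size xs + size (x0 :: xs'))%N by rewrite size_cat.
have sy : size (ys ++ y0 :: ys') = (size xs + size (x0 :: xs'))%N by rewrite size_cat s1 s2.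
rewrite (sdetE e x0 y0 sx sy) (sdetE e x0 y0 erefl (esym s1)) (sdetE e x0 y0 erefl (esym s2)).
set A := \matrix_(i < size xs, j < size xs) _; set B := \matrix_(i < size (x0 :: xs'), j < _) _.
set M := \matrix_(i, j) _.
rewrite -(det_lblock A (\matrix_(i < size (x0 :: xs'), j < size xs) e (nth x0 (x0 :: xs') i) (nth y0 ys j)) B).
congr (\det _); apply/matrixP => i j; rewrite -[i]splitK -[j]splitK.
case: (split i) => i'; case: (split j) => j';
  rewrite /= ?block_mxEul ?block_mxEur ?block_mxEdl ?block_mxEdr !mxE !nth_cat /=.
- by rewrite -s1 !ltn_ord.
- rewrite ltn_ord -s1 ifN ?addKn; last by rewrite -leqNgt leq_addr.
  by rewrite z // mem_nth // -s2.
- by rewrite -s1 ltn_ord ifN ?addKn // -leqNgt leq_addr.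
- by rewrite -s1 !ifN ?addKn // -leqNgt leq_addr.
Qed.

Lemma sdet_flatten (X Y I : eqType) (e : X -> Y -> R) (s : seq I) (xs : I -> seq X) (ys : I -> seq Y) :
  uniq s -> (forall i, i \in s -> size (xs i) = size (ys i)) ->
  (forall i j x y, i \in s -> j \in s -> i != j -> x \in xs i -> y \in ys j -> e x y = 0) ->
  sdet e (flatten [seq xs i | i <- s]) (flatten [seq ys i | i <- s]) = \prod_(i <- s) sdet e (xs i) (ys i).
Proof.
elim: s => [|i s IH] /=; first by rewrite big_nil /sdet /= ndet0.
move=> /andP [ni us] sz z; rewrite big_cons sdet_block ?sz ?mem_head //.
- rewrite IH // => [j js|j k x y js ks]; first by rewrite sz // in_cons js orbT.
  by apply: z; rewrite in_cons ?js ?ks orbT.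
- rewrite !size_flatten; congr sumn; rewrite /shape -!map_comp; apply/eq_in_map => j js /=.
  by rewrite sz // in_cons js orbT.
- move=> x y xx /flattenP [t /mapP [j js ->] yt].
  apply: (z i j) => //; rewrite ?mem_head // ?in_cons ?js ?orbT //.
  by apply: contraNneq ni => ->.
Qed.

End SeqDet.

Lemma vol_sdet (R : realType) (N : nat) (J : finType) (v : J -> 'rV[R]_N) (T : {set J}) : #|T| = N ->
  vol v T = `|sdet (fun A (c : 'I_N) => v A 0 c) (enum T) (enum 'I_N)|.
Proof.
move=> cT; rewrite /vol /detr; congr `|_|; have sT : size (enum T) = N by rewrite -cardE.
case: N v cT sT => [|N] v cT sT; first by rewrite /sdet sT ndet0 det_mx00.
have /card_gt0P [A0 _] : (0 < #|T|)%N by rewrite cT.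
rewrite (sdetE _ A0 ord0 sT (size_enum_ord _)); congr (\det _); apply/matrixP => i j.
by rewrite !mxE /rows (nth_map A0) ?sT // nth_ord_enum.
Qed.

(** * Invariance of the count under relabelling of rays *)

Section Reindex.
Variables (R : realType) (N : nat) (J1 J2 : finType) (phi : J1 -> J2).
Variables (v1 : J1 -> 'rV[R]_N) (v2 : J2 -> 'rV[R]_N) (g1 : {set J1} -> bool) (g2 : {set J2} -> bool).
Implicit Types (T : {set J1}).
Hypothesis phiI : injective phi.
Hypothesis vE : forall A, v2 (phi A) = v1 A.
Hypothesis gE : forall T : {set J2}, g2 T <-> exists2 T1, g1 T1 & T = (phi @: T1)%SET.

Lemma vol_imset T : #|T| = N -> vol v2 (phi @: T) = vol v1 T.
Proof.
move=> cT; have cT' : #|(phi @: T)%SET| = N by rewrite card_imset.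
rewrite !vol_sdet //; have pe : perm_eq (enum (phi @: T)%SET) [seq phi A | A <- enum T].
  apply: uniq_perm; rewrite ?enum_uniq ?(map_inj_uniq phiI) ?enum_uniq // => B.
  rewrite mem_enum; apply/imsetP/mapP => [[A AT ->]|[A AT ->]]; exists A => //.
    by rewrite mem_enum.
  by rewrite mem_enum in AT.
rewrite (sdet_perml _ _ pe) sdet_mapl; congr `|_|; apply: eq_sdet => A c _ _.
by rewrite vE.
Qed.

Lemma g2_imset T : g2 (phi @: T) = g1 T.
Proof. by apply/idP/idP => [/gE [T1 h /imset_inj ->]|h] //; apply/gE; exists T. Qed.

Lemma top_imset T : top v2 g2 (phi @: T) = top v1 g1 T.
Proof.
rewrite /top g2_imset card_imset //; case: eqP => [cT|_]; last by rewrite !andbF.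
by rewrite vol_imset.
Qed.

Lemma co_imset T A u : top v1 g1 T -> A \in T -> co v2 (phi @: T) (phi A) u = co v1 T A u.
Proof.
move=> tT AT; have tT' : top v2 g2 (phi @: T) by rewrite top_imset.
have AT' : phi A \in (phi @: T)%SET by exact: imset_f.
have uE := co_solve u tT; set c := fun B => co v1 T B u in uE.
rewrite {1}uE -[RHS]/(c A).
pose c' B := \sum_(A' | phi A' == B) c A'.
have c'E A' : c' (phi A') = c A'.
  by rewrite /c' (big_pred1 A') // => A2; rewrite (inj_eq phiI).
rewrite -c'E -(co_eq c' tT' AT'); congr co.
rewrite big_imset /=; last by move=> A1 A2 _ _; exact: phiI.
by apply: eq_bigr => A' _; rewrite c'E vE.
Qed.

Lemma top_image (T : {set J2}) : top v2 g2 T -> exists2 T1, top v1 g1 T1 & T = (phi @: T1)%SET.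
Proof.
move=> tT; have [g _ _] := and3P tT; have [T1 _ e] := (gE T).1 g.
by exists T1 => //; rewrite -top_imset -e.
Qed.

Lemma generic_preim u : generic v2 g2 set0 u -> generic v1 g1 set0 u.
Proof.
move=> gu T A tT _; rewrite setD0 => AT; rewrite -co_imset //.
by apply: gu; rewrite ?top_imset ?sub0set ?setD0 ?imset_f.
Qed.

Lemma dcount_imset u : dcount v2 g2 set0 u = dcount v1 g1 set0 u.
Proof.
rewrite /dcount (reindex_onto (fun T : {set J1} => phi @: T)%SET (fun T : {set J2} => phi @^-1: T)%SET) /=; last first.
  move=> T /andP [/top_image [T1 _ ->] _]; apply/setP => B.
  apply/imsetP/imsetP => [[A]|[A AT ->]]; first by rewrite inE => /imsetP [A' A'T /phiI ->] ->; exists A'.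
  by exists A => //; rewrite inE imset_f.
apply: eq_big => T.
  have -> : phi @^-1: (phi @: T) == T by apply/eqP/setP => A; rewrite inE mem_imset.
  by rewrite andbT top_imset !sub0set.
case/andP => /andP [tT' _] _; have tT : top v1 g1 T by rewrite -top_imset.
rewrite vol_imset ?(top_card tT) //; congr (_ * (_ : bool)%:R); rewrite !setD0.
apply/forall_inP/forall_inP => h A AT; first by rewrite -co_imset //; apply: h; exact: imset_f.
by case/imsetP: AT => A1 A1T ->; rewrite co_imset //; exact: h.
Qed.

End Reindex.

Lemma uniq_flat (I X : eqType) (s : seq I) (f : I -> seq X) (k : X -> I) :
  uniq s -> (forall i, uniq (f i)) -> (forall i x, x \in f i -> k x = i) -> uniq (flatten [seq f i | i <- s]).
Proof.
move=> us uf kf; elim: s us => //= i s IH /andP [ni us]; rewrite cat_uniq uf IH // andbT /=.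
apply/hasPn => x /flattenP [t /mapP [j js ->]] xj; apply/negP => xi.
by rewrite -(kf i x xi) (kf j x xj) js in ni.
Qed.

Lemma flatten_eq (T1 T2 : eqType) (s : seq T1) (x y : T1 -> seq T2) :
  (forall i, i \in s -> size (x i) = size (y i)) -> flatten [seq x i | i <- s] = flatten [seq y i | i <- s] ->
  forall i, i \in s -> x i = y i.
Proof.
elim: s => //= i s IH sz /eqP; rewrite eqseq_cat ?sz ?mem_head // => /andP [/eqP e1 /eqP e2] j.
rewrite in_cons => /orP [/eqP -> //|]; apply: IH => // k ks.
by rewrite sz // in_cons ks orbT.
Qed.

Lemma seq_ord (T : Type) (x0 : T) (s : seq T) n : size s = n -> s = [seq nth x0 s (val c) | c <- enum 'I_n].
Proof. by move=> <-; rewrite (map_comp (nth x0 s)) val_enum_ord map_nth_iota0 // take_size. Qed.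

(** * Counts in a product of local fans *)

Section Product.
Variables (R : realType) (m N : nat) (Lam : set 'rV[R]_m).
Variables (J : finType) (q : J -> 'rV[R]_m) (J0 : {set J}) (good : {set J} -> bool).
Hypothesis F : fan N Lam q J0 good.
Variables (S0 : {set J}) (fa : seq 'cV[R]_m) (I : finType) (fi : I -> seq 'cV[R]_m).
Variables (gd : I -> {set J} -> bool) (loc : J -> I).
Let fs := fa ++ flatten [seq fi i | i <- enum I].
Hypothesis gS0 : good S0.
Hypothesis sfa : size fa = #|S0|.
Hypothesis sfs : size fs = N.
Hypothesis S0z : forall A i f, A \in S0 -> f \in fi i -> pairing (q A) f = 0.
Hypothesis crossz : forall i i' T A f, gd i T -> A \in T -> i != i' -> f \in fi i' -> pairing (q A) f = 0.
Definition part i (T : {set J}) : {set J} := [set A in T :\: S0 | loc A == i]%SET.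
Hypothesis gd_part : forall i T, good T -> S0 \subset T -> gd i (part i T).
Hypothesis gd_join : forall f : I -> {set J}, (forall i, gd i (f i)) -> good (S0 :|: \bigcup_i f i)%SET.
Hypothesis gd_loc : forall i T A, gd i T -> A \in T -> A \notin S0 /\ loc A = i.
Hypothesis gd_card : forall i T, gd i T -> (#|T| <= size (fi i))%N.
Notation vi i := (vq (size (fi i)) q (fi i)).
Notation top_i i := (top (vi i) (gd i)).
Implicit Types (T : {set J}) (i : I) (A B : J).

Let D : R := `|sdet (fun A f => pairing (q A) f) (enum S0) fa|.

Lemma part_sum (V : nmodType) (G : J -> V) T : S0 \subset T ->
  \sum_(A in T) G A = \sum_(A in S0) G A + \sum_i \sum_(A in part i T) G A.
Proof.
move=> ST; rewrite (bigID (mem S0)) /=; congr (_ + _).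
  by apply: eq_bigl => A; rewrite andbC andb_idr // => /(subsetP ST).
rewrite (partition_big loc xpredT) //=; apply: eq_bigr => i _; apply: eq_bigl => A.
by rewrite !inE [~~ _ && _]andbC.
Qed.

Lemma card_part T : S0 \subset T -> #|T| = (#|S0| + \sum_i #|part i T|)%N.
Proof.
move=> ST; rewrite -!sum1_card (part_sum _ ST); congr addn.
by apply: eq_bigr => i _; rewrite sum1_card.
Qed.

Lemma sum_size : (#|S0| + \sum_i size (fi i))%N = N.
Proof.
rewrite -sfs /fs size_cat sfa size_flatten /shape -map_comp; congr addn.
by rewrite sumnE big_map big_enum.
Qed.

Lemma join_part T : S0 \subset T -> (S0 :|: \bigcup_i part i T)%SET = T.
Proof.
move=> ST; apply/setP => A; rewrite inE; apply/orP/idP => [[/(subsetP ST)//|/bigcupP [i _]]|AT].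
  by rewrite !inE => /andP [/andP []].
have [|nS] := boolP (A \in S0); [by left|right].
by apply/bigcupP; exists (loc A) => //; rewrite !inE nS AT eqxx.
Qed.

Lemma part_join (f : I -> {set J}) i : (forall i, gd i (f i)) -> part i (S0 :|: \bigcup_i f i)%SET = f i.
Proof.
move=> gf; apply/setP => A; rewrite !inE; apply/andP/idP => [[/andP [nS]]|Af].
  by rewrite (negbTE nS) /= => /bigcupP [j _ Aj] /eqP <-; have [_ ->] := gd_loc (gf j) Aj.
have [nS lA] := gd_loc (gf i) Af; rewrite nS lA eqxx; split=> //.
by apply/orP; right; apply/bigcupP; exists i.
Qed.

(** The local upper bounds add up to what the total N requires, so each of them is an equality. *)
Lemma part_card T : good T -> S0 \subset T -> #|T| = N -> forall i, #|part i T| = size (fi i).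
Proof.
move=> gT ST cT; have le i : (#|part i T| <= size (fi i))%N by exact: gd_card (gd_part i gT ST).
have e : (\sum_i #|part i T| = \sum_i size (fi i))%N.
  by apply/eqP; rewrite -(eqn_add2l #|S0|) -card_part // cT sum_size.
have := leqif_sum (fun i (_ : true) => leqif_eq (le i)) => -[_].
by rewrite e eqxx => /esym /forallP h i; apply/eqP/(implyP (h i)).
Qed.

(** The matrix is block triangular: the rows of [S0] vanish on all local functionals, and the rows
    of one part vanish on the functionals of the others. *)
Lemma vol_part T : good T -> S0 \subset T -> #|T| = N ->
  vol (vq N q fs) T = D * \prod_i vol (vi i) (part i T).
Proof.
move=> gT ST cT; have pc := part_card gT ST cT.
have pe : perm_eq (enum T) (enum S0 ++ flatten [seq enum (part i T) | i <- enum I]).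
  apply: uniq_perm; first exact: enum_uniq.
    rewrite cat_uniq enum_uniq /=; apply/andP; split.
      apply/hasPn => A /flattenP [t /mapP [i _ ->]]; rewrite !mem_enum !inE.
      by case/andP => /andP [].
    apply: (uniq_flat (k := loc)) => [|i|i A]; rewrite ?enum_uniq //.
    by rewrite mem_enum !inE => /andP [_ /eqP].
  move=> A; rewrite mem_cat !mem_enum; apply/idP/orP => [AT|[/(subsetP ST)//|]].
    have [|nS] := boolP (A \in S0); [by left|right].
    apply/flattenP; exists (enum (part (loc A) T)); last by rewrite mem_enum !inE nS AT eqxx.
    by apply/mapP; exists (loc A); rewrite ?mem_enum.
  by case/flattenP => t /mapP [i _ ->]; rewrite mem_enum !inE => /andP [/andP []].
rewrite vol_sdet //.
have -> : sdet (fun A (c : 'I_N) => vq N q fs A 0 c) (enum T) (enum 'I_N) =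
    sdet (fun A f => pairing (q A) f) (enum T) fs.
  rewrite [in RHS](seq_ord 0 sfs) [RHS]sdet_mapr.
  by apply: eq_sdet => A c _ _; rewrite !mxE.
rewrite (sdet_perml _ _ pe) /fs sdet_block -?cardE ?sfa //.
- rewrite sdet_flatten ?enum_uniq //.
  + rewrite normrM normr_prod; congr (_ * _); rewrite big_enum; apply: eq_bigr => i _ /=.
    rewrite vol_sdet ?pc //; congr `|_|.
    rewrite {1}(seq_ord 0 (erefl (size (fi i)))) [LHS]sdet_mapr.
    by apply: eq_sdet => A c _ _; rewrite !mxE.
  + by move=> i _; rewrite -cardE pc.
  + move=> i j A f _ _ ij; rewrite mem_enum => Ai fj.
    exact: (crossz (gd_part i gT ST) Ai ij fj).
- rewrite !size_flatten /shape -!map_comp; congr sumn; apply: eq_map => i /=.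
  by rewrite -cardE pc.
- move=> A f; rewrite mem_enum => AS /flattenP [t /mapP [i _ ->]] ft.
  exact: S0z AS ft.
Qed.

Definition local_u i := xget 0 [set u | generic (vi i) (gd i) set0 u].

Lemma local_uP i : generic (vi i) (gd i) set0 (local_u i).
Proof. by apply: xgetPex; exact: generic_ex. Qed.

(** One generic local target for each factor; the entries for [fa] may be 0 because coordinates
    along [S0] are not tested. *)
Definition join_u : 'rV[R]_N := \row_(c < N)
  (nseq (size fa) 0 ++ flatten [seq [seq local_u i 0 c | c <- enum 'I_(size (fi i))] | i <- enum I])`_c.

Lemma join_uP T (c : J -> R) : join_u = \sum_(B in T) c B *: vq N q fs B ->
  forall i, local_u i = \sum_(B in T) c B *: vi i B.
Proof.
move=> uE i; pose h f := \sum_(B in T) c B * pairing (q B) f.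
have sz0 j : size [seq local_u j 0 c0 | c0 <- enum 'I_(size (fi j))] = size [seq h f | f <- fi j].
  by rewrite size_map size_enum_ord size_map.
set L1 := nseq (size fa) 0 ++ flatten [seq [seq local_u j 0 c0 | c0 <- enum 'I_(size (fi j))] | j <- enum I].
have s1 : size L1 = N.
  rewrite -sfs /L1 /fs !size_cat size_nseq !size_flatten /shape -!map_comp; congr (_ + sumn _)%N.
  by apply: eq_map => j /=; rewrite size_map size_enum_ord.
have : L1 = [seq h f | f <- fs].
  apply: (@eq_from_nth _ 0); first by rewrite size_map sfs.
  rewrite s1 => k kN; have := congr1 (fun r : 'rV[R]_N => r 0 (Ordinal kN)) uE.
  rewrite mxE summxE /= => ->; rewrite (nth_map 0) ?sfs //; apply: eq_bigr => B _.
  by rewrite !mxE.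
rewrite /fs map_cat map_flatten -map_comp => /eqP; rewrite eqseq_cat ?size_nseq ?size_map // => /andP [_ /eqP].
move/(@flatten_eq _ _ _ _ (fun j => [seq h f | f <- fi j])) => e.
have {}e := e (fun j _ => sz0 j) i (mem_enum _ i).
apply/rowP => a; have := congr1 (fun s : seq R => s`_a) e.
rewrite (nth_map a) ?size_enum_ord // nth_ord_enum (nth_map 0) // => ->.
by rewrite summxE; apply: eq_bigr => B _; rewrite !mxE.
Qed.

Lemma co_part T : top (vq N q fs) good T -> S0 \subset T ->
  (forall i, top_i i (part i T)) /\
  forall i A, A \in part i T -> co (vq N q fs) T A join_u = co (vi i) (part i T) A (local_u i).
Proof.
move=> tT ST; have /and3P [gT /eqP cT vT] := tT.
have pc := part_card gT ST cT; rewrite (vol_part gT ST cT) mulf_eq0 negb_or in vT.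
have [_ /prodf_neq0 vp] := andP vT.
have tp i : top_i i (part i T) by rewrite /top gd_part ?pc ?eqxx //= vp.
split=> // i A Ai; pose c B := co (vq N q fs) T B join_u.
have uE : join_u = \sum_(B in T) c B *: vq N q fs B := co_solve join_u tT.
have := join_uP uE i; rewrite (part_sum _ ST) [X in X + _]big1 ?add0r; last first.
  move=> B BS; rewrite (_ : vi i B = 0) ?scaler0 //; apply/rowP => a; rewrite !mxE.
  by apply: (S0z (i := i)) => //; rewrite mem_nth.
rewrite (bigD1 i) //= [X in _ + X]big1 ?addr0 => [e|j ji]; last first.
  apply: big1 => B Bj; rewrite (_ : vi i B = 0) ?scaler0 //; apply/rowP => a; rewrite !mxE.
  by apply: (crossz (gd_part j gT ST) Bj ji); rewrite mem_nth.
by rewrite e (co_eq c (tp i) Ai).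
Qed.

Lemma generic_join : generic (vq N q fs) good S0 join_u.
Proof.
move=> T A tT ST; rewrite inE => /andP [nS AT].
have [tp ce] := co_part tT ST; have Ai : A \in part (loc A) T by rewrite !inE nS AT eqxx.
rewrite (ce _ _ Ai); apply: local_uP (tp _) _ _; rewrite ?sub0set //.
by rewrite setD0.
Qed.

(** A maximal cone around [S0] is a choice of one local maximal cone for each i. Volumes and
    positivity tests are products, so the sum factors. *)
Lemma dg_product : dg N q good fs S0 = D * \prod_i dg (size (fi i)) q (gd i) (fi i) set0.
Proof.
rewrite -(dg_generic F gS0 generic_join).
pose F1 T := vol (vq N q fs) T * [forall A in T :\: S0, 0 < co (vq N q fs) T A join_u]%:R.
pose Fi i T := vol (vi i) T * [forall A in T :\: set0, 0 < co (vi i) T A (local_u i)]%:R.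
pose P1 T := [&& good T, S0 \subset T & #|T| == N].
pose Pi i T := gd i T && (#|T| == size (fi i)).
have -> : dcount (vq N q fs) good S0 join_u = \sum_(T | P1 T) F1 T.
  rewrite /dcount [RHS](bigID (fun T => vol (vq N q fs) T != 0)) /= [X in _ + X]big1 ?addr0; last first.
    by move=> T /andP [_ /negPn /eqP v0]; rewrite /F1 v0 mul0r.
  apply: eq_bigl => T; rewrite /P1 /top; case: (good T); case: (S0 \subset T); case: (#|T| == N); by rewrite ?andbT ?andbF.
have Ei i : dg (size (fi i)) q (gd i) (fi i) set0 = \sum_(T | Pi i T) Fi i T.
  rewrite /dg /dgr -/(local_u i) /dcount [RHS](bigID (fun T => vol (vi i) T != 0)) /= [X in _ + X]big1 ?addr0; last first.
    by move=> T /andP [_ /negPn /eqP v0]; rewrite /Fi v0 mul0r.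
  by apply: eq_bigl => T; rewrite /Pi /top sub0set andbT andbA.
under [in RHS]eq_bigr => i _ do rewrite Ei.
rewrite bigA_distr_big_dep mulr_sumr.
pose h (f : {ffun I -> {set J}}) := (S0 :|: \bigcup_i f i)%SET.
pose h' T := [ffun i => part i T].
rewrite (reindex_onto h h') /=; last first.
  move=> T /and3P [_ ST _]; rewrite /h -[RHS](join_part ST); congr (_ :|: _)%SET.
  by apply: eq_bigr => i _; rewrite ffunE.
apply: eq_big => f.
  apply/andP/familyP => [[/and3P [gf Sf /eqP cf] /eqP e] i|fP].
    have fi' : f i = part i (h f) by rewrite -{1}e ffunE.
    by rewrite unfold_in /Pi fi' gd_part //= part_card.
  have gf i : gd i (f i) by have := fP i; rewrite unfold_in => /andP [].
  have cf i : #|f i| = size (fi i) by have := fP i; rewrite unfold_in => /andP [_ /eqP].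
  have Sh : S0 \subset h f by exact: subsetUl.
  split; last by apply/eqP/ffunP => i; rewrite ffunE part_join.
  rewrite /P1 gd_join // Sh (card_part Sh) /=; apply/eqP; rewrite -sum_size; congr addn.
  by apply: eq_bigr => i _; rewrite part_join.
move=> /andP [/and3P [gf Sf /eqP cf] /eqP e].
have fi' i : f i = part i (h f) by rewrite -{1}e ffunE.
rewrite /F1; have [v0|v0] := eqVneq (vol (vq N q fs) (h f)) 0.
  rewrite v0 mul0r; apply/esym/eqP; move: v0; rewrite (vol_part gf Sf cf) => /eqP.
  rewrite !mulf_eq0 => /orP [->//|/prodf_eq0 [i _ vi0]]; apply/orP; right.
  by apply/prodf_eq0; exists i => //; rewrite /Fi fi' mulf_eq0 vi0.
have tT : top (vq N q fs) good (h f) by rewrite /top gf cf eqxx.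
have [tp ce] := co_part tT Sf; rewrite (vol_part gf Sf cf) -mulrA; congr (_ * _).
under [in RHS]eq_bigr => i _ do rewrite /Fi fi'.
rewrite big_split /= -natr_prod; congr (_ * _%:R).
have bE (b : I -> bool) : (\prod_i b i : nat)%N = [forall i, b i] :> nat.
  case: (boolP [forall i, b i]) => [/forallP hb|/forallPn [i ni]]; first by rewrite big1 // => i _; rewrite hb.
  by rewrite (bigD1 i) //= (negbTE ni).
rewrite bE; congr nat_of_bool; apply/forall_inP/forallP => [ha i|ha A].
  apply/forall_inP => A; rewrite setD0 => Ai; rewrite -ce //; apply: ha.
  by move: Ai; rewrite inE => /andP [].
move=> AX; have Ai : A \in part (loc A) (h f) by rewrite inE AX eqxx.
by rewrite (ce _ _ Ai); have /forall_inP := ha (loc A); apply; rewrite setD0.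
Qed.

End Product.

(** * Stars of vertices and local weights *)

Section Stars.
Local Open Scope set_scope.
Variables (R : realType) (n d : nat) (Delta : 'I_d -> 'rV[int]_2).
Variable C : tcurve R n Delta.
Notation E := (ends n d).
Notation x0 := (inl ord0 : E).
Notation root := (inr x0 : node C).
Notation par := (gpar root).
Notation rk := (grk root).
Let T : rooted (@adj R E C) root par rk := tree_rooted root.
Notation anG := (anc par rk).
Notation kids := (kids (G := C) x0).
Implicit Types (v w u : vert C) (i j : E).

Definition sb v i : star v := star_branch v i.

Lemma sbE v i : val (sb v i) = branch (inl v : node C) (inr i). Proof. by []. Qed.

(** If the path from v to the end i does not start towards w, then w reaches i through v. *)
Lemma branch_cross v w i : v != w -> branch (inl v : node C) (inr i) != branch (inl v : node C) (inl w) ->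
  branch (inl w : node C) (inr i) = branch (inl w : node C) (inl v).
Proof.
move=> vw ne; have Tw := tree_rooted (inl w : node C).
have vw' : inl v != inl w :> node C by apply: contraNneq vw => -[->].
have pE : gpar (inl w : node C) (inl v) = branch (inl v : node C) (inl w) by rewrite /gpar (negbTE vw').
have vi : anc (gpar (inl w : node C)) (grk (inl w : node C)) (inl v) (inr i).
  by apply: contraNT ne => /negbTE h; rewrite (branch_nx Tw) // -pE; have [-> _] := nx_up Tw h.
have [|n1 n2 n3] := nx_down Tw (root_anc Tw (inl v)); first by rewrite eq_sym.
rewrite !(branch_nx Tw) //; last by rewrite eq_sym.
exact: (nx_par Tw n1 n2 (anc_trans Tw n3 vi)).
Qed.

Definition rho v : star v := sb v x0.

Lemma rhoE v : val (rho v) = par (inl v). Proof. by []. Qed.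

Lemma sb_kid v c i : c \in kids v -> anG c (inr i) -> val (sb v i) = c.
Proof. by move=> cv ci; rewrite sbE (branch_nx T) // (kids_nx (b := fun _ : unit => x0) (k0 := tt) cv ci). Qed.

Lemma star_par v (c : star v) : c != rho v -> val c \in kids v.
Proof.
move=> h; have := valP c; rewrite (adj_kids x0) => /orP [/eqP e|//].
by case/eqP: h; apply: val_inj; rewrite rhoE.
Qed.

Lemma sb_surj v (c : star v) : exists i, sb v i = c.
Proof.
have [->|h] := eqVneq c (rho v); first by exists x0.
have cv := star_par h; have [i ci] := leaf_below x0 (val c).
by exists i; apply: val_inj; exact: sb_kid cv ci.
Qed.

Lemma sb_anc v i : sb v i != rho v -> anG (val (sb v i)) (inr i).
Proof.
move=> h; have kv := star_par h; case vi : (anG (inl v) (inr i)).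
  by have [_] := nx_kid (b := fun _ : unit => x0) (k0 := tt) vi isT; rewrite sbE (branch_nx T).
case/eqP: h; apply: val_inj; rewrite rhoE sbE (branch_nx T) //.
by have [] := nx_up T vi.
Qed.

Lemma clE_sb v i : (i \in cl x0 v) = (sb v i != rho v).
Proof.
rewrite inE; apply/idP/idP => [vi|h]; last by refine (anc_trans T (kid_anc (star_par h)) (sb_anc h)).
have [kv _] := nx_kid (b := fun _ : unit => x0) (k0 := tt) vi isT.
apply/eqP => /(congr1 val); rewrite rhoE sbE (branch_nx T) // => e.
by have := kid_par (b := fun _ : unit => x0) (k0 := tt) kv; rewrite e eqxx.
Qed.

Lemma card_star v : #|star v| = valence v.
Proof.
rewrite card_sig /valence; apply: eq_card => y; rewrite unfold_in.
by apply/idP/idP => [/mem_set|/set_mem].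
Qed.

Lemma star3 v : (2 < #|star v|)%N.
Proof. by rewrite card_star; have [_ _ _ h _] := tree_valid C; exact: h. Qed.

(** A split of the branches at v, read as a split of the labels; these are the edges by which v can
    be resolved. *)
Definition phi v (A : {set star v}) : {set E} := [set i | sb v i \in A].

Lemma in_phi v (A : {set star v}) i : (i \in phi A) = (sb v i \in A).
Proof. by rewrite inE. Qed.

Lemma phi_sub v (A B : {set star v}) : (phi A \subset phi B) = (A \subset B).
Proof.
apply/subsetP/subsetP => h c; last by rewrite !in_phi; exact: h.
by have [i <-] := sb_surj c; rewrite -!in_phi; exact: h.
Qed.

Lemma phi_inj v : injective (@phi v).
Proof. by move=> A B e; apply/eqP; rewrite eqEsubset -!phi_sub e subxx. Qed.

Lemma phi_compat v (A B : {set star v}) : compat (phi A) (phi B) = compat A B.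
Proof.
rewrite /compat !phi_sub; congr [|| _, _ | _].
have -> : phi A :&: phi B = phi (A :&: B) by apply/setP => i; rewrite !inE.
have -> : set0 = phi (set0 : {set star v}) by apply/setP => i; rewrite !inE.
exact: inj_eq (@phi_inj v) _ _.
Qed.

(** Seen from w, all branches at v other than c lie in the one branch c', and conversely. The
    relation between splits at v and at w is therefore decided by the sides of c and c'. *)
Lemma phi_cross v w (A : {set star v}) (B : {set star w}) c c' : v != w ->
  val c = branch (inl v : node C) (inl w) -> val c' = branch (inl w : node C) (inl v) ->
  [/\ c \notin A -> c' \notin B -> phi A :&: phi B = set0,
      c \notin A -> c' \in B -> phi A \subset phi B,
      c \in A -> c' \notin B -> phi B \subset phi A & c \in A -> c' \in B -> phi A :|: phi B = setT].
Proof.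
move=> vw cE c'E.
have h i : sb v i = c \/ sb w i = c'.
  have [|ne] := eqVneq (sb v i) c; [by left|right]; apply: val_inj; rewrite c'E sbE.
  apply: branch_cross vw _; rewrite -cE -sbE; apply: contra ne => /eqP e; exact/eqP/val_inj.
split=> cA cB.
- apply/setP => i; rewrite !inE; apply/negP => /andP [iA iB].
  by case: (h i) => e; rewrite e in iA iB; rewrite ?iA ?iB in cA cB.
- apply/subsetP => i; rewrite !inE => iA; case: (h i) => [e|-> //].
  by rewrite -e iA in cA.
- apply/subsetP => i; rewrite !inE => iB; case: (h i) => [-> //|e].
  by rewrite -e iB in cB.
- apply/setP => i; rewrite !inE; case: (h i) => ->; rewrite ?cA ?cB ?orbT //.
Qed.

Lemma star_toward v w : v != w -> exists c : star v, val c = branch (inl v : node C) (inl w).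
Proof.
move=> vw; have ne : inl v != inl w :> node C by apply: contraNneq vw => -[->].
by exists (exist (fun x : node C => adj (inl v : node C) x) _ (adj_branch ne)).
Qed.

Lemma phi_compat_cross v w (A : {set star v}) (B : {set star w}) : v != w ->
  rho v \notin A -> rho w \notin B -> compat (phi A) (phi B).
Proof.
move=> vw rA rB; have [c cE] := star_toward vw; have wv : w != v by rewrite eq_sym.
have [c' c'E] := star_toward wv; have [h1 h2 h3 h4] := phi_cross A B vw cE c'E.
rewrite /compat; case: (boolP (c \in A)) => cA; case: (boolP (c' \in B)) => cB.
- have := in_setT x0; rewrite -(h4 cA cB) in_setU !in_phi.
  by rewrite -![sb _ x0]/(rho _) (negbTE rA) (negbTE rB).
- by rewrite (h3 cA cB) orbT.
- by rewrite (h2 cA cB).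
- by rewrite (h1 cA cB) eqxx !orbT.
Qed.

Definition full v : {set star v} := ~: [set rho v].

Lemma phi_full v : phi (full v) = cl x0 v.
Proof. by apply/setP => i; rewrite in_phi clE_sb !inE. Qed.

Lemma phi_full_neq v w (A : {set star v}) : v != w -> clus (rho v) A -> phi A != cl x0 w.
Proof.
move=> vw cA; apply/eqP; rewrite -phi_full => e; have /and3P [rA A1 cA1] := cA.
have [c cE] := star_toward vw; have wv : w != v by rewrite eq_sym.
have [c' c'E] := star_toward wv; have [h1 h2 h3 h4] := phi_cross A (full w) vw cE c'E.
have [g1 g2 g3 g4] := phi_cross (~: [set c]) (~: [set c']) vw cE c'E.
have [k1 k2 k3 k4] := phi_cross A [set c'] vw cE c'E.
have [l1 l2 l3 l4] := phi_cross [set c] (full w) vw cE c'E.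
have /card_gt0P [a aA] : (0 < #|A|)%N by exact: ltnW.
have [i ia] := sb_surj a; have iX : i \in phi A by rewrite in_phi ia.
have rw : rho w \notin full w by rewrite !inE eqxx.
case: (boolP (c \in A)) => nA.
  have nB : c' \notin full w.
    apply/negP => cB; have := in_setT x0; rewrite -(h4 nA cB) in_setU !in_phi.
    by rewrite -![sb _ x0]/(rho _) (negbTE rA) (negbTE rw).
  have : phi (full w) \subset phi [set c] by apply: l3 => //; rewrite set11.
  rewrite -e phi_sub => /subset_leq_card; rewrite cards1 leqNgt A1 //.
case: (boolP (c' \in full w)) => nB.
  have : phi [set c'] \subset phi A.
    by rewrite e phi_sub sub1set.
  move=> sub; have : phi (~: [set c]) \subset phi [set c'].
    have [_ q2 _ _] := phi_cross (~: [set c]) [set c'] vw cE c'E.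
    by apply: q2; rewrite !inE eqxx.
  move/subset_trans/(_ sub); rewrite phi_sub -setCS setCK => /subset_leq_card; rewrite cards1 leqNgt cA1 //.
by have := in_set0 i; rewrite -(h1 nA nB) in_setI iX -e iX.
Qed.

Lemma phi_neq v w (A : {set star v}) (B : {set star w}) : v != w -> clus (rho v) A -> clus (rho w) B ->
  phi A != phi B.
Proof.
move=> vw cA cB; apply/eqP => e; have /and3P [rA A1 cA1] := cA; have /and3P [rB B1 cB1] := cB.
have [c cE] := star_toward vw; have wv : w != v by rewrite eq_sym.
have [c' c'E] := star_toward wv; have [h1 h2 h3 h4] := phi_cross A B vw cE c'E.
have /card_gt0P [a aA] : (0 < #|A|)%N by exact: ltnW.
have [i ia] := sb_surj a; have iX : i \in phi A by rewrite in_phi ia.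
case: (boolP (c \in A)) => nA; case: (boolP (c' \in B)) => nB.
- have := in_setT x0; rewrite -(h4 nA nB) in_setU !in_phi.
  by rewrite -![sb _ x0]/(rho _) (negbTE rA) (negbTE rB).
- have : phi B \subset phi [set c].
    by have [_ _ q3 _] := phi_cross [set c] B vw cE c'E; apply: q3; rewrite ?set11.
  by rewrite -e phi_sub => /subset_leq_card; rewrite cards1 leqNgt A1.
- have : phi A \subset phi [set c'].
    by have [_ q2 _ _] := phi_cross A [set c'] vw cE c'E; apply: q2; rewrite ?set11.
  by rewrite e phi_sub => /subset_leq_card; rewrite cards1 leqNgt B1.
- by have := in_set0 i; rewrite -(h1 nA nB) in_setI iX -e iX.
Qed.

Lemma phi_clus v (A : {set star v}) : clus (rho v) A -> clus x0 (phi A).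
Proof.
case/and3P => rA A1 cA1; rewrite /clus in_phi rA /=.
have two (B : {set star v}) : (1 < #|B|)%N -> (1 < #|phi B|)%N.
  case/card_gt1P => c [c' [cB cB' cc]]; have [i ic] := sb_surj c; have [j jc] := sb_surj c'.
  apply/card_gt1P; exists i, j; rewrite !in_phi ic jc; split=> //.
  by apply: contraNneq cc => e; rewrite -ic -jc e.
rewrite two //=; have -> : ~: phi A = phi (~: A) by apply/setP => i; rewrite !inE.
exact: two.
Qed.

Lemma phi_notin v (A : {set star v}) : clus (rho v) A -> phi A \notin Scl x0 C.
Proof.
move=> cA; apply/negP => /imsetP [w _]; have [<-|vw] := eqVneq v w; last exact/eqP/phi_full_neq.
rewrite -phi_full => /phi_inj e; have /and3P [_ _] := cA.
by rewrite e /full setCK cards1.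
Qed.

(** A split that is compatible with all edges of C but is not one of them resolves a vertex, namely
    v with the smallest cluster around X: by compatibility X is a union of branches below v. *)
Lemma loc_ex (X : {set E}) : clus x0 X -> X \notin Scl x0 C -> (forall B, B \in Scl x0 C -> compat X B) ->
  exists v (A : {set star v}), clus (rho v) A /\ X = phi A.
Proof.
move=> cX nX cc; have /and3P [rX X1 cX1] := cX.
have [t tp] := top_ex C x0.
have h0 : X \subset cl x0 t.
  by rewrite (cl_top tp); apply/subsetP => i iX; rewrite !inE; apply: contraNneq rX => <-.
pose v := [arg min_(v < t | X \subset cl x0 v) #|cl (G := C) x0 v|].
have [Xv mn] : X \subset cl x0 v /\ forall u, X \subset cl x0 u -> (#|cl x0 v| <= #|cl x0 u|)%N.
  by rewrite /v; case: arg_minnP.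
pose A : {set star v} := [set c | (c != rho v) && ([set i | anG (val c) (inr i)] \subset X)].
have XA : X = phi A.
  apply/setP => i; rewrite in_phi inE; apply/idP/andP => [iX|[ir /subsetP sX]]; last first.
    by apply: sX; rewrite inE; exact: sb_anc.
  have ir : sb v i != rho v by rewrite -clE_sb (subsetP Xv).
  split=> //; have kv := star_par ir; have ai := sb_anc ir.
  case: (val (sb v i)) kv ai => [u|k] kv ai; last first.
    have kr : k != x0 by move: kv; rewrite inE => /andP [h _]; apply: contraNneq h => ->.
    apply/subsetP => j; rewrite inE => /(leaf_anc kr) [->].
    by have [<-] := leaf_anc kr ai.
  have ut : ~~ itop (G := C) x0 u.
    by move: kv; rewrite inE /itop => /andP [_ /eqP ->].
  have := cc (cl x0 u); rewrite cl_Scl ut => /(_ isT) /or3P [Xu|//|/eqP e]; last first.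
    by have := in_set0 i; rewrite -e in_setI iX inE ai.
  have := mn u Xu; have pu : par (inl u) = inl v by move: kv; rewrite inE => /andP [_ /eqP].
  rewrite leqNgt => /negP []; apply: proper_card; rewrite properEneq.
  rewrite (anc_cl (kid_anc kv)) andbT; apply/eqP => /cl_inj e.
  by have := kid_above (b := fun _ : unit => x0) (k0 := tt) kv erefl; rewrite e anc_refl.
exists v, A; split=> //; apply/and3P; split; first by rewrite inE eqxx.
  rewrite ltnNge; apply/negP => A1.
  have : (0 < #|A|)%N.
    have /card_gt0P [i] : (0 < #|X|)%N by exact: ltnW.
    by rewrite XA in_phi => iA; apply/card_gt0P; exists (sb v i).
  rewrite lt0n => A0; have /cards1P [c Ac] : #|A| == 1%N by rewrite eqn_leq A1 lt0n.
  have : c \in A by rewrite Ac set11.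
  rewrite inE => /andP [cr _]; have kv := star_par cr.
  have Xc : X = [set i | anG (val c) (inr i)].
    apply/setP => i; rewrite XA in_phi Ac in_set1 inE; apply/eqP/idP => [e|ci].
      by rewrite -e; apply: sb_anc; rewrite e.
    by apply: val_inj; exact: sb_kid kv ci.
  case: (val c) kv Xc => [u|k] kv Xc.
    case/negP: nX; rewrite Xc -[[set i | _]]/(cl x0 u) cl_Scl /itop.
    by move: kv; rewrite inE => /andP [_ /eqP ->].
  have kr : k != x0 by move: kv; rewrite inE => /andP [h _]; apply: contraNneq h => ->.
  move: X1; rewrite Xc (_ : [set i | _] = [set k]) ?cards1 //.
  by apply/setP => j; rewrite !inE; apply/idP/eqP => [/(leaf_anc kr) []//|->]; exact: anc_refl.
rewrite ltnNge; apply/negP => A1.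
have AE : A = full v.
  have : ~: A = [set rho v].
    by apply/esym/eqP; rewrite eqEcard cards1 A1 sub1set !inE eqxx.
  by move/(congr1 (fun Y : {set star v} => ~: Y)); rewrite setCK.
have Xcl : X = cl x0 v by rewrite XA AE phi_full.
have vt : itop (G := C) x0 v by rewrite -[itop _ _]negbK -cl_Scl -Xcl.
by move: cX1; rewrite Xcl (cl_top vt) setCK cards1.
Qed.

End Stars.

(** * Products of degenerated cross-ratios in M_{0,L} *)

Section M0Cycles.
Variables (R : realType) (L : finType) (r : L).
Hypothesis L3 : (2 < #|L|)%N.
Notation q0 := (@vsplit R L).
Notation inM0 := (inM q0 set0 (laminar r)).
Notation supp0 := (supp q0 set0 (laminar r)).
Notation inv0 := (inv (#|L| - 3) (@lattice0 R L) q0 set0 (laminar r)).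
Let F0 := lam_fan r R L3.

Lemma M0_inv : inv0 (M0 R L) [::].
Proof. by apply: (fan_inv F0) => //; exact: M0_cells. Qed.

Definition qcr (b : 'I_4 -> L) : 'cV[R]_(qdim R L) :=
  xget 0 [set f | forall dd, (forall i j, dd i j = dd j i) ->
    pairing (qt dd) f = quad (b 0) (b 1) (b 2) (b 3) dd].

Lemma qcrP b : injective b -> forall dd, (forall i j, dd i j = dd j i) ->
    pairing (qt dd) (qcr b) = quad (b 0) (b 1) (b 2) (b 3) dd.
Proof. by move=> bI; have := xgetPex 0 (quadfP R bI); exact. Qed.

Lemma qcr_cut b A : injective b -> pairing (q0 A) (qcr b) = quad (b 0) (b 1) (b 2) (b 3) (cutd R A).
Proof. by move=> bI; rewrite qcrP //; exact: cutd_sym. Qed.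

Lemma ex_tree x : inM0 x -> exists G : marked_tree R L, pt0 G = x.
Proof.
move=> yM; have [pc xc] := crdP F0 yM; set c := crd _ _ _ _ _ in pc xc.
have lS := sup_good yM; set S := supp0 x in pc xc lS.
have c0 B : B \in S -> 0 < c B by move=> BS; apply: pc; rewrite setD0.
exists (MarkedTree (tree_of_lamP lS L3 c0)).
exact: etrans (pt0_lam L3 lS c0) (esym xc).
Qed.

Lemma ft0_inv b Y Ls : injective b -> inv0 Y Ls -> (0 < wdim Y)%N -> inv0 (ft0_div b Y) (rcons Ls (qcr b, 0)).
Proof.
move=> bI iY w0; apply: (div_inv F0 iY) => //.
- by apply: lattice0_int => A; rewrite qcr_cut // quad_int.
- move=> y yM; apply: (descend_eq (g := fun y => Num.max (pairing y (qcr b)) 0)); last exact: ex_tree.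
  move=> G; rewrite ell_ft //; congr Num.max; rewrite -(qcrP bI) // => i j; exact: dist_sym r _ _.
- move=> x y xM yM yx; apply: (sign_const F0) => //; first by move=> B; rewrite in_set0.
  case: (quad_sign R b (sup_good xM)) => s; [left|right] => A Ax; rewrite qcr_cut //; exact: s.
Qed.

(** With as many cross-ratios as the dimension, the origin is a cell of dimension 0 on all
    hyperplanes, and its weight is the count along the empty set of rays. *)
Lemma ft0_prod (I : eqType) (b : I -> 'I_4 -> L) (s : seq I) : (forall j, j \in s -> injective (b j)) ->
  size s = (#|L| - 3)%N ->
  wt (foldr (fun j => ft0_div (b j)) (M0 R L) s) [set 0] =
  dg (#|L| - 3) q0 (laminar r) (rev [seq qcr (b j) | j <- s]) set0.
Proof.
move=> bI sz; pose cs (s : seq I) := rev [seq (qcr (b j), 0 : R) | j <- s].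
have key : forall s', subseq s' s -> inv0 (foldr (fun j => ft0_div (b j)) (M0 R L) s') (cs s') /\
    wdim (foldr (fun j => ft0_div (b j)) (M0 R L) s') = (#|L| - 3 - size s')%N.
  elim=> [_|j s' IH js]; first by rewrite subn0; split=> //; exact: M0_inv.
  have [|iY wY] := IH; first exact: subseq_trans (subseq_cons _ _) js.
  have szl := size_subseq js; rewrite /= sz in szl; set Z := foldr _ _ s' in iY wY *.
  split; last by rewrite /= -/Z wY -subnS.
  rewrite /cs /= rev_cons; apply: ft0_inv => //; last by rewrite wY subn_gt0.
  by apply: bI; apply: (mem_subseq js); exact: mem_head.
have [iY wY] := key s (subseq_refl s); rewrite sz subnn in wY.
have [||xM xS] := sup_eq F0 (S := set0) (a := fun=> 0) (x := 0) (lam0 r).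
- by move=> A; rewrite setD0 in_set0.
- by rewrite /comb big_set0.
rewrite (point_wt F0 iY wY xM); last first.
  apply/eqP; rewrite -leqn0; apply: leq_trans (dimvS (capvSl _ _)) _.
  by rewrite xS /sp big_set0 dimv0.
have -> : inH (cs s) 0.
  by apply/allP => -[f c]; rewrite mem_rev => /mapP [j _ [-> ->]] /=; rewrite pairing0l.
by rewrite mul1r xS /cs map_rev -map_comp.
Qed.

End M0Cycles.

(** * Cross-ratios at a vertex and the weight [omega] *)

Section LocalWeights.
Variables (R : realType) (n d l : nat) (Delta : 'I_d -> 'rV[int]_2).
Variables (lam : 'I_l -> cross_ratio R (ends n d)).
Variable C : tcurve R n Delta.
Notation E := (ends n d).
Notation qM := (@qM R n d).
Notation cb j := (cr_lab (lam j)).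
Notation crj j := (crf R (cb j)).
Implicit Types (v w : vert C) (j : 'I_l).

(** By [ft_valence], v stays 4-valent exactly if the four labels leave it through four different
    edges. *)
Lemma lambda_atP v j : reflect (injective (fun k => sb v (cb j k))) (j \in lambda_at lam v).
Proof.
have vE (w : vert (ft (cb j) C)) : valence w = #|[set branch (inl (val w) : node C) (inr (cb j k)) | k : 'I_4]%SET|.
  exact: (@ft_valence R E _ (cb j) 0 C (@cr_lab_inj _ _ (lam j)) w).
have iE (w : vert C) : (#|[set branch (inl w : node C) (inr (cb j k)) | k : 'I_4]%SET| == 4%N) =
    injectiveb (fun k => sb w (cb j k)).
  have -> : #|[set branch (inl w : node C) (inr (cb j k)) | k : 'I_4]%SET| = #|[set sb w (cb j k) | k : 'I_4]%SET|.
    rewrite -[RHS](card_imset _ val_inj) -imset_comp; apply: eq_card => y.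
    by congr (y \in _); apply: eq_imset => k.
  apply/eqP/injectiveP => [c4|h]; last by rewrite card_imset // card_ord.
  have /imset_injP h : #|[set sb w (cb j k) | k in 'I_4]%SET| == #|'I_4| by rewrite c4 card_ord.
  by move=> k k' e; apply: h.
apply: (iffP idP) => [|h].
  rewrite inE => /existsP [w /andP [/eqP <-]]; rewrite vE iE => /injectiveP h.
  exact: h.
have c4 := iE v; have ib : injectiveb (fun k => sb v (cb j k)) by apply/injectiveP.
rewrite ib in c4; have rv : remains (cb j) v by rewrite /remains (eqP c4).
rewrite inE; apply/existsP; exists (exist _ v rv : ft_vert (cb j) C).
by rewrite eqxx vE /= c4.
Qed.

Lemma quad_phi v (b : 'I_4 -> E) (A : {set star v}) :
  quad (b 0) (b 1) (b 2) (b 3) (cutd R (phi A)) =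
  quad (sb v (b 0)) (sb v (b 1)) (sb v (b 2)) (sb v (b 3)) (cutd R A).
Proof. by rewrite !quad_cut !in_phi. Qed.

Lemma crf_ray b X : injective b -> pairing (qM (inl X)) (crf R b) = quad (b 0) (b 1) (b 2) (b 3) (cutd R X).
Proof. by move=> bI; have [_ h] := crfP R bI; rewrite /= h // => i j; exact: cutd_sym. Qed.

Definition phiJ v (A : {set star v}) : ({set E} + 'I_2)%type := inl (phi A).

Lemma phiJ_inj v : injective (@phiJ v).
Proof. by move=> A B [] /phi_inj. Qed.

Definition gd v (T : {set {set E} + 'I_2}) : bool :=
  [exists T1 : {set {set star v}}, laminar (rho v) T1 && (T == @phiJ v @: T1)%SET].

Lemma gdP v T : gd v T <-> exists2 T1, laminar (rho v) T1 & T = (@phiJ v @: T1)%SET.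
Proof.
split=> [/existsP [T1 /andP [h /eqP ->]]|[T1 h ->]]; first by exists T1.
by apply/existsP; exists T1; rewrite h eqxx.
Qed.

Definition fi v : seq 'cV[R]_(qdim R E + 2) := rev [seq crj j | j <- enum (lambda_at lam v)].

Lemma size_fi v : size (fi v) = #|lambda_at lam v|.
Proof. by rewrite size_rev size_map -cardE. Qed.

(** [phi] turns rays of M_{0,star v} into rays of the big fan, and by [quad_phi] the cross-ratio
    functionals have the same values on both, so the counts agree. *)
Lemma omega_dg v : #|lambda_at lam v| = (#|star v| - 3)%N ->
  omega lam v = dg (size (fi v)) qM (gd v) (fi v) set0.
Proof.
move=> cv; have s3 := star3 v; pose bv j := star_branch v \o cb j.
have bI j : j \in enum (lambda_at lam v) -> injective (bv j).
  by rewrite mem_enum => /lambda_atP.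
rewrite /omega (@ft0_prod R (star v) (rho v) s3 _ bv _ bI) -?cardE // size_fi cv.
set f1 := rev _; have F0 := lam_fan (rho v) R s3.
have vE (A : {set star v}) : vq (#|star v| - 3) qM (fi v) (phiJ A) = vq (#|star v| - 3) (@vsplit R (star v)) f1 A.
  apply/rowP => c; rewrite !mxE /fi /f1.
  have lc : (c < size (enum (lambda_at lam v)))%N by rewrite -cardE cv.
  rewrite !nth_rev ?size_map //; set a := (_ - _)%N.
  have la : (a < size (enum (lambda_at lam v)))%N by rewrite /a; case: (size _) lc => // m _; rewrite subSS ltnS leq_subr.
  have [j0 _] : exists j0, j0 \in enum (lambda_at lam v).
    by case: (enum _) la => // j0 s' _; exists j0; exact: mem_head.
  rewrite !(nth_map j0) //; set j := nth j0 _ a; have jI : j \in enum (lambda_at lam v) by exact: mem_nth.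
  by rewrite crf_ray ?quad_phi; [rewrite qcr_cut //; exact: bI|exact: cr_lab_inj].
rewrite [RHS]/dg /dgr (dcount_imset (@phiJ_inj v) vE (gdP v)) (dg_generic F0) //; first exact: lam0.
apply: (generic_preim (@phiJ_inj v) vE (gdP v)); apply: xgetPex; exact: generic_ex.
Qed.

End LocalWeights.

Section RaySpaces.
Variables (R : realType) (m N : nat) (Lam : set 'rV[R]_m).
Variables (J : finType) (q : J -> 'rV[R]_m) (J0 : {set J}) (good : {set J} -> bool).
Hypothesis F : fan N Lam q J0 good.
Implicit Types (S T : {set J}).

Lemma dim_sp S : good S -> \dim (sp q S) = #|S|.
Proof.
move=> gS; have fr : free [seq q A | A <- enum S].
  apply: free_map_uniq => [|c c0 A]; first exact: enum_uniq.
  rewrite mem_enum => AS; have := pairing_comb F c gS AS (subxx _); rewrite AS => <-.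
  by rewrite /comb -big_enum c0 pairing0l.
move: fr; rewrite /free size_map -cardE => /eqP <-; congr (\dim _).
apply/vspaceP => w; by rewrite /sp span_def big_map big_enum.
Qed.

Lemma dg_ex fs S : dg N q good fs S != 0 -> good S -> exists T, top (vq N q fs) good T /\ S \subset T.
Proof.
move=> d0 gS; have [u gu] := generic_ex (vq N q fs) good.
move: d0; rewrite -(dg_generic F gS (generic_set0 (S0 := S) gu)).
have [[T tT ST]|nT] := pselect (exists2 T, top (vq N q fs) good T & S \subset T); first by exists T.
rewrite /dcount big_pred0 ?eqxx // => T; apply/negbTE/negP => /andP [tT ST].
by apply: nT; exists T.
Qed.

(** A point in the relative interior of a facet lies on no proper face, so its own cell is the whole
    facet. *)
Lemma facet_dim Y Ls x : inv N Lam q J0 good Y Ls -> (exists2 s, facets Y s & relint s x) ->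
  inM q J0 good x /\ \dim (V q J0 good Ls x) = wdim Y.
Proof.
move=> [_ _ cY _] [s [+ ps] [sx nf]]; rewrite cY => -[y [yM _ sE]]; subst s.
have xM : inM q J0 good x by case: sx.
split=> //; rewrite -ps /pdim; suff -> : P q J0 good Ls y = P q J0 good Ls x by rewrite (linP F).
have [//|ne] := pselect (P q J0 good Ls y = P q J0 good Ls x).
have fc : is_face (P q J0 good Ls x) (P q J0 good Ls y) by apply/(faceP F).
by case: (nf _ fc _ (P_refl Ls xM)) => e; apply: ne.
Qed.

End RaySpaces.

(** * The multiplicity as a product over the vertices *)

Section PartTwo.
Local Open Scope set_scope.
Variables (R : realType) (n d l : nat) (Delta : 'I_d -> 'rV[int]_2).
Variables (p : 'I_n.+1 -> 'rV[R]_2) (lam : 'I_l -> cross_ratio R (ends n d)).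
Hypothesis Dg : is_degree R Delta.
Hypothesis nl : (n.+1 + l = d.-1)%N.
Notation E := (ends n d).
Notation x0 := (inl ord0 : E).
Notation W := 'rV[R]_(qdim R E + 2).
Notation qM := (@qM R n d).
Notation JM := (@JM n d).
Notation goodM := (@goodM n d).
Notation inMM := (inM qM JM goodM).
Notation suppM := (supp qM JM goodM).
Notation NM := (#|E| - 3 + 2)%N.
Notation inv := (inv NM (@lattice R n d) qM JM goodM).
Notation cb j := (cr_lab (lam j)).
Notation crj j := (crf R (cb j)).
Let FMh := FM R n (deg2 Dg).
Let d2 := deg2 Dg.

Let crL := cr_conds lam (fun=> 0) (enum 'I_l).
Let evLp := evL Delta p.
Let crs : seq 'cV[R]_(qdim R E + 2) := rev [seq crj j | j <- enum 'I_l].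
Definition ev_fs : seq 'cV[R]_(qdim R E + 2) := map fst evLp.

Lemma size_ev_fs : size ev_fs = (2 * n.+1)%N.
Proof. by rewrite size_map /evLp /evL size_ev_conds size_enum_ord. Qed.

Lemma X_inv : inv (X Delta lam) crL /\ wdim (X Delta lam) = (2 * n.+1)%N.
Proof.
have [|h ->] := div_cr_inv (s := enum 'I_l) lam Dg (M_inv n Dg); first by rewrite size_enum_ord /= -/(NM) (NM_E Dg nl) leq_addl.
by split=> //; rewrite /= -/(NM) (NM_E Dg nl) size_enum_ord addnK.
Qed.

Lemma evX_inv : inv (ev_prod Delta p (X Delta lam)) (crL ++ evLp) /\ wdim (ev_prod Delta p (X Delta lam)) = 0%N.
Proof.
have [iX wX] := X_inv; have [|h ->] := ev_inv (s := enum 'I_n.+1) p Dg nl iX; first by rewrite wX size_enum_ord.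
by split=> //; rewrite wX size_enum_ord subnn.
Qed.

Variable C : tcurve R n Delta.
Hypothesis contC : contributes p lam C.
Hypothesis intX : degen_in_interiors Delta p lam.
Let x := pt C.
Let S := suppM x.

Lemma contrib_dg : [/\ inMM x, inH (evLp ++ crL) x, dg NM qM goodM (ev_fs ++ crs) S != 0 &
  mult p lam C = dg NM qM goodM (ev_fs ++ crs) S].
Proof.
have [iY w0] := cycle_degen_inv p lam Dg nl.
have [s [/(facetsP FMh iY w0) [y [yM dy ->]] wt0 xs]] := contC.
have {}xs : pt C = y by [].
subst y.
have e : wt (cycle_degen Delta p lam) [set x]%classic = _ := point_wt FMh iY w0 yM dy.
rewrite conds_fst in e; rewrite /mult e; move: wt0; rewrite e.
by case: (inH _ _); rewrite ?mul0r ?eqxx // mul1r; split.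
Qed.

Let xM : inMM x. Proof. by case: contrib_dg. Qed.
Let gS : goodM S. Proof. exact: sup_good xM. Qed.
Let S_prj : prj S = Scl x0 C. Proof. by have [] := pt_inM d2 C. Qed.

Lemma crj_zero j : pairing x (crj j) = 0.
Proof.
have [_ /allP h _ _] := contrib_dg; have := h (crj j, 0); rewrite mem_cat => /(_ _)/eqP; apply.
by rewrite /crL /cr_conds mem_rev; apply/orP; right; apply/mapP; exists j; rewrite ?mem_enum.
Qed.

Lemma crf_lin b k : pairing (qM (inr k)) (crf R b) = 0.
Proof. by rewrite /qM /ql /crf pairing_row pairing0l pairing0r addr0. Qed.

(** The value at x is a combination, with positive coefficients, of the values on the rays, which
    have one sign by [quad_sign]; the total is 0 by [crj_zero], so every value is 0. *)
Lemma S0z j A : A \in S -> pairing (qM A) (crj j) = 0.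
Proof.
move=> AS; have bI := @cr_lab_inj _ _ (lam j).
have lS : laminar x0 (prj S) by case/andP: gS.
have Az B : B \in S -> B \in JM -> pairing (qM B) (crj j) = 0.
  by case: B => [B _|k _ _]; [rewrite inE|exact: crf_lin].
have [A0|A0] := boolP (A \in JM); first exact: Az.
have [pc _] := crdP FMh xM; have cA : 0 < crd (@lattice R n d) qM JM goodM x A by apply: pc; rewrite inE A0.
have := crj_zero j; rewrite (pairing_crd FMh) // => e.
have key (t : W) : (forall B, B \in S -> 0 <= crd (@lattice R n d) qM JM goodM x B * pairing (qM B) (crj j)) \/
    (forall B, B \in S -> 0 <= - (crd (@lattice R n d) qM JM goodM x B * pairing (qM B) (crj j))).
  have cr0 B : B \notin JM -> 0 <= crd (@lattice R n d) qM JM goodM x B by exact: (crd_ge0 FMh).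
  have {}cr0 := cr0; have [h|h] := quad_sign R (cb j) lS; [left|right]; case=> [B|k] BS; rewrite ?crf_lin ?mulr0 ?oppr0 //.
    by rewrite mulr_ge0 ?cr0 ?inE // crf_ray //; apply: h; rewrite inE.
  by rewrite -mulrN mulr_ge0 ?cr0 ?inE // oppr_ge0 crf_ray //; apply: h; rewrite inE.
suff /eqP : crd (@lattice R n d) qM JM goodM x A * pairing (qM A) (crj j) = 0.
  by rewrite mulf_eq0 gt_eqF //= => /eqP.
case: (key 0) => h.
  by apply/eqP; move/eqP: e; rewrite psumr_eq0 // => /allP /(_ A (mem_index_enum _)); rewrite AS.
apply/eqP; rewrite -oppr_eq0; move/eqP: e; rewrite -oppr_eq0 -sumrN psumr_eq0 //.
by move/allP => /(_ A (mem_index_enum _)); rewrite AS.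
Qed.

(** By the interior hypothesis the cell of x in [X] has full dimension 2(n+1); it is the whole cone
    of x, because by [S0z] the cross-ratios vanish there. *)
Lemma card_S : #|S| = (2 * n.+1)%N.
Proof.
have [iX wX] := X_inv; have [iE wE] := evX_inv.
have [_ Hx d0 _] := contrib_dg.
have Hx' : inH (crL ++ evLp) x by move: Hx; rewrite /inH !all_cat andbC.
have szf : size (ev_fs ++ crs) = NM.
  by rewrite size_cat size_ev_fs size_rev size_map size_enum_ord (NM_E Dg nl).
have d0' : dg NM qM goodM (map fst (crL ++ evLp)) S != 0.
  suff <- : dg NM qM goodM (ev_fs ++ crs) S = dg NM qM goodM (map fst (crL ++ evLp)) S by [].
  apply: (dg_perm FMh gS) => //; rewrite map_cat perm_catC perm_cat2r.
  by rewrite /crL /cr_conds map_rev -map_comp.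
have dV := dim0 FMh iE wE xM Hx' d0'.
have xin : Defs.support (ev_prod Delta p (X Delta lam)) x.
  exists [set x]%classic; split=> //; first by apply/(facetsP FMh iE wE); exists x.
  by rewrite (point_wt FMh iE wE xM dV) Hx' mul1r.
have [_] := facet_dim FMh iX (intX xin); rewrite wX => <-.
rewrite -(dim_sp FMh gS); congr (\dim _); apply/vspaceP => w; apply/idP/VP => [ws|[]//].
split=> // L c; rewrite /crL /cr_conds mem_rev => /mapP [j _ [-> _]] _.
have /spP [a ->] := ws; rewrite pairing_suml big1 // => A AS.
by rewrite pairingZl S0z ?mulr0.
Qed.

Lemma card_Scl : #|Scl x0 C| = (2 * n)%N.
Proof. by have := card_prj gS; rewrite card_S S_prj mulnS addnC => /eqP; rewrite eqn_add2r => /eqP. Qed.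

Lemma card_tops : #|[pred v : vert C | itop x0 v]| = 1%N.
Proof.
have [v vt] := top_ex C x0; rewrite -(card1 v); apply: eq_card => w; rewrite !inE.
apply/idP/eqP => [wt|->//]; apply: (@cl_inj R E C x0); rewrite !cl_top //.
Qed.

Lemma card_vert : #|vert C| = (2 * n).+1.
Proof.
rewrite -(cardC [pred v : vert C | itop x0 v]) card_tops add1n; congr _.+1; rewrite -card_Scl card_in_imset.
  by apply: eq_card => v; rewrite !inE.
by move=> v w _ _; exact: cl_inj.
Qed.

Lemma ex_topM : exists T, [/\ goodM T, #|T| = NM, vol (vq NM qM (ev_fs ++ crs)) T != 0 & S \subset T].
Proof.
have [_ _ d0 _] := contrib_dg.
by have [T [/and3P [gT /eqP cT vT] ST]] := dg_ex FMh d0 gS; exists T.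
Qed.

Lemma size_fs : size (ev_fs ++ crs) = NM.
Proof. by rewrite size_cat size_ev_fs size_rev size_map size_enum_ord (NM_E Dg nl). Qed.

Lemma I4P (i : 'I_4) : [\/ i = 0, i = 1, i = 2 | i = 3].
Proof.
case: i => -[|[|[|[|//]]]] ip; [apply: Or41|apply: Or42|apply: Or43|apply: Or44]; exact: val_inj.
Qed.

Lemma quad3 (v : vert C) (A : {set star v}) b : (exists k : 'I_4, exists c : bool, forall i, i != k -> (sb v (b i) \in A) = c) ->
  quad (b 0) (b 1) (b 2) (b 3) (cutd R (phi A)) = 0.
Proof.
move=> [k [c h]]; rewrite quad_cut !in_phi.
have [g h'] : exists g, forall i, (sb v (b i) \in A) = if i == k then g else c.
  by exists (sb v (b k) \in A) => i; case: eqVneq => [->//|/h].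
rewrite !h' {h h'}.
case: (I4P k) => ->; case: g; case: c; rewrite /= ?subrr //.
Qed.

(** At w at most one of the four labels lies towards v, so from v at least three of them lie towards
    w. A split at v leaves these three together, and the four-point functional vanishes. *)
Lemma crossz (v w : vert C) (A : {set star v}) j : v != w -> j \in lambda_at lam w ->
  pairing (qM (inl (phi A))) (crj j) = 0.
Proof.
move=> vw /lambda_atP wI; rewrite crf_ray; last exact: cr_lab_inj.
apply: quad3; have [c cE] := star_toward vw.
have wv : w != v by rewrite eq_sym.
have [[k ke]|no] := pselect (exists k, branch (inl w : node C) (inr (cb j k)) = branch (inl w : node C) (inl v)).
  exists k; exists (c \in A) => i ik; suff -> : sb v (cb j i) = c by []; apply: val_inj; rewrite cE sbE.
  apply: branch_cross => //; rewrite -ke; apply: contra_neq ik => e; apply: wI; exact: val_inj.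
exists 0; exists (c \in A) => i _; suff -> : sb v (cb j i) = c by []; apply: val_inj; rewrite cE sbE.
by apply: branch_cross => //; apply/eqP => e; apply: no; exists i.
Qed.

(** Each of the four labels lies towards w from v or towards v from w, by [branch_cross]; but at
    most one label can do so at each of the two vertices. *)
Lemma lambda_uniq (v w : vert C) j : j \in lambda_at lam v -> j \in lambda_at lam w -> v = w.
Proof.
move=> /lambda_atP vI /lambda_atP wI; apply/eqP/negPn/negP => vw.
have tw i i' : i != i' -> branch (inl v : node C) (inr (cb j i)) = branch (inl v : node C) (inl w) \/
    branch (inl v : node C) (inr (cb j i')) = branch (inl v : node C) (inl w).
  move=> ii'; have [e|e] := eqVneq (branch (inl v : node C) (inr (cb j i))) (branch (inl v : node C) (inl w)); first by left.
  have [e'|e'] := eqVneq (branch (inl v : node C) (inr (cb j i'))) (branch (inl v : node C) (inl w)); first by right.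
  case/eqP: ii'; apply: wI; apply: val_inj; rewrite !sbE.
  by rewrite (branch_cross vw e) (branch_cross vw e').
have no i i' : i != i' -> branch (inl v : node C) (inr (cb j i)) = branch (inl v : node C) (inl w) ->
    branch (inl v : node C) (inr (cb j i')) = branch (inl v : node C) (inl w) -> False.
  by move=> ii' e e'; case/eqP: ii'; apply: vI; apply: val_inj; rewrite !sbE e e'.
by case: (tw 0 1 isT) => e; case: (tw 2 3 isT) => e'; exact: no _ _ _ e e'.
Qed.

(** A partition of four labels into two pairs is determined by one of its pairs. *)
Lemma two_two (f g : 'I_4 -> bool) (k k' : 'I_4) : k != k' -> f k = f k' -> g k -> g k' ->
  (forall i, g i -> f i = f k) ->
  [&& f 0 == f 1, f 2 == f 3 & f 0 != f 2] || [&& f 0 == f 2, f 1 == f 3 & f 0 != f 1] ->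
  exists c, forall i, f i = (g i (+) c).
Proof.
move=> kk' fk gk gk' gf h; exists (~~ f k) => i.
have [gi|gi] := boolP (g i); first by rewrite (gf i gi) addTb negbK.
have ik : i != k by apply: contraNneq gi => ->.
have ik' : i != k' by apply: contraNneq gi => ->.
rewrite addFb; move: kk' fk ik ik' h; clear.
by case: (I4P k) => ->; case: (I4P k') => -> //; case: (I4P i) => -> // _; case: (f 0); case: (f 1); case: (f 2); case: (f 3).
Qed.

Lemma one_edge (v : vert C) (c : star v) (i i' : E) : i != i' -> sb v i = c -> sb v i' = c ->
  exists X : {set E}, X \in Scl x0 C /\ exists t : bool, forall j, (j \in X) = ((sb v j == c) (+) t).
Proof.
move=> ii' ci ci'; have [cr|cr] := eqVneq c (rho v).
  exists (cl x0 v); rewrite cl_Scl; split; last by exists true => j; rewrite clE_sb cr addbT.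
  apply/negP => vt; have cz j : sb v j = c -> j = x0.
    move=> jc; have : j \notin cl x0 v by rewrite clE_sb jc cr eqxx.
    by rewrite cl_top // !inE negbK => /eqP.
  by case/eqP: ii'; rewrite (cz i) // (cz i').
have cv := star_par cr; have an j : sb v j = c -> anc (gpar (inr x0 : node C)) (grk (inr x0 : node C)) (val c) (inr j).
  by move=> jc; rewrite -{1}jc; apply: sb_anc; rewrite jc.
case e : (val c) => [u|k]; last first.
  have kr : k != x0 by move: cv; rewrite e inE => /andP [h _]; apply: contraNneq h => ->.
  have lf j : sb v j = c -> j = k.
    move=> jc; have := an j jc; rewrite e => kj.
    by have [] := leaf_anc kr kj.
  by case/eqP: ii'; rewrite (lf i) // (lf i').
have ut : ~~ itop x0 u.
  by move: cv; rewrite e inE => /andP [_ /eqP h]; rewrite /itop h.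
exists (cl x0 u); rewrite cl_Scl; split=> //; exists false => j; rewrite addbF inE -e.
apply/idP/eqP => [uj|]; last exact: an.
by apply: val_inj; exact: sb_kid.
Qed.

Lemma col_vol (T : {set {set E} + 'I_2}) f : #|T| = NM -> f \in ev_fs ++ crs -> (forall A, A \in T -> pairing (qM A) f = 0) ->
  vol (vq NM qM (ev_fs ++ crs)) T = 0.
Proof.
move=> cT fin z; have [k kf ke] := nthP 0 fin; rewrite size_fs in kf.
rewrite /vol /detr (expand_det_col _ (Ordinal kf)) big1 ?normr0 // => i _.
rewrite mxE; have iT : (i < size (enum T))%N by rewrite -cardE cT.
case e : (enum T) iT => [|A0 s] iT //; rewrite -e in iT.
rewrite /rows (nth_map A0) // !mxE /= ke z ?mul0r //.
by rewrite -mem_enum mem_nth.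
Qed.

Lemma in_crs j : crj j \in ev_fs ++ crs.
Proof. by rewrite mem_cat mem_rev; apply/orP; right; apply/mapP; exists j; rewrite ?mem_enum. Qed.

Lemma T_loc (T : {set {set E} + 'I_2}) X : goodM T -> S \subset T -> inl X \in T -> inl X \notin S ->
  exists (v : vert C) (A : {set star v}), clus (rho v) A /\ X = phi A.
Proof.
move=> /andP [_ lT] ST XT nX; have /lamP [cT oT] := lT.
apply: loc_ex; first by apply: cT; rewrite inE.
  by rewrite -S_prj inE.
move=> B; rewrite -S_prj inE => BS; apply: oT; rewrite inE //.
exact: (subsetP ST).
Qed.

(** Otherwise the functional vanishes on all rays of a maximal cone around S, which then has volume
    0. At the vertex v of such a ray two labels leave through one edge. If the functional were
    nonzero on the ray, this edge, a bounded edge of C by [one_edge], would split the four labels in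
    the same way; but by [S0z] the functional vanishes on the edges of C. *)
Lemma lambda_ex j : exists v : vert C, j \in lambda_at lam v.
Proof.
have [//|no] := pselect (exists v : vert C, j \in lambda_at lam v).
have [T [gT cT vT ST]] := ex_topM; have bI := @cr_lab_inj _ _ (lam j).
case/eqP: vT; apply: (col_vol cT (in_crs j)) => -[X XT|k _]; last exact: crf_lin.
have [XS|XS] := boolP (inl X \in S); first exact: S0z.
have [v [A [cA XE]]] := T_loc gT ST XT XS.
have nI : ~ injective (fun k => sb v (cb j k)) by move=> /lambda_atP h; apply: no; exists v.
have [k [k' [kk' e]]] : exists k k' : 'I_4, k != k' /\ sb v (cb j k) = sb v (cb j k').
  apply: contrapT => nk; apply: nI => k k' e; apply/eqP/negPn/negP => kk'.
  by apply: nk; exists k, k'.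
rewrite crf_ray //; apply/eqP/negPn/negP => qX.
have bkk : cb j k != cb j k' by rewrite (inj_eq bI).
have [Y [YS [t Yt]]] := one_edge bkk erefl (esym e).
have := S0z j (A := inl Y); rewrite -[inl Y \in S]/(_) => /(_ _).
have YinS : inl Y \in S by rewrite -S_prj inE in YS.
move=> /(_ YinS); rewrite crf_ray // => qY; move: qX.
pose f i := cb j i \in X; pose g i := sb v (cb j i) == sb v (cb j k).
have qXf : quad (cb j 0) (cb j 1) (cb j 2) (cb j 3) (cutd R X) != 0 ->
  [&& f 0 == f 1, f 2 == f 3 & f 0 != f 2] || [&& f 0 == f 2, f 1 == f 3 & f 0 != f 1].
  rewrite quad_cut -!/(f _); do 2!case: [&& _, _ & _] => //; by rewrite subrr eqxx.
move=> qX; have [||||c fg] := @two_two f g k k' kk' _ _ _ _ (qXf qX).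
- by rewrite /f XE !in_phi e.
- by rewrite /g.
- by rewrite /g e.
- by move=> i /eqP gi; rewrite /f XE !in_phi gi.
- move: qX; rewrite quad_cut -!/(f _) !fg; move: qY; rewrite quad_cut !Yt -!/(g _).
  by case: t {Yt}; case: c {fg}; case: (g 0); case: (g 1); case: (g 2); case: (g 3) => /= ->; rewrite eqxx.
Qed.

Lemma kids_sum : (\sum_(v : vert C) #|kids (G := C) x0 v| = 2 * n + #|E| - 1)%N.
Proof.
under eq_bigr => v _ do rewrite -sum1_card big_mkcond /=.
rewrite exchange_big big_sumType /= -[in RHS]card_Scl -sum1_card Scl_sum.
have -> : (\sum_(u : vert C) \sum_(v : vert C) (if inl u \in kids (G := C) x0 v then 1 else 0) =
    \sum_(u : vert C | ~~ itop x0 u) 1)%N.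
  rewrite [RHS]big_mkcond; apply: eq_bigr => u _; rewrite -big_mkcond /=.
  case: ifP => [ut|/negbFE ut].
    by rewrite (big_pred1 (pv x0 u)) // => v; rewrite inE (pvP ut) /= eq_sym.
  by rewrite big_pred0 // => v; rewrite inE (eqP ut).
have -> : (\sum_(i : E) \sum_(v : vert C) (if inr i \in kids (G := C) x0 v then 1 else 0) = \sum_(i : E | i != x0) 1)%N.
  rewrite [RHS]big_mkcond; apply: eq_bigr => i _; rewrite -big_mkcond /=.
  case: ifP => [ir|/negbFE/eqP ->].
    have [u ue] := par_end C ir; rewrite (big_pred1 u) // => v; rewrite inE ue.
    have -> : inr i != inr x0 :> node C by apply: contraNneq ir => -[->].
    by rewrite eq_sym.
  by rewrite big_pred0 // => v; rewrite inE eqxx.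
rewrite sum1_card -addnBA; last by apply/card_gt0P; exists x0.
by congr (_ + _)%N; rewrite subn1 -(cardC1 x0) sum1_card.
Qed.

(** Every bounded edge and every end but [x0] is counted once among the kids, and [card_vert] gives
    the number of vertices. *)
Lemma valence_sum : (\sum_(v : vert C) (#|star v| - 3) = l)%N.
Proof.
have : (\sum_(v : vert C) (#|star v| - 3) + 3 * #|vert C| = \sum_(v : vert C) #|kids (G := C) x0 v| + #|vert C|)%N.
  rewrite -[X in (_ + _ * X)%N]sum1_card -[X in (_ = _ + X)%N]sum1_card big_distrr -!big_split; apply: eq_bigr => v _ /=.
  by rewrite subnK ?star3 // card_star (valence_kids x0) addn1.
by rewrite kids_sum card_vert card_ends; have := d2; have := nl; lia.
Qed.

Definition vert0 : vert C := xchoose (top_ex C x0).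

Definition loc (A : {set E} + 'I_2) : vert C :=
  if A is inl X then odflt vert0 [pick v | [exists A : {set star v}, clus (rho v) A && (X == phi A)]] else vert0.

Lemma locE (v : vert C) (A : {set star v}) : clus (rho v) A -> loc (inl (phi A)) = v.
Proof.
move=> cA; rewrite /loc; case: pickP => [w /existsP [B /andP [cB /eqP e]]|/(_ v)/existsP []]; last first.
  by exists A; rewrite cA eqxx.
by apply/eqP/negPn/negP => wv; have := phi_neq wv cB cA; rewrite e eqxx.
Qed.

Notation prt v T := (part S loc v T).

Lemma prt_gd (v : vert C) (T : {set {set E} + 'I_2}) : goodM T -> S \subset T -> gd v (prt v T).
Proof.
move=> gT ST; have /andP [_ /lamP [cT oT]] := gT.
have inP A : A \in prt v T -> exists2 B : {set star v}, clus (rho v) B & A = phiJ B /\ inl (phi B) \in T.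
  rewrite !inE => /andP [/andP [nS AT] /eqP lA]; case: A nS AT lA => [X|k] nS AT lA; last first.
    by rewrite (goodl_in _ gS) in nS.
  have [w [B [cB XE]]] := T_loc gT ST AT nS; move: AT lA; rewrite XE locE // => AT wv; subst w.
  by exists B.
pose T1 := [set B : {set star v} | phiJ B \in prt v T].
have T1P B : (B \in T1) = (phiJ B \in prt v T) by rewrite [LHS]in_set.
apply/gdP; exists T1.
  apply/lamP; split=> [B|B B']; rewrite !T1P.
    by move/inP => [B1 cB1 [/phiJ_inj -> _]].
  move=> /inP [B1 _ [/phiJ_inj -> BT]] /inP [B1' _ [/phiJ_inj -> BT']]; by rewrite -phi_compat; apply: oT; rewrite inE.
apply/setP => A; apply/idP/imsetP => [AP|[B + ->]]; last by rewrite T1P.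
by have [B _ [AE _]] := inP A AP; exists B; rewrite // T1P -AE.
Qed.

Lemma gd_prt_card (v : vert C) (T : {set {set E} + 'I_2}) : gd v T -> (#|T| <= #|star v| - 3)%N.
Proof.
move/gdP => [T1 lT ->]; rewrite card_imset; last exact: phiJ_inj.
exact: fan_dim (lam_fan (rho v) R (star3 v)) _ lT.
Qed.

(** Replace the functionals of the cross-ratios at v by the dual coordinates of the rays of T at v.
    The list still separates the points of the span of T, since those functionals vanish on all
    other rays; so it is at least as long as the dimension. *)
Lemma lambda_le (v : vert C) (T : {set {set E} + 'I_2}) : goodM T -> #|T| = NM -> vol (vq NM qM (ev_fs ++ crs)) T != 0 -> S \subset T ->
  (#|lambda_at lam v| <= #|prt v T|)%N.
Proof.
move=> gT cT vT ST; have dT : dg NM qM goodM (ev_fs ++ crs) T != 0 by rewrite (dg_top FMh).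
pose g := ev_fs ++ [seq crj j | j <- enum (~: lambda_at lam v)] ++
  [seq dualf (@lattice R n d) qM T A | A <- enum (prt v T)].
have : (\dim (sp qM T) <= size g)%N.
  apply: dim_le_kernel => w wT w0; apply: (dg_inj FMh dT gT wT); apply/rowP => k; rewrite !mxE.
  have kf : (k < size (ev_fs ++ crs))%N by rewrite size_fs.
  have := mem_nth 0 kf; set f := nth _ _ _; rewrite mem_cat => /orP [fe|].
    by apply: w0; rewrite mem_cat fe.
  rewrite mem_rev => /mapP [j _ fE]; rewrite fE.
  have [jv|jv] := boolP (j \in lambda_at lam v); last first.
    by apply: w0; rewrite !mem_cat; apply/or3P/Or32/map_f; rewrite mem_enum inE.
  have /spP [a wE] := wT; rewrite wE pairing_suml big1 // => A AT; rewrite pairingZl.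
  have [AS|AS] := boolP (A \in S); first by rewrite S0z ?mulr0.
  have [Av|Av] := boolP (A \in prt v T).
    have := w0 (dualf (@lattice R n d) qM T A); rewrite !mem_cat [_ \in [seq dualf _ _ _ _ | _ <- _]]map_f ?orbT ?mem_enum // => /(_ isT).
    by rewrite wE (pairing_comb FMh) // AT => ->; rewrite mul0r.
  case: A AT AS Av => [X|k'] AT AS Av; last by rewrite crf_lin mulr0.
  have [u [B [cB XE]]] := T_loc gT ST AT AS; rewrite XE (crossz (w := v)) ?mulr0 //.
  have lX : loc (inl X) = u by rewrite XE locE.
  by apply: contraNneq Av => <-; rewrite inE lX eqxx inE AS AT.
rewrite (dim_sp FMh gT) cT !size_cat size_ev_fs !size_map -!cardE (NM_E Dg nl).
by rewrite leq_add2l -{1}(card_ord l) -(cardsC (lambda_at lam v)) addnC leq_add2l.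
Qed.

Lemma sum_lambda : (\sum_(v : vert C) #|lambda_at lam v| = l)%N.
Proof.
under eq_bigr => v _ do rewrite -sum1_card big_mkcond /=.
rewrite exchange_big /= -[RHS]card_ord -sum1_card; apply: eq_bigr => j _; rewrite -big_mkcond /=.
have [v jv] := lambda_ex j; rewrite (big_pred1 v) // => w.
by apply/idP/eqP => [jw|->//]; exact: lambda_uniq jw jv.
Qed.

(** [lambda_le] and the dimension of M_{0,star v} give an inequality at every vertex, and both sides
    sum to l. *)
Lemma card_lambda (v : vert C) : #|lambda_at lam v| = (#|star v| - 3)%N.
Proof.
have [T [gT cT vT ST]] := ex_topM.
have le (w : vert C) : (#|lambda_at lam w| <= #|star w| - 3)%N.
  exact: leq_trans (lambda_le w gT cT vT ST) (gd_prt_card (prt_gd w gT ST)).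
have := leqif_sum (fun w (_ : true) => leqif_eq (le w)) => -[_].
rewrite sum_lambda valence_sum eqxx => /esym /forallP /(_ v) h.
by apply/eqP; exact: (implyP h).
Qed.

Lemma mult_product : mult p lam C =
  `|sdet (fun A f => pairing (qM A) f) (enum S) ev_fs| * \prod_(v : vert C) omega lam v.
Proof.
have [_ _ _ ->] := contrib_dg.
pose fs' := ev_fs ++ flatten [seq fi lam v | v <- enum (vert C)].
have pe : perm_eq (ev_fs ++ crs) fs'.
  rewrite perm_cat2l /crs perm_rev perm_sym.
  have -> : flatten [seq fi lam v | v <- enum (vert C)] = flatten [seq [seq crj j | j <- rev (enum (lambda_at lam v))] | v <- enum (vert C)].
    by congr flatten; apply: eq_map => v; rewrite /fi map_rev.
  have -> (s : seq (vert C)) : flatten [seq [seq crj j | j <- rev (enum (lambda_at lam v))] | v <- s] =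
      [seq crj j | j <- flatten [seq rev (enum (lambda_at lam v)) | v <- s]].
    by rewrite map_flatten -map_comp.
  apply: perm_map; apply: uniq_perm; rewrite ?enum_uniq //.
    pose k j := xchoose (lambda_ex j).
    apply: (uniq_flat (k := k)) => [|v|v j]; rewrite ?enum_uniq ?rev_uniq ?enum_uniq //.
    by rewrite mem_rev mem_enum => jv; exact: lambda_uniq (xchooseP (lambda_ex j)) jv.
  move=> j; rewrite mem_enum; apply/flattenP; have [v jv] := lambda_ex j.
  by exists (rev (enum (lambda_at lam v))); [apply/mapP; exists v; rewrite ?mem_enum|rewrite mem_rev mem_enum].
rewrite (dg_perm FMh gS size_fs pe).
have fiP (v : vert C) f : f \in fi lam v -> exists2 j, j \in lambda_at lam v & f = crj j.
  by rewrite mem_rev => /mapP [j jv ->]; exists j => //; rewrite mem_enum in jv.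
rewrite (dg_product FMh (gd := fun v => @gd R n d Delta C v) (loc := loc) gS).
- by congr (_ * _); apply: eq_bigr => v _; rewrite omega_dg // card_lambda.
- by rewrite size_ev_fs card_S.
- by rewrite -(perm_size pe) size_fs.
- by move=> A v f AS /fiP [j _ ->]; exact: S0z.
- move=> v w T A f /gdP [T1 _ ->] /imsetP [B _ ->] vw /fiP [j jw ->].
  by exact: crossz vw jw.
- by move=> v T gT ST; exact: prt_gd.
(* Resolutions of different vertices are compatible with each other and with the edges of C, so
   local choices can be combined freely. *)
- move=> f gf; have fP v X : inl X \in f v -> exists2 A : {set star v}, clus (rho v) A & X = phi A.
    have /gdP [T1 /lamP [cT _] ->] := gf v; move=> /imsetP [A AT [->]]; exists A => //; exact: cT.
  have lS := Scl_lam x0 C; have /lamP [cS oS] := lS.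
  apply/andP; split.
    by apply: subset_trans (subsetUl _ _); case/andP: gS.
  have mem X : X \in prj (S :|: \bigcup_v f v) -> X \in Scl x0 C \/ exists v, inl X \in f v.
    by rewrite !inE -S_prj inE => /orP [->|/bigcupP [v _ Xv]]; [left|right; exists v].
  have fc (v w : vert C) (A : {set star v}) : clus (rho v) A -> compat (phi A) (cl (G := C) x0 w).
    move=> cA; have rA : rho v \notin A by case/and3P: cA.
    rewrite -phi_full; have [vw|vw] := eqVneq v w; last by apply: phi_compat_cross; rewrite // !inE eqxx.
    subst w; rewrite phi_compat /compat; apply/or3P/Or31/subsetP => c cc.
    by rewrite !inE; apply: contraNneq rA => <-.
  have cC (A B : {set E}) : compat A B = compat B A.
    by rewrite /compat setIC; case: (A \subset B); case: (B \subset A).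
  apply/lamP; split=> [X /mem [/cS //|[v /fP [A cA ->]]]|X Y]; first exact: phi_clus.
  move=> /mem [XS|[v Xv]] /mem [YS|[w Yw]]; first exact: oS.
  + by have [A cA ->] := fP _ _ Yw; have /imsetP [u _ ->] := XS; rewrite cC; exact: fc.
  + by have [A cA ->] := fP _ _ Xv; have /imsetP [u _ ->] := YS; exact: fc.
  + have [vw|vw] := eqVneq v w; last first.
      have [A cA ->] := fP _ _ Xv; have [B cB ->] := fP _ _ Yw.
      by case/and3P: cA => ? _ _; case/and3P: cB => ? _ _; exact: phi_compat_cross.
    subst w; have /gdP [T1 /lamP [_ oT] fE] := gf v.
    move: Xv Yw; rewrite fE => /imsetP [A AT [->]] /imsetP [B BT [->]].
    by rewrite phi_compat; exact: oT.
- move=> v T A /gdP [T1 /lamP [cT _] ->] /imsetP [B BT ->]; have cB := cT B BT.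
  split; last exact: locE.
  by have := phi_notin cB; rewrite -S_prj inE.
- move=> v T gT; rewrite size_fi card_lambda; exact: gd_prt_card.
Qed.

End PartTwo.

(** * The evaluation determinant *)

Section Determinants.
Variable R : realType.

Lemma sdet_mul (X Z : Type) (B : finType) (x0 : X) (b0 : B) (z0 : Z) (f : X -> B -> R) (g : B -> Z -> R) xs zs :
  size xs = #|B| -> size zs = #|B| ->
  sdet (fun x z => \sum_b f x b * g b z) xs zs = sdet f xs (enum B) * sdet g (enum B) zs.
Proof.
move=> sx sz; have sB : size (enum B) = #|B| by rewrite -cardE.
rewrite (sdetE _ x0 z0 sx sz) (sdetE _ x0 b0 sx sB) (sdetE _ b0 z0 sB sz) -det_mulmx.
congr (\det _); apply/matrixP => i j; rewrite !mxE -big_enum (big_nth b0) sB big_mkord.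
by apply: eq_bigr => k _; rewrite !mxE.
Qed.

Lemma sdet2 (X Y : Type) (e : X -> Y -> R) x x' y y' :
  sdet e [:: x; x'] [:: y; y'] = e x y * e x' y' - e x y' * e x' y.
Proof.
rewrite (sdetE _ x y (n := 2)) // (expand_det_row _ ord0) !big_ord_recl big_ord0 addr0.
by rewrite /cofactor !det_mx11 !mxE /= !expr0 !expr1 !mul1r mulN1r mulrN.
Qed.

Lemma sdet_tri (V X Y : eqType) (e : X -> Y -> R) (xs : V -> seq X) (ys : V -> seq Y) (s : seq V) (r : rel V) :
  (forall v, v \in s -> size (xs v) = size (ys v)) -> pairwise r s ->
  (forall u v x y, r u v -> x \in xs u -> y \in ys v -> e x y = 0) ->
  sdet e (flatten [seq xs v | v <- s]) (flatten [seq ys v | v <- s]) = \prod_(v <- s) sdet e (xs v) (ys v).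
Proof.
move=> + + z; elim: s => [_ _|v s IH sz] /=; first by rewrite big_nil /sdet; exact: det_mx00.
case/andP => /allP rv ps; have sz' w : w \in s -> size (xs w) = size (ys w).
  by move=> ws; apply: sz; rewrite inE ws orbT.
rewrite big_cons sdet_block ?IH //.
- by apply: sz; exact: mem_head.
- rewrite !size_flatten /shape -!map_comp; congr sumn; apply/eq_in_map => w ws; exact: sz'.
- by move=> x y xv /flattenP [t /mapP [w ws ->]] yw; exact: z (rv w ws) xv yw.
Qed.

(** Sort the blocks by decreasing [r]: each block of rows then vanishes on all later blocks of
    columns. *)
Lemma sdet_rank (V : finType) (X Y : eqType) (e : X -> Y -> R) (xs : V -> seq X) (ys : V -> seq Y) (r : V -> nat) X0 Y0 :
  (forall v, size (xs v) = size (ys v)) ->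
  (forall u v x y, u != v -> (r v <= r u)%N -> x \in xs u -> y \in ys v -> e x y = 0) ->
  perm_eq X0 (flatten [seq xs v | v <- enum V]) -> perm_eq Y0 (flatten [seq ys v | v <- enum V]) ->
  `|sdet e X0 Y0| = \prod_v `|sdet e (xs v) (ys v)|.
Proof.
move=> sz z pX pY; pose le := [rel u v | (r v <= r u)%N].
have lt : transitive le by move=> y x w /= h1 h2; exact: leq_trans h2 h1.
pose s := sort le (enum V); have ps : perm_eq s (enum V) by rewrite perm_sort.
have px : perm_eq X0 (flatten [seq xs v | v <- s]).
  by rewrite (perm_trans pX) //; apply/perm_flatten/perm_map; rewrite perm_sym.
have py : perm_eq Y0 (flatten [seq ys v | v <- s]).
  by rewrite (perm_trans pY) //; apply/perm_flatten/perm_map; rewrite perm_sym.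
have szf : size (flatten [seq xs v | v <- s]) = size (flatten [seq ys v | v <- s]).
  by rewrite !size_flatten /shape -!map_comp; congr sumn; apply: eq_map => v; exact: sz.
have szf' : size (flatten [seq xs v | v <- s]) = size Y0 by rewrite szf (perm_size py).
rewrite (sdet_perml _ _ px) (sdet_permr _ szf' py).
have rs : pairwise [rel u v | (u != v) && le u v] s.
  rewrite pairwise_relI -uniq_pairwise sort_uniq enum_uniq -sorted_pairwise //.
  by apply: sort_sorted => u v; exact: leq_total.
rewrite (sdet_tri (fun v _ => sz v) rs) => [|u v x y /andP [uv ruv]]; last exact: z.
by rewrite normr_prod (perm_big _ ps) big_enum.
Qed.

Lemma sdet_row0 (X Y : eqType) (e : X -> Y -> R) xs ys x : size xs = size ys -> x \in xs ->
  (forall y, y \in ys -> e x y = 0) -> sdet e xs ys = 0.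
Proof.
move=> sz xx z; case: ys sz z => [sz|y ys sz] z; first by rewrite (size0nil sz) in xx.
rewrite (sdetE _ x y sz erefl); have xi : (index x xs < size (y :: ys))%N by rewrite -sz index_mem.
rewrite (expand_det_row _ (Ordinal xi)) big1 // => j _; rewrite mxE /= nth_index // z ?mul0r //.
exact: mem_nth.
Qed.

Lemma sdet_id (V : eqType) (s : seq V) : uniq s -> sdet (fun u v => (u == v)%:R : R) s s = 1.
Proof.
case: s => [|v s] us; first by rewrite /sdet; exact: det_mx00.
rewrite (sdetE _ v v erefl erefl) -[RHS](det1 R (size (v :: s))); congr (\det _).
by apply/matrixP => i j; rewrite !mxE nth_uniq.
Qed.

Lemma perm_blocks (X V : finType) (g : X -> V) : perm_eq (enum X) (flatten [seq [seq x <- enum X | g x == v] | v <- enum V]).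
Proof.
apply: uniq_perm; first exact: enum_uniq.
  apply: (uniq_flat (k := g)) => [|v|v x]; rewrite ?mem_filter.
  - exact: enum_uniq.
  - by rewrite filter_uniq ?enum_uniq.
  - by case/andP => /eqP.
move=> x; rewrite mem_enum; apply/esym/flattenP.
by exists [seq y <- enum X | g y == g x]; [apply/mapP; exists (g x); rewrite ?mem_enum|rewrite mem_filter eqxx mem_enum].
Qed.

Lemma perm_enum2 (V : finType) : perm_eq (enum (@predT (V * 'I_2)%type)) (flatten [seq [:: (v, 0); (v, 1)] | v <- enum V]).
Proof.
apply: uniq_perm; first exact: enum_uniq.
  apply: (uniq_flat (k := @fst V 'I_2)) => [|v|v x]; rewrite ?inE.
  - exact: enum_uniq.
  - by rewrite /= inE xpair_eqE eqxx.
  - by case/orP => /eqP ->.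
move=> -[v k]; rewrite mem_enum; apply/esym/flattenP; exists [:: (v, 0); (v, 1)].
  by apply/mapP; exists v; rewrite ?mem_enum.
by rewrite !inE !xpair_eqE eqxx /=; case: k => -[|[|//]] kp; apply/orP; [left|right].
Qed.

End Determinants.

(** * Displacements of the vertices and fixed components *)

Section EvDet.
Local Open Scope set_scope.
Variables (R : realType) (n d : nat) (Delta : 'I_d -> 'rV[int]_2).
Hypothesis Dg : is_degree R Delta.
Variable C : tcurve R n Delta.
Hypothesis cV : #|vert C| = (2 * n).+1.
Notation E := (ends n d).
Notation x0 := (inl ord0 : E).
Notation qM := (@qM R n d).
Notation JM := (@JM n d).
Notation goodM := (@goodM n d).
Notation root := (inr x0 : node C).
Notation par := (gpar root).
Notation rk := (grk root).
Let T : rooted (@adj R E C) root par rk := tree_rooted root.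
Notation anG := (anc par rk).
Notation kids := (kids (G := C) x0).
Notation itop := (itop (G := C) x0).
Notation pv := (pv (G := C) x0).
Notation below u v := (anG (inl u) (inl v)).
Implicit Types (u v w : vert C) (k : 'I_2) (i : 'I_n.+1).

Definition wv u : 'rV[R]_2 := vecR R (dsum Delta (cl x0 u)).
Definition bedge : finType := {u : vert C | ~~ itop u}.
Definition cond : finType := (bedge + 'I_n.+1 * 'I_2)%type.
Definition coords : finType := (vert C * 'I_2)%type.
Definition mv i : vert C := sval (cid (end_vert C (inl i))).

Lemma mvP i v : adj (inl v : node C) (inr (inl i)) = (v == mv i).
Proof. by rewrite /mv; case: cid => u [_ /= h]. Qed.

Lemma mv_anc u i : below u (mv i) = itop u || (inl i \in cl x0 u).
Proof.
have am : adj (inl (mv i) : node C) (inr (inl i)) by rewrite mvP.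
have topb w : itop u -> below u w by move=> ut; apply: cl_anc; rewrite (cl_top ut) subsetC sub1set inE cl_root.
move: am; rewrite (adj_kids x0) => /orP [/eqP e|mk].
  have ie : inl i = x0 :> E.
    apply/eqP/negPn/negP => ir; have := par_anc T (vert_root x0 (mv i)); rewrite -e.
    by move/(leaf_anc ir).
  have mt : itop (mv i) by rewrite /itop -e ie.
  rewrite ie (negbTE (cl_root _ _)) orbF; apply/idP/idP => [um|/topb //].
  suff -> : u = mv i by [].
  move: um; rewrite (anc_par T) ?vert_root // (eqP mt) (anc_root T) orbC /=.
  by move/eqP => [].
have ir : inl i != x0 :> E by move: mk; rewrite inE => /andP [h _]; apply: contraNneq h => ->.
have -> : below u (mv i) = (inl i \in cl x0 u).
  move: mk; rewrite !inE => /andP [h /eqP p]; by rewrite (anc_par T _ h) p.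
by case ut : (itop u) => //=; have := topb (mv i) ut; move: mk; rewrite !inE => /andP [h /eqP p]; rewrite (anc_par T _ h) p.
Qed.

Lemma below_pv u v : ~~ itop v -> below u v = (u == v) || below u (pv v).
Proof. by move=> vt; rewrite (anc_par T) ?vert_root // pvP // (inj_eq (@inl_inj _ _)). Qed.

Lemma below_top u v : itop v -> below u v = (u == v).
Proof. by move=> vt; rewrite (anc_par T) ?vert_root // (eqP vt) (anc_root T) orbF (inj_eq (@inl_inj _ _)). Qed.

Lemma not_below_pv u : ~~ itop u -> below u (pv u) = false.
Proof. by move=> ut; have := anc_par_self T (vert_root x0 u); rewrite pvP. Qed.

Definition cross (a b : 'rV[R]_2) : R := a 0 0 * b 0 1 - a 0 1 * b 0 0.

(* Conditions on displacements of the vertices: a bounded edge keeps its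
   direction, a marked point keeps its image. *)
Definition zz (q : coords) (e : cond) : R :=
  match e with
  | inl u => cross (wv (val u)) (delta_mx 0 q.2) * ((q.1 == val u)%:R - (q.1 == pv (val u))%:R)
  | inr (i, k) => (q == (mv i, k))%:R
  end.

Definition eqf (F : vert C -> 'rV[R]_2) (e : cond) : R :=
  match e with
  | inl u => cross (wv (val u)) (F (val u) - F (pv (val u)))
  | inr (i, k) => F (mv i) 0 k
  end.

Lemma sum2 (G : 'I_2 -> R) : \sum_k G k = G 0 + G 1.
Proof. by rewrite !big_ord_recl big_ord0 addr0; congr (G _ + G _); exact: val_inj. Qed.

Lemma cross_pick (f0 f1 a b : R) (s t : bool) :
  f0 * ((a * 0 - b * 1) * (s%:R - t%:R)) + f1 * ((a * 1 - b * 0) * (s%:R - t%:R)) =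
  (if s then a * f1 - b * f0 else 0) - (if t then a * f1 - b * f0 else 0).
Proof. by case: s; case: t => /=; ring. Qed.

Lemma sum_pick (V0 : nmodType) (X : finType) (x : X) (F : X -> V0) : \sum_y (if y == x then F y else 0) = F x.
Proof. by rewrite -big_mkcond big_pred1_eq. Qed.

Lemma eqfE (F : vert C -> 'rV[R]_2) e : \sum_q F q.1 0 q.2 * zz q e = eqf F e.
Proof.
case: e => [u|[i k]] /=; last first.
  rewrite (eq_bigr (fun q => if q == (mv i, k) then F q.1 0 q.2 else 0)) ?sum_pick // => q _.
  by case: eqP; rewrite ?mulr1 ?mulr0.
rewrite -(pair_bigA _ (fun v k => F v 0 k * (cross (wv (val u)) (delta_mx 0 k) *
  ((v == val u)%:R - (v == pv (val u))%:R)))) /=.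
have -> : \sum_v \sum_k F v 0 k * (cross (wv (val u)) (delta_mx 0 k) * ((v == val u)%:R - (v == pv (val u))%:R)) =
    \sum_v ((if v == val u then cross (wv (val u)) (F v) else 0) - (if v == pv (val u) then cross (wv (val u)) (F v) else 0)).
  apply: eq_bigr => v _; rewrite sum2 /cross !mxE /=.
  exact: cross_pick.
by rewrite big_split sumrN /= !sum_pick /cross !mxE; ring.
Qed.

(* para (u, k) displaces the vertices below u: along the edge above u for k = 0,
   transversally for k = 1; if u is the top vertex, by the k-th unit vector. *)
Definition perp (w : 'rV[R]_2) : 'rV[R]_2 :=
  (w 0 0 ^+ 2 + w 0 1 ^+ 2)^-1 *: \row_k (if k == 0 then - w 0 1 else w 0 0).

Definition bas u k : 'rV[R]_2 :=
  if itop u then delta_mx 0 k else if k == 0 then wv u else perp (wv u).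

Definition para (q : coords) v : 'rV[R]_2 := (below q.1 v)%:R *: bas q.1 q.2.

Lemma cross_self a : cross a a = 0. Proof. by rewrite /cross mulrC subrr. Qed.

Lemma cross0 a : cross a 0 = 0. Proof. by rewrite /cross !mxE !mulr0 subrr. Qed.

Lemma row2 (a : 'rV[R]_2) : a 0 0 = 0 -> a 0 1 = 0 -> a = 0.
Proof.
move=> h0 h1; apply/rowP => k; rewrite mxE; case: k => -[|[|//]] kp.
  by rewrite -h0; congr (a 0 _); exact: val_inj.
by rewrite -h1; congr (a 0 _); exact: val_inj.
Qed.

Lemma cross_perp a : a != 0 -> cross a (perp a) = 1.
Proof.
move=> a0; have s0 : a 0 0 ^+ 2 + a 0 1 ^+ 2 != 0.
  rewrite paddr_eq0 ?sqr_ge0 // !sqrf_eq0; apply: contra a0 => /andP [/eqP h0 /eqP h1].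
  by apply/eqP/row2.
by rewrite /cross !mxE /=; field.
Qed.

(** Displacing everything below a vertex disturbs at most the edge above it. Sliding along this edge
    keeps its direction, and [perp] is normalized so that the transversal displacement has value
    1. *)
Lemma eqf_para q (u : bedge) : wv (val u) != 0 ->
  eqf (para q) (inl u) = (q == (val u, 1))%:R.
Proof.
move=> w0; have ut := valP u; rewrite /= /para (below_pv _ ut).
case: q => v k /=; rewrite xpair_eqE; have [->|vu] /= := eqVneq v (val u).
  rewrite not_below_pv // scale1r scale0r subr0 /bas (negbTE ut).
  have [->|k0] := eqVneq k 0; first by rewrite cross_self.
  have -> : k = 1 by case: k k0 => -[|[|//]] kp // _; exact: val_inj.
  by rewrite cross_perp.
by rewrite subrr cross0.
Qed.

Lemma eqf_para_mark q i k : eqf (para q) (inr (i, k)) = (below q.1 (mv i))%:R * bas q.1 q.2 0 k.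
Proof. by rewrite /= /para !mxE. Qed.

Definition vcoords v : seq coords := [:: (v, 0); (v, 1)].
Definition tops : seq coords := [seq q <- enum coords | itop q.1].
Definition edges k : seq coords := [seq (val e, k) | e <- enum bedge].
Definition marks : seq cond := [seq inr ik | ik <- enum (@predT ('I_n.+1 * 'I_2)%type)].

Lemma ord2 k : k = 0 \/ k = 1.
Proof. by case: k => -[|[|//]] kp; [left|right]; exact: val_inj. Qed.

Lemma perm_coords : perm_eq (enum coords) ((edges 0 ++ tops) ++ edges 1).
Proof.
have ue k : uniq (edges k) by rewrite map_inj_uniq ?enum_uniq // => e e' [] /val_inj.
have me k q : (q \in edges k) = ~~ itop q.1 && (q.2 == k).
  apply/mapP/andP => [[e _ ->]|[qt /eqP qk]]; first by rewrite /= (valP e).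
  by exists (Sub q.1 qt); rewrite ?mem_enum //= -qk; case: q {qt qk}.
have mt q : (q \in tops) = itop q.1 by rewrite mem_filter mem_enum andbT.
apply: uniq_perm; first exact: enum_uniq.
  rewrite !cat_uniq !ue filter_uniq ?enum_uniq //=; apply/and3P; split=> //; try (rewrite andbT).
    by apply/hasPn => q; rewrite mt /= me => ->.
  apply/hasPn => q; rewrite me => /andP [qt /eqP q1]; by rewrite /= mem_cat me mt negb_or (negbTE qt) q1.
move=> q; rewrite mem_enum !mem_cat !me mt; case: (itop q.1) => //=.
by case: (ord2 q.2) => ->.
Qed.

Lemma perm_cond : perm_eq (enum cond) (marks ++ [seq inl e | e <- enum bedge]).
Proof.
apply: uniq_perm; first exact: enum_uniq.
  have i1 : injective (inl : bedge -> cond) by move=> ? ? [].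
  have i2 : injective (inr : _ -> cond) by move=> ? ? [].
  rewrite cat_uniq (map_inj_uniq i1) (map_inj_uniq i2) !enum_uniq andbT.
   apply/hasPn => e /mapP [a _ ->]; apply/negP => /mapP [? _].
  by [].
move=> e; rewrite mem_enum mem_cat; case: e => [a|ik]; apply/esym/orP; [right|left]; apply: map_f; exact: mem_enum.
Qed.

Lemma card_bedge : #|bedge| = (2 * n)%N.
Proof.
have := cardC [pred v : vert C | itop v]; rewrite card_tops cV add1n => -[<-].
by rewrite card_sig; apply: eq_card => v; rewrite !inE.
Qed.

Lemma card_cond : #|cond| = #|coords|.
Proof. by rewrite card_sum !card_prod !card_ord card_bedge cV; lia. Qed.

Lemma size_marks : size (edges 0 ++ tops) = size marks.
Proof.
have := perm_size perm_coords; rewrite (size_cat _ (edges 1)) -cardE -card_cond cardE (perm_size perm_cond) (size_cat marks).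
have -> : size (edges 1) = size [seq (inl e : cond) | e <- enum bedge] by rewrite !size_map.
by move/eqP; rewrite eqn_add2r => /eqP.
Qed.

(** The fields [para] form a basis of all displacements, block triangular over the vertices with
    determinant 1 up to sign. In this basis the edge conditions see only the transversal fields, by
    an identity matrix; the evaluations of the other fields remain. *)
Lemma sdet_para : (forall u, ~~ itop u -> wv u != 0) ->
  `|sdet (fun q e => eqf (para q) e) (edges 0 ++ tops) marks| = `|sdet zz (enum coords) (enum cond)|.
Proof.
move=> w0; have [t tt] := top_ex C x0.
have sc : size (enum cond) = #|coords| by rewrite -cardE card_cond.
have pp1 : `|sdet (fun q q' : coords => para q q'.1 0 q'.2) (enum coords) (enum coords)| = 1.
  rewrite (sdet_rank (xs := vcoords) (ys := vcoords) (r := fun v => rk (inl v))) ?perm_enum2 //; last first.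
    move=> u v q q' uv ruv qu q'v; rewrite /para !mxE; have -> : q.1 = u by move: qu; rewrite !inE => /orP [] /eqP ->.
    have -> : q'.1 = v by move: q'v; rewrite !inE => /orP [] /eqP ->.
    case uv' : (below u v); last by rewrite mul0r.
    by have [] := anc_eq uv' ruv => e; rewrite e eqxx in uv.
  rewrite big1 // => v _; rewrite sdet2 /para !mxE /= anc_refl !mul1r /bas; case: ifP => vt.
    by rewrite !mxE /= mulr1 mulr0 subr0 normr1.
  by rewrite -/(cross (wv v) (perp (wv v))) cross_perp ?normr1 // w0 ?vt.
have pz : sdet (fun q e => eqf (para q) e) (enum coords) (enum cond) =
    sdet (fun q q' : coords => para q q'.1 0 q'.2) (enum coords) (enum coords) * sdet zz (enum coords) (enum cond).
  rewrite -(sdet_mul (t, 0) (t, 0) (inr (ord0, 0)) _ _ (esym (cardE _)) sc).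
  by apply: eq_sdet => q e _ _; rewrite eqfE.
have := congr1 Num.norm pz; rewrite normrM pp1 mul1r => <-.
rewrite (sdet_perml _ _ perm_coords) (sdet_permr _ _ perm_cond) -?(perm_size perm_coords) -?cardE ?sc //.
have s1 : size (edges 1) = size [seq (inl e : cond) | e <- enum bedge] by rewrite !size_map.
rewrite sdet_block //.
- rewrite [X in _ * X](_ : _ = 1) ?mulr1 // /edges sdet_mapl sdet_mapr -[RHS](sdet_id R (enum_uniq bedge)).
  apply: eq_sdet => e e' _ _; rewrite eqf_para ?w0 ?(valP e') // xpair_eqE eqxx andbT.
  by rewrite (inj_eq val_inj).
- exact: size_marks.
- move=> q e; rewrite mem_cat => qf /mapP [a _ ->]; rewrite eqf_para ?w0 ?(valP a) //.
  apply/eqP; rewrite pnatr_eq0 eqb0; apply: contraTneq qf => ->; rewrite negb_or; apply/andP; split.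
    by apply/mapP => -[].
  by rewrite mem_filter /= (negbTE (valP a)).
- by rewrite -sc cardE.
Qed.

Lemma pv_below u : ~~ itop u -> below (pv u) u.
Proof. by move=> ut; rewrite -pvP //; exact: par_anc T _ (vert_root x0 u). Qed.

(** Lengthening the edge above u moves all vertices below u along it, so the ray of u acts as
    [para (u, 0)]; the lineality rays act as translations. *)
Lemma ev_sdet p (S : {set {set E} + 'I_2}) : goodM S -> prj S = Scl x0 C ->
  `|sdet (fun A f => pairing (qM A) f) (enum S) (ev_fs Delta p)| =
  `|sdet (fun q e => eqf (para q) e) (edges 0 ++ tops) marks|.
Proof.
move=> gS pS; pose h (q : coords) : {set E} + 'I_2 := if itop q.1 then inr q.2 else inl (cl x0 q.1).
pose ef (ik : 'I_n.+1 * 'I_2) := evf R Delta ik.1 ik.2.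
have Lq q : q \in edges 0 ++ tops -> itop q.1 || (q.2 == 0).
  rewrite mem_cat => /orP [/mapP [a _ ->]|]; first by rewrite eqxx orbT.
  by rewrite mem_filter => /andP [->].
have pL : perm_eq (enum S) [seq h q | q <- edges 0 ++ tops].
  apply: uniq_perm; first exact: enum_uniq.
    rewrite map_inj_in_uniq; last first.
      move=> [u k] [u' k'] /Lq /= qk /Lq /= qk'; rewrite /h /=.
      case: ifP qk => ut qk; case: ifP qk' => ut' qk' // [e]; last first.
        by rewrite (eqP qk) (eqP qk') (cl_inj e).
      by rewrite e; congr pair; apply: (@cl_inj R E C x0); rewrite !cl_top.
    have := enum_uniq coords; rewrite (perm_uniq perm_coords) cat_uniq.
    by case/andP.
  have inL q : itop q.1 || (q.2 == 0) -> q \in edges 0 ++ tops.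
    have := mem_enum coords q; rewrite (perm_mem perm_coords) mem_cat => /orP [//|/mapP [a _ ->]].
    by rewrite /= (negbTE (valP a)).
  move=> A; rewrite mem_enum; apply/idP/mapP => [|[q /Lq qk ->]].
    case: A => [X|k] AS.
      have : X \in Scl x0 C by rewrite -pS inE.
      move=> /imsetP [v]; rewrite inE => vt ->; exists (v, 0); first by apply: inL; rewrite eqxx orbT.
      by rewrite /h (negbTE vt).
    by have [t tt] := top_ex C x0; exists (t, k); [apply: inL; rewrite tt|rewrite /h tt].
  rewrite /h; case: ifP => qt; first exact: goodl_in gS.
  by have : cl x0 q.1 \in prj S; [rewrite pS cl_Scl qt|rewrite inE].
have pE : perm_eq (ev_fs Delta p) [seq ef ik | ik <- enum (@predT ('I_n.+1 * 'I_2)%type)].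
  apply: (perm_trans (y := [seq ef ik | ik <- flatten [seq [:: (i, 0); (i, 1)] | i <- enum 'I_n.+1]])); last first.
    by apply: perm_map; rewrite perm_sym; exact: perm_enum2.
  rewrite /ev_fs /evL; elim: (enum _) => //= i s IH; rewrite !map_rcons /=.
  by rewrite -!cats1 -catA perm_catC /= !perm_cons.
rewrite (sdet_perml _ _ pL) (sdet_permr _ _ pE) ?size_map; last first.
  by rewrite size_marks /marks size_map; have := perm_size pE; rewrite /ev_fs !size_map => ->.
rewrite sdet_mapl sdet_mapr /marks [in RHS]sdet_mapr; congr `|_|; apply: eq_sdet => q [i k] /Lq qk _.
rewrite eqf_para_mark mv_anc /h /bas /ef /=; case: ifP qk => qt qk /=.
  by rewrite mul1r /evf /qM /ql pairing_row pairing0l add0r pairing_delta.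
have [_ ->] := evfP R (deg0 Dg) i k; last exact: cl_root.
by rewrite (eqP qk) eqxx [X in _ + X]mxE addr0.
Qed.

Hypothesis nz : sdet (fun q e => eqf (para q) e) (edges 0 ++ tops) marks != 0.

Lemma wv_neq0 u : ~~ itop u -> wv u != 0.
Proof.
move=> ut; apply: contra nz => /eqP w0; apply/eqP; apply: (sdet_row0 (x := (u, 0))).
- exact: size_marks.
- by rewrite mem_cat; apply/orP; left; apply/mapP; exists (Sub u ut : bedge); rewrite ?mem_enum.
- by move=> e /mapP [[i k] _ ->]; rewrite eqf_para_mark /bas (negbTE ut) w0 /= mxE mulr0.
Qed.

Lemma zz_neq0 : sdet zz (enum coords) (enum cond) != 0.
Proof. by rewrite -normr_eq0 -(sdet_para wv_neq0) normr_eq0. Qed.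

Lemma eqf_inj (F : vert C -> 'rV[R]_2) : (forall e, eqf F e = 0) -> forall v, F v = 0.
Proof.
move=> F0 v; have [t _] := top_ex C x0; have sB : size (enum coords) = #|coords| by rewrite -cardE.
have sz : size (enum cond) = #|coords| by rewrite -cardE card_cond.
pose delta : 'rV[R]_#|coords| := \row_i let q := nth (t, 0) (enum coords) i in F q.1 0 q.2.
have d0 : delta = 0.
  have := zz_neq0; rewrite (sdetE _ (t, 0) (inr (ord0, 0)) sB sz); set M := \matrix_(_, _) _ => Mn.
  have uM : M \in unitmx by rewrite unitmxE unitfE.
  rewrite -[delta](mulmxK uM) [X in X *m _](_ : _ = 0) ?mul0mx //.
  apply/rowP => j; rewrite !mxE -[RHS](F0 (nth (inr (ord0, 0)) (enum cond) j)) -eqfE.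
  rewrite -[RHS]big_enum (big_nth (t, 0)) sB big_mkord.
  by apply: eq_bigr => k _; rewrite !mxE.
have h k : F v 0 k = 0.
  have vi : (index (v, k) (enum coords) < #|coords|)%N by rewrite -sB index_mem mem_enum.
  have := congr1 (fun r : 'rV[R]__ => r 0 (Ordinal vi)) d0.
  by rewrite !mxE /= nth_index // mem_enum.
exact: row2.
Qed.

Lemma ex_field (K : {set vert C}) (es : seq cond) : (size es < 2 * #|K|)%N -> exists F : vert C -> 'rV[R]_2,
  [/\ exists v, F v != 0, forall v, v \notin K -> F v = 0 & forall e, e \in es -> eqf F e = 0].
Proof.
move=> lt; pose KQ : finType := {q : coords | q.1 \in K}.
have cK : #|KQ| = (2 * #|K|)%N.
  rewrite card_sig mulnC -[X in (_ * X)%N](card_ord 2) -[X in (_ * X)%N]cardsT -cardsX.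
  by apply: eq_card => q; rewrite !inE andbT.
pose A : 'M[R]_(#|KQ|, size es) := \matrix_(i, j) zz (val (enum_val i)) (nth (inr (ord0, 0)) es j).
have : kermx A != 0.
  rewrite kermx_eq0 /row_free neq_ltn (leq_ltn_trans (rank_leq_col A)) // cK //.
move=> /rowV0Pn [x /sub_kermxP xA x0'].
pose F v : 'rV[R]_2 := \row_k (if insub (v, k) is Some q then x 0 (enum_rank (q : KQ)) else 0).
have FE (q : KQ) : F (val q).1 0 (val q).2 = x 0 (enum_rank q).
  by rewrite mxE -surjective_pairing valK.
exists F; split.
- apply: contrapT => nF; case/eqP: x0'; apply/rowP => j; rewrite mxE -[j]enum_valK -FE.
  suff -> : F (val (enum_val j : KQ)).1 = 0 by rewrite mxE.
  by apply/eqP/negPn/negP => h; apply: nF; eexists; exact: h.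
- by move=> v vK; apply/rowP => k; rewrite !mxE insubF //=; exact: negbTE.
- move=> e /(nthP (inr (ord0, 0))) [j jes <-]; rewrite -eqfE.
  have := congr1 (fun r : 'rV[R]__ => r 0 (Ordinal jes)) xA; rewrite !mxE /= => xE.
  rewrite (bigID (fun q : coords => q.1 \in K)) /= [X in _ + X]big1 ?addr0; last first.
    move=> q qK; rewrite mxE insubF ?mul0r //=; exact: negbTE.
  rewrite -[RHS]xE (reindex_omap (val : KQ -> coords) insub) /=; last first.
    by move=> q qK; rewrite insubT.
  rewrite (reindex (@enum_val KQ predT)) /=; last exact: onW_bij (@enum_val_bij KQ).
  apply: eq_big => [i|i _]; first by rewrite valK eqxx andbT (valP (enum_val i)).
  by rewrite FE enum_valK mxE.
Qed.

Definition bset u : {set vert C} := [set a | below u a].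

Definition nmarks (K : {set vert C}) : nat := #|[set i | mv i \in K]|.

(* The conditions on the vertices of K, apart from the edge above u: the
   bounded edges inside K and the marked points on K. *)
Definition inner u (K : {set vert C}) (e : cond) : bool :=
  match e with inl a => (val a != u) && (val a \in K) | inr ik => mv ik.1 \in K end.

Definition side u (K : {set vert C}) := K = bset u \/ K = ~: bset u.

Lemma side_pv u K a : side u K -> ~~ itop a -> a != u -> (pv a \in K) = (a \in K).
Proof.
by move=> sK ta au; case: sK => ->; rewrite !inE (below_pv u ta) [u == a]eq_sym (negbTE au).
Qed.

Lemma side_gt0 u K : ~~ itop u -> side u K -> (0 < #|K|)%N.
Proof.
move=> ut [] ->; apply/card_gt0P; first by exists u; rewrite inE anc_refl.
by exists (pv u); rewrite !inE not_below_pv.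
Qed.

(** One condition for each of the #K - 1 edges inside the tree K, and two for each marked point on
    it. *)
Lemma card_inner u K : ~~ itop u -> side u K -> #|inner u K| = (#|K|.-1 + 2 * nmarks K)%N.
Proof.
move=> ut sK; rewrite -[LHS]sum1_card big_mkcond [LHS](@big_sumType _ _ _ bedge ('I_n.+1 * 'I_2)%type) /= -!big_mkcond /= !sum1_card; congr addn; last first.
  rewrite -[RHS]mulnC -[X in (_ * X)%N](card_ord 2) -[X in (_ * X)%N]cardsT -cardsX.
  by apply: eq_card => -[i k]; rewrite !inE andbT.
have -> : #|[pred a : bedge | (val a != u) && (val a \in K)]| = #|[set a in K | (a != u) && ~~ itop a]|.
  rewrite -(card_imset _ val_inj); apply: eq_card => a; rewrite !inE; apply/imsetP/and3P.
    by case=> b; rewrite inE => /andP [bu bK] ->; rewrite bu bK (valP b).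
  by move=> [aK au ta]; exists (Sub a ta : bedge); rewrite // !inE /= au.
have [t tt] := top_ex C x0.
have tu : itop =1 pred1 t by move=> a; apply/idP/eqP => [ta|->//]; have := below_top t ta; rewrite (cl_anc _) ?cl_top // => /esym/eqP.
case: sK => KE.
  have uK : u \in K by rewrite KE inE anc_refl.
  rewrite (cardsD1 u K) uK add1n; apply: eq_card => a; rewrite !inE andbCA; congr (_ && _).
  rewrite andb_idr // KE inE => ua; apply: contra ut => ta; by move: ua; rewrite below_top // => /eqP ->.
have tK : t \in K by rewrite KE !inE below_top //; apply: contraNneq ut => ->.
rewrite (cardsD1 t K) tK add1n; apply: eq_card => a; rewrite !inE tu [RHS]andbC; apply: andb_id2l => aK.
by rewrite andb_idl //= => _; move: aK; rewrite KE !inE; apply: contraNneq => ->; exact: anc_refl.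
Qed.

Definition other u (e : cond) : bool := if e is inl a then val a != u else true.

Lemma otherP u (ut : ~~ itop u) e : e != inl (Sub u ut : bedge) -> other u e.
Proof. by case: e => // a; apply: contra_neqN => /eqP au; congr inl; exact: val_inj. Qed.

Lemma eqf_outer u K F : side u K -> (forall v, v \notin K -> F v = 0) ->
  (forall e, inner u K e -> eqf F e = 0) -> forall e, other u e -> eqf F e = 0.
Proof.
move=> sK F0 FK [a au|[i k] _].
  have [h|h] := boolP (val a \in K); first by apply: FK; rewrite /= h andbT.
  by rewrite /= !F0 ?subrr ?cross0 // (side_pv sK) // (valP a).
have [h|h] := boolP (mv i \in K); first exact: FK.
by rewrite /= F0 // mxE.
Qed.

(** With fewer marked points, the inner conditions and the edge above u would be fewer than the 2 #K
    unknowns, and a nonzero field on K would satisfy all conditions, against [eqf_inj]. *)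
Lemma side_le u K : ~~ itop u -> side u K -> (#|K| <= 2 * nmarks K)%N.
Proof.
move=> ut sK; rewrite leqNgt; apply/negP => lt; pose ue : bedge := Sub u ut.
have [|F [[v Fv] F0 FE]] := @ex_field K (inl ue :: enum (inner u K)).
  by rewrite /= -cardE (card_inner ut sK); lia.
case/eqP: Fv; apply: eqf_inj => e.
have [->|ne] := eqVneq e (inl ue); first by apply: FE; exact: mem_head.
apply: (eqf_outer sK F0) => [e' ie'|]; first by apply: FE; rewrite inE mem_enum; apply/orP; right; exact: ie'.
exact: otherP ne.
Qed.

(** Both sides satisfy [side_le]. Together they have 2n+1 vertices and n+1 marked points, so only
    one unit is to spare, and parity gives it to the odd side. *)
Lemma side_marks u K : ~~ itop u -> side u K -> (2 * nmarks K = #|K| + odd #|K|)%N.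
Proof.
move=> ut sK; have sK' : side u (~: K) by case: sK => ->; [right|left; rewrite setCK].
have := side_le ut sK; have := side_le ut sK'; have := cardsC K; rewrite cV.
have : (nmarks K + nmarks (~: K) = n.+1)%N.
  rewrite -[RHS]card_ord /nmarks -(cardsC [set i | mv i \in K]); congr addn.
  by apply: eq_card => i; rewrite !inE.
have := odd_double_half #|K|; lia.
Qed.

(** The even side has one inner condition too few and carries a nonzero field [G] that violates only
    the edge above u. A multiple of [G] corrects F at this edge; the difference satisfies all
    conditions and is 0, hence F is 0 on its own side. *)
Lemma fixed_side u K F : ~~ itop u -> side u K -> odd #|K| -> (forall v, v \notin K -> F v = 0) ->
  (forall e, inner u K e -> eqf F e = 0) -> forall v, F v = 0.
Proof.
move=> ut sK oK F0 FK; have sK' : side u (~: K) by case: sK => ->; [right|left; rewrite setCK].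
have oK' : ~~ odd #|~: K|.
  by have := cardsC K; rewrite cV => /(congr1 odd); rewrite oddD oK /= mul2n odd_double /=; case: (odd _).
pose ue : bedge := Sub u ut.
have [|G [[w Gw] G0 GE]] := @ex_field (~: K) (enum (inner u (~: K))).
  rewrite -cardE (card_inner ut sK') (side_marks ut sK') (negbTE oK').
  by have := side_gt0 ut sK'; lia.
have GK e : inner u (~: K) e -> eqf G e = 0 by move=> ie; apply: GE; rewrite mem_enum.
have oF := eqf_outer sK F0 FK; have oG := eqf_outer sK' G0 GK.
have Gu : eqf G (inl ue) != 0.
  apply: contra Gw => /eqP gu; apply/eqP; apply: eqf_inj => e.
  have [->//|ne] := eqVneq e (inl ue); apply: oG.
  exact: otherP ne.
pose c := eqf F (inl ue) / eqf G (inl ue).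
have lin e : eqf (fun v => F v - c *: G v) e = eqf F e - c * eqf G e.
  by case: e => [a|[i k]]; rewrite /= ?/cross !mxE; ring.
have z : forall v, F v - c *: G v = 0.
  apply: eqf_inj => e; rewrite lin; have [->|ne] := eqVneq e (inl ue); first by rewrite /c divfK // subrr.
  by rewrite (oF e (otherP ne)) (oG e (otherP ne)) mulr0 subrr.
move=> v; have [vK|vK] := boolP (v \in K); last exact: F0.
by have := z v; rewrite G0 ?inE ?negbK // scaler0 subr0.
Qed.

Lemma pv_kid u : ~~ itop u -> (inl u : node C) \in kids (pv u).
Proof. by move=> ut; rewrite inE pvP // eqxx andbT. Qed.

Lemma kid_uniq u u' a : ~~ itop u -> ~~ itop u' -> pv u = pv u' -> below u a -> below u' a -> u = u'.
Proof.
move=> ut ut' e ua ua'; have := pv_kid ut'; rewrite -e => k'.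
by have [] := kids_disj (pv_kid ut) k' ua ua'.
Qed.

Lemma kid_ex v a : below v a -> a != v -> exists u, [/\ ~~ itop u, pv u = v & below u a].
Proof.
move=> va av; have ne : inl a != inl v :> node C by apply: contraNneq av => -[->].
have [[u|j]] := kid_toward va ne; rewrite inE => /andP [cr /eqP cp] ca.
  have ut : ~~ itop u by rewrite /itop cp.
  by exists u; split=> //; move: cp; rewrite pvP // => -[].
have jr : j != x0 by apply: contraNneq cr => ->.
by have := leaf_anc jr ca.
Qed.

Lemma bset_sum v (F : vert C -> nat) :
  (\sum_(a in bset v) F a = F v + \sum_(u | ~~ itop u && (pv u == v)) \sum_(a in bset u) F a)%N.
Proof.
have vv : v \in bset v by rewrite inE anc_refl.
rewrite (bigD1 v vv) /=; congr addn; rewrite [RHS](exchange_big_dep [pred a | (a \in bset v) && (a != v)]) /=.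
  apply: eq_bigr => a /andP [va0 av]; have va : below v a by have : a \in bset v := va0; rewrite inE.
  have [u [ut up ua]] := kid_ex va av.
  rewrite (big_pred1 u) // => w; rewrite inE; apply/andP/eqP => [[/andP [wt /eqP wp] wa]|->]; last by rewrite ut up eqxx.
  by apply: kid_uniq wa ua => //; rewrite wp.
move=> u a /andP [ut /eqP <-]; rewrite !inE => ua; apply/andP; split.
  by refine (anc_trans T _ ua); rewrite -pvP // ; exact: par_anc T _ (vert_root x0 u).
by apply: contraTneq ua => ->; rewrite not_below_pv.
Qed.

(** An edge is directed away from its odd, fixed side, and its condition belongs to the vertex it
    points to. *)
Definition owner (e : cond) : vert C :=
  match e with inl a => if odd #|bset (val a)| then pv (val a) else val a | inr ik => mv ik.1 end.

Definition own v : seq cond := [seq e <- enum cond | owner e == v].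

Lemma mem_own v e : (e \in own v) = (owner e == v).
Proof. by rewrite mem_filter mem_enum andbT. Qed.

Lemma nmarks_sum (K : {set vert C}) : nmarks K = (\sum_(a in K) #|[set i | mv i == a]|)%N.
Proof.
rewrite /nmarks -sum1_card (partition_big mv (mem K)) /= => [|i]; last by rewrite inE.
apply: eq_bigr => a aK; rewrite -sum1_card; apply: eq_bigl => i; rewrite !inE.
by case: eqP => [->|]; rewrite ?andbF ?andbT.
Qed.

(** Subtract [side_marks] for the sets below the kids of v from that for the set below v, or from
    the total at the top vertex: marked points and incoming edges at v account for the
    difference. *)
Lemma size_own v : size (own v) = 2%N.
Proof.
rewrite size_filter -sum1_count big_enum_cond big_mkcond [LHS](@big_sumType _ _ _ bedge ('I_n.+1 * 'I_2)%type) /=.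
have -> : (\sum_(ik : 'I_n.+1 * 'I_2) (if mv ik.1 == v then 1 else 0) = 2 * #|[set i | mv i == v]|)%N.
  rewrite -big_mkcond sum1_card [RHS]mulnC -[X in (_ * X)%N](card_ord 2) -[X in (_ * X)%N]cardsT -cardsX.
  by apply: eq_card => -[i k]; rewrite !inE andbT.
pose b u := #|bset u|.
have -> : (\sum_(a : bedge) (if (if odd #|bset (val a)| then pv (val a) else val a) == v then 1 else 0) =
    \sum_(u | ~~ itop u && (pv u == v)) odd (b u) + (~~ itop v && ~~ odd (b v)))%N.
  transitivity (\sum_(u | ~~ itop u) ((if pv u == v then odd (b u) : nat else 0) + (if u == v then ~~ odd (b u) : nat else 0)))%N.
    rewrite [RHS](reindex_omap (val : bedge -> _) insub) /=; last by move=> u ut; rewrite insubT.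
    apply: eq_big => [a|a _]; first by rewrite valK eqxx andbT (valP a).
    by rewrite /b; case: (odd _); rewrite ?if_same ?addn0 //; case: eqP.
  rewrite big_split /= -big_mkcondr /=; congr addn.
  case vt : (itop v) => /=; last by rewrite (bigD1 v) ?vt //= eqxx big1 ?addn0 // => u /andP [_ /negbTE ->].
  by rewrite big1 // => u ut; case: eqP => // uv; rewrite uv vt in ut.
have e1 : (b v = 1 + \sum_(u | ~~ itop u && (pv u == v)) b u)%N.
  rewrite /b -sum1_card bset_sum; congr addn; by apply: eq_bigr => u _; rewrite sum1_card.
have : (2 * nmarks (bset v) + 1 = 2 * #|[set i | mv i == v]| + b v + \sum_(u | ~~ itop u && (pv u == v)) odd (b u))%N.
  rewrite nmarks_sum bset_sum mulnDr big_distrr /= (eq_bigr (fun u => b u + odd (b u))%N); last first.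
    by move=> u /andP [ut _]; rewrite -nmarks_sum (side_marks ut) //; left.
  rewrite big_split /= e1 -[LHS]addnA -[RHS]addnA; congr addn.
  by rewrite addnC addnA.
have [vt|vt] := boolP (itop v).
  have bT : bset v = setT by apply/setP => a; rewrite !inE cl_anc // (cl_top vt) subsetC sub1set inE cl_root.
  rewrite /b bT cardsT cV /nmarks; have -> : #|[set i | mv i \in [set: vert C]]| = n.+1.
    by rewrite -[RHS]card_ord -cardsT; apply: eq_card => i; rewrite !inE.
  by rewrite /=; lia.
have sv : side v (bset v) by left.
rewrite (side_marks vt sv) /b; case: (odd _) => /=; lia.
Qed.

(* The vertices that the fixed components of v reach, with v itself: these
   sets increase along the edges directed from their fixed to their free side. *)
Definition reach v : {set vert C} := [set a | (a == v) ||
  if below v a then [exists u, [&& ~~ itop u, pv u == v, below u a & odd #|bset u|]] else ~~ odd #|bset v|].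

(** Along an edge directed into v, the reach of the other end is contained in that of v, and v
    itself is new. *)
Lemma reach_lt (a : bedge) v : owner (inl a) = v ->
  (#|reach (if val a == v then pv v else val a)| < #|reach v|)%N.
Proof.
have at0 := valP a; set u := val a in at0 *; rewrite /=; have up : u != pv u.
  by apply: contraTneq (anc_refl par rk (inl u)) => {2}->; rewrite not_below_pv.
have pu : below (pv u) u by rewrite -pvP //; exact: par_anc T _ (vert_root x0 u).
case: ifP => [ob <-|eb <-]; rewrite ?(negbTE up) ?eqxx; apply: proper_card; apply/properP; split.
- apply/subsetP => w; rewrite !inE => /orP [/eqP ->|].
    by rewrite pu; apply/orP; right; apply/existsP; exists u; rewrite at0 eqxx anc_refl.
  case: ifP => [uw _|]; last by rewrite ob.
  have pw : below (pv u) w := anc_trans T pu uw.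
  by rewrite pw; apply/orP; right; apply/existsP; exists u; rewrite at0 eqxx uw.
- exists (pv u); rewrite inE ?eqxx // eq_sym (negbTE up) not_below_pv //= negbK.
  by [].
- apply/subsetP => w; rewrite !inE; have [->//|wu /=] := eqVneq w u.
  have [uw|nuw] := boolP (below (sval a) w); last by rewrite eb.
  have pw : below (pv u) w := anc_trans T pu uw; rewrite pw => /orP [/eqP wp|/existsP [u' /and4P [t' /eqP p' b' o']]].
    by move: uw; rewrite wp not_below_pv.
  by have e : u' = sval a := kid_uniq t' at0 p' b' uw; rewrite -e o' in eb.
- exists u; rewrite inE ?eqxx // (negbTE up) pu /=; apply/existsP => -[u' /and4P [t' /eqP p' b' o']].
  by have e : u' = sval a := kid_uniq t' at0 p' b' (anc_refl par rk (inl u)); rewrite -e o' in eb.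
Qed.

(** An edge condition involves only its owner and the other end, whose reach is smaller; ordering by
    reach makes the matrix block triangular. *)
Lemma sdet_zz : `|sdet zz (enum coords) (enum cond)| = \prod_v `|sdet zz (vcoords v) (own v)|.
Proof.
apply: (sdet_rank (r := fun v => #|reach v|)); rewrite ?perm_enum2 ?perm_blocks //.
  by move=> v; rewrite size_own.
move=> u v q e uv ruv; have qu : q \in vcoords u -> q.1 = u by rewrite !inE => /orP [] /eqP ->.
move=> /qu {}qu; rewrite mem_own; case: e => [a|[i k]] /eqP ev; last first.
  by rewrite /=; case: eqP => // qe; rewrite -qu qe -ev eqxx in uv.
have := reach_lt ev; rewrite /= qu; case: (eqVneq (val a) v) ev => [av ev|av ev] lt.
  rewrite av (negbTE uv); case: eqP => [ue|]; last by rewrite subrr mulr0.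
  by rewrite ue leqNgt lt in ruv.
have -> : pv (val a) = v by move: ev; rewrite /=; case: ifP => // _ e; case/eqP: av.
rewrite (negbTE uv); case: eqP => [ue|]; last by rewrite subrr mulr0.
by rewrite ue leqNgt lt in ruv.
Qed.

Lemma adj_cases u v : adj (inl u : node C) (inl v) -> (~~ itop u /\ v = pv u) \/ (~~ itop v /\ u = pv v).
Proof.
have h a b : inl b = par (inl a) -> ~~ itop a /\ b = pv a.
  by move=> e; have at0 : ~~ itop a; [rewrite /itop -e|split=> //; move: e; rewrite pvP // => -[]].
by move=> /(r_adj T) [[_ /h]|[_ /h]]; [left|right].
Qed.

Lemma dir_pv u : ~~ itop u -> vecR R (dir (inl u : node C) (inl (pv u))) = - wv u.
Proof. by move=> ut; rewrite -pvP // dir_down /vecR map_mxN. Qed.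

Lemma dir_kid u : ~~ itop u -> vecR R (dir (inl (pv u) : node C) (inl u)) = wv u.
Proof.
by move=> ut; rewrite dir_anti 1?tree_adj_sym ?pv_adj // /vecR map_mxN -/(vecR R _) dir_pv // opprK.
Qed.

Lemma comp_kid u : ~~ itop u -> component (pv u) u = bset u.
Proof.
move=> ut; apply/setP => a; rewrite !inE; have [->|ap] := eqVneq a (pv u).
  rewrite (branch_id T) not_below_pv //; apply/eqP => -[e].
  by have := not_below_pv ut; rewrite e anc_refl.
rewrite (branch_nx T); last by apply: contraNneq ap => -[->].
apply/eqP/idP => [e|ua]; last by rewrite (kids_nx (b := fun _ : unit => x0) (k0 := tt) (pv_kid ut) ua).
case pa : (below (pv u) a).
  by have [|_] := nx_kid (b := fun _ : unit => x0) (k0 := tt) pa; rewrite ?e //; apply: contraNneq ap => -[->].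
have [e' _] := nx_up T pa; have := kid_par (b := fun _ : unit => x0) (k0 := tt) (pv_kid ut).
by rewrite -e -e' eqxx.
Qed.

Lemma comp_par u : ~~ itop u -> component u (pv u) = ~: bset u.
Proof.
move=> ut; apply/setP => a; rewrite !inE; have [->|au] := eqVneq a u.
  rewrite (branch_id T) anc_refl; apply/eqP => -[e].
  by have := not_below_pv ut; rewrite -e anc_refl.
have ne : inl u != inl a :> node C by apply: contraNneq au => -[->].
rewrite (branch_nx T ne) -pvP //; case ua : (below u a); last by have [-> _] := nx_up T ua; rewrite eqxx.
have [k _] := nx_kid (b := fun _ : unit => x0) (k0 := tt) ua ne.
exact/negbTE/(kid_par (b := fun _ : unit => x0) (k0 := tt) k).
Qed.

Definition slope (a x : 'rV[R]_2) : R := (a 0 0 * x 0 0 + a 0 1 * x 0 1) / (a 0 0 ^+ 2 + a 0 1 ^+ 2).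

Lemma slopeP a x : a != 0 -> cross a x = 0 -> x = slope a x *: a.
Proof.
move=> a0; have s0 : a 0 0 ^+ 2 + a 0 1 ^+ 2 != 0.
  rewrite paddr_eq0 ?sqr_ge0 // !sqrf_eq0; apply: contra a0 => /andP [/eqP h0 /eqP h1].
  by apply/eqP/row2.
rewrite /cross => /subr0_eq h; apply/eqP; rewrite -subr_eq0; apply/eqP/row2; rewrite !mxE /slope.
  apply: (mulfI s0); rewrite mulr0 mulrBr [X in _ - X](_ : _ = (a 0 0 * x 0 0 + a 0 1 * x 0 1) * a 0 0); last by field.
  transitivity (a 0 1 * (a 0 1 * x 0 0 - a 0 0 * x 0 1)); first by ring.
  by rewrite h subrr mulr0.
apply: (mulfI s0); rewrite mulr0 mulrBr [X in _ - X](_ : _ = (a 0 0 * x 0 0 + a 0 1 * x 0 1) * a 0 1); last by field.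
transitivity (a 0 0 * (a 0 0 * x 0 1 - a 0 1 * x 0 0)); first by ring.
by rewrite h subrr mulr0.
Qed.

Lemma slopeN a x : slope (- a) (- x) = slope a x.
Proof. by rewrite /slope !mxE !mulrNN !sqrrN. Qed.

Lemma dir_neq0 u v : adj (inl u : node C) (inl v) -> vecR R (dir (inl u : node C) (inl v)) != 0.
Proof.
by move=> /adj_cases [[ut ->]|[vt ->]]; rewrite ?dir_pv ?dir_kid ?oppr_eq0 // wv_neq0.
Qed.

(** On an even side the inner conditions have a nonzero solution [F], and a small multiple of it is
    a genuine deformation. On an odd side, a deformation minus the curve is a solution, so it
    vanishes by [fixed_side], and the positions determine the lengths. *)
Lemma fixedP v w u : ~~ itop u -> side u (component v w) -> is_fixed v (inl w : node C) <-> odd #|component v w|.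
Proof.
set K := component v w => ut sK; split=> [fx|oK len' pos' [def1 def2]].
  apply/negPn/negP => eK; have [|F [[a Fa] F0 FE]] := @ex_field K (enum (inner u K)).
    by rewrite -cardE (card_inner ut sK) (side_marks ut sK) (negbTE eK); have := side_gt0 ut sK; lia.
  have FK e : inner u K e -> eqf F e = 0 by move=> ie; apply: FE; rewrite mem_enum.
  pose D b c := vecR R (dir (inl b : node C) (inl c)); pose m b c := slope (D b c) (F c - F b).
  have Dn b c : adj (inl b : node C) (inl c) -> D b c = - D c b.
    by move=> bc; rewrite /D dir_anti // /vecR map_mxN.
  have mE b c : b \in K -> c \in K -> adj (inl b : node C) (inl c) -> F c - F b = m b c *: D b c.
    have pvE b0 : ~~ itop b0 -> b0 \in K -> pv b0 \in K -> F b0 - F (pv b0) = m (pv b0) b0 *: D (pv b0) b0.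
      move=> bt bK pK; apply: slopeP; rewrite /D dir_kid ?wv_neq0 //.
      apply: (FK (inl (Sub b0 bt : bedge))); rewrite /= bK andbT; apply: contraTneq pK => be.
      by case: sK => KE; move: bK; rewrite KE be !inE ?not_below_pv // anc_refl.
    move=> bK cK bc; case: (adj_cases bc) => [[bt ce]|[ct be]]; last by move: bK; rewrite be => bK; exact: pvE.
    subst c; rewrite -[LHS]opprB pvE // -scalerN -Dn //; congr (_ *: _).
    by rewrite /m (Dn b) // -[F (pv b) - F b]opprB slopeN.
  (* [F] changes the length of an edge by the slope [m]; [e] is small enough to keep all lengths
     positive. *)
  have [e e0 he] := small_eps [seq (len b c, m b c) | b <- enum (vert C), c <- enum (vert C)].
  have [_ _ _ _ lenP] := tree_valid C.
  have epos b c : 0 < len b c -> 0 < len b c + e * m b c.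
    by move=> l0; have [||h _] := he (len b c) (m b c) e; [by apply/allpairsP; exists (b, c); rewrite !mem_enum|by rewrite e0 lexx|exact: h].
  have aK : a \in K by apply: contraNT Fa => /F0 ->.
  have [|pa _] := fx (fun b c => len b c + e * m b c) (fun b => pos b + e *: F b) _ a aK.
    split=> [b c bK cK bc|b i bK].
      have [l0 ls] := lenP b c bc; split; first exact: epos.
        rewrite ls; congr (_ + _ * _); rewrite /m (Dn b c) // -[F c - F b]opprB slopeN //.
      rewrite (tcurve_edge bc) scalerDl -/(D b c) -scalerA -mE // scalerBr.
      by rewrite [RHS]addrACA [e *: F b + _]addrC subrK.
    rewrite mvP => /eqP be; suff -> : F b = 0 by rewrite scaler0 addr0.
    by subst b; apply: row2; [exact: (FK (inr (i, 0)))|exact: (FK (inr (i, 1)))].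
  move: pa => /eqP; rewrite -subr_eq0 addrC addKr scaler_eq0 gt_eqF //= => Fa0.
  by rewrite Fa0 in Fa.
pose F b : 'rV[R]_2 := if b \in K then pos' b - pos b else 0.
have FE b : b \in K -> pos' b = pos b + F b by move=> bK; rewrite /F bK addrC subrK.
have z : forall b, F b = 0.
  apply: (fixed_side ut sK oK) => [b /negbTE nb|]; first by rewrite /F nb.
  case=> [b /= /andP [bu bK]|[i k] /= iK]; last first.
    by rewrite /F iK (def2 _ i) ?subrr ?mxE // mvP.
  have bt := valP b; have pK : pv (val b) \in K by rewrite (side_pv sK).
  have ab := pv_adj bt; have [_ _ p'E] := def1 _ _ bK pK ab; have pE := tcurve_edge ab.
  rewrite dir_pv // in p'E pE; rewrite /F bK pK p'E pE.
  set x := wv _; rewrite /cross !mxE; ring.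
move=> a aK; rewrite FE // z addr0; split=> // b bK ab.
have [_ _ p'E] := def1 a b aK bK ab; move: p'E; rewrite !FE // !z !addr0 (tcurve_edge ab).
move/addrI/eqP; rewrite -subr_eq0 -scalerBl scaler_eq0 (negbTE (dir_neq0 ab)) orbF subr_eq0.
by move/eqP.
Qed.

(** The other end of the edge a, seen from its end v. *)
Definition nbr v (a : bedge) : node C := if val a == v then inl (pv v) else inl (val a).

Lemma owner_cases a v : owner (inl a) = v -> val a = v \/ pv (val a) = v.
Proof. by rewrite /=; case: ifP => _; [right|left]. Qed.

Lemma odd_setC (K : {set vert C}) : odd #|~: K| = ~~ odd #|K|.
Proof.
have := cardsC K; rewrite cV => /(congr1 odd); rewrite oddD /= mul2n odd_double.
by case: (odd #|K|); case: (odd _).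
Qed.

Lemma kid_fixed u : ~~ itop u -> is_fixed (pv u) (inl u : node C) <-> odd #|bset u|.
Proof. by move=> ut; rewrite (fixedP ut) comp_kid //; left. Qed.

Lemma par_fixed u : ~~ itop u -> is_fixed u (inl (pv u) : node C) <-> ~~ odd #|bset u|.
Proof. by move=> ut; rewrite (fixedP ut) comp_par // ?odd_setC //; right. Qed.

Lemma fixed_edgesP v x : reflect (exists a, owner (inl a) = v /\ x = nbr v a) (x \in fixed_edges v).
Proof.
apply: (iffP idP) => [|[a [av ->]]].
  rewrite inE => /andP [ax /asboolP]; case: x ax => [w|//] vw fx.
  case: (adj_cases vw) => [[vt wE]|[wt vE]]; subst.
    exists (Sub v vt); rewrite /nbr /= eqxx; split=> //.
    by move/(par_fixed vt)/negbTE: fx => ->.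
  exists (Sub w wt); rewrite /nbr /=; split; first by move/(kid_fixed wt): fx => ->.
  by case: eqP => // wp; have := not_below_pv wt; rewrite -wp anc_refl.
have at0 := valP a; move: av; rewrite inE /nbr /=; case: ifP => oa av.
  have ne : (val a == v) = false.
    by apply/eqP => e; have := not_below_pv at0; rewrite av -e anc_refl.
  rewrite ne -av tree_adj_sym pv_adj //; exact/asboolP/kid_fixed.
by rewrite -av eqxx pv_adj //; apply/asboolP/par_fixed => //; rewrite oa.
Qed.

Lemma dir_nbr a v : owner (inl a) = v -> exists s : bool, dir (inl v : node C) (nbr v a) = (-1) ^+ s *: dsum Delta (cl x0 (val a)).
Proof.
have at0 := valP a; move/owner_cases; rewrite /nbr; case: eqVneq => [<- _|ne [/eqP|pa]].
- by exists true; rewrite -pvP // dir_down scaleN1r.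
- by rewrite (negbTE ne).
- exists false; rewrite -pa dir_anti 1?tree_adj_sym ?pv_adj // -pvP // dir_down opprK scale1r //.
Qed.

Lemma zz_nbr a v : owner (inl a) = v -> exists s : bool, forall k, zz (v, k) (inl a) = (-1) ^+ s * cross (wv (val a)) (delta_mx 0 k).
Proof.
have at0 := valP a; move/owner_cases => av; have ne : val a != pv (val a).
  by apply: contraTneq (anc_refl par rk (inl (val a))) => {2}->; rewrite not_below_pv.
by case: av => <-; [exists false|exists true] => k'; rewrite /= eqxx 1?[pv _ == _]eq_sym (negbTE ne) ?subr0 ?sub0r ?mulr1 ?mul1r ?mulrN1 ?mulN1r.
Qed.

Lemma det2 (x y : 'rV[int]_2) : \det (col_mx x y : 'M_2) = x 0 0 * y 0 1 - x 0 1 * y 0 0.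
Proof.
have e0 k : (col_mx x y : 'M_2) 0 k = x 0 k by rewrite -(col_mxEu x y 0 k); congr (fun_of_matrix _ _ _); exact: val_inj.
have e1 k : (col_mx x y : 'M_2) 1 k = y 0 k by rewrite -(col_mxEd x y 0 k); congr (fun_of_matrix _ _ _); exact: val_inj.
rewrite -e0 -e1 -(e0 1) -(e1 0); set M : 'M_2 := col_mx x y; clearbody M.
rewrite (expand_det_row _ ord0) !big_ord_recl big_ord0 addr0 /cofactor !det_mx11 !mxE /= expr0 expr1 mul1r mulN1r mulrN.
by congr (M _ _ * M _ _ - M _ _ * M _ _); exact: val_inj.
Qed.

Lemma det_nbr v a b : owner (inl a) = v -> owner (inl b) = v ->
  `|\det (col_mx (dir (inl v : node C) (nbr v a)) (dir (inl v) (nbr v b)) : 'M[int]_2)|%:~R =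
  `|cross (wv (val a)) (wv (val b))|.
Proof.
move=> /dir_nbr [s ->] /dir_nbr [t ->]; rewrite det2 intr_norm !mxE.
transitivity `|(-1) ^+ s * ((-1) ^+ t * cross (wv (val a)) (wv (val b)))|; last by rewrite !normrMsign.
by congr `|_|; rewrite /cross !mxE rmorphB !rmorphM /= !rmorph_sign; ring.
Qed.

Lemma nbr_inj v a b : owner (inl a) = v -> owner (inl b) = v -> nbr v a = nbr v b -> a = b.
Proof.
have h (c e : bedge) : val c = v -> owner (inl e) = v -> val e != v -> pv v != val e.
  move=> cv /owner_cases [->|ev]; first by rewrite eqxx.
  by move=> _; apply/eqP => e'; have h1 := not_below_pv (valP c); have h2 := pv_below (valP e); rewrite ev -e' -cv h1 in h2.
rewrite /nbr => av bv; case: eqVneq => [a1|a1]; case: eqVneq => [b1|b1] e; apply: val_inj => //; try case: e => e.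
- by rewrite a1 b1.
- by case/eqP: (h a b a1 bv b1).
- by case/eqP: (h b a b1 av a1); exact: esym.
- exact: e.
Qed.

(** The two conditions owned by v are the coordinates of its marked point, with the unit matrix, or
    two incoming edges. The latter come from the fixed components, and the block is the determinant
    of their directions up to sign. *)
Lemma sdet_mult v : `|sdet zz (vcoords v) (own v)| = (mult_ev v)%:~R.
Proof.
have uo : uniq (own v) by rewrite filter_uniq ?enum_uniq.
rewrite /mult_ev; case: ifPn => [/existsP [i]|noi].
  rewrite mvP => /eqP vi.
  have pe : perm_eq (own v) [:: inr (i, 0); inr (i, 1)].
    have sub : {subset [:: inr (i, 0); inr (i, 1)] <= own v} by move=> e; rewrite !inE mem_own => /orP [] /eqP ->; rewrite /= -vi.
    have ul : uniq [:: inr (i, 0) : cond; inr (i, 1)] by rewrite /= inE (inj_eq (@inr_inj _ _)) xpair_eqE eqxx.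
    have [_ eqm] := uniq_min_size ul sub (eq_leq (size_own v)).
    by rewrite perm_sym; apply: uniq_perm.
  rewrite (sdet_permr _ _ pe) ?size_own // sdet2 /= !xpair_eqE vi !eqxx /= mulr1 mulr0 subr0 normr1.
  by [].
have inlE e : e \in own v -> exists a, e = inl a.
  rewrite mem_own; case: e => [a _|[i k] /eqP e]; first by exists a.
  by case/existsP: noi; exists i; rewrite mvP -e.
have := size_own v; case oE : (own v) => [|e1 [|e2 [|]]] // _.
have [[a ae] [b be]] : (exists a, e1 = inl a) /\ (exists b, e2 = inl b).
  by split; apply: inlE; rewrite oE !inE eqxx ?orbT.
subst e1 e2; have ao c : (owner (inl c) == v) = (c == a) || (c == b).
  by rewrite -mem_own oE !inE !(inj_eq (@inl_inj _ _)).
have av : owner (inl a) = v by apply/eqP; rewrite ao eqxx.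
have bv : owner (inl b) = v by apply/eqP; rewrite ao eqxx orbT.
have ab : nbr v a != nbr v b.
  by apply/eqP => /(nbr_inj av bv) e; move: uo; rewrite oE e /= inE eqxx.
have fe : fixed_edges v = [set nbr v a; nbr v b].
  apply/setP => x; rewrite in_set2; apply/fixed_edgesP/orP => [[c [/eqP + ->]]|].
    by rewrite ao => /orP [] /eqP ->; [left|right].
  by case=> /eqP ->; [exists a|exists b].
have -> : `|sdet zz (vcoords v) [:: inl a; inl b]| = `|cross (wv (val a)) (wv (val b))|.
  rewrite sdet2; have [s sE] := zz_nbr av; have [t tE] := zz_nbr bv; rewrite !sE !tE.
  rewrite -[RHS](normrMsign s) -[in RHS](normrMsign t); congr `|_|.
  by rewrite /cross !mxE /=; ring.
case: pickP => [[e1 e2] /= /andP [ne /eqP]|/(_ (nbr v a, nbr v b))]; last by rewrite /= ab fe eqxx.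
rewrite fe => /setP E2; have := E2 e1; have := E2 e2; rewrite !inE !eqxx orbT /=.
move=> /orP [] /eqP h2 /orP [] /eqP h1; rewrite h1 h2 ?eqxx // in ne *.
- by rewrite det_nbr //; rewrite /cross -[RHS]normrN; congr `|_|; ring.
- by rewrite det_nbr.
Qed.

Lemma ev_det : `|sdet (fun q e => eqf (para q) e) (edges 0 ++ tops) marks| = \prod_(v : vert C) (mult_ev v)%:~R.
Proof. by rewrite (sdet_para wv_neq0) sdet_zz; apply: eq_bigr => v _; exact: sdet_mult. Qed.

End EvDet.

Unset Implicit Arguments.
Local Close Scope classical_set_scope.

Theorem theorem2p20 (R : realType) (n d l : nat) (Delta : 'I_d -> 'rV[int]_2)
    (p : 'I_n.+1 -> 'rV[R]_2) (lam : 'I_l -> cross_ratio R (ends n d)) :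
  is_degree R Delta ->
  (n.+1 + l = d.-1)%N ->
  general_position Delta p lam ->
  N Delta p lam = N_degen Delta p lam /\
  (degen_in_interiors Delta p lam ->
   forall C : tcurve R n Delta, contributes p lam C ->
     mult p lam C = \prod_(v : vert C) ((mult_ev v)%:~R * omega lam v)).
Proof.
move=> Dg nl _; split; first exact: N_eq.
move=> intX C contC; have e := mult_product Dg nl contC intX.
have [xM _ nz mE] := contrib_dg Dg nl contC.
have [_ pS] := pt_inM (deg2 Dg) C; have cV := card_vert Dg nl contC intX.
(* The multiplicity of a contributing curve is nonzero, hence so is the evaluation determinant;
   [ev_det] rests on this. *)
rewrite -mE e (ev_sdet Dg cV p (sup_good xM) pS) in nz.
rewrite big_split /= e (ev_sdet Dg cV p (sup_good xM) pS) ev_det //.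
by apply: contraNneq nz => ->; rewrite normr0 mul0r.
Qed.
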